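(* Let $G$ be a compactly generated locally compact group and let $\mathcal E$ be a class of superreflexive Banach spaces closed under finite representability. The following are equivalent (item 4 being included in the equivalence provided $\mathcal E$ contains a space of infinite dimension): 1. $G$ has ($\overline{\mathrm F}_{\mathcal E}$). 2. For every $C>0$, there exist $N\in\mathbf N$ and $\varepsilon>0$ such that $\mathcal C_{\mathcal F(\mathcal E^{N,\varepsilon},\varepsilon\ell+C)}(G)$ has a Kazhdan projection and $H^1(G;\pi)=0$ for every $(\pi,E)\in\mathcal F(\mathcal E^{N,\varepsilon},\varepsilon\ell+C)$. 3. For every $C>0$, there exists $\varepsilon>0$ such that $\mathcal C_{\mathcal F(\mathcal E,\varepsilon\ell+C)}(G)$ has a Kazhdan projection and $H^1(G;\pi)=0$ for every $(\pi,E)\in\mathcal F(\mathcal E,\varepsilon\ell+C)$. 4. (If $\mathcal E$ contains a space of infinite dimension) For every $C>0$, there exists $\varepsilon>0$ such that $\mathcal C_{\mathcal F(\mathcal E,\varepsilon\ell+C)}(G)$ has a Kazhdan projection. In that case, and if $\mathcal E$ is stable by duality, then (for every $C>0$ and $\varepsilon$ as in these statements) $\mathcal C_{\mathcal F(\mathcal E,\varepsilon\ell+C)}(G)$ has a central Kazhdan projection.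
   Context: Standing assumptions: $G$ is compactly generated, locally compact, separable and infinite; $S\subset G$ is a compact symmetric generating set containing the identity; $\ell(g)=\min\{n:g\in S^n\}$; $\int f$ is integration against a left Haar measure. A representation $(\pi,E)$ is a strongly continuous homomorphism from $G$ to the bounded invertible operators of a Banach space $E$; $\pi(f)=\int f(g)\pi(g)\,dg$ for $f\in C_c(G)$. A continuous affine action with linear part $(\pi,E)$ is $\sigma(g)x=\pi(g)x+b(g)$ with $b:G\to E$ continuous, $b(gh)=b(g)+\pi(g)b(h)$. $H^1(G;\pi)=0$ means every continuous affine action with linear part $\pi$ has a fixed point. $G$ has ($\overline{\mathrm F}_{\mathcal E}$) if every continuous affine action of $G$ on a space in $\mathcal E$ whose linear part is a uniformly bounded representation ($\sup_{g\in G}\|\pi(g)\|<\infty$) has a fixed point. A Banach space $X$ is finitely representable in $\mathcal E$ if every finite dimensional subspace of $X$ is, for every $\varepsilon>0$, at (multiplicative) Banach–Mazur distance less than $1+\varepsilon$ from a subspace of a space in $\mathcal E$; $\mathcal E$ is closed under finite representability if it contains every such $X$. A space or class is superreflexive if every Banach space finitely representable in it is reflexive. $\mathcal E^{N,\varepsilon}$ is the class of Banach spaces all of whose subspaces of dimension at most $N$ are at Banach–Mazur distance less than $1+\varepsilon$ from a subspace of a space in $\mathcal E$. For a class $\mathcal E$ and a function $m$ on $G$, $\mathcal F(\mathcal E,m)$ is the collection of representations $(\pi,E)$ of $G$ with $E$ isometric to a space in $\mathcal E$ and $\|\pi(g)\|_{B(E)}\le e^{m(g)}$ for all $g\in G$.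 $\mathcal C_{\mathcal F}(G)$ is the (Hausdorff) completion of $C_c(G)$ for $\|f\|_{\mathcal F}=\sup_{(\pi,E)\in\mathcal F}\|\pi(f)\|_{B(E)}$. A Kazhdan projection in it is an idempotent $p$ in the closure of $\{f\in C_c(G):\int f=1\}$ such that $\pi(p)$ is a projection onto $E^\pi=\{x:\pi(g)x=x\ \forall g\}$ for every $(\pi,E)\in\mathcal F$; it is central if it lies in the center of $\mathcal C_{\mathcal F}(G)$. *)

(* Defs.v *)
From HB Require Import structures.
From mathcomp Require Import all_boot all_order all_algebra.
From mathcomp Require Import all_classical all_reals all_analysis.
From mathcomp Require Import complex.
Set Implicit Arguments.
Unset Strict Implicit.
Unset Printing Implicit Defensive.
Import Order.TTheory GRing.Theory Num.Theory.
Import numFieldNormedType.Exports.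
Local Open Scope classical_set_scope.
Local Open Scope ring_scope.

(* Banach spaces are over R or C: [scalars] selects which of the two. *)
Variant scalars := RealScalars | ComplexScalars.

Definition scalar_field (R : realType) (s : scalars) : numFieldType :=
  match s with RealScalars => R | ComplexScalars => R[i] end.

Definition real_part (R : realType) (s : scalars) : scalar_field R s -> R :=
  match s return scalar_field R s -> R with
  | RealScalars => fun x => x
  | ComplexScalars => fun z => complex.Re z
  end.

(* The distinguished point inherited from [PointedTopological] plays no role;
   it is there because the library builds generated sigma-algebras on pointed
   types only. *)
HB.mixin Record isTopGroup G of PointedTopological G & Group G := {
  mulg_continuous : continuous (fun x : G * G => (x.1 * x.2)%g) ;
  invg_continuous : continuous (fun x : G => (x^-1)%g)
}.

#[short(type="topGroupType")]
HB.structure Definition TopGroup :=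
  {G of PointedTopological G & Group G & isTopGroup G}.

Section topological_groups.
Variable G : topGroupType.

Definition separable_space := exists2 D : set G, countable D & dense D.

Fixpoint set_power (S : set G) (n : nat) : set G :=
  if n is n'.+1 then [set (x * y)%g | x in set_power S n' & y in S]
  else [set 1%g].

(* For a symmetric S the subgroup generated by S is the union of the S^n. *)
Record compact_symmetric_generating (S : set G) : Prop := {
  csg_compact : compact S ;
  csg_symmetric : forall g, S g -> S (g^-1)%g ;
  csg_one : S 1%g ;
  csg_generates : forall g, exists n, set_power S n g
}.

Definition word_length (S : set G) (g : G) : nat :=
  xget 0%N [set n | set_power S n g /\
                    forall k, set_power S k g -> (n <= k)%N].

Definition borel := g_sigma_algebraType (@open G).

Record left_haar (R : realType) (mu : {measure set borel -> \bar R}) : Prop := {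
  haar_nonzero : mu setT <> 0%E ;
  haar_invariant : forall (g : G) (A : set borel), measurable A ->
    mu [set (g * x)%g | x in A] = mu A ;
  haar_compact : forall A : set G, compact A -> (mu A < +oo)%E ;
  haar_outer : forall A : set borel, measurable A ->
    mu A = ereal_inf [set mu U | U in [set U : set G | open U /\ A `<=` U]] ;
  haar_inner : forall U : set G, open U ->
    mu U = ereal_sup [set mu A | A in [set A : set G | compact A /\ A `<=` U]]
}.

End topological_groups.

Section banach_spaces.
Variables (R : realType) (s : scalars).
Local Notation K := (scalar_field R s).
Local Notation banach := (completeNormedModType K).

(* The norm of a normed module takes its values in K; [rnorm] is the same norm
   as an element of R. *)
Definition rnorm (X : normedModType K) (x : X) : R := real_part `|x|.

Definition opnorm (X Y : normedModType K) (V : set X) (f : X -> Y) : \bar R :=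
  ereal_inf [set M%:E | M in [set M : R |
    0 <= M /\ forall x, V x -> rnorm (f x) <= M * rnorm x]].

Definition banach_class := banach -> Prop.

Definition is_subspace (X : banach) (V : set X) :=
  V 0 /\ forall (a : K) x y, V x -> V y -> V (a *: x + y).

Definition subspace_dim_le (n : nat) (X : banach) (V : set X) :=
  exists v : 'I_n -> X,
    V = [set \sum_(i < n) c i *: v i | c in [set: 'I_n -> K]].

Definition infinite_dimensional (X : banach) :=
  forall n, ~ subspace_dim_le n [set: X].

Definition linear_on (X Y : banach) (V : set X) (f : X -> Y) :=
  forall (a : K) x y, V x -> V y -> f (a *: x + y) = a *: f x + f y.

(* Infimum of |T| |T^-1| over the linear isomorphisms T from V onto W; here U
   is the inverse of T. *)
Definition banach_mazur (X Y : banach) (V : set X) (W : set Y) : \bar R :=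
  ereal_inf [set d | exists (T : X -> Y) (U : Y -> X),
    [/\ linear_on V T,
        (forall x, V x -> W (T x) /\ U (T x) = x),
        (forall y, W y -> V (U y) /\ T (U y) = y) &
        d = (opnorm V T * opnorm W U)%E]].

Definition close_to_subspace_of (Ecl : banach_class) (eps : R) (X : banach)
    (V : set X) :=
  exists (Y : banach) (W : set Y),
    [/\ Ecl Y, is_subspace W & (banach_mazur V W < (1 + eps)%:E)%E].

Definition finitely_representable (Ecl : banach_class) (X : banach) :=
  forall (n : nat) (V : set X), subspace_dim_le n V ->
  forall eps : R, 0 < eps -> close_to_subspace_of Ecl eps V.

Definition closed_under_finite_representability (Ecl : banach_class) :=
  forall X : banach, finitely_representable Ecl X -> Ecl X.

Definition local_class (Ecl : banach_class) (N : nat) (eps : R) : banach_class :=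
  fun X => forall V : set X, subspace_dim_le N V ->
    close_to_subspace_of Ecl eps V.

(* [dual_pairing B] : y |-> B y is an isometric linear isomorphism from Y onto
   the space of continuous linear functionals on X with the operator norm, that
   is, Y is the dual of X through B. *)
Record dual_pairing (X Y : banach) (B : Y -> {linear X -> K^o}) : Prop := {
  dual_continuous : forall y, continuous (B y) ;
  dual_linear : forall (a : K) y z x, B (a *: y + z) x = a *: B y x + B z x ;
  dual_isometric : forall y, opnorm setT (B y) = (rnorm y)%:E ;
  dual_surjective : forall phi : {linear X -> K^o}, continuous phi ->
    exists y, forall x, B y x = phi x
}.

(* The canonical map from X to its bidual is onto.  The dual exists and is
   unique up to isometric isomorphism, so it does not matter which realisation
   (Y, B) of it is used. *)
Definition reflexive_space (X : banach) :=
  forall (Y : banach) (B : Y -> {linear X -> K^o}), dual_pairing B ->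
  forall Psi : {linear Y -> K^o}, continuous Psi ->
    exists x : X, forall y, Psi y = B y x.

Definition superreflexive (X : banach) :=
  forall Y : banach, finitely_representable (fun Z => Z = X) Y ->
    reflexive_space Y.

Definition stable_by_duality (Ecl : banach_class) :=
  forall (X Y : banach) (B : Y -> {linear X -> K^o}),
    Ecl X -> dual_pairing B -> Ecl Y.

Definition isometric_spaces (X Y : banach) :=
  exists T : {linear X -> Y},
    (forall x, rnorm (T x) = rnorm x) /\ (forall y, exists x, T x = y).

End banach_spaces.

Section representations.
Variables (R : realType) (s : scalars) (G : topGroupType).
Local Notation K := (scalar_field R s).
Local Notation banach := (completeNormedModType K).

Record representation (E : banach) := Representation {
  rep :> G -> {linear E -> E} ;
  rep_bounded : forall g, continuous (rep g) ;
  rep_one : forall x, rep 1%g x = x ;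
  rep_mul : forall g h x, rep (g * h)%g x = rep g (rep h x) ;
  rep_strongly_continuous : forall x, continuous (fun g => rep g x)
}.

Definition invariant_vectors (E : banach) (pi : representation E) : set E :=
  [set x | forall g, pi g x = x].

Definition uniformly_bounded (E : banach) (pi : representation E) :=
  (ereal_sup (range (fun g => opnorm setT (pi g))) < +oo)%E.

Definition is_cocycle (E : banach) (pi : representation E) (b : G -> E) :=
  continuous b /\ forall g h, b (g * h)%g = b g + pi g (b h).

Definition H1_vanishes (E : banach) (pi : representation E) :=
  forall b : G -> E, is_cocycle pi b ->
    exists x : E, forall g, pi g x + b g = x.

Definition property_FE (Ecl : banach_class R s) :=
  forall (E : banach) (pi : representation E),
    Ecl E -> uniformly_bounded pi -> H1_vanishes pi.

Definition rep_class := forall E : banach, representation E -> Prop.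

Definition rep_class_of (Ecl : banach_class R s) (m : G -> R) : rep_class :=
  fun E pi => (exists2 Y : banach, Ecl Y & isometric_spaces E Y) /\
              forall g, (opnorm setT (pi g) <= (expR (m g))%:E)%E.

End representations.

Section kazhdan.
Variables (R : realType) (s : scalars) (G : topGroupType).
Variable mu : {measure set (borel G) -> \bar R}.
Local Notation K := (scalar_field R s).
Local Notation banach := (completeNormedModType K).

Definition Cc (f : G -> K) :=
  continuous f /\ compact (closure [set g | f g != 0]).

Definition scalar_integral : (G -> K) -> K :=
  match s return (G -> scalar_field R s) -> scalar_field R s with
  | RealScalars => fun f => Rintegral mu setT f
  | ComplexScalars => fun f =>
      Complex (Rintegral mu setT (fun g => complex.Re (f g)))
              (Rintegral mu setT (fun g => complex.Im (f g)))
  end.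

(* Weak integral of a vector-valued function.  It is only used for continuous
   compactly supported F, for which it exists and is unique. *)
Definition vector_integral (E : banach) (F : G -> E) : E :=
  xget 0 [set y | forall phi : {linear E -> K^o}, continuous phi ->
    phi y = scalar_integral (fun g => phi (F g))].

Definition convolution (f h : G -> K) : G -> K :=
  fun x => scalar_integral (fun y => f y * h (y^-1 * x)%g).

Definition rep_integral (E : banach) (pi : representation G E) (f : G -> K) :
    E -> E :=
  fun x => vector_integral (fun g => f g *: pi g x).

Variable F : rep_class R s G.

(* The value 0 is added so that the supremum over an empty F is 0. *)
Definition F_norm (f : G -> K) : \bar R :=
  ereal_sup ([set 0%E] `|`
    [set r | exists (E : banach) (pi : representation G E),
       F pi /\ r = opnorm setT (rep_integral pi f)]).

(* Elements of the Hausdorff completion C_F(G) are represented by the Cauchy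
   sequences of C_c(G); two of them are the same element when their
   [completion_dist] is 0. *)
Record completion := Completion {
  approx :> nat -> G -> K ;
  approx_Cc : forall n, Cc (approx n) ;
  approx_cauchy : forall eps : R, 0 < eps -> exists N : nat,
    forall n k, (N <= n)%N -> (N <= k)%N ->
      (F_norm (approx n \- approx k)%R < eps%:E)%E
}.

(* For Cauchy sequences the upper limit is a limit. *)
Definition completion_dist (a b : nat -> G -> K) : \bar R :=
  limn_esup (fun n => F_norm (a n \- b n)).

Definition completion_mul (a b : nat -> G -> K) : nat -> G -> K :=
  fun n => convolution (a n) (b n).

(* pi(p), the limit of the operators pi(p_n) *)
Definition completion_rep (E : banach) (pi : representation G E)
    (p : completion) : E -> E :=
  fun x => lim (rep_integral pi (p n) x @[n --> \oo]).

Definition in_closure_of_mean_one (p : completion) :=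
  forall eps : R, 0 < eps -> exists f : G -> K,
    [/\ Cc f, scalar_integral f = 1 &
        (completion_dist p (fun=> f) < eps%:E)%E].

Definition is_projection_onto (E : banach) (P : E -> E) (V : set E) :=
  (forall x, P (P x) = P x) /\ range P = V.

Record kazhdan_projection (p : completion) : Prop := {
  kp_idempotent : completion_dist (completion_mul p p) p = 0%E ;
  kp_mean_one : in_closure_of_mean_one p ;
  kp_projection : forall (E : banach) (pi : representation G E), F pi ->
    is_projection_onto (completion_rep pi p) (invariant_vectors pi)
}.

Definition central (p : completion) :=
  forall q : completion,
    completion_dist (completion_mul p q) (completion_mul q p) = 0%E.

Definition has_kazhdan_projection :=
  exists p : completion, kazhdan_projection p.

Definition has_central_kazhdan_projection :=
  exists p : completion, kazhdan_projection p /\ central p.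

End kazhdan.

Section conditions.
Variables (R : realType) (s : scalars) (G : topGroupType) (S : set G).
Variable mu : {measure set (borel G) -> \bar R}.
Variable Ecl : banach_class R s.

Definition rep_class_length (D : banach_class R s) (eps C : R) :
    rep_class R s G :=
  rep_class_of D (fun g => eps * (word_length S g)%:R + C).

Definition kazhdan_and_H1 (D : banach_class R s) (eps C : R) :=
  has_kazhdan_projection mu (rep_class_length D eps C) /\
  forall (E : completeNormedModType (scalar_field R s))
         (pi : representation G E),
    rep_class_length D eps C pi -> H1_vanishes pi.

Definition condition2 (C : R) (N : nat) (eps : R) :=
  kazhdan_and_H1 (local_class Ecl N eps) eps C.

Definition condition3 (C eps : R) := kazhdan_and_H1 Ecl eps C.

Definition condition4 (C eps : R) :=
  has_kazhdan_projection mu (rep_class_length Ecl eps C).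

End conditions.

(* Main.v *)
Require Import Defs.
From HB Require Import structures.
From mathcomp Require Import all_boot all_order all_algebra.
From mathcomp Require Import all_classical all_reals all_analysis.
From mathcomp Require Import complex measurable_realfun.
From mathcomp Require Import ring lra.
Set Implicit Arguments.
Unset Strict Implicit.
Unset Printing Implicit Defensive.
Import Order.TTheory GRing.Theory Num.Theory.
Import numFieldNormedType.Exports.
Local Open Scope classical_set_scope.
Local Open Scope ring_scope.


(** Fix a density f on G, continuous with compact support and positive on S, and
    let F_n be the representations of length growth at most l/n + C on spaces
    whose n-dimensional subspaces are 1/n-close to those of E.

    If item 1 holds then, for some n, every affine action with linear part in F_n
    has the property that a point of displacement r on S is within nr of a point
    of displacement r/2: otherwise the ultraproduct of a sequence of rescaled
    counterexamples, smoothed by f so that their cocycles become equicontinuous,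
    is an affine action with bounded linear part on a space of E without fixed
    point.  Iterating, H^1 vanishes on F_n and there is a uniform spectral gap.

    The averages by f then halve the displacement after a uniform number of steps:
    otherwise an ultraproduct contains a bounded backward orbit Y_k = pi(f) Y_{k+1}
    with Y_0 not invariant.  Reflexive spaces being dentable, the closed convex
    hull of the translates of the Y_k has a slice of small diameter; for a
    translate of Y_k deep in the slice most of the translates of Y_{k+1} that it
    averages are also in the slice, so Y_{k+1} is almost invariant, up to
    translation, and by the spectral gap Y_0 is too.  Hence the powers
    f^{*(nk+1)} converge in norm to a Kazhdan projection.

    Conversely, from item 4, a cocycle b defines the representation
    (x, t) |-> (pi(g) x + t d b(g), t) of E + K, realised on a space of the class
    of E, and for d small the projection of (0, 1) is a fixed point (x, 1).
    For centrality, comparing the projection P with that of the contragredient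
    representation gives P pi(g) = P. *)

(** * Scalars and norms *)


(** The index n of F_n controls three defects at once: the growth of the action, the distance of its
    space to E in low dimensions, and the distance at which a less displaced point is looked for.
    Along an ultraproduct the first two disappear: the limit action is bounded by e^C and its space
    lies in E. The third makes a point of small displacement in the limit contradict the
    counterexamples. The obstacle is strong continuity: G is not discrete, so the ultraproduct is
    cut down to equicontinuous families, and the cocycles and vectors fed into it are first averaged
    by f. Superreflexivity enters as reflexivity of the limit spaces; a small slice replaces the
    strict convexity of an invariant norm. In the second ultraproduct about n averages are applied
    to a representation of F_n. If f is supported on words of length at most L, n averages cost
    exp(nL/n + C), a bound free of n; the n-th power of the norm of one average would be useless.
    The exponent nk+1, rather than nk, is there because convolution has in general no unit in
    C_c(G). In item 4 the infinite dimensional space provides room for one more dimension: E + K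
    must again be isomorphic to a space of the class. *)

Section scalar_embedding.
Variables (R : realType) (s : scalars).
Local Notation K := (scalar_field R s).

Definition emb : R -> K :=
  match s return R -> scalar_field R s with
  | RealScalars => fun x => x
  | ComplexScalars => fun x => Complex x 0
  end.

Definition kabs (k : K) : R := real_part `|k|.

Lemma embK x : real_part (emb x) = x.
Proof. by rewrite /emb /real_part; case: s. Qed.

Lemma emb_inj : injective emb.
Proof. by move=> x y /(congr1 (@real_part R s)); rewrite !embK. Qed.

Lemma emb0 : emb 0 = 0. Proof. by rewrite /emb; case: s. Qed.

Lemma emb1 : emb 1 = 1. Proof. by rewrite /emb; case: s. Qed.

Lemma embD x y : emb (x + y) = emb x + emb y.
Proof. by rewrite /emb; case: s => //=; apply/eqP; rewrite eq_complex /= addr0 !eqxx. Qed.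

Lemma embN x : emb (- x) = - emb x.
Proof. by apply/eqP; rewrite -addr_eq0 -embD addNr emb0. Qed.

Lemma embB x y : emb (x - y) = emb x - emb y.
Proof. by rewrite embD embN. Qed.

Lemma embM x y : emb (x * y) = emb x * emb y.
Proof.
rewrite /emb; case: s => //=; apply/eqP.
by rewrite eq_complex /= !(mulr0, mul0r) subr0 addr0 !eqxx.
Qed.

Lemma le_emb x y : (emb x <= emb y) = (x <= y).
Proof. by rewrite /emb; case: s => //=; rewrite lecE /= eqxx. Qed.

Lemma lt_emb x y : (emb x < emb y) = (x < y).
Proof. by rewrite !lt_neqAle le_emb (inj_eq emb_inj). Qed.

Lemma emb_eq0 x : (emb x == 0) = (x == 0).
Proof. by rewrite -emb0 (inj_eq emb_inj). Qed.

Lemma embV x : emb x^-1 = (emb x)^-1.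
Proof.
have [->|x0] := eqVneq x 0; first by rewrite emb0 !invr0 emb0.
apply: (mulfI (x := emb x)); rewrite ?emb_eq0 //.
by rewrite -embM divff // emb1 divff // emb_eq0.
Qed.

Lemma rpD (a b : K) : real_part (a + b) = real_part a + real_part b.
Proof. by move: a b; rewrite /real_part; case: s => //= -[a a'] [b b']. Qed.

Lemma rp0 : real_part (0 : K) = 0.
Proof. by rewrite -emb0 embK. Qed.

Lemma rpN (a : K) : real_part (- a) = - real_part a.
Proof. by apply/eqP; rewrite -addr_eq0 -rpD addNr rp0. Qed.

Lemma rpB (a b : K) : real_part (a - b) = real_part a - real_part b.
Proof. by rewrite rpD rpN. Qed.

Lemma rp_sum I (r : seq I) (P : pred I) (F : I -> K) :
  real_part (\sum_(i <- r | P i) F i) = \sum_(i <- r | P i) real_part (F i).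
Proof. exact: (big_morph _ rpD rp0). Qed.

Lemma rpZ a (k : K) : real_part (emb a * k) = a * real_part k.
Proof.
by move: k; rewrite /real_part /emb; case: s => //= -[k k'] /=; rewrite mul0r subr0.
Qed.

Lemma emb_real_part (k : K) : 0 <= k -> k = emb (real_part k).
Proof.
move: k; rewrite /real_part /emb; case: s => //= -[a b].
by rewrite lecE /= => /andP[/eqP -> _].
Qed.

Lemma norm_kabs (k : K) : `|k| = emb (kabs k).
Proof. exact: emb_real_part. Qed.

Lemma kabs_ge0 k : 0 <= kabs k.
Proof. by rewrite -le_emb -norm_kabs emb0. Qed.

Lemma kabs0 : kabs 0 = 0. Proof. by rewrite /kabs normr0 rp0. Qed.

Lemma kabs_emb a : kabs (emb a) = `|a|.
Proof.
apply: emb_inj; rewrite -norm_kabs /emb; case: s => //=.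
by rewrite normc_def /= expr0n /= addr0 sqrtr_sqr.
Qed.

Lemma kabs1 : kabs 1 = 1. Proof. by rewrite -emb1 kabs_emb normr1. Qed.

Lemma kabsM a b : kabs (a * b) = kabs a * kabs b.
Proof. by apply: emb_inj; rewrite embM -!norm_kabs normrM. Qed.

Lemma kabsD a b : kabs (a + b) <= kabs a + kabs b.
Proof. by rewrite -le_emb embD -!norm_kabs ler_normD. Qed.

Lemma kabsN a : kabs (- a) = kabs a.
Proof. by rewrite /kabs normrN. Qed.

Lemma kabs_eq0 a : kabs a = 0 -> a = 0.
Proof. by move=> a0; apply/normr0_eq0; rewrite norm_kabs a0 emb0. Qed.

Lemma kabsV a : kabs a^-1 = (kabs a)^-1.
Proof. by apply: emb_inj; rewrite embV -!norm_kabs normfV. Qed.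

Lemma rp_le_kabs k : `|real_part k| <= kabs k.
Proof.
rewrite -le_emb -norm_kabs; move: k; rewrite /real_part /emb; case: s => //=.
by move=> -[a b]; rewrite normc_def /= lecE /= eqxx /= -sqrtr_sqr ler_wsqrtr //
  lerDl sqr_ge0.
Qed.

End scalar_embedding.
Arguments emb {R} s x.
Arguments kabs {R s} k.

Section complex_scalars.
Variable R : realType.
Local Notation C := (scalar_field R ComplexScalars).

Lemma kabs_imaginary_unit : kabs (Complex 0 1 : C) = 1.
Proof. by rewrite /kabs normc_def /= expr0n expr1n add0r sqrtr1. Qed.

Lemma im_le_kabs (z : R[i]) : `|complex.Im z| <= kabs (z : C).
Proof.
have := @rp_le_kabs R ComplexScalars (Complex 0 1 * z).
rewrite kabsM kabs_imaginary_unit.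
by case: z => a b /=; rewrite mul0r sub0r mul1r normrN mul1r.
Qed.

Lemma complex_sub_emb (a b : R) (z : R[i]) : Complex a b - z =
  emb ComplexScalars (a - complex.Re z) + Complex 0 1 * emb ComplexScalars (b - complex.Im z) :> C.
Proof.
case: z => c d; apply/eqP; rewrite eq_complex /=.
by rewrite !(mul0r, mulr0, mul1r, subr0, add0r, addr0) !eqxx.
Qed.

End complex_scalars.

Section real_norm.
Variables (R : realType) (s : scalars).
Local Notation K := (scalar_field R s).
Variable X : normedModType K.
Implicit Types x y : X.

Lemma norm_rnorm x : `|x| = emb s (rnorm x).
Proof. exact: emb_real_part. Qed.

Lemma rnorm_ge0 x : 0 <= rnorm x.
Proof. by rewrite -(le_emb s) -norm_rnorm emb0. Qed.

Lemma rnorm0 : rnorm (0 : X) = 0.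
Proof. by rewrite /rnorm normr0 rp0. Qed.

Lemma rnorm0_eq0 x : rnorm x = 0 -> x = 0.
Proof. by move=> x0; apply/normr0_eq0; rewrite norm_rnorm x0 emb0. Qed.

Lemma ler_rnormD x y : rnorm (x + y) <= rnorm x + rnorm y.
Proof. by rewrite -(le_emb s) embD -!norm_rnorm ler_normD. Qed.

Lemma rnormN x : rnorm (- x) = rnorm x.
Proof. by rewrite /rnorm normrN. Qed.

Lemma rdistC x y : rnorm (x - y) = rnorm (y - x).
Proof. by rewrite /rnorm distrC. Qed.

Lemma ler_rnormB x y : rnorm (x - y) <= rnorm x + rnorm y.
Proof. by rewrite -(rnormN y); apply: ler_rnormD. Qed.

Lemma ler_rdist (z x y : X) : rnorm (x - y) <= rnorm (x - z) + rnorm (z - y).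
Proof. by rewrite -[x - y](subrKA z); apply: ler_rnormD. Qed.

Lemma ler_rnorm_dist x y : rnorm x <= rnorm y + rnorm (x - y).
Proof. by rewrite -{1}[x](subrK y) addrC; apply: ler_rnormD. Qed.

Lemma ler_dist_rnorm x y : `|rnorm x - rnorm y| <= rnorm (x - y).
Proof.
rewrite ler_norml; have := ler_rnorm_dist x y; have := ler_rnorm_dist y x.
by rewrite (rdistC y x); lra.
Qed.

Lemma rnormZ (a : K) x : rnorm (a *: x) = kabs a * rnorm x.
Proof. by apply: (@emb_inj R s); rewrite embM -norm_rnorm normrZ norm_rnorm norm_kabs. Qed.

Lemma rnormZe (a : R) x : rnorm (emb s a *: x) = `|a| * rnorm x.
Proof. by rewrite rnormZ kabs_emb. Qed.

Lemma ler_rnorm_sum I (r : seq I) (P : pred I) (F : I -> X) :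
  rnorm (\sum_(i <- r | P i) F i) <= \sum_(i <- r | P i) rnorm (F i).
Proof.
elim/big_ind2 : _ => //; first by rewrite rnorm0.
by move=> x1 x2 y1 y2 h1 h2; rewrite (le_trans (ler_rnormD _ _)) ?lerD.
Qed.

Lemma cvg_rnorm T (F : set_system T) {FF : Filter F} (f : T -> X) (l : X) :
  f @ F --> l <-> forall e : R, 0 < e -> \forall t \near F, rnorm (f t - l) < e.
Proof.
split.
  move=> /cvgrPdist_lt fl e e0; have := fl (emb s e).
  rewrite -(emb0 R s) lt_emb => /(_ e0); apply: filterS => t.
  by rewrite norm_rnorm lt_emb rdistC.
move=> fl; apply/cvgrPdist_lt => e e0.
have ee : e = emb s (real_part e) by apply: emb_real_part; exact: ltW.
move: e0; rewrite ee; move: (real_part e) => {ee}e; rewrite -(emb0 R s) lt_emb.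
by move=> /fl; apply: filterS => t; rewrite norm_rnorm lt_emb rdistC.
Qed.

Lemma continuous_rnorm (T : topologicalType) (f : T -> X) :
  continuous f <-> forall t (e : R), 0 < e -> \forall u \near t, rnorm (f u - f t) < e.
Proof.
split=> fc t; last first.
  apply/cvg_rnorm.
  exact: fc.
by have /cvg_rnorm := fc t.
Qed.

Lemma cvg_seq_rnorm (u : nat -> X) (l : X) : u n @[n --> \oo] --> l <->
  forall e : R, 0 < e -> exists N, forall n, (N <= n)%N -> rnorm (u n - l) < e.
Proof.
split.
  move=> /cvg_rnorm ul e e0; have [N _ NP] := ul _ e0; by exists N => n; apply: NP.
by move=> ul; apply/cvg_rnorm => e e0; have [N NP] := ul e e0; exists N.
Qed.

Lemma rnorm_lim_unique (x y : X) :
  (forall e : R, 0 < e -> rnorm (x - y) < e) -> x = y.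
Proof.
move=> xy; apply/eqP; rewrite -subr_eq0; apply/eqP/rnorm0_eq0/eqP.
rewrite eq_le rnorm_ge0 andbT leNgt; apply/negP => d0.
by have := xy _ d0; rewrite ltxx.
Qed.

End real_norm.

Lemma rnorm_K (R : realType) (s : scalars) (k : (scalar_field R s)^o) :
  rnorm k = kabs k.
Proof. by []. Qed.

(** * Completion of seminormed spaces *)

(** A dependent product under its own name, so that it can carry a module structure. It serves with
    a constant factor for the dual of a space and with varying factors for ultraproducts. *)
Definition families (I : Type) (T : I -> Type) := forall i, T i.

Section families.
Variables (K : pzRingType) (I : Type) (T : I -> lmodType K).
Local Notation fam := (families T).

HB.instance Definition _ := gen_eqMixin fam.
HB.instance Definition _ := gen_choiceMixin fam.

Fact fam_addA : associative (fun (x y : fam) => (fun i => x i + y i) : fam).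
Proof. by move=> x y z; apply/functional_extensionality_dep => i; exact: addrA. Qed.
Fact fam_addC : commutative (fun (x y : fam) => (fun i => x i + y i) : fam).
Proof. by move=> x y; apply/functional_extensionality_dep => i; exact: addrC. Qed.
Fact fam_add0 : left_id ((fun i => 0) : fam) (fun (x y : fam) => (fun i => x i + y i) : fam).
Proof. by move=> x; apply/functional_extensionality_dep => i; exact: add0r. Qed.
Fact fam_addN : left_inverse ((fun i => 0) : fam) (fun x : fam => (fun i => - x i) : fam)
  (fun (x y : fam) => (fun i => x i + y i) : fam).
Proof. by move=> x; apply/functional_extensionality_dep => i; exact: addNr. Qed.

HB.instance Definition _ := GRing.isZmodule.Build fam fam_addA fam_addC fam_add0 fam_addN.

Fact fam_scaleA (a b : K) (v : fam) :
  (fun i => a *: (b *: v i)) = (fun i => (a * b) *: v i) :> fam.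
Proof. by apply/functional_extensionality_dep => i; exact: scalerA. Qed.
Fact fam_scale1 (v : fam) : (fun i => 1 *: v i) = v.
Proof. by apply/functional_extensionality_dep => i; exact: scale1r. Qed.
Fact fam_scaleDr (a : K) (u v : fam) :
  (fun i => a *: (u i + v i)) = (fun i => a *: u i + a *: v i) :> fam.
Proof. by apply/functional_extensionality_dep => i; exact: scalerDr. Qed.
Fact fam_scaleDl (v : fam) (a b : K) :
  (fun i => (a + b) *: v i) = (fun i => a *: v i + b *: v i) :> fam.
Proof. by apply/functional_extensionality_dep => i; exact: scalerDl. Qed.

HB.instance Definition _ := GRing.Zmodule_isLmodule.Build K fam
  fam_scaleA fam_scale1 fam_scaleDr fam_scaleDl.

Lemma famD (x y : fam) i : (x + y) i = x i + y i. Proof. by []. Qed.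
Lemma famB (x y : fam) i : (x - y) i = x i - y i. Proof. by []. Qed.
Lemma famZ a (x : fam) i : (a *: x) i = a *: x i. Proof. by []. Qed.
Lemma fam0 i : (0 : fam) i = 0. Proof. by []. Qed.
Lemma fam_sum J (r : seq J) (P : pred J) (F : J -> fam) i :
  (\sum_(j <- r | P j) F j) i = \sum_(j <- r | P j) F j i.
Proof. exact: (big_morph (fun v : fam => v i)). Qed.

End families.

(** * Completeness through geometric increments *)

Section complete_sequences.
Variables (R : realType) (s : scalars).
Local Notation K := (scalar_field R s).

Lemma half_expn_small (e : R) : 0 < e -> exists N : nat, 2^-1 ^+ N < e.
Proof.
move=> e0.
have /cvgrPdist_lt /(_ _ e0) [N _ /(_ N (leqnn _))] /= :
  (2^-1 : R) ^+ n @[n --> \oo] --> (0 : R).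
  by apply: cvg_expr; rewrite ger0_norm ?invr_ge0 // invf_lt1 // ltr1n.
rewrite sub0r normrN ger0_norm; last by rewrite exprn_ge0 // invr_ge0.
by move=> ?; exists N.
Qed.

Lemma geometric_dist (X : normedModType K) (C : R) (u : nat -> X) :
  (forall n, rnorm (u n.+1 - u n) <= C * 2^-1 ^+ n) ->
  forall n k, (n <= k)%N -> rnorm (u k - u n) <= 2 * C * 2^-1 ^+ n.
Proof.
move=> uC n k /subnK <-; set d := (k - n)%N.
(* The exact value of the geometric sum is kept, since the induction on d does not close with the
   weaker bound. *)
suff : rnorm (u (d + n)%N - u n) <= C * (2 * 2^-1 ^+ n - 2 * 2^-1 ^+ (d + n)).
  move/le_trans; apply.
  have C0 : 0 <= C by have := le_trans (rnorm_ge0 _) (uC 0%N); rewrite expr0 mulr1.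
  have : 0 <= C * (2^-1 : R) ^+ (d + n) by rewrite mulr_ge0 // exprn_ge0 // invr_ge0.
  lra.
elim: {k}d => [|d IH]; first by rewrite add0n !subrr mulr0 rnorm0.
have := ler_rdist (u (d + n)%N) (u (d.+1 + n)%N) (u n).
have := uC (d + n)%N; rewrite addSn exprS; lra.
Qed.

Lemma cauchy_seq_cvg (X : completeNormedModType K) (u : nat -> X) :
  (forall e : R, 0 < e -> exists N, forall n k, (N <= n)%N -> (N <= k)%N ->
    rnorm (u n - u k) < e) -> exists l : X, u n @[n --> \oo] --> l.
Proof.
move=> uC; apply/cvg_ex; apply: cauchy_cvg; apply: (@cauchy_exP K X _ _) => e e0.
have ee : e = emb s (real_part e) by apply: emb_real_part; exact: ltW.
have [N NP] : exists N, forall n k, (N <= n)%N -> (N <= k)%N ->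
    rnorm (u n - u k) < real_part e.
  by apply: uC; rewrite -(lt_emb s) -ee emb0.
exists (u N); exists N => // n /= Nn.
by rewrite -ball_normE /ball_ /= norm_rnorm ee lt_emb; apply: NP.
Qed.

Lemma geometric_cvg (X : completeNormedModType K) (C : R) (u : nat -> X) :
  (forall n, rnorm (u n.+1 - u n) <= C * 2^-1 ^+ n) ->
  exists l : X, u n @[n --> \oo] --> l /\ forall n, rnorm (l - u n) <= 2 * C * 2^-1 ^+ n.
Proof.
move=> uC; have uG := geometric_dist uC.
have C0 : 0 <= C by have := le_trans (rnorm_ge0 _) (uC 0%N); rewrite expr0 mulr1.
have [l ul] : exists l : X, u n @[n --> \oo] --> l.
  apply: cauchy_seq_cvg => e e0.
  have C1 : 0 < 4 * C + 1 by lra.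
  have [N NP] := half_expn_small (divr_gt0 e0 C1).
  exists N => n k Nn Nk.
  have := ler_rdist (u N) (u n) (u k); rewrite (rdistC (u N)).
  have := uG _ _ Nn; have := uG _ _ Nk.
  move: NP; rewrite ltr_pdivlMr; last lra.
  have : 0 <= (2^-1 : R) ^+ N by rewrite exprn_ge0 // invr_ge0.
  lra.
exists l; split=> // n; apply/ler_addgt0Pr => e e0.
have [N NP] := (cvg_seq_rnorm _ _).1 ul e e0.
have := NP _ (leq_maxl N n); have := uG _ _ (leq_maxr N n).
have := ler_rdist (u (maxn N n)) l (u n); rewrite (rdistC l (u (maxn N n))).
lra.
Qed.

End complete_sequences.

(** * The Banach space of a complete seminorm *)

Section quotient_banach.
Variables (R : realType) (s : scalars).
Local Notation K := (scalar_field R s).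

(** The domain D is needed because p is an infimum or an ultralimit in the applications, which means
    something only on bounded functions or bounded families. Completeness is asked of rapidly Cauchy
    sequences, which is the form in which both applications prove it. *)
Record complete_seminorm (V : lmodType K) (D : set V) (p : V -> R) : Prop := {
  sn_0 : D 0 ;
  sn_lin : forall a x y, D x -> D y -> D (a *: x + y) ;
  sn_D : forall x y, D x -> D y -> p (x + y) <= p x + p y ;
  sn_Z : forall a x, D x -> p (a *: x) = kabs a * p x ;
  sn_complete : forall u : nat -> V, (forall k, D (u k)) ->
    (forall k, p (u k.+1 - u k) <= 2^-1 ^+ k) ->
    exists2 l, D l & forall e, 0 < e -> exists N, forall k, (N <= k)%N -> p (u k - l) < e
}.

Variables (V : lmodType K) (D : set V) (p : V -> R).
Hypothesis Dp : complete_seminorm D p.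

Let DZ a x : D x -> D (a *: x).
Proof. by move=> Dx; rewrite -[_ *: _]addr0; apply: (sn_lin Dp) => //; exact: sn_0 Dp. Qed.
Let DD x y : D x -> D y -> D (x + y).
Proof. by move=> Dx Dy; rewrite -[x]scale1r; apply: (sn_lin Dp). Qed.
Let DN x : D x -> D (- x).
Proof. by move=> Dx; rewrite -scaleN1r; exact: DZ. Qed.
Let DB x y : D x -> D y -> D (x - y).
Proof. by move=> Dx Dy; apply: DD => //; exact: DN. Qed.
Let p0 : p 0 = 0.
Proof. by rewrite -(scale0r 0) (sn_Z Dp) ?kabs0 ?mul0r //; exact: sn_0 Dp. Qed.
Let pN x : D x -> p (- x) = p x.
Proof. by move=> Dx; rewrite -scaleN1r (sn_Z Dp) // kabsN kabs1 mul1r. Qed.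
Let p_ge0 x : D x -> 0 <= p x.
Proof.
move=> Dx; have := sn_D Dp Dx (DN Dx); rewrite subrr p0 pN // -mulr2n.
by rewrite pmulrn_lge0.
Qed.
Let pC x y : D x -> D y -> p (x - y) = p (y - x).
Proof. by move=> Dx Dy; rewrite -pN ?opprB //; exact: DB. Qed.

(* A point of the quotient is represented by a chosen element of its class. *)
Let canon (x : V) : V := xget 0 [set y | D y /\ p (x - y) = 0].

Let canonP x : D x -> D (canon x) /\ p (x - canon x) = 0.
Proof.
move=> Dx; rewrite /canon; case: xgetP => [y -> []//|/(_ x)].
by rewrite /= subrr p0 => -[].
Qed.

Let canon_eq x y : D x -> D y -> p (x - y) = 0 -> canon x = canon y.
Proof.
move=> Dx Dy xy; rewrite /canon; congr xget; apply/seteqP.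
have sub a b z : D a -> D b -> p (a - b) = 0 -> D z /\ p (a - z) = 0 -> D z /\ p (b - z) = 0.
  move=> Da Db ab [Dz az]; split=> //; apply/eqP; rewrite eq_le p_ge0 ?andbT; last exact: DB.
  rewrite -(subrKA a); apply: le_trans (sn_D Dp (DB Db Da) (DB Da Dz)) _.
  by rewrite pC // ab az addr0.
by split=> z; apply: sub => //; rewrite pC.
Qed.

Let P (x : V) : bool := `[< D x /\ canon x = x >].

Definition quotient_carrier := {x : V | P x}.
Local Notation Q := quotient_carrier.
HB.instance Definition _ := SubType.copy Q {x : V | P x}.
HB.instance Definition _ := [Choice of Q by <:].

Let P_canon x : D x -> P (canon x).
Proof.
move=> Dx; have [Dc xc] := canonP Dx; apply/asboolP; split=> //.
by apply/esym/canon_eq.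
Qed.

Let QD (x : Q) : D (val x).
Proof. by case: x => x /= /asboolP[]. Qed.

Let q0 (x : V) : Q :=
  match pselect (D x) with
  | left Dx => Sub (canon x) (P_canon Dx)
  | right _ => Sub (canon 0) (P_canon (sn_0 Dp))
  end.

Let val_q0 x : D x -> val (q0 x) = canon x.
Proof. by move=> Dx; rewrite /q0; case: pselect. Qed.

Let q0K (x : Q) : q0 (val x) = x.
Proof.
by apply/val_inj; rewrite val_q0 //; case: x => x /= /asboolP[].
Qed.

Let q0_eq x y : D x -> D y -> p (x - y) = 0 -> q0 x = q0 y.
Proof. by move=> Dx Dy xy; apply: val_inj; rewrite !val_q0 //; exact: canon_eq. Qed.

Let q0_val x : D x -> p (val (q0 x) - x) = 0.
Proof. by move=> Dx; rewrite val_q0 // pC ?(canonP Dx).2 //; exact: (canonP Dx).1. Qed.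

Let q0_eqD x y x' y' : D x -> D y -> D x' -> D y' -> p (x - x') = 0 -> p (y - y') = 0 ->
  q0 (x + y) = q0 (x' + y').
Proof.
move=> Dx Dy Dx' Dy' xx yy; apply: q0_eq; [exact: DD|exact: DD|].
apply/eqP; rewrite eq_le p_ge0 ?andbT; last by apply: DB; exact: DD.
rewrite opprD addrACA; apply: le_trans (sn_D Dp (DB Dx Dx') (DB Dy Dy')) _.
by rewrite xx yy addr0.
Qed.

Let q0_eqZ a x x' : D x -> D x' -> p (x - x') = 0 -> q0 (a *: x) = q0 (a *: x').
Proof.
move=> Dx Dx' xx; apply: q0_eq; [exact: DZ|exact: DZ|].
by rewrite -scalerBr (sn_Z Dp) ?xx ?mulr0 //; exact: DB.
Qed.

Let Qadd (x y : Q) : Q := q0 (val x + val y).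
Let Qopp (x : Q) : Q := q0 (- val x).
Let Qzero : Q := q0 0.
Let Qscale a (x : Q) : Q := q0 (a *: val x).

Let psub x : p (x - x) = 0. Proof. by rewrite subrr p0. Qed.

Let QaddC : commutative Qadd.
Proof. by move=> x y; rewrite /Qadd addrC. Qed.
Let QaddA : associative Qadd.
Proof.
move=> x y z; rewrite /Qadd.
transitivity (q0 (val x + (val y + val z))).
  by apply: q0_eqD => //; [exact: DD|rewrite q0_val //; exact: DD].
by rewrite addrA; apply/esym/q0_eqD => //; [exact: DD|rewrite q0_val //; exact: DD].
Qed.
Let Qadd0 : left_id Qzero Qadd.
Proof.
move=> x; rewrite /Qadd -{2}[x]q0K -[in RHS](add0r (val x)).
by apply: q0_eqD => //; [exact: sn_0 Dp|rewrite q0_val //; exact: sn_0 Dp].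
Qed.
Let QaddN : left_inverse Qzero Qopp Qadd.
Proof.
move=> x; rewrite /Qadd /Qopp /Qzero -[in RHS](addNr (val x)).
by apply: q0_eqD => //; [exact: DN|rewrite q0_val //; exact: DN].
Qed.
HB.instance Definition _ := GRing.isZmodule.Build Q QaddA QaddC Qadd0 QaddN.

Let QaddE (x y : Q) : x + y = q0 (val x + val y). Proof. by []. Qed.

Let QscaleA (a b : K) (v : Q) : Qscale a (Qscale b v) = Qscale (a * b) v.
Proof.
rewrite /Qscale -scalerA; apply: q0_eqZ => //; first exact: DZ.
by rewrite q0_val //; exact: DZ.
Qed.
Let Qscale1 (v : Q) : Qscale 1 v = v.
Proof. by rewrite /Qscale scale1r q0K. Qed.
Let QscaleDr (a : K) (u v : Q) : Qscale a (u + v) = Qscale a u + Qscale a v.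
Proof.
rewrite !QaddE /Qscale (q0_eqZ a (QD _) (DD (QD u) (QD v)) (q0_val _)); last exact: DD.
rewrite scalerDr; apply: (q0_eqD (DZ _ (QD u)) (DZ _ (QD v)) (QD _) (QD _)).
  by rewrite (pC (DZ _ (QD _)) (QD _)) (q0_val (DZ _ (QD u))).
by rewrite (pC (DZ _ (QD _)) (QD _)) (q0_val (DZ _ (QD v))).
Qed.
Let QscaleDl (v : Q) (a b : K) : Qscale (a + b) v = Qscale a v + Qscale b v.
Proof.
rewrite QaddE /Qscale scalerDl.
apply: (q0_eqD (DZ _ (QD _)) (DZ _ (QD _)) (QD _) (QD _)).
  by rewrite (pC (DZ _ (QD _)) (QD _)) (q0_val (DZ a (QD v))).
by rewrite (pC (DZ _ (QD _)) (QD _)) (q0_val (DZ b (QD v))).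
Qed.
HB.instance Definition _ := GRing.Zmodule_isLmodule.Build K Q
  QscaleA Qscale1 QscaleDr QscaleDl.

Let QscaleE a (x : Q) : a *: x = q0 (a *: val x). Proof. by []. Qed.

Let peq x y : D x -> D y -> p (x - y) = 0 -> p x = p y.
Proof.
move=> Dx Dy xy; apply/eqP; rewrite eq_le; apply/andP; split.
  have := sn_D Dp (DB Dx Dy) Dy; rewrite subrK xy add0r //.
have := sn_D Dp (DB Dy Dx) Dx; rewrite subrK pC // xy add0r //.
Qed.

Let pq0 x : D x -> p (val (q0 x)) = p x.
Proof. by move=> Dx; apply: peq; rewrite ?q0_val. Qed.

Let Qnorm (x : Q) : K := emb s (p (val x)).
Let Qnorm_D x y : Qnorm (x + y) <= Qnorm x + Qnorm y.
Proof. by rewrite -embD le_emb pq0 ?(sn_D Dp) //; exact: DD. Qed.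
Let Qnorm_Z (l : K) x : Qnorm (l *: x) = `|l| * Qnorm x.
Proof. by rewrite norm_kabs -embM /Qnorm pq0 ?(sn_Z Dp) //; exact: DZ. Qed.
Let Qnorm_0 x : Qnorm x = 0 -> x = 0.
Proof.
move=> /eqP; rewrite emb_eq0 => /eqP x0; rewrite -[x]q0K.
by apply: q0_eq; rewrite ?subr0 //; exact: sn_0 Dp.
Qed.
HB.instance Definition _ := Lmodule_isNormed.Build K Q Qnorm_D Qnorm_Z Qnorm_0.

Let rnormQ (x : Q) : rnorm x = p (val x).
Proof. by rewrite /rnorm /Num.norm /= embK. Qed.

Let q0_lin a x y : D x -> D y -> q0 (a *: x + y) = a *: q0 x + q0 y.
Proof.
move=> Dx Dy; rewrite QscaleE (q0_eqZ a (QD _) Dx (q0_val Dx)) QaddE.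
apply: (q0_eqD (DZ _ Dx) Dy (QD _) (QD _)).
  by rewrite (pC (DZ _ Dx) (QD _)) (q0_val (DZ a Dx)).
by rewrite (pC Dy (QD _)) (q0_val Dy).
Qed.

Let q0B x y : D x -> D y -> q0 x - q0 y = q0 (x - y).
Proof.
by move=> Dx Dy; rewrite -(scaleN1r (q0 y)) -(scaleN1r y) addrC -q0_lin // addrC.
Qed.

Let Qcomplete (F : set_system Q) : ProperFilter F -> cauchy F -> cvg F.
Proof.
move=> FF Fc.
(* Two balls of the filter meet, so consecutive centres are at distance less than 2^-(k+2) +
   2^-(k+3), within the 2^-k required by [sn_complete]. *)
have small k : exists x : Q, F (ball x (emb s (2^-1 ^+ k.+2))).
  have /(@cauchyP K Q _ FF) := Fc; apply; rewrite -(emb0 R s) lt_emb.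
  by rewrite exprn_gt0 // invr_gt0.
have [u uP] := choice small.
have [|l Dl lP] := @sn_complete _ _ _ Dp (fun k => val (u k)) (fun k => QD (u k)).
  move=> k; rewrite -(_ : rnorm (u k.+1 - u k) = p (val (u k.+1) - val (u k))); last first.
    rewrite -[u k.+1 in LHS]q0K -[u k in LHS]q0K q0B // rnormQ pq0 //; exact: DB.
  have [y [y1 y2]] := filter_ex (filterI (uP k) (uP k.+1)).
  have := ler_rdist y (u k.+1) (u k).
  move: y1 y2; rewrite -!ball_normE /ball_ /= !norm_rnorm !lt_emb (rdistC y) !exprS.
  have : 0 < (2^-1 : R) ^+ k by rewrite exprn_gt0 // invr_gt0.
  lra.
apply/cvg_ex; exists (q0 l); apply/cvg_rnorm => e e0.
have e2 : 0 < e / 2 by rewrite divr_gt0.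
have [N1 N1P] := half_expn_small e2; have [N2 N2P] := lP _ e2.
set N := maxn N1 N2; apply: filterS (uP N) => y.
rewrite -ball_normE /ball_ /= norm_rnorm lt_emb => yN.
have := ler_rdist (u N) y (q0 l); rewrite (rdistC y (u N)).
have -> : rnorm (u N - q0 l) = p (val (u N) - l).
  by rewrite -[u N in LHS]q0K q0B // rnormQ pq0 //; exact: DB.
have := N2P N (leq_maxr _ _).
have : (2^-1 : R) ^+ N.+2 <= 2^-1 ^+ N1.
  by rewrite ler_wiXn2l // ?invr_ge0 // ?invf_le1 ?ler1n // (leq_trans (leq_maxl N1 N2)) // -addn2 leq_addr.
lra.
Qed.

HB.instance Definition _ := Uniform_isComplete.Build Q Qcomplete.

(** The interface behind which the construction is hidden: q is total, but says something only about
    the vectors of D. *)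
Lemma quotient_banachP : exists (E : completeNormedModType K) (q : V -> E),
  [/\ forall a x y, D x -> D y -> q (a *: x + y) = a *: q x + q y,
      forall x, D x -> rnorm (q x) = p x &
      forall e : E, exists2 x, D x & q x = e].
Proof.
exists Q, q0; split; [exact: q0_lin|by move=> x Dx; rewrite rnormQ pq0|].
by move=> e; exists (val e); rewrite ?q0K.
Qed.

End quotient_banach.

(** * Hahn-Banach theorem *)

Section hahn_banach.
Variables (R : realType) (s : scalars).
Local Notation K := (scalar_field R s).
Variables (V : lmodType K) (p : V -> R).
Hypothesis pD : forall x y, p (x + y) <= p x + p y.
Hypothesis pZ : forall t x, 0 <= t -> p (emb s t *: x) = t * p x.

Let p0 : p 0 = 0.
Proof. by rewrite -(scale0r 0) -(emb0 R s) pZ ?mul0r. Qed.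

(** A partial real functional is encoded by its graph. Functionality is not part of the definition:
    two values at one point would differ by a value of the graph at 0, which [p 0] = 0 dominates. *)
Let dominated (g : set (V * R)) :=
  (forall t x y a b, g (x, a) -> g (y, b) -> g (emb s t *: x + y, t * a + b)) /\
  (forall x a, g (x, a) -> a <= p x).

Let dominated_extend (g : set (V * R)) (x1 : V) : dominated g -> g !=set0 ->
  exists2 h, dominated h & g `<=` h /\ exists a, h (x1, a).
Proof.
move=> [glin gp] g0.
have gN x a : g (x, a) -> g (- x, - a).
  move=> gxa; have := glin (- 2) _ _ _ _ gxa gxa.
  have -> : emb s (- 2) *: x + x = - x.
    rewrite -[X in _ + X]scale1r -(emb1 R s) -scalerDl -embD -scaleN1r.
    by rewrite -(emb1 R s) -embN; congr (emb s _ *: _); ring.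
  by have -> : - 2 * a + a = - a by ring.
have g00 : g (0, 0).
  case: g0 => -[x a] gxa; have := glin 1 _ _ _ _ gxa (gN _ _ gxa).
  by rewrite emb1 scale1r mul1r !subrr.
(* A value c at x1 is admissible when it lies between all a - p (x - x1) and all p (y + x1) - b;
   subadditivity puts the former below the latter, and c is the supremum of the former. *)
pose L := [set r | exists x a, g (x, a) /\ r = a - p (x - x1)].
have Lub y b : g (y, b) -> ubound L (p (y + x1) - b).
  move=> gyb _ [x [a [gxa ->]]].
  have := gp _ _ (glin 1 _ _ _ _ gxa gyb); rewrite emb1 scale1r mul1r.
  have -> : x + y = (x - x1) + (y + x1) by rewrite addrACA addNr addr0.
  by have := pD (x - x1) (y + x1); lra.
have Lsup : has_sup L.
  split; first by exists (0 - p (0 - x1)), 0, 0.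
  by exists (p (0 + x1) - 0); apply: Lub.
pose c := sup L.
have c_le y b : g (y, b) -> c <= p (y + x1) - b.
  by move=> gyb; apply: sup_le_ub; [case: Lsup|exact: Lub].
have c_ge x a : g (x, a) -> a - p (x - x1) <= c.
  by move=> gxa; apply: sup_upper_bound => //; exists x, a.
exists [set z | exists x a t, [/\ g (x, a), z.1 = x + emb s t *: x1 & z.2 = a + t * c]].
  split.
    move=> t _ _ _ _ [x [a [u [/= gxa -> ->]]]] [y [b [v [/= gyb -> ->]]]].
    exists (emb s t *: x + y), (t * a + b), (t * u + v); split; [exact: glin| |by ring].
    by rewrite scalerDr embD scalerDl embM scalerA addrACA.
  move=> _ _ [x [a [t [/= gxa -> ->]]]].
  have gS r : g (emb s r *: x, r * a).
    by have := glin r _ _ _ _ gxa g00; rewrite !addr0.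
  have [t0|t0|t0] := ltgtP t 0.
  - have Nt0 : 0 < - t by lra.
    have h := c_ge _ _ (gS (- t)^-1); rewrite -(ler_pM2l Nt0) in h.
    rewrite mulrBr mulrA divff ?gt_eqF // mul1r -pZ ?(ltW Nt0) // in h.
    rewrite scalerBr scalerA -embM divff ?gt_eqF // emb1 scale1r in h.
    by move: h; rewrite embN scaleNr opprK; lra.
  - have h := c_le _ _ (gS t^-1); rewrite -(ler_pM2l t0) in h.
    rewrite mulrBr mulrA divff ?gt_eqF // mul1r -pZ ?(ltW t0) // in h.
    rewrite scalerDr scalerA -embM divff ?gt_eqF // emb1 scale1r in h.
    by move: h; lra.
  - by rewrite t0 emb0 scale0r mul0r !addr0; exact: gp.
split=> [[x a] gxa|]; first by exists x, a, 0; rewrite emb0 scale0r mul0r !addr0.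
by exists c, 0, 0, 1; rewrite emb1 scale1r mul1r !add0r.
Qed.

Lemma hahn_banach (x0 : V) : exists psi : V -> R,
  [/\ forall x y, psi (x + y) = psi x + psi y,
      forall t x, psi (emb s t *: x) = t * psi x,
      forall x, psi x <= p x & psi x0 = p x0].
Proof.
pose L : set (V * R) := [set z | exists t, z = (emb s t *: x0, t * p x0)].
have domL : dominated L.
  split.
    move=> t _ _ _ _ [u [-> ->]] [v [-> ->]]; exists (t * u + v).
    by rewrite scalerA -embM -scalerDl -embD mulrDl mulrA.
  move=> _ _ [t [-> ->]]; case: (leP 0 t) => t0; first by rewrite pZ.
  have := pD (emb s t *: x0) (emb s (- t) *: x0).
  rewrite -scalerDl -embD subrr emb0 scale0r p0 (@pZ (- t)); lra.
(* The order is on the sets g with g and L together dominated, not on the dominated sets containing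
   L: the empty chain, whose union is empty, is then no exception. *)
have [|g [gP gmax]] := @Zorn_bigcup _ [set g | dominated (g `|` L)].
  move=> F FP Ftot; split.
    move=> t x y a b; pose z1 := (x, a); pose z2 := (y, b); rewrite -/z1 -/z2.
    have pick1 z X : F X -> ((\bigcup_(Y in F) Y) `|` L) z ->
        exists2 Y, F Y & (Y `|` L) z.
      by move=> FX [[Y FY Yz]|Lz]; [exists Y => //; left|exists X => //; right].
    move=> h1 h2.
    have [[X FX]|F0] := pselect (F !=set0); last first.
      have noF z : ((\bigcup_(Y in F) Y) `|` L) z -> L z.
        by move=> [[Y FY _]|//]; case: F0; exists Y.
      by right; apply: domL.1; exact: noF.
    have [X1 FX1 X1z] := pick1 _ _ FX h1; have [X2 FX2 X2z] := pick1 _ _ FX h2.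
    have [Y FY [Y1 Y2]] : exists2 Y, F Y & (Y `|` L) z1 /\ (Y `|` L) z2.
      have [X12|X21] := Ftot _ _ FX1 FX2.
        by exists X2 => //; split=> //; case: X1z => [/X12|]; [left|right].
      by exists X1 => //; split=> //; case: X2z => [/X21|]; [left|right].
    have [Ylin _] := FP _ FY.
    by case: (Ylin t _ _ _ _ Y1 Y2) => ?; [left; exists Y|right].
  move=> x a [[Y FY Yz]|Lz]; last exact: domL.2.
  by apply: (FP _ FY).2; left.
pose G := g `|` L.
have GL0 : G (x0, p x0) by right; exists 1; rewrite emb1 scale1r mul1r.
have Gtot x : exists a, G (x, a).
  have G0 : G !=set0 by exists (x0, p x0).
  have [h hdom [Gh [a ha]]] := dominated_extend x gP G0.
  have hL : h `|` L = h by apply/seteqP; split=> [z [//|Lz]|z]; [apply: Gh; right|left].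
  have [hG|hG] := pselect (h `<=` G); first by exists a; exact: hG.
  have := gmax (h `|` L); rewrite hL => H; exfalso; apply: H; last by rewrite /= hL.
  by split=> [z gz|hg]; [apply: Gh; left|apply: hG => z /hg; left].
have [Glin Gp] := gP; have [psi psiP] := choice Gtot.
have G_inj x a b : G (x, a) -> G (x, b) -> a = b.
  have half u v : G (x, u) -> G (x, v) -> u <= v.
    move=> Gu Gv; have := Gp _ _ (Glin (- 1) _ _ _ _ Gv Gu).
    by rewrite embN emb1 scaleN1r addNr p0; lra.
  by move=> Ga Gb; apply/eqP; rewrite eq_le !half.
exists psi; split.
- move=> x y; apply: G_inj (psiP _) _.
  by have := Glin 1 _ _ _ _ (psiP x) (psiP y); rewrite emb1 scale1r mul1r.
- move=> t x; apply: G_inj (psiP _) _.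
  have G00 : G (0, 0) by right; exists 0; rewrite emb0 scale0r mul0r.
  by have := Glin t _ _ _ _ (psiP x) G00; rewrite !addr0.
- by move=> x; apply: Gp (psiP x).
- exact: G_inj (psiP _) _.
Qed.

End hahn_banach.

Lemma exists_linear (K : pzRingType) (U V : lmodType K) (f : U -> V) :
  (forall a x y, f (a *: x + y) = a *: f x + f y) ->
  exists g : {linear U -> V}, forall x, g x = f x.
Proof.
move=> flin.
pose g := HB.pack_for {linear U -> V} f (GRing.isLinear.Build K U V _ f flin).
by exists g.
Qed.

(** * Continuous functionals from real ones *)

Section functionals.
Variables (R : realType) (s : scalars).
Local Notation K := (scalar_field R s).

Lemma nbhs_rnorm (X : normedModType K) (x : X) (A : set X) :
  nbhs x A <-> exists2 d : R, 0 < d & forall y, rnorm (y - x) < d -> A y.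
Proof.
split=> [/nbhs_ballP[d d0 dA]|[d d0 dA]].
  have dd : d = emb s (real_part d) by apply: emb_real_part; exact: ltW.
  exists (real_part d); first by rewrite -(lt_emb s) -dd emb0.
  by move=> y yx; apply: dA; rewrite -ball_normE /ball_ /= norm_rnorm dd lt_emb rdistC.
apply/nbhs_ballP; exists (emb s d); first by rewrite /= -(emb0 R s) lt_emb.
by move=> y; rewrite -ball_normE /ball_ /= norm_rnorm lt_emb rdistC; exact: dA.
Qed.

Lemma rnorm_bound_continuous (X Y : normedModType K) (f : {linear X -> Y}) (c : R) :
  (forall x, rnorm (f x) <= c * rnorm x) -> continuous f.
Proof.
move=> fc; apply/continuous_rnorm => x e e0.
have c1 : 0 < `|c| + 1 by rewrite ltr_wpDl.
apply/nbhs_rnorm; exists (e / (`|c| + 1)); first by rewrite divr_gt0.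
move=> y; rewrite ltr_pdivlMr // -linearB; apply: le_lt_trans.
apply: le_trans (fc _) _; rewrite mulrC ler_wpM2l ?rnorm_ge0 //.
by have := ler_norm c; lra.
Qed.

Lemma continuous_rnorm_bound (X Y : normedModType K) (f : {linear X -> Y}) :
  continuous f -> exists2 c, 0 <= c & forall x, rnorm (f x) <= c * rnorm x.
Proof.
move=> /continuous_rnorm/(_ 0 1 ltr01); rewrite linear0.
move/nbhs_rnorm => [d d0 dP].
exists (2 / d) => [|x]; first by rewrite divr_ge0 // ltW.
have [->|x0] := eqVneq x 0; first by rewrite linear0 !rnorm0 mulr0.
have nx : 0 < rnorm x.
  by rewrite lt_neqAle rnorm_ge0 andbT eq_sym; apply: contra_neq x0 => /rnorm0_eq0.
pose t := d / (2 * rnorm x).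
have t0 : 0 < t by rewrite divr_gt0 // mulr_gt0.
have tn : t * rnorm x = d / 2 by rewrite /t; field; rewrite gt_eqF.
have := dP (emb s t *: x); rewrite !subr0 linearZ /= !rnormZe gtr0_norm // tn.
have d2 : d / 2 < d by lra.
move=> /(_ d2) /ltW h; rewrite -(ler_pM2l t0) (le_trans h) //.
by rewrite mulrCA tn le_eqVlt; apply/orP; left; apply/eqP; field; rewrite gt_eqF.
Qed.

(** Over the complex numbers the functional is psi x - i psi (i x), the only complex linear one with
    real part psi. *)
Lemma exists_complexification (V : lmodType K) (psi : V -> R) :
  (forall x y, psi (x + y) = psi x + psi y) ->
  (forall t x, psi (emb s t *: x) = t * psi x) ->
  exists phi : {linear V -> K^o}, forall x, real_part (phi x : K) = psi x.
Proof.
move=> psiD psiZ; move: V psi psiD psiZ; rewrite /emb /real_part; case: s => V psi psiD psiZ.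
  have [|phi phiE] := @exists_linear _ V (R^o) psi.
    by move=> a x y; rewrite psiD psiZ.
  by exists phi => x; rewrite phiE.
pose i : R[i] := Complex 0 1.
have [|phi phiE] := @exists_linear _ V ((R[i])^o) (fun x => Complex (psi x) (- psi (i *: x))).
  have psiab a b (z : V) : psi (Complex a b *: z) = a * psi z + b * psi (i *: z).
    rewrite -!psiZ scalerA -psiD -scalerDl; congr (psi (_ *: _)).
    by apply/eqP; rewrite eq_complex /= !(mul0r, mulr0, mulr1, subr0, addr0, add0r) !eqxx.
  move=> [a b] x y; rewrite scalerDr !psiD scalerA.
  have -> : i * Complex a b = Complex (- b) a.
    by apply/eqP; rewrite eq_complex /= !(mul0r, mul1r, sub0r, add0r) !eqxx.
  rewrite (psiab a b) (psiab (- b) a); apply/eqP; rewrite eq_complex /=; apply/andP; split; apply/eqP; ring.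
by exists phi => x; rewrite phiE.
Qed.

(* |phi x| is the value of the real part of phi at a unit multiple of x. *)
Lemma kabs_le_of_real_part (V : lmodType K) (phi : {linear V -> K^o}) (x : V) (c : R) :
  (forall u : K, kabs u = 1 -> real_part (phi (u *: x) : K) <= c) -> kabs (phi x : K) <= c.
Proof.
move=> phic; have [px0|px0] := eqVneq (phi x : K) 0.
  by have := phic 1 (kabs1 _ _); rewrite scale1r px0 kabs0 rp0.
have k0 : kabs (phi x : K) != 0 by apply: contra_neq px0 => /kabs_eq0.
pose u : K := emb s (kabs (phi x : K)) / phi x.
have u1 : kabs u = 1 by rewrite kabsM kabsV kabs_emb ger0_norm ?kabs_ge0 // divff.
have := phic u u1; rewrite linearZ /= -[_ *: _]/(u * (phi x : K)).
by rewrite /u divfK // embK.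
Qed.

Lemma norming_functional (X : normedModType K) (x : X) : exists phi : {linear X -> K^o},
  [/\ continuous phi, forall y, kabs (phi y : K) <= rnorm y & real_part (phi x : K) = rnorm x].
Proof.
have [||psi [psiD psiZ psile psix]] := @hahn_banach R s X (@rnorm R s X) _ _ x.
- exact: ler_rnormD.
- by move=> t y t0; rewrite rnormZe ger0_norm.
have [phi phiE] := exists_complexification psiD psiZ.
have phib y : kabs (phi y : K) <= rnorm y.
  by apply: kabs_le_of_real_part => u u1; rewrite phiE (le_trans (psile _)) // rnormZ u1 mul1r.
exists phi; split=> //.
  by apply: (@rnorm_bound_continuous _ _ _ 1) => y; rewrite mul1r; exact: phib.
by rewrite phiE.
Qed.

End functionals.

(** * Ultralimits and duals *)

Section operator_norm.
Variables (R : realType) (s : scalars).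
Local Notation K := (scalar_field R s).
Variables X Y : normedModType K.
Implicit Types (V : set X) (f : X -> Y).

Lemma opnorm_le V f (M : R) : 0 <= M -> (forall x, V x -> rnorm (f x) <= M * rnorm x) ->
  (opnorm V f <= M%:E)%E.
Proof. by move=> M0 fM; apply: ereal_inf_lbound; exists M. Qed.

Lemma opnorm_ltP V f (e : R) : (opnorm V f < e%:E)%E ->
  exists M, [/\ 0 <= M, M < e & forall x, V x -> rnorm (f x) <= M * rnorm x].
Proof.
by move=> /ereal_inf_lt[_ [M [M0 fM] <-]]; rewrite lte_fin => Me; exists M.
Qed.

Lemma opnorm_leP V f (M : R) : (opnorm V f <= M%:E)%E ->
  forall x, V x -> rnorm (f x) <= M * rnorm x.
Proof.
move=> fM x Vx; apply/ler_addgt0Pr => e e0.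
have n1 : 0 < rnorm x + 1 by rewrite ltr_wpDl // rnorm_ge0.
have [|N [_ Ne /(_ _ Vx) /le_trans]] := @opnorm_ltP V f (M + e / (rnorm x + 1)).
  by rewrite (le_lt_trans fM) // lte_fin ltrDl divr_gt0.
apply; apply: le_trans (ler_wpM2r (rnorm_ge0 _) (ltW Ne)) _.
rewrite mulrDl lerD2l mulrAC ler_pdivrMr // ler_pM2l //.
by rewrite lerDl.
Qed.

Lemma opnorm_ge0 V f : (0 <= opnorm V f)%E.
Proof. by apply: le_ereal_inf_tmp => _ [M [M0 _] <-]; rewrite lee_fin. Qed.

End operator_norm.

Section ultralimits.
Variables (R : realType) (U : set_system nat).
Hypothesis U_ultra : UltraFilter U.
Hypothesis U_free : forall N, U [set n | (N <= n)%N].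

(** For a sequence bounded on a set of U this is its limit along U; for other sequences the value is
    meaningless. *)
Definition ulimit (u : nat -> R) : R := sup [set r | U [set n | r <= u n]].

Lemma ulimitP (u : nat -> R) (c : R) : U [set n | `|u n| <= c] ->
  forall e, 0 < e -> U [set n | `|u n - ulimit u| < e].
Proof.
move=> uc e e0.
have lb : U [set n | - c <= u n].
  by apply: filterS uc => n /=; rewrite ler_norml => /andP[].
have ub r : U [set n | r <= u n] -> r <= c.
  move=> ur; have [n [/= un rn]] := filter_ex (filterI uc ur).
  by rewrite (le_trans rn) // (le_trans (ler_norm _)).
have hs : has_sup [set r | U [set n | r <= u n]].
  by split; [exists (- c)|exists c => r; exact: ub].
have h1 : U [set n | ulimit u - e < u n].
  have [r Ur re] := sup_adherent e0 hs.
  by apply: filterS Ur => n /=; apply: lt_le_trans.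
have h2 : U [set n | u n < ulimit u + e].
  have [Ue|Ue] := @in_ultra_setVsetC _ _ [set n | ulimit u + e <= u n] U_ultra.
    have := sup_upper_bound hs Ue; rewrite -/(ulimit u); lra.
  by apply: filterS Ue => n /= /negP; rewrite -ltNge.
apply: filterS (filterI h1 h2) => n /= [n1 n2].
by rewrite ltr_norml; apply/andP; split; lra.
Qed.

Lemma ulimit_unique (u : nat -> R) (l : R) :
  (forall e, 0 < e -> U [set n | `|u n - l| < e]) -> ulimit u = l.
Proof.
move=> ul; have ub : U [set n | `|u n| <= `|l| + 1].
  apply: filterS (ul 1 ltr01) => n /= h.
  by rewrite -[u n](subrK l) (le_trans (ler_normD _ _)) // addrC lerD2l ltW.
apply/eqP; rewrite -subr_eq0 -normr_le0 leNgt; apply/negP => d0.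
have d2 : 0 < `|ulimit u - l| / 2 by rewrite divr_gt0.
have [n [/= h1 h2]] := filter_ex (filterI (ul _ d2) (ulimitP ub d2)).
have := ler_distD (u n) (ulimit u) l.
rewrite (distrC (ulimit u) (u n)); lra.
Qed.

Lemma ulimit_le (u : nat -> R) (c b : R) : U [set n | `|u n| <= c] ->
  U [set n | u n <= b] -> ulimit u <= b.
Proof.
move=> uc ub; apply/ler_addgt0Pr => e e0.
have [n [/= h1 h2]] := filter_ex (filterI ub (ulimitP uc e0)).
by move: h2; rewrite ltr_norml => /andP[]; lra.
Qed.

Lemma ulimit_ge (u : nat -> R) (c b : R) : U [set n | `|u n| <= c] ->
  U [set n | b <= u n] -> b <= ulimit u.
Proof.
move=> uc ub; apply/ler_addgt0Pr => e e0.
have [n [/= h1 h2]] := filter_ex (filterI ub (ulimitP uc e0)).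
by move: h2; rewrite ltr_norml => /andP[]; lra.
Qed.

Lemma ulimitD (u v : nat -> R) (c d : R) : U [set n | `|u n| <= c] ->
  U [set n | `|v n| <= d] -> ulimit (fun n => u n + v n) = ulimit u + ulimit v.
Proof.
move=> uc vd; apply: ulimit_unique => e e0; have e2 : 0 < e / 2 by rewrite divr_gt0.
apply: filterS (filterI (ulimitP uc e2) (ulimitP vd e2)) => n /= [].
by rewrite !ltr_norml => /andP[? ?] /andP[? ?]; apply/andP; split; lra.
Qed.

Lemma ulimitZ (a : R) (u : nat -> R) (c : R) : U [set n | `|u n| <= c] ->
  ulimit (fun n => a * u n) = a * ulimit u.
Proof.
move=> uc; apply: ulimit_unique => e e0.
have a1 : 0 < `|a| + 1 by rewrite ltr_wpDl.
apply: filterS (ulimitP uc (divr_gt0 e0 a1)) => n /=.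
rewrite ltr_pdivlMr // -mulrBr normrM => h; apply: le_lt_trans h.
by rewrite mulrC ler_wpM2l // lerDl.
Qed.

End ultralimits.

Lemma free_ultrafilter : exists U : set_system nat,
  UltraFilter U /\ forall N, U [set n | (N <= n)%N].
Proof.
have [U [UU sU]] := @ultraFilterLemma nat \oo _.
by exists U; split=> // N; apply: sU; exists N.
Qed.

(** * The dual as a Banach space *)

Section dual_space.
Variables (R : realType) (s : scalars).

(** Real and imaginary parts converge separately, hence the constant 4 where [geometric_cvg] has
    2. *)
Lemma scalar_geometric_cvg (C : R) (u : nat -> scalar_field R s) :
  (forall n, kabs (u n.+1 - u n) <= C * 2^-1 ^+ n) ->
  exists l, forall n, kabs (l - u n) <= 4 * C * 2^-1 ^+ n.
Proof.
have real_case (v : nat -> R) : (forall n, `|v n.+1 - v n| <= C * 2^-1 ^+ n) ->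
    exists l, forall n, `|l - v n| <= 2 * C * 2^-1 ^+ n.
  move=> vC; have [l [_ lP]] := @geometric_cvg R RealScalars R^o C v vC.
  by exists l.
case: s u => u uC.
  have [l lP] := real_case u uC; exists l => n; apply: le_trans (lP n) _.
  have C0 : 0 <= C.
    by have := le_trans (kabs_ge0 _) (uC 0%N); rewrite expr0 mulr1.
  have : 0 <= C * (2^-1 : R) ^+ n by rewrite mulr_ge0 // exprn_ge0 // invr_ge0.
  lra.
have Re_le (z : R[i]) : `|complex.Re z| <= kabs (z : scalar_field R ComplexScalars).
  exact: (@rp_le_kabs R ComplexScalars z).
have [|a aP] := real_case (fun n => complex.Re (u n)).
  by move=> n; apply: le_trans (uC n); rewrite -raddfB; exact: Re_le.
have [|b bP] := real_case (fun n => complex.Im (u n)).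
  by move=> n; apply: le_trans (uC n); rewrite -raddfB; exact: im_le_kabs.
exists (Complex a b) => n.
rewrite complex_sub_emb; apply: le_trans (kabsD _ _) _; rewrite kabsM !kabs_emb.
rewrite kabs_imaginary_unit; have := aP n; have := bP n; lra.
Qed.

Local Notation K := (scalar_field R s).
Variable X : completeNormedModType K.

(** The dual is obtained from the general quotient, with D the bounded linear functions among all
    functions from X to K. On D the seminorm is already a norm, so the quotient map is injective
    there. *)
Let V : lmodType K := families (fun _ : X => K^o).
Let bound (f : V) : set R := [set M | 0 <= M /\ forall x, kabs (f x : K) <= M * rnorm x].
Let D : set V := [set f | (forall a x y, f (a *: x + y) = a *: f x + f y) /\ bound f !=set0].
Let p (f : V) : R := inf (bound f).

Let pP f : D f -> 0 <= p f /\ forall x, kabs (f x : K) <= p f * rnorm x.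
Proof.
move=> [_ [M0 M0P]].
have hi : has_inf (bound f) by split; [exists M0|exists 0 => r []].
have p0 : 0 <= p f by apply: lb_le_inf; [exists M0|move=> r []].
split=> // x; apply/ler_addgt0Pr => e e0.
have n1 : 0 < rnorm x + 1 by rewrite ltr_wpDl // rnorm_ge0.
have [M [_ MP] Me] := inf_adherent (divr_gt0 e0 n1) hi.
apply: le_trans (MP x) _; apply: le_trans (ler_wpM2r (rnorm_ge0 _) (ltW Me)) _.
by rewrite mulrDl lerD2l mulrAC ler_pdivrMr // ler_pM2l // lerDl.
Qed.

Let p_le f M : 0 <= M -> (forall x, kabs (f x : K) <= M * rnorm x) -> p f <= M.
Proof. by move=> M0 fM; apply: ge_inf; [exists 0 => r []|]. Qed.

Let dual_seminorm : complete_seminorm D p.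
Proof.
split.
- split=> [a x y|]; first by rewrite !fam0 scaler0 addr0.
  by exists 0; split=> // x; rewrite fam0 kabs0 mul0r.
- move=> a f g Df Dg; have [pf fP] := pP Df; have [pg gP] := pP Dg; split.
    move=> b x y; rewrite !famD !famZ Df.1 Dg.1 !scalerDr !scalerA mulrC -!addrA.
    by congr (_ + _); rewrite addrCA.
  exists (kabs a * p f + p g); split; first by rewrite addr_ge0 // mulr_ge0 // kabs_ge0.
  move=> x; apply: le_trans (kabsD _ _) _; rewrite kabsM mulrDl -mulrA lerD //.
  by rewrite ler_wpM2l ?kabs_ge0.
- move=> f g Df Dg; have [pf fP] := pP Df; have [pg gP] := pP Dg.
  apply: p_le => [|x]; first exact: addr_ge0.
  by apply: le_trans (kabsD _ _) _; rewrite mulrDl lerD.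
- have half a f : D f -> p (a *: f) <= kabs a * p f.
    move=> Df; have [pf fP] := pP Df; apply: p_le; first by rewrite mulr_ge0 // kabs_ge0.
    by move=> x; rewrite famZ kabsM -mulrA ler_wpM2l ?kabs_ge0.
  move=> a f Df; apply/eqP; rewrite eq_le half //=.
  have [->|a0] := eqVneq a 0.
    rewrite kabs0 mul0r; apply: lb_le_inf; last by move=> r [].
    by exists 0; split=> // x; rewrite scale0r fam0 kabs0 mul0r.
  have Daf : D (a *: f).
    split=> [b x y|]; first by rewrite !famZ Df.1 scalerDr !scalerA mulrC.
    have [pf fP] := pP Df; exists (kabs a * p f); split; first by rewrite mulr_ge0 // kabs_ge0.
    by move=> x; rewrite famZ kabsM -mulrA ler_wpM2l ?kabs_ge0.
  have := half a^-1 _ Daf; rewrite scalerA mulVf // scale1r kabsV.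
  rewrite -(@ler_pM2l _ (kabs a)); last first.
    by rewrite lt_neqAle kabs_ge0 andbT eq_sym; apply: contra_neq a0 => /kabs_eq0.
  by rewrite mulrA divff ?mul1r //; apply: contra_neq a0 => /kabs_eq0.
- move=> u Du uC.
  have DB f g : D f -> D g -> D (f - g).
    move=> Df Dg; have [pf fP] := pP Df; have [pg gP] := pP Dg; split.
      move=> a x y; rewrite !famB Df.1 Dg.1 scalerBr opprD addrACA; congr (_ + _).
    exists (p f + p g); split; first exact: addr_ge0.
    by move=> x; apply: le_trans (kabsD _ _) _; rewrite kabsN mulrDl lerD.
  have ux x n : kabs ((u n.+1 x : K) - u n x) <= rnorm x * 2^-1 ^+ n.
    have := (pP (DB _ _ (Du n.+1) (Du n))).2 x; rewrite famB => /le_trans; apply.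
    by rewrite mulrC ler_wpM2l ?rnorm_ge0.
  have [l lP] := choice (fun x => scalar_geometric_cvg (ux x)).
  have lb n x : kabs ((l x : K) - u n x) <= 4 * 2^-1 ^+ n * rnorm x.
    by apply: le_trans (lP x n) _; rewrite mulrAC.
  have h2 n : 0 <= (2^-1 : R) ^+ n by rewrite exprn_ge0 // invr_ge0.
  have Dl : D l.
    split.
      move=> a x y; apply: (@rnorm_lim_unique R s K^o) => e e0.
      pose c := 4 * (rnorm (a *: x + y) + kabs a * rnorm x + rnorm y) + 1.
      have c0 : 0 < c.
        by rewrite ltr_wpDl // mulr_ge0 // !addr_ge0 ?rnorm_ge0 // mulr_ge0 ?kabs_ge0 ?rnorm_ge0.
      have [n] := half_expn_small (divr_gt0 e0 c0); rewrite ltr_pdivlMr // => nP.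
      pose k1 : K := l (a *: x + y) - u n (a *: x + y).
      pose k2 : K := l x - u n x; pose k3 : K := l y - u n y.
      have -> : rnorm (l (a *: x + y) - (a *: l x + l y)) = kabs (k1 - (a * k2 + k3)).
        rewrite /rnorm /kabs; congr (real_part `|_|).
        by rewrite /k1 /k2 /k3 (Du n).1 mulrBr addrACA -opprD opprB addrA subrK.
      apply: le_lt_trans (kabsD _ _) _; rewrite kabsN.
      have := kabsD (a * k2) k3; rewrite kabsM.
      have := lb n (a *: x + y); have := lb n y; rewrite -/k1 -/k3.
      have := ler_wpM2l (kabs_ge0 a) (lb n x); rewrite -/k2.
      have := h2 n; move: nP; rewrite /c; lra.
    exists (4 + p (u 0%N)); split; first by rewrite addr_ge0 // (pP (Du 0%N)).1.
    move=> x; rewrite -[l x](subrK (u 0%N x)); apply: le_trans (kabsD _ _) _.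
    rewrite mulrDl lerD ?(pP (Du 0%N)).2 //.
    by have := lb 0%N x; rewrite expr0 mulr1.
  exists l => // e e0.
  have four_gt0 : 0 < 4 :> R by [].
  have [N NP] := half_expn_small (divr_gt0 e0 four_gt0).
  exists N => n Nn; apply: (@le_lt_trans _ _ (4 * 2^-1 ^+ n)).
    apply: p_le => [|x]; first by rewrite mulr_ge0.
    by rewrite famB -kabsN opprB.
  move: NP; rewrite ltr_pdivlMr // mulrC; apply: le_lt_trans; rewrite ler_wpM2l //.
  by rewrite ler_wiXn2l // ?invr_ge0 // invf_le1 ?ler1n.
Qed.

Lemma exists_dual : exists (Y : completeNormedModType K) (B : Y -> {linear X -> K^o}),
  dual_pairing B.
Proof.
have [Y [q [qlin qnorm qsurj]]] := quotient_banachP dual_seminorm.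
have BP y : exists g : {linear X -> K^o}, D g /\ q g = y.
  have [f Df fy] := qsurj y; have [g gf] := exists_linear Df.1.
  have -> : y = q g by rewrite -fy; congr q; apply/functional_extensionality_dep.
  by exists g; split=> //; rewrite (_ : (g : V) = f) //; apply/functional_extensionality_dep.
have [B BqP] := choice BP; exists Y, B.
have inj f g : D f -> D g -> q f = q g -> f = g.
  move=> Df Dg fg; apply/functional_extensionality_dep => x.
  have Dfg : D (- 1 *: f + g) by apply: (sn_lin dual_seminorm).
  have p0 : p (- 1 *: f + g) = 0.
    by rewrite -qnorm // qlin // fg scaleN1r addNr rnorm0.
  have := (pP Dfg).2 x; rewrite p0 mul0r => h.
  have /kabs_eq0 : kabs ((- 1 *: f + g) x : K) = 0 by apply/eqP; rewrite eq_le h kabs_ge0.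
  by rewrite famD famZ scaleN1r => /eqP; rewrite addrC subr_eq0 => /eqP.
have DB y : D (B y) by case: (BqP y).
split.
- move=> y; apply: (@rnorm_bound_continuous R s X K^o (B y) (p (B y))) => x.
  exact: (pP (DB y)).2.
- move=> a y z x; rewrite -[RHS]/((a *: (B y : V) + (B z : V)) x); congr (_ x).
  apply: inj => //; first by apply: (sn_lin dual_seminorm).
  by rewrite qlin // (BqP _).2 (BqP y).2 (BqP z).2.
- move=> y; rewrite -{2}(BqP y).2 qnorm //; apply/eqP; rewrite eq_le; apply/andP; split.
    by apply: opnorm_le => [|x _]; [exact: (pP (DB y)).1|exact: (pP (DB y)).2].
  apply: le_ereal_inf_tmp => _ [M [M0 MP] <-]; rewrite lee_fin.
  by apply: p_le => // x; exact: MP.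
- move=> phi phic; have [c c0 cP] := continuous_rnorm_bound phic.
  have Dphi : D phi by split; [exact: linearP|exists c].
  by exists (q phi) => x; congr (_ x); apply: inj => //; rewrite (BqP _).2.
Qed.

End dual_space.

(** * Dentability of reflexive spaces *)

Section convexity.
Variables (R : realType) (s : scalars).
Local Notation K := (scalar_field R s).

Definition rconvex (V : lmodType K) (C : set V) := forall x y t, C x -> C y ->
  0 <= t -> t <= 1 -> C (emb s t *: x + emb s (1 - t) *: y).

(** The gauge of C - c0 may be infinite, since C may have empty interior. Its infimal convolution p
    with L times the norm is finite, sublinear and continuous; p is at most 1 on C - c0 and exceeds
    1 at a - c0. A functional dominated by p and equal to it at a - c0 separates. *)
Lemma separation (X : normedModType K) (C : set X) (a : X) (d : R) :
  rconvex C -> C !=set0 -> 0 < d -> (forall c, C c -> d <= rnorm (a - c)) ->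
  exists (phi : {linear X -> K^o}) (b : R), [/\ continuous phi,
    b < real_part (phi a : K) & forall c, C c -> real_part (phi c : K) <= b].
Proof.
move=> Cconv [c0 Cc0] d0 aC.
pose L := 4 / d; have L0 : 0 < L by rewrite divr_gt0.
pose S x := [set r | exists t c, [/\ 0 <= t, C c & r = t + L * rnorm (x - emb s t *: (c - c0))]].
pose p x := inf (S x).
have lbS x : lbound (S x) 0.
  by move=> _ [t [c [t0 _ ->]]]; rewrite addr_ge0 // mulr_ge0 ?rnorm_ge0 ?ltW.
have p_le x t c : 0 <= t -> C c -> p x <= t + L * rnorm (x - emb s t *: (c - c0)).
  by move=> t0 Cc; apply: ge_inf; [exists 0; exact: lbS|exists t, c].
have le_p x m : (forall t c, 0 <= t -> C c -> m <= t + L * rnorm (x - emb s t *: (c - c0))) ->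
    m <= p x.
  move=> h; apply: lb_le_inf; last by move=> _ [t [c [t0 Cc ->]]]; exact: h.
  by exists (0 + L * rnorm (x - emb s 0 *: (c0 - c0))), 0, c0.
have pD x y : p (x + y) <= p x + p y.
  rewrite -lerBlDr; apply: (le_p) => t c t0 Cc; rewrite lerBlDl -lerBlDr.
  apply: (le_p) => u e u0 Ce; rewrite lerBlDr.
  have [tu|tu] := leP (t + u) 0.
    have [-> ->] : t = 0 /\ u = 0 by split; lra.
    have := p_le (x + y) 0 c (lexx 0) Cc; rewrite emb0 !scale0r !subr0 !add0r.
    have := ler_wpM2l (ltW L0) (ler_rnormD x y); rewrite mulrDr; lra.
  pose r := t / (t + u).
  have r01 : 0 <= r <= 1 by rewrite /r divr_ge0 ?(ltW tu) //= ler_pdivrMr // mul1r lerDl.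
  have /andP[r0 r1] := r01.
  have := p_le (x + y) (t + u) _ (ltW tu) (Cconv _ _ _ Cc Ce r0 r1).
  have -> : x + y - emb s (t + u) *: (emb s r *: c + emb s (1 - r) *: e - c0) =
      (x - emb s t *: (c - c0)) + (y - emb s u *: (e - c0)).
    rewrite addrACA -opprD; congr (_ - _).
    rewrite [in LHS]scalerBr scalerDr !scalerA -!embM.
    have -> : (t + u) * r = t by rewrite /r mulrC divfK ?gt_eqF.
    have -> : (t + u) * (1 - r) = u by rewrite mulrBr /r mulr1 mulrC divfK ?gt_eqF //; ring.
    by rewrite !scalerBr addrACA embD scalerDl opprD.
  have := ler_wpM2l (ltW L0) (ler_rnormD (x - emb s t *: (c - c0)) (y - emb s u *: (e - c0))).
  rewrite mulrDr; lra.
have p_L x : p x <= L * rnorm x.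
  by have := p_le x 0 c0 (lexx 0) Cc0; rewrite emb0 scale0r subr0 add0r.
have p_ge0 x : 0 <= p x.
  by apply: (le_p) => t c t0 _; rewrite addr_ge0 // mulr_ge0 ?rnorm_ge0 ?ltW.
have pZ_le u x : 0 < u -> p (emb s u *: x) <= u * p x.
  move=> u0; rewrite -ler_pdivrMl //; apply: (le_p) => t c t0 Cc; rewrite ler_pdivrMl //.
  have := p_le (emb s u *: x) (u * t) c (mulr_ge0 (ltW u0) t0) Cc.
  by rewrite embM -scalerA -scalerBr rnormZe gtr0_norm // mulrDr mulrCA.
have pZ u x : 0 <= u -> p (emb s u *: x) = u * p x.
  rewrite le_eqVlt => /orP[/eqP <-|u0].
    rewrite emb0 scale0r mul0r; apply/eqP; rewrite eq_le p_ge0 andbT.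
    by have := p_L 0; rewrite rnorm0 mulr0.
  apply/eqP; rewrite eq_le pZ_le //= -ler_pdivlMl //.
  have := @pZ_le u^-1 (emb s u *: x); rewrite invr_gt0 => /(_ u0).
  by rewrite scalerA -embM mulVf ?gt_eqF // emb1 scale1r.
have [psi [psiD psiZ psile psia]] := hahn_banach pD pZ (a - c0).
have [phi phiE] := exists_complexification psiD psiZ.
pose n := rnorm (a - c0).
(* For t at most 1 convexity keeps the point t c + (1 - t) c0 in C, at distance d from a. Up to t =
   1 + th the distance drops by at most th n, that is d / 2, and L (d / 2) = 2 still suffices.
   Beyond 1 + th the summand t alone is large enough. *)
pose th := d / (2 * (n + 1)).
have n1 : 0 < n + 1 by rewrite ltr_wpDl // rnorm_ge0.
have th0 : 0 < th by rewrite divr_gt0 // mulr_gt0.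
have thn : th * n <= d / 2.
  have -> : d / 2 = th * (n + 1) by rewrite /th; field; rewrite gt_eqF.
  by rewrite ler_pM2l // lerDl.
have pa : 1 + Num.min 1 th <= p (a - c0).
  have Ld : L * (d / 2) = 2 by rewrite /L; field; rewrite gt_eqF.
  have m1 : Num.min 1 th <= 1 by rewrite ge_min lexx.
  have m2 : Num.min 1 th <= th by rewrite ge_min lexx orbT.
  apply: (le_p) => t c t0 Cc; have [t1|t1] := leP t 1.
    have := aC _ (Cconv _ _ _ Cc Cc0 t0 t1).
    have -> : a - (emb s t *: c + emb s (1 - t) *: c0) = a - c0 - emb s t *: (c - c0).
      rewrite -addrA -opprD; congr (_ - _).
      by rewrite embB emb1 scalerBl scale1r scalerBr addrCA.
    move=> h; have := ler_wpM2l (ltW L0) h; lra.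
  have [t2|t2] := leP t (1 + th); last first.
    have := mulr_ge0 (ltW L0) (rnorm_ge0 (a - c0 - emb s t *: (c - c0))); lra.
  have h1 : d <= rnorm (a - c0 - (c - c0)).
    by rewrite opprB addrA subrK; exact: aC.
  have h2 : rnorm (a - c0 - (c - c0)) <= rnorm (a - c0 - emb s t *: (c - c0)) + th * n.
    pose w := a - c0 - emb s t *: (c - c0).
    have tV : 0 < t by lra.
    have -> : a - c0 - (c - c0) = emb s t^-1 *: w + emb s (1 - t^-1) *: (a - c0).
      rewrite /w [in RHS]scalerBr scalerA -embM mulVf ?gt_eqF // emb1 scale1r.
      by rewrite [in RHS]addrAC -scalerDl -embD addrC [t^-1 + _]addrC subrK emb1 scale1r addrC.
    apply: le_trans (ler_rnormD _ _) _; rewrite !rnormZe lerD //.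
      rewrite ger0_norm ?invr_ge0 ?(ltW tV) // ler_piMl ?rnorm_ge0 // invf_le1 //.
      by rewrite ltW.
    rewrite ler_wpM2r ?rnorm_ge0 //.
    have tV1 : t^-1 <= 1 by rewrite invf_le1 // ltW.
    rewrite ger0_norm ?subr_ge0 //.
    have : 1 - th <= t^-1.
      rewrite -(ler_pM2l tV) divff ?gt_eqF //.
      have : 0 <= (t - 1) * th by rewrite mulr_ge0 //; lra.
      lra.
    lra.
  have h3 : d / 2 <= rnorm (a - c0 - emb s t *: (c - c0)) by lra.
  have := ler_wpM2l (ltW L0) h3; lra.
have min0 : 0 < Num.min 1 th by rewrite lt_min th0 ltr01.
exists phi, (1 + real_part (phi c0 : K)); split.
- apply: (@rnorm_bound_continuous R s X K^o phi L) => x.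
  apply: kabs_le_of_real_part => u u1; rewrite phiE (le_trans (psile _)) //.
  by rewrite (le_trans (p_L _)) // rnormZ u1 mul1r.
- by move: psia; rewrite -phiE linearB rpB => h; lra.
- move=> c Cc; have := psile (c - c0); rewrite -phiE linearB rpB.
  have := p_le (c - c0) 1 c ler01 Cc; rewrite emb1 scale1r subrr rnorm0 mulr0; lra.
Qed.

End convexity.

Section reflexive_spaces.
Variables (R : realType) (s : scalars).
Local Notation K := (scalar_field R s).
Variable X : completeNormedModType K.
Hypothesis X_reflexive : reflexive_space X.

Lemma continuous_functional_bound (phi : {linear X -> K^o}) : continuous phi ->
  exists2 c, 0 < c & forall x, `|real_part (phi x : K)| <= c * rnorm x.
Proof.
move=> /continuous_rnorm_bound[c c0 cP]; exists (c + 1); first by rewrite ltr_wpDl.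
move=> x; apply: le_trans (rp_le_kabs _) _; apply: le_trans (cP x) _.
by rewrite ler_wpM2r ?rnorm_ge0 // lerDl.
Qed.

(** The ultralimit of the evaluations at the a n is a bounded functional on the dual, and
    reflexivity makes it the evaluation at a point x. *)
Lemma reflexive_weak_limit (U : set_system nat) (UU : UltraFilter U)
    (a : nat -> X) (c : R) : (forall n, rnorm (a n) <= c) ->
  exists x, forall phi : {linear X -> K^o}, continuous phi ->
    real_part (phi x : K) = ulimit U (fun n => real_part (phi (a n) : K)).
Proof.
move=> ac; have [Y [B BX]] := exists_dual X.
have Bb y n : `|real_part (B y (a n) : K)| <= c * rnorm y.
  apply: le_trans (rp_le_kabs _) _.
  have /opnorm_leP/(_ (a n) I) : (opnorm setT (B y) <= (rnorm y)%:E)%E.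
    by rewrite (dual_isometric BX).
  by move/le_trans; apply; rewrite mulrC ler_wpM2r ?rnorm_ge0.
have Ub y : U [set n | `|real_part (B y (a n) : K)| <= c * rnorm y].
  by apply: filterS filterT => n _; exact: Bb.
pose psi y := ulimit U (fun n => real_part (B y (a n) : K)).
have psiD y z : psi (y + z) = psi y + psi z.
  rewrite -(ulimitD UU (Ub y) (Ub z)); congr ulimit; apply/funext => n.
  by rewrite -{1}[y]scale1r (dual_linear BX) scale1r rpD.
have psiZ t y : psi (emb s t *: y) = t * psi y.
  rewrite -(ulimitZ UU t (Ub y)); congr ulimit; apply/funext => n.
  rewrite -[_ *: y]addr0 (dual_linear BX) -rpZ.
  have := dual_linear BX (- 1) 0 0 (a n); rewrite scaler0 addr0 scaleN1r addNr => ->.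
  by rewrite addr0.
have [Psi PsiE] := exists_complexification psiD psiZ.
have psib y : `|psi y| <= c * rnorm y.
  rewrite ler_norml; apply/andP; split.
    by apply: (ulimit_ge UU (Ub y)); apply: filterS (Ub y) => n /=; rewrite ler_norml => /andP[].
  by apply: (ulimit_le UU (Ub y)); apply: filterS (Ub y) => n /=; rewrite ler_norml => /andP[].
have Psic : continuous Psi.
  apply: (@rnorm_bound_continuous R s Y K^o Psi c) => y.
  apply: kabs_le_of_real_part => u u1; rewrite PsiE (le_trans (ler_norm _)) //.
  by rewrite (le_trans (psib _)) // rnormZ u1 mul1r.
have [x xP] := X_reflexive BX Psic; exists x => phi /(dual_surjective BX)[y yP].
rewrite -yP -xP PsiE; congr ulimit; apply/funext => n.
by rewrite yP.
Qed.

Lemma weak_limit_closed_convex (U : set_system nat) (UU : UltraFilter U)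
    (C : set X) (a : nat -> X) (c : R) (x : X) :
  rconvex C -> (forall x, (forall e, 0 < e -> exists2 y, C y & rnorm (x - y) < e) -> C x) ->
  (forall n, C (a n)) -> (forall n, rnorm (a n) <= c) ->
  (forall phi : {linear X -> K^o}, continuous phi ->
    real_part (phi x : K) = ulimit U (fun n => real_part (phi (a n) : K))) -> C x.
Proof.
move=> Cconv Cclosed Ca ac xP; apply: Cclosed => e e0; apply: contrapT => no.
have [||phi [b [phic bx Cb]]] := @separation _ _ X C x e Cconv _ e0.
- by exists (a 0%N).
- by move=> y Cy; rewrite leNgt; apply/negP => xy; apply: no; exists y.
have [m m0 mP] := continuous_functional_bound phic.
have : real_part (phi x : K) <= b.
  rewrite xP //; apply: (@ulimit_le _ _ _ _ (m * c)).
    apply: filterS filterT => n _ /=; apply: le_trans (mP _) _.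
    by rewrite ler_pM2l.
  by apply: filterS filterT => n _ /=; exact: Cb.
by rewrite leNgt bx.
Qed.

Section dentability.
Variables (C : set X) (rad : R) (b : nat -> X).
Hypothesis C_convex : rconvex C.
Hypothesis C_bounded : forall x, C x -> rnorm x <= rad.
Hypothesis C_closed : forall x,
  (forall e, 0 < e -> exists2 y, C y & rnorm (x - y) < e) -> C x.
Hypothesis C_nonempty : C !=set0.
Hypothesis C_separable : forall x, C x ->
  forall e, 0 < e -> exists n, rnorm (x - b n) < e.

Let rad0 : 0 <= rad.
Proof. by have [x /C_bounded] := C_nonempty; apply: le_trans (rnorm_ge0 _). Qed.

Variable eta : R.
Hypothesis eta_gt0 : 0 < eta.
Hypothesis no_small_slice : forall (phi : {linear X -> K^o}) (al : R), continuous phi ->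
  (exists2 x, C x & al < real_part (phi x : K)) ->
  exists x y, [/\ C x, C y, al < real_part (phi x : K), al < real_part (phi y : K) &
    eta < rnorm (x - y)].

Let state : Type := ({linear X -> K^o} * R)%type.
(** A state is a functional with a level. The slice above the level is required to be a proper part
    of C: the point below the level makes the complement [K1] of the next step non-empty. *)
Let good (z : state) := [/\ continuous z.1, exists2 x, C x & z.2 < real_part (z.1 x : K) &
  exists2 x, C x & real_part (z.1 x : K) <= z.2].

(* The part of the slice missing a small ball cannot be swallowed by the closed
   convex hull of the ball and the complement of the slice: otherwise thin
   slices in the same direction would have small diameter. *)
Let next_slice (z : state) (p : X) : good z -> exists2 z' : state, good z' &
  forall x, C x -> z'.2 <= real_part (z'.1 x : K) ->
    z.2 < real_part (z.1 x : K) /\ eta / 4 <= rnorm (x - p).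
Proof.
case: z => phi al [/= phic [x1 Cx1 x1al] [x2 Cx2 x2al]].
pose K0 := [set x | C x /\ rnorm (x - p) < eta / 4].
pose K1 := [set x | C x /\ real_part (phi x : K) <= al].
have [[k0 K0k0]|K0e] := pselect (K0 !=set0); last first.
  exists (phi, (al + real_part (phi x1 : K)) / 2) => /=.
    split=> //=; first by exists x1 => //; lra.
    by exists x2 => //; lra.
  move=> x Cx xal; split; first lra.
  by rewrite leNgt; apply/negP => xp; apply: K0e; exists x.
(* J is the convex hull of the part of C close to p and of the complement of the slice. *)
pose J := [set z | exists x y l, [/\ K0 x, K1 y, 0 <= l, l <= 1 &
  z = emb s l *: x + emb s (1 - l) *: y]].
have K1x2 : K1 x2 by [].
have rpcomb (f : {linear X -> K^o}) t x y :
    real_part (f (emb s t *: x + emb s (1 - t) *: y) : K) =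
    t * real_part (f x : K) + (1 - t) * real_part (f y : K).
  by rewrite linearD !linearZ rpD !rpZ.
have K0conv : rconvex K0.
  move=> x y t [Cx xp] [Cy yp] t0 t1; split; first exact: C_convex.
  have -> : emb s t *: x + emb s (1 - t) *: y - p =
      emb s t *: (x - p) + emb s (1 - t) *: (y - p).
    by rewrite !scalerBr addrACA -opprD -scalerDl -embD [t + _]addrC subrK emb1 scale1r.
  apply: le_lt_trans (ler_rnormD _ _) _; rewrite !rnormZe !ger0_norm ?subr_ge0 //.
  have [->|t0'] := eqVneq t 0; first by rewrite mul0r add0r subr0 mul1r.
  have tp : 0 < t by rewrite lt_neqAle eq_sym t0'.
  have := ler_wpM2l (_ : 0 <= 1 - t) (ltW yp); rewrite subr_ge0 => /(_ t1).
  by move: xp; rewrite -(ltr_pM2l tp); lra.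
have K1conv : rconvex K1.
  move=> x y t [Cx xp] [Cy yp] t0 t1; split; first exact: C_convex.
  rewrite rpcomb; have := ler_wpM2l t0 xp; have := ler_wpM2l (_ : 0 <= 1 - t) yp.
  rewrite subr_ge0 => /(_ t1); lra.
have J_conv : rconvex J.
  move=> _ _ t [x [y [l [K0x K1y l0 l1 ->]]]] [x' [y' [l' [K0x' K1y' l0' l1' ->]]]] t0 t1.
  have t1' : 0 <= 1 - t by lra.
  have join (S : set X) u v a a' : rconvex S -> S u -> S v -> 0 <= a -> 0 <= a' ->
      exists2 w, S w & emb s (a + a') *: w = emb s a *: u + emb s a' *: v.
    move=> Sconv Su Sv a0 a0'; have [aa|aa] := leP (a + a') 0.
      have [-> ->] : a = 0 /\ a' = 0 by split; lra.
      by exists u => //; rewrite addr0 emb0 !scale0r addr0.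
    exists (emb s (a / (a + a')) *: u + emb s (1 - a / (a + a')) *: v).
      apply: Sconv => //; first by rewrite divr_ge0 // ltW.
      by rewrite ler_pdivrMr // mul1r lerDl.
    rewrite scalerDr !scalerA -!embM mulrC divfK ?gt_eqF //.
    congr (_ + emb s _ *: _); rewrite mulrBr mulr1 mulrC divfK ?gt_eqF //; ring.
  have [w K0w wE] := join K0 x x' (t * l) ((1 - t) * l') K0conv K0x K0x'
    (mulr_ge0 t0 l0) (mulr_ge0 t1' l0').
  have l1n : 0 <= 1 - l by lra.
  have l1n' : 0 <= 1 - l' by lra.
  have [v K1v vE] := join K1 y y' (t * (1 - l)) ((1 - t) * (1 - l')) K1conv K1y K1y'
    (mulr_ge0 t0 l1n) (mulr_ge0 t1' l1n').
  exists w, v, (t * l + (1 - t) * l'); split=> //.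
  - by rewrite addr_ge0 // mulr_ge0.
  - have := ler_wpM2l t0 l1; have := ler_wpM2l t1' l1'; lra.
  - have -> : 1 - (t * l + (1 - t) * l') = t * (1 - l) + (1 - t) * (1 - l') by ring.
    by rewrite wE vE !scalerDr !scalerA -!embM addrACA.
have J0 : J !=set0.
  by exists (emb s 1 *: k0 + emb s (1 - 1) *: x2), k0, x2, 1; split.
have J_K0 x : K0 x -> J x.
  move=> K0x; exists x, x2, 1; split=> //.
  by rewrite subrr emb0 emb1 scale1r scale0r addr0.
have J_K1 x : K1 x -> J x.
  move=> K1x; exists k0, x, 0; split=> //.
  by rewrite subr0 emb0 emb1 scale1r scale0r add0r.
(* If a point of C is at positive distance from J, separating it from J gives a slice which lies in
   the old one and misses the ball. Otherwise J is dense in C, and this is to be refuted. *)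
have [[a Ca [d d0 dP]]|dense] :=
    pselect (exists2 a, C a & exists2 d, 0 < d & forall z, J z -> d <= rnorm (a - z)).
  have [f [be [fc bea beJ]]] := separation J_conv J0 d0 dP.
  exists (f, (be + real_part (f a : K)) / 2) => /=.
    split=> //=; first by exists a => //; lra.
    by exists x2 => //; have := beJ _ (J_K1 _ K1x2); lra.
  move=> x Cx xf; split.
    rewrite ltNge; apply/negP => xal; have := beJ _ (J_K1 x (conj Cx xal)); lra.
  rewrite leNgt; apply/negP => xp; have := beJ _ (J_K0 x (conj Cx xp)); lra.
exfalso.
have near a d : C a -> 0 < d -> exists2 z, J z & rnorm (a - z) < d.
  move=> Ca d0; apply: contrapT => no; apply: dense; exists a => //; exists d => // z Jz.
  by rewrite leNgt; apply/negP => az; apply: no; exists z.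
have [c c0 cP] := continuous_functional_bound phic.
have hs : has_sup [set real_part (phi x : K) | x in C].
  split; first by exists (real_part (phi x1 : K)), x1.
  exists (c * rad) => _ [x Cx <-]; apply: le_trans (ler_norm _) _.
  by apply: le_trans (cP x) _; rewrite ler_pM2l //; exact: C_bounded.
pose m := sup [set real_part (phi x : K) | x in C].
have mP x : C x -> real_part (phi x : K) <= m.
  by move=> Cx; apply: sup_upper_bound => //; exists x.
have m_al : 0 < m - al by have := mP _ Cx1; lra.
(* A point u of C of height above m - r (m - al) is within eta / 8 of some l v + (1 - l) w, where w
   is below al; this forces 1 - l < 2 r. Replacing w by v costs at most 4 r rad, hence at most eta /
   8, and v is within eta / 4 of p. So u is within eta / 2 of p, and this thin slice has diameter at
   most eta. *)
pose r := eta / (32 * (rad + 1)).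
have r0 : 0 < r by rewrite divr_gt0 // mulr_gt0 // ltr_wpDl.
have [_ [x0 Cx0 <-] x0r] := sup_adherent (mulr_gt0 r0 m_al) hs.
have [x [y [Cx Cy xm ym xy]]] : exists x y, [/\ C x, C y,
    m - r * (m - al) < real_part (phi x : K), m - r * (m - al) < real_part (phi y : K) &
    eta < rnorm (x - y)].
  by apply: no_small_slice => //; exists x0.
pose d := Num.min (eta / 8) (r * (m - al) / c).
have d0 : 0 < d by rewrite lt_min divr_gt0 //= divr_gt0 // mulr_gt0.
have close u : C u -> m - r * (m - al) < real_part (phi u : K) ->
    rnorm (u - p) <= eta / 2.
  move=> Cu um; have [_ [v [w [l [[Cv vp] [Cw wal] l0 l1 ->]]]] uz] := near _ _ Cu d0.
  have d1 : d <= eta / 8 by rewrite ge_min lexx.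
  have d2 : c * d <= r * (m - al).
    by rewrite mulrC -ler_pdivlMr // ge_min lexx orbT.
  have l2 : 1 - l < 2 * r.
    have h : real_part (phi u : K) - real_part (phi (emb s l *: v + emb s (1 - l) *: w) : K)
        <= c * d.
      rewrite -rpB -linearB; apply: le_trans (ler_norm _) _; apply: le_trans (cP _) _.
      by rewrite ler_pM2l // ltW.
    rewrite rpcomb in h.
    have h1 := ler_wpM2l l0 (mP _ Cv).
    have l1' : 0 <= 1 - l by lra.
    have h2 := ler_wpM2l l1' wal.
    rewrite -(ltr_pM2r m_al); lra.
  have -> : u - p = (u - (emb s l *: v + emb s (1 - l) *: w)) +
      (emb s (1 - l) *: (w - v) + (v - p)).
    have -> : emb s (1 - l) *: (w - v) + (v - p) =
        emb s l *: v + emb s (1 - l) *: w - p.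
      rewrite addrA; congr (_ - p); rewrite scalerBr -addrA addrC; congr (_ + _).
      by rewrite embB emb1 scalerBl scale1r opprB subrK.
    by rewrite addrA subrK.
  have := ler_rnormD (u - (emb s l *: v + emb s (1 - l) *: w))
    (emb s (1 - l) *: (w - v) + (v - p)).
  have := ler_rnormD (emb s (1 - l) *: (w - v)) (v - p).
  rewrite rnormZe ger0_norm; last lra.
  have : (1 - l) * rnorm (w - v) <= 2 * r * (2 * rad).
    have l0' : 0 <= 1 - l by lra.
    apply: (ler_pM l0' (rnorm_ge0 _) (ltW l2)).
    by apply: le_trans (ler_rnormB _ _) _; have := C_bounded Cw; have := C_bounded Cv; lra.
  have : 2 * r * (2 * rad) <= eta / 8.
    have -> : eta / 8 = 4 * r * (rad + 1).
      by rewrite /r; field; rewrite gt_eqF // ltr_wpDl.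
    have := r0; nra.
  lra.
have := ler_rdist p x y; rewrite (rdistC p).
have := close _ Cx xm; have := close _ Cy ym; lra.
Qed.

(** A decreasing sequence of slices is built, the (n+1)-st avoiding the ball of radius eta / 4
    around b n. Points chosen in them have a weak limit in C, which lies in every slice and hence is
    approximated by no b n. *)
Lemma no_small_slice_absurd : False.
Proof.
(* For the zero functional and the level -1 the slice is C itself; this yields two distant points,
   and a functional norming their difference gives a first proper slice. *)
have [phi0 phi0E] := @exists_linear K X K^o (fun=> 0) (fun a x y =>
  esym (etrans (addr0 _) (scaler0 _ _))).
have [x [y [Cx Cy _ _ xy]]] : exists x y, [/\ C x, C y, - 1 < real_part (phi0 x : K),
    - 1 < real_part (phi0 y : K) & eta < rnorm (x - y)].
  apply: no_small_slice.
    apply: (@rnorm_bound_continuous R s X K^o phi0 0) => x.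
    by rewrite phi0E rnorm0 mul0r.
  by have [x Cx] := C_nonempty; exists x => //; rewrite phi0E rp0; lra.
have [phi [phic _ phixy]] := norming_functional (x - y).
have good0 : good (phi, real_part (phi y : K)).
  split=> //=; [exists x => //|exists y => //].
  by move: phixy xy eta_gt0; rewrite linearB rpB; lra.
have step (kz : nat * state) : exists z', good kz.2 -> good z' /\
    forall x, C x -> z'.2 <= real_part (z'.1 x : K) ->
    kz.2.2 < real_part (kz.2.1 x : K) /\ eta / 4 <= rnorm (x - b kz.1).
  have [gz|] := pselect (good kz.2); last by exists kz.2.
  by have [z' gz' z'P] := next_slice (b kz.1) gz; exists z'.
have [f fP] := choice step.
pose z n : state := nat_rect (fun=> state) (phi, real_part (phi y : K)) (fun k z => f (k, z)) n.
have zgood n : good (z n) by elim: n => [//|n IH]; case: (fP (n, z n) IH).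
have zS n u : C u -> (z n.+1).2 <= real_part ((z n.+1).1 u : K) ->
    (z n).2 < real_part ((z n).1 u : K) /\ eta / 4 <= rnorm (u - b n).
  by move=> Cu; have [_] := fP (n, z n) (zgood n); apply.
have aP n : exists u, C u /\ (z n).2 < real_part ((z n).1 u : K).
  by have [_ [u Cu ?] _] := zgood n; exists u.
have [a {}aP] := choice aP.
have nest n d u : C u -> (z (n + d)%N).2 <= real_part ((z (n + d)%N).1 u : K) ->
    (z n).2 <= real_part ((z n).1 u : K).
  move=> Cu; elim: d => [|d IH]; first by rewrite addn0.
  by rewrite addnS => /(zS _ _ Cu)[/ltW/IH].
have nested n d : (z n).2 <= real_part ((z n).1 (a (n + d)%N) : K).
  by have [Ca /ltW] := aP (n + d)%N; exact: nest.
have [U [UU Ufree]] := free_ultrafilter.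
have Ca n : C (a n) by case: (aP n).
have ab n : rnorm (a n) <= rad by apply: C_bounded.
have [w wP] := reflexive_weak_limit UU ab.
have Cw : C w by apply: (weak_limit_closed_convex UU C_convex C_closed Ca ab).
(* Only the non-strict inequality survives in the weak limit; the strict one at level n then comes
   from level n+1 through [zS]. *)
have wz n : (z n).2 <= real_part ((z n).1 w : K).
  have [zc _ _] := zgood n; rewrite wP //.
  have [c c0 cP] := continuous_functional_bound zc.
  apply: (@ulimit_ge _ _ UU _ (c * rad)).
    by apply: filterS filterT => k _ /=; apply: le_trans (cP _) _; rewrite ler_pM2l.
  by apply: filterS (Ufree n) => k /= /subnKC <-; exact: nested.
have e4 : 0 < eta / 4 by rewrite divr_gt0.
have [n nP] := C_separable Cw e4.
by have [_] := zS n w Cw (wz n.+1); rewrite leNgt nP.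
Qed.

End dentability.

Lemma small_slice (C : set X) (rad : R) (b : nat -> X) (eta : R) :
  rconvex C -> (forall x, C x -> rnorm x <= rad) ->
  (forall x, (forall e, 0 < e -> exists2 y, C y & rnorm (x - y) < e) -> C x) ->
  C !=set0 -> (forall x, C x -> forall e, 0 < e -> exists n, rnorm (x - b n) < e) ->
  0 < eta -> exists (phi : {linear X -> K^o}) (al : R), [/\ continuous phi,
    exists2 x, C x & al < real_part (phi x : K) &
    forall x y, C x -> C y -> al < real_part (phi x : K) -> al < real_part (phi y : K) ->
      rnorm (x - y) <= eta].
Proof.
move=> Cconv Cb Cc C0 Csep eta0; apply: contrapT => no.
apply: (no_small_slice_absurd Cconv Cb Cc C0 Csep eta0) => phi al phic slice.
apply: contrapT => small; apply: no; exists phi, al; split=> // x y Cx Cy xal yal.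
by rewrite leNgt; apply/negP => xy; apply: small; exists x, y.
Qed.

End reflexive_spaces.

(** * Finite dimensional subspaces and finite representability *)

Section finite_dimensional.
Variables (R : realType) (s : scalars).
Local Notation K := (scalar_field R s).

(** Induction on m. If combinations of the first vectors approached minus the last one, their
    coordinates would be Cauchy by the induction hypothesis and converge to a linear dependence. So
    the last vector is at some distance d > 0 from the span of the others, which bounds the last
    coordinate and then the remaining ones. *)
Lemma independent_coordinates_bound (X : completeNormedModType K) (m : nat) (v : 'I_m -> X) :
  (forall c : 'I_m -> K, \sum_(i < m) c i *: v i = 0 -> forall i, c i = 0) ->
  exists2 a, 0 < a & forall (c : 'I_m -> K) i, a * kabs (c i) <= rnorm (\sum_(i < m) c i *: v i).
Proof.
elim: m v => [|m IH] v v_free; first by exists 1 => // c [].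
pose w i := v (widen_ord (leqnSn m) i).
have sumE c : \sum_(i < m.+1) c i *: v i =
    \sum_(i < m) c (widen_ord (leqnSn m) i) *: w i + c ord_max *: v ord_max.
  by rewrite big_ord_recr.
pose ext (c : 'I_m -> K) (k : K) (i : 'I_m.+1) : K :=
  if unlift ord_max i is Some j then c j else k.
have ext_w c k i : ext c k (widen_ord (leqnSn m) i) = c i.
  have -> : widen_ord (leqnSn m) i = lift ord_max i by apply/val_inj; rewrite /= /bump leqNgt ltn_ord.
  by rewrite /ext liftK.
have ext_m c k : ext c k ord_max = k by rewrite /ext unlift_none.
have ext_sum c k : \sum_(i < m.+1) ext c k i *: v i = \sum_(i < m) c i *: w i + k *: v ord_max.
  by rewrite sumE ext_m; congr (_ + _); apply: eq_bigr => i _; rewrite ext_w.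
have [|a a0 aP] := IH w.
  move=> c c0 i; rewrite -(ext_w c 0); apply: v_free.
  by rewrite ext_sum c0 scale0r addr0.
have [d d0 dP] : exists2 d, 0 < d & forall c : 'I_m -> K,
    d <= rnorm (\sum_(i < m) c i *: w i + v ord_max).
  apply: contrapT => no.
  have approx k : exists c : 'I_m -> K, rnorm (\sum_(i < m) c i *: w i + v ord_max) < 2^-1 ^+ k.
    apply: contrapT => nok; apply: no; exists (2^-1 ^+ k); first by rewrite exprn_gt0 // invr_gt0.
    by move=> c; rewrite leNgt; apply/negP => h; apply: nok; exists c.
  have [c cP] := choice approx.
  have sumB (f g : 'I_m -> K) : \sum_(i < m) (f i - g i) *: w i =
      (\sum_(i < m) f i *: w i + v ord_max) - (\sum_(i < m) g i *: w i + v ord_max).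
    rewrite opprD addrACA subrr addr0 -sumrB; apply: eq_bigr => i _.
    by rewrite scalerBl.
  have h2 k : 0 < (2^-1 : R) ^+ k by rewrite exprn_gt0 // invr_gt0.
  have cG i k : kabs (c k.+1 i - c k i) <= 2 / a * 2^-1 ^+ k.
    rewrite mulrAC ler_pdivlMr // mulrC; apply: le_trans (aP (fun i => c k.+1 i - c k i) i) _.
    rewrite sumB; apply: le_trans (ler_rnormB _ _) _.
    have := cP k; have := cP k.+1; rewrite exprS; have := h2 k; lra.
  have [l lP] := choice (fun i => scalar_geometric_cvg (cG i)).
  have l0 : \sum_(i < m) l i *: w i + v ord_max = 0.
    apply: rnorm_lim_unique => e e0; rewrite subr0.
    pose Q := 1 + \sum_(i < m) (4 * (2 / a)) * rnorm (w i).
    have Q0 : 0 < Q.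
      rewrite ltr_pwDl // sumr_ge0 // => i _; rewrite mulr_ge0 ?rnorm_ge0 //.
      by rewrite mulr_ge0 // divr_ge0 // ltW.
    have [k] := half_expn_small (divr_gt0 e0 Q0); rewrite ltr_pdivlMr // => kP.
    apply: le_lt_trans kP.
    apply: le_trans (ler_rnorm_dist _ (\sum_(i < m) c k i *: w i + v ord_max)) _.
    rewrite -sumB mulrDr mulr1 lerD ?(ltW (cP k)) // mulr_sumr.
    apply: le_trans (ler_rnorm_sum _ _ _) _; apply: ler_sum => i _.
    rewrite rnormZ [X in _ <= X]mulrA ler_wpM2r ?rnorm_ge0 //; apply: le_trans (lP i k) _.
    by rewrite mulrC.
  have := v_free (ext l 1); rewrite ext_sum scale1r => /(_ l0 ord_max).
  by rewrite ext_m => /eqP; rewrite oner_eq0.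
have last_le (c : 'I_m.+1 -> K) : d * kabs (c ord_max) <= rnorm (\sum_(i < m.+1) c i *: v i).
  have [->|cm] := eqVneq (c ord_max) 0; first by rewrite kabs0 mulr0 rnorm_ge0.
  have -> : \sum_(i < m.+1) c i *: v i = c ord_max *: 
      (\sum_(i < m) (c (widen_ord (leqnSn m) i) / c ord_max) *: w i + v ord_max).
    rewrite sumE scalerDr scaler_sumr; congr (_ + _); apply: eq_bigr => i _.
    by rewrite scalerA mulrC divfK.
  by rewrite rnormZ mulrC ler_wpM2l ?kabs_ge0.
pose q := 1 + rnorm (v ord_max) / d.
have q1 : 1 <= q by rewrite lerDl divr_ge0 ?rnorm_ge0 // ltW.
have q0 : 0 < q by lra.
exists (Num.min d (a / q)); first by rewrite lt_min d0 divr_gt0.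
move=> c i; case: (unliftP ord_max i) => [j ->|->]; last first.
  apply: le_trans (last_le c); rewrite ler_wpM2r ?kabs_ge0 //.
  by rewrite ge_min lexx.
have -> : lift ord_max j = widen_ord (leqnSn m) j by apply/val_inj; rewrite /= /bump leqNgt ltn_ord.
apply: (@le_trans _ _ (a / q * kabs (c (widen_ord (leqnSn m) j)))).
  by rewrite ler_wpM2r ?kabs_ge0 // ge_min lexx orbT.
rewrite mulrAC ler_pdivrMr //; apply: le_trans (aP (fun j => c (widen_ord (leqnSn m) j)) j) _.
have -> : \sum_(j < m) c (widen_ord (leqnSn m) j) *: w j =
   \sum_(i < m.+1) c i *: v i - c ord_max *: v ord_max by rewrite sumE addrK.
apply: le_trans (ler_rnormB _ _) _; rewrite rnormZ /q mulrDr mulr1 lerD2l.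
rewrite mulrCA mulrC ler_wpM2l ?rnorm_ge0 // ler_pdivlMr // mulrC.
exact: last_le.
Qed.

Lemma scalar_net (d : R) : 0 < d -> exists (n : nat) (k : 'I_n -> K),
  forall x, kabs x <= 1 -> exists i, kabs (x - k i) <= d.
Proof.
have real_net (e : R) : 0 < e -> exists (n : nat) (k : 'I_n -> R),
    forall x, `|x| <= 1 -> exists i, `|x - k i| <= e.
  move=> e0; pose N := (Num.truncn e^-1).+1.
  have N0 : 0 < N%:R :> R by rewrite ltr0n.
  have Ne : N%:R^-1 <= e.
    rewrite invf_ple ?posrE //; apply/ltW; rewrite /N.
    exact: truncnS_gt.
  exists (N + N).+1, (fun i => i%:R / N%:R - 1) => x; rewrite ler_norml => /andP[x1 x2].
  have y0 : 0 <= (x + 1) * N%:R by apply: mulr_ge0 (ltW N0); lra.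
  have /andP[t1 t2] := truncn_itv y0; set t := Num.truncn _ in t1 t2.
  have tN : (t < (N + N).+1)%N.
    rewrite ltnS -(ler_nat R); apply: le_trans t1 _; rewrite natrD.
    have := ltW N0; nra.
  exists (Ordinal tN) => /=; rewrite ler_norml.
  have u1 : t%:R / N%:R <= x + 1 by rewrite ler_pdivrMr.
  have u2 : x + 1 <= t%:R / N%:R + N%:R^-1.
    have -> : t%:R / N%:R + N%:R^-1 = t.+1%:R / N%:R :> R by rewrite -natr1 mulrDl mul1r.
    by rewrite ler_pdivlMr //; exact: ltW.
  by apply/andP; split; lra.
move=> d0; case: s; first exact: real_net.
have [n [k kP]] := real_net _ (divr_gt0 d0 (ltr0Sn R 1)).
exists #|{: 'I_n * 'I_n}|, (fun i => Complex (k (enum_val i).1) (k (enum_val i).2)) => -[x y] xy1.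
have xy := @rp_le_kabs R ComplexScalars (Complex x y).
have yx := le_trans (im_le_kabs (Complex x y)) xy1.
have [i iP] := kP x (le_trans xy xy1); have [j jP] := kP y yx.
exists (enum_rank (i, j)); rewrite enum_rankK.
rewrite [X in kabs X](complex_sub_emb x y (Complex (k i) (k j))).
apply: le_trans (kabsD _ _) _; rewrite kabsM !kabs_emb.
rewrite kabs_imaginary_unit /=; lra.
Qed.

Definition span (X : lmodType K) (n : nat) (v : 'I_n -> X) : set X :=
  [set \sum_(i < n) c i *: v i | c in [set: 'I_n -> K]].

(** A spanning family of least size is free, since a dependence would allow one member to be
    dropped. *)
Lemma independent_spanning (X : completeNormedModType K) (n : nat) (V : set X) :
  subspace_dim_le n V -> exists m (v : 'I_m -> X), [/\ (m <= n)%N, V = span v &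
    forall c : 'I_m -> K, \sum_(i < m) c i *: v i = 0 -> forall i, c i = 0].
Proof.
move=> Vn.
have exm : exists m, `[< subspace_dim_le m V >] by exists n; apply/asboolP.
case: (ex_minnP exm) => m /asboolP[v Vv] mmin.
exists m, v; split=> //; first by apply: mmin; apply/asboolP.
move=> c c0 i0; apply: contrapT => /eqP ci0.
have : (m <= m.-1)%N; last by rewrite leqNgt prednK ?leqnn ?(leq_trans _ (ltn_ord i0)).
apply: mmin; apply/asboolP; case: m v c i0 Vv c0 ci0 {exm} => [|m] v c i0 Vv c0 ci0.
  by case: i0 ci0.
exists (fun j => v (lift i0 j)); rewrite Vv; apply/seteqP; split=> _ [d _ <-].
  exists (fun j => d (lift i0 j) - d i0 / c i0 * c (lift i0 j)) => //.
  have vi0 : v i0 = - \sum_(j < m) (c (lift i0 j) / c i0) *: v (lift i0 j).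
    move: c0; rewrite (bigD1_ord i0) //= => /(congr1 (fun x => (c i0)^-1 *: x)).
    rewrite scaler0 scalerDr scalerA mulVf // scale1r => /eqP; rewrite addr_eq0 => /eqP ->.
    by rewrite scaler_sumr; congr (- _); apply: eq_bigr => j _; rewrite scalerA mulrC.
  rewrite [RHS](bigD1_ord i0) //= vi0 scalerN scaler_sumr addrC -sumrB.
  by apply: eq_bigr => j _; rewrite scalerBl scalerA mulrA mulrAC.
exists (fun i => if unlift i0 i is Some j then d j else 0) => //.
rewrite (bigD1_ord i0) //= unlift_none scale0r add0r.
by apply: eq_bigr => j _; rewrite liftK.
Qed.

End finite_dimensional.

(** * Closeness of subspaces through coefficients, and limits of spaces *)

Section local_structure.
Variables (R : realType) (s : scalars).
Local Notation K := (scalar_field R s).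
Local Notation banach := (completeNormedModType K).

Lemma linear_on_sum (X Y : banach) (V : set X) (T : X -> Y) n (v : 'I_n -> X) (c : 'I_n -> K) :
  V = span v -> linear_on V T -> T (\sum_(i < n) c i *: v i) = \sum_(i < n) c i *: T (v i).
Proof.
move=> Vv Tlin.
have V0 : V 0.
  by rewrite Vv; exists (fun=> 0) => //; rewrite big1 // => i _; rewrite scale0r.
have T0 : T 0 = 0.
  have := Tlin (- 1) 0 0 V0 V0.
  by rewrite scaler0 addr0 scaleN1r addNr.
have Vlin a x y : V x -> V y -> V (a *: x + y).
  rewrite Vv => -[d _ <-] [e _ <-]; exists (fun i => a * d i + e i) => //.
  by rewrite scaler_sumr -big_split; apply: eq_bigr => i _; rewrite scalerDl scalerA.
have Vi i : V (v i).
  rewrite Vv; exists (fun j => (j == i)%:R) => //; rewrite (bigD1 i) //= eqxx scale1r.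
  by rewrite big1 ?addr0 // => j /negPf ->; rewrite scale0r.
suff [] : V (\sum_(i < n) c i *: v i) /\
    T (\sum_(i < n) c i *: v i) = \sum_(i < n) c i *: T (v i) by [].
elim/big_rec2 : _ => [//|i y x _ [Vx Tx]].
by split; [exact: Vlin|rewrite Tlin // Tx].
Qed.

(** The families may be dependent: applied to differences of coefficients, the two inequalities show
    that matching combinations gives well defined maps in both directions. *)
Lemma banach_mazur_span (X Y : banach) n (v : 'I_n -> X) (w : 'I_n -> Y) (A B : R) :
  0 <= A -> 0 <= B ->
  (forall c : 'I_n -> K, rnorm (\sum_(i < n) c i *: w i) <= A * rnorm (\sum_(i < n) c i *: v i)) ->
  (forall c : 'I_n -> K, rnorm (\sum_(i < n) c i *: v i) <= B * rnorm (\sum_(i < n) c i *: w i)) ->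
  (banach_mazur (span v) (span w) <= (A * B)%:E)%E.
Proof.
move=> A0 B0 hA hB.
have transfer (X' Y' : banach) (v' : 'I_n -> X') (w' : 'I_n -> Y') D :
    (forall c : 'I_n -> K, rnorm (\sum_(i < n) c i *: w' i) <= D * rnorm (\sum_(i < n) c i *: v' i)) ->
    exists T : X' -> Y', forall c : 'I_n -> K, T (\sum_(i < n) c i *: v' i) = \sum_(i < n) c i *: w' i.
  move=> hD.
  have cP x : exists c : 'I_n -> K, span v' x -> x = \sum_(i < n) c i *: v' i.
    by have [[c _ <-]|no] := pselect (span v' x); [exists c|exists (fun=> 0)].
  have [c {}cP] := choice cP; exists (fun x => \sum_(i < n) c x i *: w' i) => d.
  set x := \sum_(i < n) d i *: v' i; have /cP xE : span v' x by exists d.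
  apply/eqP; rewrite -subr_eq0 -sumrB; apply/eqP/rnorm0_eq0/eqP.
  under eq_bigr do rewrite -scalerBl.
  rewrite eq_le rnorm_ge0 andbT; apply: le_trans (hD (fun i => c x i - d i)) _.
  under eq_bigr do rewrite scalerBl.
  by rewrite sumrB -xE subrr rnorm0 mulr0.
have [T TP] := transfer _ _ _ _ _ hA; have [U UP] := transfer _ _ _ _ _ hB.
apply: (@le_trans _ _ (opnorm (span v) T * opnorm (span w) U)%E).
  apply: ereal_inf_lbound; exists T, U; split=> //.
  - move=> a _ _ [c _ <-] [d _ <-]; rewrite !TP scaler_sumr -big_split /=.
    under eq_bigr do rewrite scalerA -scalerDl.
    rewrite (TP (fun i => a * c i + d i)) scaler_sumr -big_split /=.
    by apply: eq_bigr => i _; rewrite scalerDl scalerA.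
  - by move=> _ [c _ <-]; rewrite TP UP; split=> //; exists c.
  - by move=> _ [c _ <-]; rewrite UP TP; split=> //; exists c.
rewrite EFinM; apply: lee_pmul; rewrite ?opnorm_ge0 //.
  by apply: opnorm_le => // _ [c _ <-]; rewrite TP.
by apply: opnorm_le => // _ [c _ <-]; rewrite UP.
Qed.

(** All later uses of the Banach-Mazur distance go through this description, in which only real
    constants and coefficients occur. *)
Lemma close_to_subspace_span (Ecl : banach_class R s) (eps : R) (X : banach) n (v : 'I_n -> X) :
  close_to_subspace_of Ecl eps (span v) <->
  exists (Y : banach) (w : 'I_n -> Y) (A B : R), [/\ Ecl Y, 0 <= A, 0 <= B, A * B < 1 + eps &
    (forall c : 'I_n -> K, rnorm (\sum_(i < n) c i *: w i) <= A * rnorm (\sum_(i < n) c i *: v i)) /\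
    (forall c : 'I_n -> K, rnorm (\sum_(i < n) c i *: v i) <= B * rnorm (\sum_(i < n) c i *: w i))].
Proof.
split; last first.
  move=> [Y [w [A [B [EY A0 B0 AB [hA hB]]]]]]; exists Y, (span w); split=> //.
    split; first by exists (fun=> 0) => //; rewrite big1 // => i _; rewrite scale0r.
    move=> a _ _ [c _ <-] [d _ <-]; exists (fun i => a * c i + d i) => //.
    by rewrite scaler_sumr -big_split; apply: eq_bigr => i _; rewrite scalerDl scalerA.
  by apply: le_lt_trans (banach_mazur_span A0 B0 hA hB) _; rewrite lte_fin.
move=> [Y [W [EY [W0 Wlin] /ereal_inf_lt[d [T [U [Tlin TW UV ->]]]]]]].
set V := span v in Tlin TW UV * => TU.
have V_sum c : V (\sum_(i < n) c i *: v i) by exists c.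
have T_sum := linear_on_sum _ (erefl : V = span v) Tlin.
exists Y, (fun i => T (v i)).
have eps1 : 0 < 1 + eps.
  by rewrite -lte_fin; apply: le_lt_trans TU; apply: mule_ge0; exact: opnorm_ge0.
have trivial_case : (forall x, V x -> x = 0) -> exists A B : R,
    [/\ Ecl Y, 0 <= A, 0 <= B, A * B < 1 + eps &
      (forall c : 'I_n -> K,
        rnorm (\sum_(i < n) c i *: T (v i)) <= A * rnorm (\sum_(i < n) c i *: v i)) /\
      (forall c : 'I_n -> K,
        rnorm (\sum_(i < n) c i *: v i) <= B * rnorm (\sum_(i < n) c i *: T (v i)))].
  move=> V0; exists 0, 0; split; rewrite ?mulr0 //; split=> c; last first.
    by rewrite (V0 _ (V_sum c)) rnorm0 mul0r.
  rewrite -T_sum (V0 _ (V_sum c)) mul0r.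
  have -> : T 0 = 0.
    have := T_sum (fun=> 0); rewrite !big1 // => i _; exact: scale0r.
  by rewrite rnorm0.
(* An infinite norm can occur in the product because +oo * 0 is 0; the other factor is then 0, which
   forces the span to be zero. *)
have inf_case (e : \bar R) : (0 <= e)%E -> (+oo * e < (1 + eps)%:E)%E -> e = 0%E.
  move=> e0; have [//|e1] := eqVneq e 0%E.
  by rewrite gt0_mulye // lt_neqAle e0 eq_sym e1.
have := opnorm_ge0 V T; have := opnorm_ge0 W U; move: TU.
case ET : (opnorm V T) => [a| |] //; case EU : (opnorm W U) => [b| |] //.
- rewrite -EFinM lte_fin !lee_fin => ab b0 a0; exists a, b; split=> //; split=> c.
    by rewrite -T_sum; apply: (@opnorm_leP _ _ _ _ V); rewrite ?ET.
  rewrite -T_sum -{1}[\sum_(i < n) _]((TW _ (V_sum c)).2).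
  by apply: (@opnorm_leP _ _ _ _ W); rewrite ?EU //; case: (TW _ (V_sum c)).
- rewrite muleC => h _ a0; have T0 := inf_case _ a0 h.
  apply: trivial_case => x Vx; have [Wx <-] := TW x Vx.
  have := @opnorm_leP _ _ _ _ V T 0; rewrite ET T0 => /(_ (lexx _)) Tz.
  have T_0 y : V y -> T y = 0.
    move=> Vy; apply/rnorm0_eq0/eqP; rewrite eq_le rnorm_ge0 andbT.
    by have := Tz y Vy; rewrite mul0r.
  have V0 : V 0 by have := V_sum (fun=> 0); rewrite big1 // => i _; rewrite scale0r.
  by rewrite T_0 // -(T_0 _ V0); case: (TW _ V0).
- move=> h b0 _; have U0 := inf_case _ b0 h.
  apply: trivial_case => x Vx; have [Wx <-] := TW x Vx.
  have := @opnorm_leP _ _ _ _ W U 0; rewrite EU U0 => /(_ (lexx _) _ Wx); rewrite mul0r => h0.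
  by apply/rnorm0_eq0/eqP; rewrite eq_le rnorm_ge0 andbT.
Qed.

Variable Ecl : banach_class R s.

Lemma close_refl (X : banach) (V : set X) n eps : Ecl X -> 0 < eps -> subspace_dim_le n V ->
  close_to_subspace_of Ecl eps V.
Proof.
move=> EX e0 [v ->]; apply/(close_to_subspace_span _ _ v).
by exists X, v, 1, 1; split=> //; [lra|split=> c; rewrite mul1r].
Qed.

Lemma local_class_incl (X : banach) N eps : 0 < eps -> Ecl X -> local_class Ecl N eps X.
Proof. by move=> e0 EX V; exact: close_refl. Qed.

Lemma subspace_dim_le_widen (X : banach) (V : set X) n n' : (n <= n')%N ->
  subspace_dim_le n V -> subspace_dim_le n' V.
Proof.
move=> /subnKC <- [v ->]; move: (n' - n)%N => k.
pose v0 (i : 'I_(n + k)) := if fintype.split i is inl j then v j else 0.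
have sumE (c : 'I_(n + k) -> K) :
    \sum_(i < n + k) c i *: v0 i = \sum_(i < n) c (lshift k i) *: v i.
  rewrite big_split_ord /= [X in _ + X]big1 ?addr0; last first.
    by move=> i _; rewrite /v0 -[rshift n i]/(unsplit (inr i)) unsplitK scaler0.
  by apply: eq_bigr => i _; rewrite /v0 -[lshift k i]/(unsplit (inl i)) unsplitK.
exists v0; apply/seteqP; split=> _ [c _ <-]; last by exists (fun i => c (lshift k i)).
exists (fun i => if fintype.split i is inl j then c j else 0) => //; rewrite sumE.
by apply: eq_bigr => i _; rewrite -[lshift k i]/(unsplit (inl i)) unsplitK.
Qed.

Lemma local_class_mono (X : banach) N N' eps eps' : (N' <= N)%N -> eps <= eps' ->
  local_class Ecl N eps X -> local_class Ecl N' eps' X.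
Proof.
move=> NN ee EX V /(subspace_dim_le_widen NN)/EX[Y [W [EY Wsub BM]]].
by exists Y, W; split=> //; apply: lt_le_trans BM _; rewrite lee_fin lerD2l.
Qed.

Lemma local_class_isometric (X Y : banach) N eps : local_class Ecl N eps Y ->
  isometric_spaces X Y -> local_class Ecl N eps X.
Proof.
move=> EY [T [Tiso _]] V [v ->]; apply/(close_to_subspace_span _ _ v).
have : close_to_subspace_of Ecl eps (span (fun i => T (v i))) by apply: EY; exists (fun i => T (v i)).
move=> /close_to_subspace_span[Z [w [A [B [EZ A0 B0 AB [hA hB]]]]]].
have TE c : rnorm (\sum_(i < N) c i *: T (v i)) = rnorm (\sum_(i < N) c i *: v i).
  by rewrite -Tiso linear_sum; congr rnorm; apply: eq_bigr => i _; rewrite linearZ.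
by exists Z, w, A, B; split=> //; split=> c; rewrite -TE.
Qed.

Hypothesis Ecl_closed : closed_under_finite_representability Ecl.

(** The hypothesis gives convergence of the norm of each single combination. A finite net of the
    unit cube of coefficients makes it uniform, and the lower bound a on coordinates turns the
    additive error into a multiplicative one. The lift r is merely a choice of representatives and
    need not be linear. *)
Lemma ultralimit_in_class (U : set_system nat) (UU : UltraFilter U) (E : nat -> banach)
    (X : banach) (r : X -> forall n, E n) :
  (forall N eps, 0 < eps -> U [set n | local_class Ecl N eps (E n)]) ->
  (forall m (v : 'I_m -> X) (c : 'I_m -> K) e, 0 < e ->
    U [set n | `|rnorm (\sum_(i < m) c i *: r (v i) n) - rnorm (\sum_(i < m) c i *: v i)| < e]) ->
  Ecl X.
Proof.
move=> Eloc rlim; apply: Ecl_closed => n V Vn eps eps0.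
have [m [v [_ -> vfree]]] := independent_spanning Vn.
have [a a0 aP] := independent_coordinates_bound vfree.
(* Small enough for (1 + th)^2 / (1 - th) < 1 + eps: one factor 1 + th comes from the class of
   [E j], the rest from comparing the span of w with that of v. *)
pose th := Num.min eps 1 / 16.
have th0 : 0 < th by rewrite divr_gt0 // lt_min eps0 ltr01.
have th1 : th <= 1 / 16 by rewrite ler_pM2r // ge_min lexx orbT.
have th2 : 16 * th <= eps by rewrite /th mulrC divfK // ge_min lexx.
(* Rounding coefficients to the net costs d times the sum of the norms of the v i, and as much for
   the w i, whose norms are at most those of the v i plus 1; the net points themselves cost d. The
   total is d Q = th a. *)
pose Q := 1 + \sum_(i < m) (2 * rnorm (v i) + 1).
have Q0 : 0 < Q.
  by rewrite ltr_pwDl // sumr_ge0 // => i _; rewrite addr_ge0 // mulr_ge0 ?rnorm_ge0.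
pose d := th * a / Q.
have d0 : 0 < d by rewrite divr_gt0 // mulr_gt0.
have [k [net netP]] := scalar_net s d0.
have U1 : U [set n | forall f : {ffun 'I_m -> 'I_k},
    `|rnorm (\sum_(i < m) net (f i) *: r (v i) n) - rnorm (\sum_(i < m) net (f i) *: v i)| < d].
  by apply: filter_forall => f; apply: rlim.
have U2 : U [set n | forall i, rnorm (r (v i) n) <= rnorm (v i) + 1].
  apply: filter_forall => i.
  have := rlim m v (fun j => (j == i)%:R) 1 ltr01; apply: filterS => j /=.
  have pick (W : banach) (w : 'I_m -> W) : \sum_(j < m) (j == i)%:R *: w j = w i.
    rewrite (bigD1 i) //= eqxx scale1r big1 ?addr0 // => l /negPf ->.
    by rewrite scale0r.
  by rewrite !pick ltr_norml => /andP[]; lra.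
have U3 := Eloc m th th0.
have [j [[/= netj bj] Ej]] := filter_ex (filterI (filterI U1 U2) U3).
pose w i := r (v i) j.
have cube (c : 'I_m -> K) : (forall i, kabs (c i) <= 1) ->
    `|rnorm (\sum_(i < m) c i *: w i) - rnorm (\sum_(i < m) c i *: v i)| <= d * Q.
  move=> c1; have [f fP] := choice (fun i => netP _ (c1 i)).
  have diff (W : banach) (u : 'I_m -> W) :
      `|rnorm (\sum_(i < m) c i *: u i) - rnorm (\sum_(i < m) net (f i) *: u i)| <=
      d * \sum_(i < m) rnorm (u i).
    apply: le_trans (ler_dist_rnorm _ _) _; rewrite -sumrB.
    apply: le_trans (ler_rnorm_sum _ _ _) _; rewrite mulr_sumr; apply: ler_sum => i _.
    by rewrite -scalerBl rnormZ ler_wpM2r ?rnorm_ge0.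
  have := netj [ffun i => f i].
  under eq_bigr do rewrite ffunE.
  under [X in `|_ - rnorm X|]eq_bigr do rewrite ffunE.
  move=> h; have h1 := diff _ w; have h2 := diff _ v.
  have h3 : \sum_(i < m) rnorm (w i) <= \sum_(i < m) (rnorm (v i) + 1).
    by apply: ler_sum => i _; exact: bj.
  have h4 : Q = 1 + (\sum_(i < m) rnorm (v i) + \sum_(i < m) (rnorm (v i) + 1)).
    by rewrite /Q -big_split /=; congr (_ + _); apply: eq_bigr => i _; ring.
  have := ler_wpM2l (ltW d0) h3.
  move: h h1 h2; rewrite h4 mulrDr mulrDr mulr1 ltr_norml !ler_norml.
  move=> /andP[? ?] /andP[? ?] /andP[? ?] ?; apply/andP; split; lra.
have close (c : 'I_m -> K) :
    `|rnorm (\sum_(i < m) c i *: w i) - rnorm (\sum_(i < m) c i *: v i)| <=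
    th * rnorm (\sum_(i < m) c i *: v i).
  pose M := \big[Num.max/0]_(i < m) kabs (c i).
  have cM i : kabs (c i) <= M by rewrite /M (bigD1 i) //= le_max lexx.
  have M0 : 0 <= M by rewrite /M; elim/big_ind : _ => [//|x y x0 _|i _]; rewrite ?le_max ?x0 //; exact: kabs_ge0.
  have [M_0|Mn0] := eqVneq M 0.
    have c0 i : c i = 0 by apply: kabs_eq0; apply/eqP; rewrite eq_le kabs_ge0 -M_0 cM.
    by rewrite !big1 ?rnorm0 ?subrr ?normr0 ?mulr0 // => i _; rewrite c0 scale0r.
  have Mp : 0 < M by rewrite lt_neqAle eq_sym Mn0.
  have aM : a * M <= rnorm (\sum_(i < m) c i *: v i).
    rewrite /M; elim/big_ind : _ => [|x y hx hy|i _]; rewrite ?mulr0 ?rnorm_ge0 //.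
    by case: (leP x y).
  have := cube (fun i => emb s M^-1 * c i).
  have -> : d * Q = th * a by rewrite /d divfK // gt_eqF.
  have scal (W : banach) (u : 'I_m -> W) : rnorm (\sum_(i < m) (emb s M^-1 * c i) *: u i) =
      M^-1 * rnorm (\sum_(i < m) c i *: u i).
    rewrite -[X in X * _]gtr0_norm ?invr_gt0 // -rnormZe scaler_sumr.
    by congr rnorm; apply: eq_bigr => i _; rewrite scalerA.
  rewrite !scal -mulrBr normrM gtr0_norm ?invr_gt0 // ler_pdivrMl // => h.
  apply: le_trans (h _) _.
    by move=> i; rewrite kabsM kabs_emb gtr0_norm ?invr_gt0 // ler_pdivrMl // mulr1.
  by rewrite mulrCA ler_pM2l // mulrC.
have : close_to_subspace_of Ecl th (span w) by apply: Ej; exists w.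
move=> /close_to_subspace_span[Y [y [A [B [EY A0 B0 AB [hA hB]]]]]].
apply/close_to_subspace_span; exists Y, y, (A * (1 + th)), (B * (1 - th)^-1).
have th3 : 0 < 1 - th by lra.
split=> //; [by rewrite mulr_ge0 //; lra|by rewrite mulr_ge0 // invr_ge0 ltW| |].
  have -> : A * (1 + th) * (B * (1 - th)^-1) = A * B * (1 + th) / (1 - th) by ring.
  rewrite ltr_pdivrMr //; have : A * B * (1 + th) <= (1 + th) * (1 + th).
    by rewrite ler_wpM2r ?ltW //; lra.
  nra.
split=> c; have := close c; rewrite ler_norml => /andP[h1 h2].
  apply: le_trans (hA c) _; rewrite -mulrA ler_wpM2l //; lra.
rewrite mulrAC ler_pdivlMr //.
apply: le_trans (hB c); lra.
Qed.

Lemma subspace_in_class (X Y : banach) (J : {linear X -> Y}) :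
  (forall x, rnorm (J x) = rnorm x) -> Ecl Y -> Ecl X.
Proof.
move=> Jiso EY; have [U [UU _]] := free_ultrafilter.
apply: (@ultralimit_in_class U UU (fun=> Y) X (fun x _ => J x)).
  by move=> N eps e0; apply: filterS filterT => n _; exact: local_class_incl.
move=> m v c e e0; apply: filterS filterT => n _ /=.
rewrite -(Jiso (\sum_(i < m) c i *: v i)) linear_sum.
by under [X in `|_ - rnorm X|]eq_bigr do rewrite linearZ /=; rewrite subrr normr0.
Qed.

End local_structure.

Lemma superreflexive_reflexive (R : realType) (s : scalars)
    (X : completeNormedModType (scalar_field R s)) : superreflexive X -> reflexive_space X.
Proof. by apply => n V Vn eps e0; exact: close_refl e0 Vn. Qed.

(** * Word length and Haar measure *)

Section topological_group.
Variable G : topGroupType.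
Implicit Types (g h : G) (A B : set G).

Lemma lmul_continuous g : continuous (fun x : G => (g * x)%g).
Proof.
move=> x; apply: (@continuous_comp _ _ _ (fun x : G => (g, x)) (fun z => (z.1 * z.2)%g)).
  by apply: cvg_pair; [exact: cvg_cst|exact: cvg_id].
exact: mulg_continuous.
Qed.

Lemma rmul_continuous g : continuous (fun x : G => (x * g)%g).
Proof.
move=> x; apply: (@continuous_comp _ _ _ (fun x : G => (x, g)) (fun z => (z.1 * z.2)%g)).
  by apply: cvg_pair; [exact: cvg_id|exact: cvg_cst].
exact: mulg_continuous.
Qed.

Lemma lmul_image g A : [set (g * x)%g | x in A] = (fun x => (g^-1 * x)%g) @^-1` A.
Proof.
apply/seteqP; split=> [_ [x Ax <-]|x Ax]; first by rewrite /= mulgA mulVg mul1g.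
by exists (g^-1 * x)%g => //; rewrite mulgA mulgV mul1g.
Qed.

Lemma lmul_open g A : open A -> open [set (g * x)%g | x in A].
Proof. by move=> oA; rewrite lmul_image; apply: open_comp => // x _; exact: lmul_continuous. Qed.

Lemma lmul_nbhs g h A : nbhs (g * h)%g A -> nbhs h [set x | A (g * x)%g].
Proof. by move=> /(lmul_continuous (x:=h)). Qed.

Lemma image_compact (T : topologicalType) (f : T -> G) (A : set T) :
  continuous f -> compact A -> compact (f @` A).
Proof. by move=> fc; apply: continuous_compact; apply: continuous_subspaceT. Qed.

Lemma lmul_compact g A : compact A -> compact [set (g * x)%g | x in A].
Proof. by apply: image_compact; exact: lmul_continuous. Qed.

Lemma mul_compact A B : compact A -> compact B -> compact [set (x * y)%g | x in A & y in B].
Proof.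
move=> cA cB.
have -> : [set (x * y)%g | x in A & y in B] = (fun z : G * G => (z.1 * z.2)%g) @` (A `*` B).
  apply/seteqP; split=> [_ [x Ax [y By <-]]|_ [[x y] [Ax By] <-]]; first by exists (x, y).
  by exists x => //; exists y.
by apply: image_compact; [exact: mulg_continuous|exact: compact_setX].
Qed.

Lemma near_mul_compact A (O : set G) : compact A -> open O -> A `<=` O ->
  \forall w \near (1%g : G), forall a, A a -> O (w * a)%g.
Proof.
move=> /compact_near_coveringP cA oO AO.
apply: (cA G (nbhs (1%g : G)) (fun w a => O (w * a)%g)) => a Aa.
have := @mulg_continuous G (1%g, a) O; rewrite /= mul1g => /(_ (open_nbhs_nbhs (conj oO (AO _ Aa)))).
move=> [[U V] /= [nU nV] UV]; exists (V, U) => // -[x w] /= [Vx Uw].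
exact: (UV (w, x)).
Qed.

Lemma compact_finite_subcover A (V : G -> set G) : compact A ->
  (forall x, A x -> nbhs x (V x)) -> exists n (k : 'I_n -> G),
  (forall i, A (k i)) /\ forall y, A y -> exists i, V (k i) y.
Proof.
move=> cA AV; have : cover_compact A by rewrite -compact_cover.
move=> /(_ G A (fun x => interior (V x)))[|x Ax|D DA AD].
- by move=> x _; exact: open_interior.
- by exists x => //; exact: AV.
pose D' : seq G := finmap.enum_fset D.
exists (size D'), (tnth (in_tuple D')); split=> [i|y /AD[x xD xy]].
  by have /DA := mem_tnth i (in_tuple D'); rewrite inE.
have /tnthP[i xi] : x \in in_tuple D' by [].
by exists i; rewrite -xi; exact: interior_subset.
Qed.

End topological_group.

Section word_lengths.
Variables (G : topGroupType) (S : set G).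
Hypothesis S_generating : compact_symmetric_generating S.
Implicit Types g h : G.

Lemma set_powerD m n g h : set_power S m g -> set_power S n h -> set_power S (m + n) (g * h)%g.
Proof.
move=> Sg; elim: n h => [|n IH] h; first by move=> ->; rewrite mulg1 addn0.
by move=> [x Sx [y Sy <-]]; rewrite addnS mulgA; exists (g * x)%g; [exact: IH|exists y].
Qed.

Lemma set_power1 g : S g -> set_power S 1 g.
Proof. by move=> Sg; exists 1%g => //; exists g => //; rewrite mul1g. Qed.

Lemma set_powerV n g : set_power S n g -> set_power S n g^-1%g.
Proof.
elim: n g => [|n IH] g; first by move=> ->; rewrite invg1.
move=> [x Sx [y Sy <-]]; rewrite invgM -add1n; apply: set_powerD (IH _ Sx).
by apply: set_power1; exact: csg_symmetric S_generating _ Sy.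
Qed.

Lemma set_power_compact n : compact (set_power S n).
Proof.
elim: n => [|n IH]; first exact: compact_set1.
by apply: mul_compact => //; exact: csg_compact S_generating.
Qed.

Lemma word_lengthP g : set_power S (word_length S g) g /\
  forall k, set_power S k g -> (word_length S g <= k)%N.
Proof.
have exn : exists n, `[< set_power S n g >].
  by have [n ?] := csg_generates S_generating g; exists n; apply/asboolP.
rewrite /word_length; case: xgetP => [n -> []//|/(_ (ex_minn exn))[]].
case: ex_minnP => n /asboolP Sn nmin; split=> // k Sk; apply: nmin; exact/asboolP.
Qed.

Lemma word_length_le n g : set_power S n g -> (word_length S g <= n)%N.
Proof. exact: (word_lengthP g).2. Qed.

Lemma word_lengthM g h : (word_length S (g * h)%g <= word_length S g + word_length S h)%N.
Proof. by apply/word_length_le/set_powerD; exact: (word_lengthP _).1. Qed.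

Lemma word_lengthV g : word_length S g^-1%g = word_length S g.
Proof.
have half h : (word_length S h^-1%g <= word_length S h)%N.
  by apply: word_length_le; apply: set_powerV; case: (word_lengthP h).
by apply/eqP; rewrite eqn_leq half -{1}[g]invgK half.
Qed.

Lemma word_length_gen g : S g -> (word_length S g <= 1)%N.
Proof. by move=> Sg; exact/word_length_le/set_power1. Qed.

Lemma word_ind (P : G -> Prop) : P 1%g -> (forall g s, P g -> S s -> P (g * s)%g) -> forall g, P g.
Proof.
move=> P1 PS g; have [n] := csg_generates S_generating g.
elim: n g => [|n IH] g; first by move=> ->.
by move=> [x /IH Px [y Sy <-]]; exact: PS.
Qed.

End word_lengths.

(** * Haar integrals through Borel partitions *)

Section haar_integral.
Variables (R : realType) (G : topGroupType).
Variable mu : {measure set (borel G) -> \bar R}.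
Hypothesis G_hausdorff : hausdorff_space G.
Hypothesis mu_haar : left_haar mu.

Lemma open_borel (A : set G) : open A -> measurable (A : set (borel G)).
Proof. by move=> oA; apply: sub_sigma_algebra. Qed.

Lemma closed_borel (A : set G) : closed A -> measurable (A : set (borel G)).
Proof. by move=> cA; rewrite -[A]setCK; apply: measurableC; apply: open_borel; exact: closed_openC. Qed.

Lemma compact_borel (A : set G) : compact A -> measurable (A : set (borel G)).
Proof. by move=> cA; apply: closed_borel; exact: compact_closed. Qed.

Lemma continuous_borel (u : G -> R) : continuous u -> measurable_fun setT (u : borel G -> R).
Proof.
move=> uc; apply: (measurability _ (RGenOpens.measurableE R)).
move=> _ [_ [a [b ->] <-]]; rewrite setTI; apply: open_borel.
apply: open_comp; last exact: interval_open.
by move=> x _; exact: uc.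
Qed.

Lemma lmul_borel g (B : set (borel G)) : measurable B ->
  measurable ([set (g * x)%g | x in B] : set (borel G)).
Proof.
move=> mB; rewrite lmul_image -[X in measurable X]setTI.
suff : measurable_fun setT ((fun x : G => (g^-1 * x)%g) : borel G -> borel G).
  by apply.
apply: (@measurability _ _ (borel G) (borel G) setT (fun x : G => (g^-1 * x)%g) (@open G : set (set (borel G)))) => //.
move=> _ [W oW <-]; rewrite setTI.
by apply: open_borel; apply: open_comp => // x _; exact: lmul_continuous.
Qed.

Definition vol (B : set G) : R := fine (mu B).

Lemma vol_ge0 B : 0 <= vol B.
Proof. by rewrite fine_ge0. Qed.

Lemma vol_lmul g (B : set (borel G)) : measurable B -> vol [set (g * x)%g | x in B] = vol B.
Proof. by move=> mB; rewrite /vol haar_invariant. Qed.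

(** This class contains the continuous functions supported in A as well as the indicators of Borel
    parts of A, so that integrals can be compared with Riemann sums inside it. *)
Definition integrable_on (A : set G) (u : G -> R) := [/\ compact A,
  measurable_fun setT (u : borel G -> R), exists c, forall x, `|u x| <= c &
  forall x, ~ A x -> u x = 0].

Lemma integrable_onP A u : integrable_on A u -> mu.-integrable setT (EFin \o (u : borel G -> R)).
Proof.
move=> [cA mu_ [c uc] uA]; have mA := compact_borel cA.
have -> : (EFin \o u : borel G -> \bar R) = (EFin \o u) \_ A.
  apply/funext => x /=; rewrite patchE; case: ifPn => // /negP xA.
  by rewrite uA // => Ax; apply: xA; rewrite inE.
apply/(integrable_mkcond _ mA); apply: measurable_bounded_integrable => //.
- exact: haar_compact.
- exact: measurable_funTS.
- exists c; rewrite num_real; split=> // M cM x _ /=.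
  by rewrite (le_trans (uc x)) // ltW.
Qed.

Lemma integrable_onZ A u a : integrable_on A u -> integrable_on A (fun x => a * u x).
Proof.
move=> [cA mu_ [c uc] uA]; split=> //.
- by apply: measurable_funM => //; exact: measurable_cst.
- by exists (`|a| * c) => x; rewrite normrM ler_wpM2l.
- by move=> x /uA ->; rewrite mulr0.
Qed.

Lemma integrable_onD A u v : integrable_on A u -> integrable_on A v ->
  integrable_on A (fun x => u x + v x).
Proof.
move=> [cA mu_ [c uc] uA] [_ mv [d vd] vA]; split=> //.
- exact: measurable_funD.
- by exists (c + d) => x; rewrite (le_trans (ler_normD _ _)) // lerD.
- by move=> x Ax; rewrite uA // vA // addr0.
Qed.

Lemma integrable_on_sum A n (u : 'I_n -> G -> R) : compact A ->
  (forall i, integrable_on A (u i)) -> integrable_on A (fun x => \sum_(i < n) u i x).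
Proof.
move=> cA; elim: n u => [|n IH] u uA.
  under eq_fun do rewrite big_ord0.
  by split=> //; exists 0 => x; rewrite normr0.
under eq_fun do rewrite big_ord_recr.
by apply: integrable_onD => //; exact: IH.
Qed.

Lemma integrable_on_indic A (B : set (borel G)) : compact A -> measurable B -> B `<=` A ->
  integrable_on A (\1_B : G -> R).
Proof.
move=> cA mB BA; split=> //.
- by exists 1 => x; rewrite indicE; case: (x \in B); rewrite ?normr0 ?normr1.
- by move=> x Ax; rewrite indicE memNset // => /BA.
Qed.

Local Notation integral := (fun u : G -> R => Rintegral mu setT (u : borel G -> R)).

Lemma integral_on0 u : (forall x, u x = 0) -> integral u = 0.
Proof.
move=> u0; rewrite (_ : u = cst 0); last exact/funext.
by rewrite /Rintegral integral0.
Qed.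

Lemma integral_onZ A u a : integrable_on A u -> integral (fun x => a * u x) = a * integral u.
Proof. by move=> /integrable_onP iu; rewrite RintegralZl. Qed.

Lemma integral_onD A B u v : integrable_on A u -> integrable_on B v ->
  integral (fun x => u x + v x) = integral u + integral v.
Proof. by move=> /integrable_onP iu /integrable_onP iv; rewrite RintegralD. Qed.

Lemma integral_onB A B u v : integrable_on A u -> integrable_on B v ->
  integral (fun x => u x - v x) = integral u - integral v.
Proof. by move=> /integrable_onP iu /integrable_onP iv; rewrite RintegralB. Qed.

Lemma le_integral_on A B u v : integrable_on A u -> integrable_on B v ->
  (forall x, u x <= v x) -> integral u <= integral v.
Proof. by move=> /integrable_onP iu /integrable_onP iv uv; apply: le_Rintegral. Qed.

Lemma integral_on_sum A n (u : 'I_n -> G -> R) : compact A ->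
  (forall i, integrable_on A (u i)) ->
  integral (fun x => \sum_(i < n) u i x) = \sum_(i < n) integral (u i).
Proof.
move=> cA; elim: n u => [|n IH] u uA.
  by rewrite big_ord0 integral_on0 // => x; rewrite big_ord0.
rewrite big_ord_recr /= -IH // -(integral_onD (A := A) (B := A)) //; last first.
  exact: integrable_on_sum.
by congr Rintegral; apply/funext => x; rewrite big_ord_recr.
Qed.

Lemma integral_on_indic A (B : set (borel G)) : compact A -> measurable B -> B `<=` A ->
  integral (\1_B : G -> R) = vol B.
Proof. by move=> cA mB BA; rewrite /Rintegral integral_indic // setIT. Qed.

Lemma integral_abs_bound A u e : integrable_on A u -> (forall x, `|u x| <= e * \1_A x) ->
  `|integral u| <= e * vol A.
Proof.
move=> iu ue; have [cA _ _ _] := iu.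
have iA := integrable_on_indic cA (compact_borel cA) (@subset_refl _ A).
rewrite -(integral_on_indic cA (compact_borel cA) (@subset_refl _ A)).
rewrite ler_norml -mulNr -!(integral_onZ _ iA); apply/andP; split.
  apply: (le_integral_on (A := A) (B := A)) => //; first exact: integrable_onZ.
  by move=> x; have := ue x; rewrite ler_norml mulNr => /andP[].
apply: (le_integral_on (A := A) (B := A)) => //; first exact: integrable_onZ.
by move=> x; have := ue x; rewrite ler_norml => /andP[].
Qed.

(** The tag k i lies in A but not necessarily in the piece B i. *)
Record borel_partition (A : set G) n (k : 'I_n -> G) (B : 'I_n -> set G) : Prop := {
  bp_point : forall i, A (k i) ;
  bp_borel : forall i, measurable (B i : set (borel G)) ;
  bp_sub : forall i, B i `<=` A ;
  bp_cover : forall x, A x -> exists i, B i x /\ forall j, B j x -> j = i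
}.

(** A finite subcover is made disjoint by removing from each neighbourhood the preceding ones. *)
Lemma exists_borel_partition A (V : G -> set G) : compact A ->
  (forall x, A x -> nbhs x (V x)) -> exists n (k : 'I_n -> G) (B : 'I_n -> set G),
  borel_partition A k B /\ forall i, B i `<=` V (k i).
Proof.
move=> cA AV; have [|n [k [Ak cov]]] := @compact_finite_subcover G A (fun x => (V x)°) cA.
  by move=> x /AV/nbhs_interior.
pose B (i : 'I_n) := [set x | [/\ A x, (V (k i))° x & forall j : 'I_n, (j < i)%N -> ~ (V (k j))° x]].
exists n, k, B; split; last by move=> i x [_ /interior_subset].
split=> //; [move=> i|by move=> i x []|].
  have -> : B i = A `&` ((V (k i))° `&` ~` (\big[setU/set0]_(j < n | (j < i)%N) (V (k j))°)).
    apply/seteqP; split=> x.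
      by move=> [Ax Vx nx]; split=> //; split=> //; rewrite -bigcup_seq_cond;
         move=> [j /= /andP[_ ji]]; exact: nx.
    move=> [Ax [Vx nx]]; split=> // j ji Vj; apply: nx.
    by rewrite -bigcup_seq_cond; exists j => //=; rewrite mem_index_enum ji.
  apply: measurableI; first exact: compact_borel.
  apply: measurableI; first by apply: open_borel; exact: open_interior.
  apply: measurableC; apply: bigsetU_measurable => j _.
  by apply: open_borel; exact: open_interior.
move=> x Ax; have ex : exists i, `[< exists2 j : 'I_n, j = i :> nat & (V (k j))° x >].
  by have [i Vi] := cov x Ax; exists i; apply/asboolP; exists i.
case: (ex_minnP ex) => m /asboolP[i <- Vi] imin; exists i; split.
  split=> // j ji Vj; have : (i <= j)%N by apply: imin; apply/asboolP; exists j.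
  by rewrite leqNgt ji.
move=> j [_ Vj nj]; apply/val_inj/eqP; rewrite eqn_leq /=; apply/andP; split; last first.
  by apply: imin; apply/asboolP; exists j.
by rewrite leqNgt; apply/negP => ij; exact: nj Vi.
Qed.

Lemma riemann_sum A n (k : 'I_n -> G) B u e : borel_partition A k B -> integrable_on A u ->
  (forall i x, B i x -> `|u x - u (k i)| <= e) ->
  `|integral u - \sum_(i < n) vol (B i) * u (k i)| <= e * vol A.
Proof.
move=> bp iu ue; have [cA _ _ uA] := iu.
have iB i : integrable_on A (\1_(B i) : G -> R).
  by apply: integrable_on_indic => //; [exact: bp_borel bp _|exact: bp_sub bp _].
have iuB i : integrable_on A (fun x => u (k i) * \1_(B i) x) by exact: integrable_onZ.
have -> : \sum_(i < n) vol (B i) * u (k i) = integral (fun x => \sum_(i < n) u (k i) * \1_(B i) x).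
  rewrite (integral_on_sum cA) //; apply: eq_bigr => i _.
  rewrite (integral_onZ _ (iB i)) mulrC; congr (_ * _).
  by rewrite (integral_on_indic cA) //; [exact: bp_borel bp _|exact: bp_sub bp _].
have iS := integrable_on_sum cA iuB; rewrite -(integral_onB iu iS).
apply: integral_abs_bound.
  have -> : (fun x => u x - \sum_(i < n) u (k i) * \1_(B i) x) =
     (fun x => u x + (- 1) * \sum_(i < n) u (k i) * \1_(B i) x).
    by apply/funext => x; rewrite mulN1r.
  by apply: integrable_onD => //; exact: integrable_onZ.
move=> x; have [Ax|Ax] := pselect (A x); last first.
  rewrite uA // big1 => [|i _]; rewrite indicE memNset ?mulr0 ?subr0 ?normr0 //.
  by move=> /(bp_sub bp).
have [i [Bi iuniq]] := bp_cover bp Ax.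
rewrite indicE mem_set // mulr1 (bigD1 i) //= indicE mem_set // mulr1 big1 ?addr0; last first.
  by move=> j ji; rewrite indicE memNset ?mulr0 // => /iuniq/eqP; rewrite (negPf ji).
exact: ue.
Qed.

End haar_integral.

(** * Integration of compactly supported functions *)

Section compact_support.
Variables (R : realType) (s : scalars) (G : topGroupType).
Local Notation K := (scalar_field R s).
Implicit Types (X Y : normedModType K).

Record csupp X (A : set G) (F : G -> X) : Prop := {
  cs_compact : compact A ;
  cs_continuous : continuous F ;
  cs_supp : forall x, ~ A x -> F x = 0
}.

Lemma compact_locally_bounded (A : set G) (N : G -> R) : compact A ->
  (forall x, A x -> exists c, \forall y \near x, N y <= c) -> exists c, forall x, A x -> N x <= c.
Proof.
move=> cA loc; have loc' x : exists c, A x -> \forall y \near x, N y <= c.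
  by have [/loc[c]|] := pselect (A x); [exists c|exists 0].
have [c cP] := choice loc'.
have [n [k [_ cov]]] := @compact_finite_subcover G A (fun x => [set y | N y <= c x]) cA cP.
exists (\sum_(i < n) `|c (k i)|) => x /cov[i /= Nx]; apply: le_trans Nx _.
apply: le_trans (ler_norm _) _; rewrite (bigD1 i) //= lerDl.
by rewrite sumr_ge0.
Qed.

Lemma csupp_bounded X (A : set G) (F : G -> X) : csupp A F -> exists c, forall x, rnorm (F x) <= c.
Proof.
move=> [cA Fc F0]; have [|c cP] := @compact_locally_bounded A (fun x => rnorm (F x)) cA.
  move=> x _; exists (rnorm (F x) + 1).
  move/continuous_rnorm: Fc => /(_ x 1 ltr01); apply: filterS => y Fy.
  by have := ler_rnorm_dist (F y) (F x); lra.
exists (`|c| + 0) => x; rewrite addr0; have [Ax|/F0 ->] := pselect (A x).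
  by apply: le_trans (cP _ Ax) (ler_norm _).
by rewrite rnorm0.
Qed.

End compact_support.

Lemma csupp_rp (R : realType) (s : scalars) (G : topGroupType)
    (X : normedModType (scalar_field R s)) A (F : G -> X) (phi : {linear X -> (scalar_field R s)^o}) : csupp A F -> continuous phi ->
  @csupp R RealScalars G R^o A (fun x => real_part (phi (F x) : scalar_field R s)).
Proof.
move=> [cA Fc F0] phic; split=> // [|x /F0 ->]; last by rewrite linear0 rp0.
have [c c0 cP] := continuous_rnorm_bound phic.
have c1 : 0 < c + 1 by lra.
apply/(@continuous_rnorm R RealScalars R^o) => x e e0.
move/continuous_rnorm: Fc => /(_ x _ (divr_gt0 e0 c1)); apply: filterS => y.
rewrite ltr_pdivlMr // => h; apply: le_lt_trans h.
change (`|real_part (phi (F y) : scalar_field R s) - real_part (phi (F x) : scalar_field R s)| <= rnorm (F y - F x) * (c + 1)).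
rewrite -rpB -linearB; apply: le_trans (rp_le_kabs _) _; apply: le_trans (cP _) _.
by rewrite mulrC ler_wpM2l ?rnorm_ge0 // lerDl.
Qed.


Section real_compact_support.
Variables (R : realType) (G : topGroupType).
Variable mu : {measure set (borel G) -> \bar R}.
Hypothesis G_hausdorff : hausdorff_space G.
Hypothesis mu_haar : left_haar mu.
Local Notation rcsupp := (@csupp R RealScalars G R^o).
Local Notation integral := (fun u : G -> R => Rintegral mu setT (u : borel G -> R)).

Lemma real_continuous (T : topologicalType) (u : T -> R) : continuous u <->
  forall x e, 0 < e -> \forall y \near x, `|u y - u x| < e.
Proof. exact: (@continuous_rnorm R RealScalars R^o T u). Qed.

Lemma rcsupp_integrable A u : rcsupp A u -> integrable_on A u.
Proof.
move=> iu; have [c cP] := csupp_bounded iu; have [cA uc u0] := iu.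
by split=> //; [exact: continuous_borel|exists c].
Qed.

Lemma near_partition A (u : G -> R) e : compact A -> continuous u -> 0 < e ->
  exists n (k : 'I_n -> G) (B : 'I_n -> set G), borel_partition A k B /\
  forall i x, B i x -> `|u x - u (k i)| <= e.
Proof.
move=> cA uc e0.
have [|n [k [B [bp BV]]]] := @exists_borel_partition G G_hausdorff A
  (fun x => [set y | `|u y - u x| <= e]) cA.
  move=> x _; move/real_continuous: uc => /(_ x e e0).
  by apply: filterS => y /ltW.
by exists n, k, B.
Qed.

Lemma eq_of_small (a b c : R) : 0 <= c -> (forall e, 0 < e -> `|a - b| <= e * c) -> a = b.
Proof.
move=> c0 h; apply/eqP; rewrite -subr_eq0 -normr_le0 leNgt; apply/negP => d0.
have c1 : 0 < c + 1 by lra.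
have c2 : 0 < 2 * (c + 1) by lra.
have := h (`|a - b| / (2 * (c + 1))) (divr_gt0 d0 c2).
rewrite mulrAC ler_pdivlMr //; have := mulr_ge0 (ltW d0) c0; lra.
Qed.

(** Invariance is given for Borel sets. Translating a partition and its tags keeps the volumes of
    the pieces and the values at the tags, so both integrals are close to the same Riemann sum. *)
Lemma integral_lmul A u g : rcsupp A u -> integral (fun x => u (g * x)%g) = integral u.
Proof.
move=> iu; have [cA uc u0] := iu.
pose A' := [set (g^-1 * x)%g | x in A].
have iu' : rcsupp A' (fun x => u (g * x)%g).
  split; first exact: lmul_compact.
    by move=> x; apply: continuous_comp; [exact: lmul_continuous|exact: uc].
  by move=> x Ax; apply: u0 => Agx; apply: Ax; exists (g * x)%g => //; rewrite mulKg.
apply: (@eq_of_small _ _ (2 * vol mu A)) => [|e e0]; first by rewrite mulr_ge0 ?vol_ge0.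
have [n [k [B [bp Be]]]] := near_partition cA uc e0.
pose k' i := (g^-1 * k i)%g; pose B' i := [set (g^-1 * x)%g | x in B i].
have bp' : borel_partition A' k' B'.
  split.
  - by move=> i; exists (k i) => //; exact: bp_point bp i.
  - by move=> i; apply: lmul_borel; exact: bp_borel bp i.
  - by move=> i _ [x Bx <-]; exists x => //; exact: bp_sub bp _ _ Bx.
  - move=> _ [x Ax <-]; have [i [Bi iuniq]] := bp_cover bp Ax.
    exists i; split=> [|j [y By /(@mulgI G) yx]]; first by exists x.
    by apply: iuniq; rewrite -yx.
have volB i : vol mu (B' i) = vol mu (B i) by apply: vol_lmul => //; exact: bp_borel bp i.
have volA : vol mu A' = vol mu A by apply: vol_lmul => //; exact: compact_borel.
have h1 := riemann_sum G_hausdorff mu_haar bp (rcsupp_integrable iu) Be.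
have Be' i x : B' i x -> `|u (g * x)%g - u (g * k' i)%g| <= e.
  by move=> [y By <-]; rewrite !mulVKg; exact: Be.
have h2 := riemann_sum G_hausdorff mu_haar bp' (rcsupp_integrable iu') Be'.
have sE : \sum_(i < n) vol mu (B' i) * u (g * k' i)%g = \sum_(i < n) vol mu (B i) * u (k i).
  by apply: eq_bigr => i _; rewrite volB mulVKg.
move: h1 h2; rewrite sE volA.
move: (\sum_(i < n) _) => S h1 h2; have := ler_distD S (integral (fun x => u (g * x)%g)) (integral u).
rewrite (distrC S); lra.
Qed.

Section fubini.
Variables (A B : set G) (Psi : G -> G -> R).
Hypothesis (cA : compact A) (cB : compact B).
Hypothesis Psi_continuous : continuous (fun p : G * G => Psi p.1 p.2).
Hypothesis Psi_supp : forall x y, ~ (A x /\ B y) -> Psi x y = 0.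

Let Psi_cont1 y : continuous (fun x => Psi x y).
Proof.
move=> x; apply: (@continuous_comp _ _ _ (fun x : G => (x, y)) (fun p => Psi p.1 p.2)).
  by apply: cvg_pair; [exact: cvg_id|exact: cvg_cst].
exact: Psi_continuous.
Qed.

Let Psi_cont2 x : continuous (fun y => Psi x y).
Proof.
move=> y; apply: (@continuous_comp _ _ _ (fun y : G => (x, y)) (fun p => Psi p.1 p.2)).
  by apply: cvg_pair; [exact: cvg_cst|exact: cvg_id].
exact: Psi_continuous.
Qed.

Let tube1 x e : 0 < e -> \forall x' \near x, forall y, `|Psi x' y - Psi x y| <= e.
Proof.
move=> e0; have e2 : 0 < e / 2 by rewrite divr_gt0.
have : \forall x' \near x, forall y, B y -> `|Psi x' y - Psi x y| <= e.
  have /compact_near_coveringP := cB; apply => y By.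
  move/real_continuous: Psi_continuous => /(_ (x, y) _ e2) [[U V] /= [nU nV] UV].
  exists (V, U) => // -[y' x'] /= [Vy Ux].
  have h1 := UV (x', y') (conj Ux Vy); have h2 := UV (x, y') (conj (nbhs_singleton nU) Vy).
  have := ler_distD (Psi x y) (Psi x' y') (Psi x y'); rewrite (distrC (Psi x y)).
  move: h1 h2 => /=; lra.
apply: filterS => x' h y; have [/h//|By] := pselect (B y).
by rewrite !Psi_supp ?subrr ?normr0 ?ltW // => -[].
Qed.

Let tube2 y e : 0 < e -> \forall y' \near y, forall x, `|Psi x y' - Psi x y| <= e.
Proof.
move=> e0; have e2 : 0 < e / 2 by rewrite divr_gt0.
have : \forall y' \near y, forall x, A x -> `|Psi x y' - Psi x y| <= e.
  have /compact_near_coveringP := cA; apply => x Ax.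
  move/real_continuous: Psi_continuous => /(_ (x, y) _ e2) [[U V] /= [nU nV] UV].
  exists (U, V) => // -[x' y'] /= [Ux Vy].
  have h1 := UV (x', y') (conj Ux Vy); have h2 := UV (x', y) (conj Ux (nbhs_singleton nV)).
  have := ler_distD (Psi x y) (Psi x' y') (Psi x' y); rewrite (distrC (Psi x y)).
  move: h1 h2 => /=; lra.
apply: filterS => y' h x; have [/h//|Ax] := pselect (A x).
by rewrite !Psi_supp ?subrr ?normr0 ?ltW // => -[].
Qed.

Let cs1 y : rcsupp A (fun x => Psi x y).
Proof. by split=> // x Ax; apply: Psi_supp => -[]. Qed.
Let cs2 x : rcsupp B (fun y => Psi x y).
Proof. by split=> // y By; apply: Psi_supp => -[]. Qed.

Let diff_bound C (u v : G -> R) e : rcsupp C u -> rcsupp C v -> 0 <= e ->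
  (forall x, `|u x - v x| <= e) -> `|integral u - integral v| <= e * vol mu C.
Proof.
move=> cu cv e0 uv; have iu := rcsupp_integrable cu; have iv := rcsupp_integrable cv.
rewrite -(integral_onB G_hausdorff mu_haar iu iv); apply: integral_abs_bound => //.
  have -> : (fun x => u x - v x) = (fun x => u x + (- 1) * v x).
    by apply/funext => x; rewrite mulN1r.
  by apply: integrable_onD => //; exact: integrable_onZ.
move=> x; have [Cx|Cx] := pselect (C x); first by rewrite indicE mem_set // mulr1.
by rewrite indicE memNset // (cs_supp cu Cx) (cs_supp cv Cx) subrr normr0 mulr0.
Qed.

Lemma parameter_integral_csupp : rcsupp A (fun x => integral (Psi x)).
Proof.
split=> //; last first.
  by move=> x Ax; apply: integral_on0 => y; apply: Psi_supp => -[].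
apply/real_continuous => x e e0.
have vB : 0 < vol mu B + 1 by have := vol_ge0 mu B; lra.
have := @tube1 x _ (divr_gt0 e0 vB); apply: filterS => x' h.
apply: le_lt_trans (diff_bound (cs2 x') (cs2 x) _ h) _; first by rewrite ltW // divr_gt0.
rewrite mulrAC ltr_pdivrMr // ltr_pM2l //; lra.
Qed.

(** The set B is partitioned so finely that the dependence on y is negligible uniformly in x. Both
    iterated integrals are then within e vol A vol B of one finite sum. No product measure appears,
    so no countability of the topology is involved. *)
Lemma fubini_csupp :
  integral (fun x => integral (Psi x)) = integral (fun y => integral (fun x => Psi x y)).
Proof.
have vA := vol_ge0 mu A; have vB := vol_ge0 mu B.
apply: (@eq_of_small _ _ (2 * (vol mu A * vol mu B))) => [|e e0].
  by rewrite !mulr_ge0.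
have [|n [k [D [bp De]]]] := @exists_borel_partition G G_hausdorff B
  (fun y => [set y' | forall x, `|Psi x y' - Psi x y| <= e]) cB.
  by move=> y _; exact: tube2.
pose H y := integral (fun x => Psi x y).
have iH : integrable_on B H.
  apply: rcsupp_integrable; split=> //; last first.
    by move=> y By; apply: integral_on0 => x; apply: Psi_supp => -[].
  apply/real_continuous => y d d0.
  have vA1 : 0 < vol mu A + 1 by lra.
  have := @tube2 y _ (divr_gt0 d0 vA1); apply: filterS => y' h.
  apply: le_lt_trans (diff_bound (cs1 y') (cs1 y) _ h) _; first by rewrite ltW // divr_gt0.
  rewrite mulrAC ltr_pdivrMr // ltr_pM2l //; lra.
have h1 : `|integral H - \sum_(i < n) vol mu (D i) * H (k i)| <= e * vol mu A * vol mu B.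
  apply: riemann_sum => // i y Diy.
  apply: diff_bound => //; first exact: ltW.
  by move=> x; apply: De.
have iS i : integrable_on A (fun x => vol mu (D i) * Psi x (k i)).
  by apply: integrable_onZ => //; exact: rcsupp_integrable.
have h2 : `|integral (fun x => integral (Psi x)) - \sum_(i < n) vol mu (D i) * H (k i)|
    <= e * vol mu B * vol mu A.
  have -> : \sum_(i < n) vol mu (D i) * H (k i) =
      integral (fun x => \sum_(i < n) vol mu (D i) * Psi x (k i)).
    rewrite (integral_on_sum G_hausdorff mu_haar cA iS).
    apply: eq_bigr => i _; rewrite (integral_onZ G_hausdorff mu_haar _ (A := A)) //.
    exact: rcsupp_integrable.
  have iP := rcsupp_integrable parameter_integral_csupp.
  have iSS := integrable_on_sum cA iS.
  rewrite -(integral_onB G_hausdorff mu_haar iP iSS); apply: integral_abs_bound => //.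
    have -> : (fun x => integral (Psi x) - \sum_(i < n) vol mu (D i) * Psi x (k i)) =
        (fun x => integral (Psi x) + (- 1) * \sum_(i < n) vol mu (D i) * Psi x (k i)).
      by apply/funext => x; rewrite mulN1r.
    by apply: integrable_onD => //; exact: integrable_onZ.
  move=> x; have [Ax|Ax] := pselect (A x).
    rewrite indicE mem_set // mulr1; apply: riemann_sum => //.
      exact: rcsupp_integrable.
    by move=> i y Dy; exact: De Dy x.
  rewrite indicE memNset // mulr0 integral_on0; last by move=> y; apply: Psi_supp => -[].
  by rewrite big1 ?subrr ?normr0 // => i _; rewrite Psi_supp ?mulr0 // => -[].
move: h1 h2; rewrite -/H; move: (\sum_(i < n) _) => S h1 h2.
have := ler_distD S (integral (fun x => integral (Psi x))) (integral H).
have -> : e * (2 * (vol mu A * vol mu B)) = e * vol mu B * vol mu A + e * vol mu A * vol mu B.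
  by ring.
by rewrite (distrC S) => /le_trans; apply; rewrite lerD.
Qed.

End fubini.
End real_compact_support.

(** * Positivity of Haar measure, and positive densities *)

Section haar_positivity.
Variables (R : realType) (G : topGroupType).
Variable mu : {measure set (borel G) -> \bar R}.
Hypothesis G_hausdorff : hausdorff_space G.
Hypothesis mu_haar : left_haar mu.
Local Notation rcsupp := (@csupp R RealScalars G R^o).
Local Notation integral := (fun u : G -> R => Rintegral mu setT (u : borel G -> R)).

(** Finitely many translates of W cover a given compact set. If W were null, all compact sets would
    be, and the whole group too by inner regularity. *)
Lemma open_measure_gt0 (W : set G) : open W -> W !=set0 -> (0 < mu W)%E.
Proof.
move=> oW [g Wg]; rewrite lt_neqAle measure_ge0 andbT eq_sym; apply/eqP => W0.
apply: (haar_nonzero mu_haar); rewrite (haar_inner mu_haar openT).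
apply/eqP; rewrite eq_le; apply/andP; split; last first.
  apply: ereal_sup_ubound; exists set0; last exact: measure0.
  by split; [exact: compact0|].
apply: ge_ereal_sup => _ [A [cA _] <-].
pose V x := [set ((x * g^-1) * y)%g | y in W].
have V0 x : mu (V x) = 0%E by rewrite -W0; apply: haar_invariant => //; exact: open_borel.
have oV x : open (V x) by exact: lmul_open.
have [|n [k [_ cov]]] := @compact_finite_subcover G A V cA.
  by move=> x _; apply: open_nbhs_nbhs; split=> //; exists g => //; rewrite mulgVK.
have neg : mu.-negligible (\bigcup_j (if insub j is Some i then V (k (i : 'I_n)) else set0)).
  apply: negligible_bigcup => j; case: insub => [i|]; last exact: negligible_set0.
  by apply/negligibleP; [exact: open_borel|exact: V0].
have : mu.-negligible A.
  by apply: negligibleS neg => x /cov[i Vx]; exists (val i) => //; rewrite valK.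
by move=> /(measure_negligible (compact_borel G_hausdorff cA)) ->.
Qed.

Lemma compact_measure_fin (A : set G) : compact A -> mu A = (vol mu A)%:E.
Proof. by move=> cA; rewrite /vol fineK // ge0_fin_numE // haar_compact. Qed.

Lemma integral_gt0 A u x0 : rcsupp A u -> (forall x, 0 <= u x) -> 0 < u x0 -> 0 < integral u.
Proof.
move=> iu u0 ux0; have [cA uc uA] := iu.
pose W := [set x | u x0 / 2 < u x].
have oW : open W.
  rewrite (_ : W = u @^-1` `]u x0 / 2, +oo[%classic); last first.
    by apply/seteqP; split=> x /=; rewrite in_itv /= andbT.
  by apply: open_comp => [x _|]; [exact: uc|exact: interval_open].
have WA : W `<=` A.
  move=> x Wx; apply: contrapT => /uA ux; move: Wx; rewrite /W /= ux; lra.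
have Wx0 : W x0 by rewrite /W /=; lra.
have volW : 0 < vol mu W.
  rewrite /vol fine_gt0 // open_measure_gt0 /=; [|by []|by exists x0].
  apply: le_lt_trans (haar_compact mu_haar cA).
  by apply: le_measure; rewrite ?inE //; [exact: open_borel|exact: compact_borel].
have iW := integrable_on_indic R cA (open_borel oW) WA.
have h2 : 0 < u x0 / 2 by rewrite divr_gt0.
apply: lt_le_trans (mulr_gt0 h2 volW) _.
rewrite -(integral_on_indic mu cA (open_borel oW) WA) -(integral_onZ G_hausdorff mu_haar _ iW).
apply: (le_integral_on G_hausdorff mu_haar (A := A) (B := A)).
- exact: integrable_onZ.
- exact: rcsupp_integrable.
- move=> x; have [Wx|Wx] := pselect (W x); first by rewrite indicE mem_set // mulr1 ltW.
  by rewrite indicE memNset // mulr0.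
Qed.

Section generating_set.
Variable S : set G.
Hypothesis S_generating : compact_symmetric_generating S.

(* Some S^k has positive measure; if O contains S^k and has measure less than
   twice that of S^k, a translate of S^k inside O meets S^k. *)
Lemma set_power_nbhs1 : exists n, nbhs (1%g : G) (set_power S n).
Proof.
have [k Sk] : exists k, mu (set_power S k) != 0%E.
  apply: contrapT => no; apply: (haar_nonzero mu_haar).
  have -> : [set: borel G] = \bigcup_k (set_power S k).
    apply/seteqP; split=> // g _; have [n Sn] := csg_generates S_generating g.
    by exists n.
  apply/measure_negligible.
    apply: bigcup_measurable => k _; apply: compact_borel => //.
    exact: set_power_compact.
  apply: negligible_bigcup => k; apply/negligibleP.
    by apply: compact_borel => //; exact: set_power_compact.
  by apply: contrapT => Sk; apply: no; exists k; apply/eqP.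
set A := set_power S k in Sk.
have cA : compact A by exact: set_power_compact.
have mA := compact_borel G_hausdorff cA.
have vA : 0 < vol mu A.
  rewrite lt_neqAle vol_ge0 andbT eq_sym; apply: contra_neq Sk => h.
  by rewrite compact_measure_fin // h.
have : (mu A < (2 * vol mu A)%:E)%E by rewrite compact_measure_fin // lte_fin; lra.
rewrite {1}(haar_outer mu_haar mA) => /ereal_inf_lt[_ [W [oW AW] <-] muW].
exists (k + k)%N; apply: filterS (near_mul_compact cA oW AW) => w wA.
have [[x [[a Aa ax] Ax]]|disj] := pselect ([set (w * a)%g | a in A] `&` A !=set0).
  have -> : w = (x * a^-1)%g by rewrite -ax mulgK.
  by apply: set_powerD => //; exact: set_powerV.
exfalso; have mwA := lmul_borel w mA.
have : (mu ([set (w * a)%g | a in A] `|` A) <= mu W)%E.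
  apply: le_measure; rewrite ?inE //; [exact: measurableU|exact: open_borel|].
  by move=> _ [[a Aa <-]|/AW//]; exact: wA.
rewrite measureU //; last by apply/seteqP; split=> // x wAx; case: disj; exists x.
rewrite [X in (X + _)%E](haar_invariant mu_haar w mA) => h; have := le_lt_trans h muW.
rewrite [X in (X + _)%E](compact_measure_fin cA) [X in (_ + X)%E](compact_measure_fin cA).
by rewrite -EFinD lte_fin; lra.
Qed.

Lemma word_length_compact (A : set G) : compact A ->
  exists c : R, forall g, A g -> (word_length S g)%:R <= c.
Proof.
move=> cA; have [n Sn] := set_power_nbhs1.
apply: (@compact_locally_bounded R G A (fun g => (word_length S g)%:R)) => // x _.
exists (word_length S x + n)%:R.
have : nbhs x [set y | set_power S n (x^-1 * y)%g] by apply: lmul_nbhs; rewrite mulVg.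
apply: filterS => y Sy; rewrite ler_nat -[y in leqLHS](mulVKg x).
apply: leq_trans (word_lengthM S_generating _ _) _; rewrite leq_add2l.
exact: word_length_le.
Qed.

Hypothesis G_locally_compact : locally_compact [set: G].

Lemma exists_bump (x : G) : exists (A : set G) (u : G -> R),
  [/\ rcsupp A u, forall y, 0 <= u y & 0 < u x].
Proof.
have [B] := @G_locally_compact x I; rewrite withinET => nB [cB clB].
have : ~ (~` B°) x by move=> /(_ nB).
have clO : closed (~` B°) by apply: open_closedC; exact: open_interior.
move/(locally_compact_completely_regular (R := R) G_locally_compact G_hausdorff clO).
move/(uniform_separatorP (R := R)) => [f [fc f01 f0 f1]].
exists B, (fun y => 1 - f y); split.
- split=> // [y|y By].
    apply: (@cvgB R R^o) => //; [exact: cvg_cst|exact: fc].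
  have : [set 1] (f y) by apply: f1; exists y => // /interior_subset.
  by move=> /= ->; rewrite subrr.
- move=> y; have : range f (f y) by exists y.
  by move=> /f01 /=; rewrite in_itv /= => /andP[_]; rewrite subr_ge0.
- have : [set 0] (f x) by apply: f0; exists x.
  by move=> /= ->; rewrite subr0.
Qed.

Lemma exists_density : exists (A : set G) (u : G -> R),
  [/\ rcsupp A u, forall y, 0 <= u y, integral u = 1 & forall x, S x -> 0 < u x].
Proof.
have [A AP] := choice exists_bump; have [u uP] := choice AP.
have cS := csg_compact S_generating.
have [|n [k [_ cov]]] := @compact_finite_subcover G S (fun x => [set y | 0 < u x y]) cS.
  move=> x _; have [[_ uc _] _ ux] := uP x.
  move/real_continuous: uc => /(_ x _ ux); apply: filterS => y /=.
  by rewrite ltr_norml => /andP[]; lra.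
pose v y := \sum_(i < n) u (k i) y.
have v_ge0 y : 0 <= v y by apply: sumr_ge0 => i _; case: (uP (k i)).
have v_gt0 y : S y -> 0 < v y.
  move=> /cov[i uy]; rewrite /v (bigD1 i) //= ltr_pwDl // sumr_ge0 // => j _.
  by case: (uP (k j)).
have cv : rcsupp (\big[setU/set0]_(i < n) A (k i)) v.
  split.
  - by apply: bigsetU_compact => i _; case: (uP (k i)) => -[].
  - rewrite /v; elim: (index_enum _) => [|i r IH].
      by under eq_fun do rewrite big_nil; move=> y; exact: cvg_cst.
    under eq_fun do rewrite big_cons; move=> y; apply: (@cvgD R R^o) => //; last exact: IH.
    by case: (uP (k i)) => -[_ + _] _ _; apply.
  - move=> y Ay; rewrite /v big1 // => i _; case: (uP (k i)) => -[_ _ + _ _]; apply => Aiy.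
    by apply: Ay; rewrite -bigcup_seq; exists i => //=; rewrite mem_index_enum.
have v0 : 0 < integral v by apply: (integral_gt0 cv v_ge0 (v_gt0 _ (csg_one S_generating))).
exists (\big[setU/set0]_(i < n) A (k i)), (fun y => (integral v)^-1 * v y).
have [cA vc vA] := cv; split.
- split=> // [y|y /vA ->]; last by rewrite mulr0.
  by apply: (@cvgM R) => //; [exact: cvg_cst|exact: vc].
- by move=> y; rewrite mulr_ge0 // invr_ge0 ltW.
- have := @integral_onZ _ _ mu G_hausdorff mu_haar _ v (integral v)^-1 (rcsupp_integrable cv).
  by move=> ->; rewrite mulVf // gt_eqF.
- by move=> y Sy; rewrite mulr_gt0 ?invr_gt0 // v_gt0.
Qed.

End generating_set.
End haar_positivity.

(** * Integrals of vector valued functions *)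

Section vector_integrals.
Variables (R : realType) (s : scalars) (G : topGroupType).
Variable mu : {measure set (borel G) -> \bar R}.
Hypothesis G_hausdorff : hausdorff_space G.
Hypothesis mu_haar : left_haar mu.
Local Notation K := (scalar_field R s).
Local Notation rcsupp := (@csupp R RealScalars G R^o).
Local Notation integral := (fun u : G -> R => Rintegral mu setT (u : borel G -> R)).
Local Notation sintegral := (@scalar_integral R s G mu).
Implicit Types (A : set G) (X Y : completeNormedModType K).

Lemma exists_mul_functional (k : K) : exists phi : {linear K^o -> K^o},
  continuous phi /\ forall x, phi x = k * x.
Proof.
have [|phi phiE] := @exists_linear K K^o K^o (fun x => k * x).
  move=> a x y; rewrite mulrDr; congr (_ + _); exact: mulrCA.
exists phi; split=> //; apply: (@rnorm_bound_continuous R s K^o K^o phi (kabs k)) => x.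
by rewrite phiE rnorm_K (kabsM k x).
Qed.

Lemma exists_scaled_functional X (phi : {linear X -> K^o}) (k : K) : continuous phi ->
  exists psi : {linear X -> K^o}, continuous psi /\ forall x, psi x = k * phi x.
Proof.
move=> phic; have [c c0 cP] := continuous_rnorm_bound phic.
have [|psi psiE] := @exists_linear K X K^o (fun x => k * phi x).
  by move=> a x y; rewrite linearP mulrDr; congr (_ + _); exact: mulrCA.
exists psi; split=> //; apply: (@rnorm_bound_continuous R s X K^o psi (kabs k * c)) => x.
by rewrite psiE rnorm_K (kabsM k (phi x)) -mulrA ler_wpM2l ?kabs_ge0 //; exact: cP.
Qed.

Lemma exists_composed_functional X Y (T : {linear X -> Y}) (phi : {linear Y -> K^o}) :
  continuous T -> continuous phi -> exists psi : {linear X -> K^o},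
  continuous psi /\ forall x, psi x = phi (T x).
Proof.
move=> Tc phic; have [|psi psiE] := @exists_linear K X K^o (fun x => phi (T x)).
  by move=> a x y; rewrite !linearP.
exists psi; split=> // x; rewrite (_ : (psi : X -> K^o) = (phi : Y -> K^o) \o T); last exact/funext.
by apply: continuous_comp; [exact: Tc|exact: phic].
Qed.

Lemma rcsupp_rpM A (u : G -> K) (k : K) : csupp A (u : G -> K^o) ->
  rcsupp A (fun x => real_part (k * u x)).
Proof.
move=> cu; have [phi [phic phiE]] := exists_mul_functional k.
have := csupp_rp cu phic; rewrite (_ : (fun x => real_part (phi (u x) : K)) =
  (fun x => real_part (k * u x))) //; apply/funext => x; by rewrite phiE.
Qed.

(** Identities between scalars are thereby reduced to real integrals, in the same way over both
    fields. *)
Lemma eq_of_rpM (a b : K) : (forall k, real_part (k * a) = real_part (k * b)) -> a = b.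
Proof.
move=> ab; apply/eqP; rewrite -subr_eq0; apply: contraT => c0.
have := ab (a - b)^-1 => /eqP; rewrite -subr_eq0 -rpB -mulrBr mulVf //.
by rewrite -(emb1 R s) embK oner_eq0.
Qed.

End vector_integrals.

Section scalar_integrals.
Variables (R : realType) (G : topGroupType).
Variable mu : {measure set (borel G) -> \bar R}.
Hypothesis G_hausdorff : hausdorff_space G.
Hypothesis mu_haar : left_haar mu.
Local Notation integral := (fun u : G -> R => Rintegral mu setT (u : borel G -> R)).

Lemma rp_scalar_integral (s : scalars) A (u : G -> scalar_field R s) k :
  csupp A (u : G -> (scalar_field R s)^o) ->
  real_part (k * scalar_integral mu u) = integral (fun x => real_part (k * u x)).
Proof.
have Z v A' a : @csupp R RealScalars G R^o A' v -> integral (fun x => a * v x) = a * integral v.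
  by move=> cv; apply: (integral_onZ G_hausdorff mu_haar _ (rcsupp_integrable cv)).
case: s u k => u k cu; first by rewrite /= (Z _ _ _ cu).
have cRe : @csupp R RealScalars G R^o A (fun x => complex.Re (u x)).
  have := rcsupp_rpM (s := ComplexScalars) 1 cu.
  by rewrite (_ : (fun x => _) = (fun x => complex.Re (u x))) //; apply/funext => x; rewrite mul1r.
have cIm : @csupp R RealScalars G R^o A (fun x => complex.Im (u x)).
  have := rcsupp_rpM (s := ComplexScalars) (Complex 0 (- 1)) cu.
  rewrite (_ : (fun x => _) = (fun x => complex.Im (u x))) //; apply/funext => x.
  by case: (u x) => a b /=; rewrite mul0r sub0r mulN1r opprK.
case: k => a b.
have -> : (fun x => real_part ((Complex a b : scalar_field R ComplexScalars) * u x)) =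
    (fun x => a * complex.Re (u x) + (- b) * complex.Im (u x)).
  by apply/funext => x; case: (u x) => c d /=; rewrite mulNr.
have iRe := integrable_onZ a (rcsupp_integrable cRe).
have iIm := integrable_onZ (- b) (rcsupp_integrable cIm).
by rewrite (integral_onD G_hausdorff mu_haar iRe iIm) (Z _ _ _ cRe) (Z _ _ _ cIm) /= mulNr.
Qed.

End scalar_integrals.

Section vector_integrals2.
Variables (R : realType) (s : scalars) (G : topGroupType).
Variable mu : {measure set (borel G) -> \bar R}.
Hypothesis G_hausdorff : hausdorff_space G.
Hypothesis mu_haar : left_haar mu.
Local Notation K := (scalar_field R s).
Local Notation rcsupp := (@csupp R RealScalars G R^o).
Local Notation integral := (fun u : G -> R => Rintegral mu setT (u : borel G -> R)).
Local Notation sintegral := (@scalar_integral R s G mu).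
Implicit Types (A : set G) (X Y : completeNormedModType K).

Lemma rp_sintegral A (u : G -> K) : csupp A (u : G -> K^o) ->
  real_part (sintegral u) = integral (fun x => real_part (u x)).
Proof.
move=> cu; have := rp_scalar_integral G_hausdorff mu_haar 1 cu.
by rewrite mul1r => ->; congr Rintegral; apply/funext => x; rewrite mul1r.
Qed.

Lemma sintegral_emb A (u : G -> R) : rcsupp A u ->
  csupp A (fun x => emb s (u x) : K^o) /\ sintegral (fun x => emb s (u x)) = emb s (integral u).
Proof.
move=> cu; have cu' : csupp A (fun x => emb s (u x) : K^o).
  have [cA uc uA] := cu; split=> // [|x /uA ->]; last exact: emb0.
  apply/continuous_rnorm => x e e0; move/real_continuous: uc => /(_ x e e0).
  by apply: filterS => y; rewrite rnorm_K -(kabs_emb s) embB.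
split=> //; apply: eq_of_rpM => k; rewrite (rp_scalar_integral G_hausdorff mu_haar _ cu').
rewrite mulrC rpZ mulrC.
rewrite -(integral_onZ G_hausdorff mu_haar _ (rcsupp_integrable cu)).
by congr Rintegral; apply/funext => x; rewrite mulrC rpZ mulrC.
Qed.

Lemma csupp_comp A X (F : G -> X) (phi : {linear X -> K^o}) : csupp A F -> continuous phi ->
  csupp A (fun x => phi (F x) : K^o).
Proof.
move=> [cA Fc FA] phic; split=> // [x|x /FA ->]; last exact: linear0.
by apply: (@continuous_comp _ _ _ F phi); [exact: Fc|exact: phic].
Qed.

Lemma csupp_op A X Y (F : G -> X) (T : {linear X -> Y}) : csupp A F -> continuous T ->
  csupp A (fun x => T (F x)).
Proof.
move=> [cA Fc FA] Tc; split=> // [x|x /FA ->]; last exact: linear0.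
by apply: (@continuous_comp _ _ _ F T); [exact: Fc|exact: Tc].
Qed.

Lemma vector_near_partition A X (F : G -> X) e : compact A -> continuous F -> 0 < e ->
  exists n (k : 'I_n -> G) (B : 'I_n -> set G), borel_partition A k B /\
  forall i x, B i x -> rnorm (F x - F (k i)) <= e.
Proof.
move=> cA Fc e0.
have [|n [k [B [bp BV]]]] := @exists_borel_partition G G_hausdorff A
  (fun x => [set y | rnorm (F y - F x) <= e]) cA.
  move=> x _; move/continuous_rnorm: Fc => /(_ x e e0).
  by apply: filterS => y /ltW.
by exists n, k, B.
Qed.

Local Notation rsum B F k := (\sum_i emb s (vol mu (B i)) *: F (k i)).

Lemma functional_riemann A X (F : G -> X) n (k : 'I_n -> G) B e (phi : {linear X -> K^o}) c :
  csupp A F -> borel_partition A k B -> (forall i x, B i x -> rnorm (F x - F (k i)) <= e) ->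
  continuous phi -> 0 <= c -> (forall x, `|real_part (phi x : K)| <= c * rnorm x) ->
  `|integral (fun x => real_part (phi (F x) : K)) - real_part (phi (rsum B F k) : K)| <=
  c * e * vol mu A.
Proof.
move=> cF bp Be phic c0 cP.
have -> : real_part (phi (rsum B F k) : K) =
    \sum_(i < n) vol mu (B i) * real_part (phi (F (k i)) : K).
  by rewrite linear_sum rp_sum; apply: eq_bigr => i _; rewrite linearZ rpZ.
apply: riemann_sum => //; first exact: rcsupp_integrable (csupp_rp cF phic).
move=> i x Bx; rewrite -rpB -linearB; apply: le_trans (cP _) _.
by rewrite ler_wpM2l //; exact: Be Bx.
Qed.

Lemma norming_real X (x : X) : exists phi : {linear X -> K^o}, [/\ continuous phi,
  forall y, `|real_part (phi y : K)| <= 1 * rnorm y & real_part (phi x : K) = rnorm x].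
Proof.
have [phi [phic phib phix]] := norming_functional x; exists phi; split=> // y.
by rewrite mul1r (le_trans (rp_le_kabs _)).
Qed.

Lemma eq_of_functionals X (x y : X) : (forall phi : {linear X -> K^o}, continuous phi ->
  real_part (phi x : K) = real_part (phi y : K)) -> x = y.
Proof.
move=> xy; have [phi [phic _ phixy]] := norming_real (x - y).
apply/eqP; rewrite -subr_eq0; apply/eqP/rnorm0_eq0.
by rewrite -phixy linearB rpB xy // subrr.
Qed.

(** The integral is the limit of Riemann sums over partitions on whose pieces F varies by at most
    2^-n. Testing the difference of two sums on a norming functional carries the scalar estimate
    over to the norm. *)
Lemma vector_integral_exists A X (F : G -> X) : csupp A F -> exists y,
  forall phi : {linear X -> K^o}, continuous phi ->
  real_part (phi y : K) = integral (fun x => real_part (phi (F x) : K)).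
Proof.
move=> cF; have [cA Fc FA] := cF; have vA := vol_ge0 mu A.
have h2 n : 0 < (2^-1 : R) ^+ n by rewrite exprn_gt0 // invr_gt0.
have approx n : exists y : X, forall (phi : {linear X -> K^o}) c, continuous phi -> 0 <= c ->
    (forall x, `|real_part (phi x : K)| <= c * rnorm x) ->
    `|integral (fun x => real_part (phi (F x) : K)) - real_part (phi y : K)| <=
    c * 2^-1 ^+ n * vol mu A.
  have [m [k [B [bp Be]]]] := vector_near_partition cA Fc (h2 n).
  exists (rsum B F k) => phi c phic c0 cP.
  exact: (functional_riemann cF bp Be phic c0 cP).
have [y yP] := choice approx.
have [|l [yl _]] := @geometric_cvg R s X (2 * vol mu A) y.
  move=> n; have [phi [phic phi1 <-]] := norming_real (y n.+1 - y n).
  have := yP n phi 1 phic ler01 phi1; have := yP n.+1 phi 1 phic ler01 phi1.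
  rewrite linearB rpB !mul1r exprS !ler_norml => /andP[a b] /andP[c d].
  have := h2 n; nra.
exists l => phi phic; have [c c0 cP] := continuous_rnorm_bound phic.
have cP' x : `|real_part (phi x : K)| <= c * rnorm x.
  by apply: le_trans (rp_le_kabs _) (cP x).
apply: (@eq_of_small _ _ _ (c + 1)) => [|e e0]; first lra.
have vA1 : 0 < c * vol mu A + 1 by rewrite ltr_wpDl // mulr_ge0.
have [N1 N1P] := (cvg_seq_rnorm _ _).1 yl e e0.
have [N2] := half_expn_small (divr_gt0 e0 vA1); rewrite ltr_pdivlMr // => N2P.
set N := maxn N1 N2.
have a1 := yP N phi c phic c0 cP'.
have a2 : `|real_part (phi (y N) : K) - real_part (phi l : K)| <= c * e.
  rewrite -rpB -linearB; apply: le_trans (cP' _) _; rewrite ler_wpM2l // ltW // N1P //.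
  exact: leq_maxl.
have a3 : c * 2^-1 ^+ N * vol mu A <= e.
  apply: le_trans (ltW N2P); rewrite mulrAC mulrC.
  have : (2^-1 : R) ^+ N <= 2^-1 ^+ N2.
    by rewrite ler_wiXn2l ?leq_maxr // ?invr_ge0 // invf_le1 // ler1n.
  have cv : 0 <= c * vol mu A by rewrite mulr_ge0.
  have := h2 N2; nra.
move: a1 a2; rewrite !ler_norml => /andP[? ?] /andP[? ?].
apply/andP; split; lra.
Qed.

Lemma vector_integralP A X (F : G -> X) : csupp A F -> forall phi : {linear X -> K^o},
  continuous phi -> phi (vector_integral mu F) = sintegral (fun x => phi (F x)).
Proof.
move=> cF; rewrite /vector_integral; case: xgetP => [y _ //|no].
have [y yP] := vector_integral_exists cF; exfalso; apply: (no y) => phi phic.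
apply: eq_of_rpM => k; have [psi [psic psiE]] := exists_scaled_functional k phic.
have := yP psi psic; rewrite psiE => ->.
rewrite (rp_scalar_integral G_hausdorff mu_haar _ (csupp_comp cF phic)).
by congr Rintegral; apply/funext => x; rewrite psiE.
Qed.

Lemma rp_vector_integral A X (F : G -> X) (phi : {linear X -> K^o}) : csupp A F ->
  continuous phi -> real_part (phi (vector_integral mu F) : K) =
  integral (fun x => real_part (phi (F x) : K)).
Proof. by move=> cF phic; rewrite (vector_integralP cF phic) (rp_sintegral (csupp_comp cF phic)). Qed.

Lemma vector_integralD A B X (F H : G -> X) (a : K) : csupp A F -> csupp B H ->
  vector_integral mu (fun x => a *: F x + H x) = a *: vector_integral mu F + vector_integral mu H.
Proof.
move=> cF cH; apply: eq_of_functionals => phi phic.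
have cFH : csupp (A `|` B) (fun x => a *: F x + H x).
  have [cA Fc FA] := cF; have [cB Hc HB] := cH; split.
  - exact: compactU.
  - by move=> x; apply: cvgD; [apply: cvgZr; exact: Fc|exact: Hc].
  - by move=> x AB; rewrite FA ?HB ?scaler0 ?addr0 // => ?; apply: AB; [right|left].
rewrite (rp_vector_integral cFH phic) linearP rpD (rp_vector_integral cH phic).
have [psi [psic psiE]] := exists_scaled_functional a phic.
have -> : real_part (a *: phi (vector_integral mu F) : K) =
   integral (fun x => real_part (psi (F x) : K)).
  by rewrite -(rp_vector_integral cF psic) psiE.
rewrite -(integral_onD G_hausdorff mu_haar (rcsupp_integrable (csupp_rp cF psic))
  (rcsupp_integrable (csupp_rp cH phic))).
by congr Rintegral; apply/funext => x; rewrite psiE linearP rpD.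
Qed.

Lemma vector_integral_op A X Y (F : G -> X) (T : {linear X -> Y}) : csupp A F -> continuous T ->
  T (vector_integral mu F) = vector_integral mu (fun x => T (F x)).
Proof.
move=> cF Tc; apply: eq_of_functionals => phi phic.
have [psi [psic psiE]] := exists_composed_functional Tc phic.
rewrite -psiE (rp_vector_integral cF psic) (rp_vector_integral (csupp_op cF Tc) phic).
by congr Rintegral; apply/funext => x; rewrite psiE.
Qed.

Lemma csupp_lmul A X (F : G -> X) g : csupp A F ->
  csupp [set (g^-1 * x)%g | x in A] (fun x => F (g * x)%g).
Proof.
move=> [cA Fc FA]; split; first exact: lmul_compact.
  by move=> x; apply: (@continuous_comp _ _ _ _ F); [exact: lmul_continuous|exact: Fc].
by move=> x Ax; apply: FA => Agx; apply: Ax; exists (g * x)%g => //; rewrite mulKg.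
Qed.

Lemma vector_integral_lmul A X (F : G -> X) g : csupp A F ->
  vector_integral mu (fun x => F (g * x)%g) = vector_integral mu F.
Proof.
move=> cF; apply: eq_of_functionals => phi phic.
rewrite (rp_vector_integral (csupp_lmul g cF) phic) (rp_vector_integral cF phic).
exact: (integral_lmul G_hausdorff mu_haar g (csupp_rp cF phic)).
Qed.

Lemma vector_integral_le A B X (F : G -> X) (w : G -> R) : csupp A F -> integrable_on B w ->
  (forall x, rnorm (F x) <= w x) -> rnorm (vector_integral mu F) <= integral w.
Proof.
move=> cF iw Fw; have [phi [phic phi1 <-]] := norming_real (vector_integral mu F).
rewrite (rp_vector_integral cF phic).
apply: (le_integral_on G_hausdorff mu_haar (rcsupp_integrable (csupp_rp cF phic)) iw) => x.
by apply: le_trans (ler_norm _) _; apply: le_trans (phi1 _) _; rewrite mul1r.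
Qed.

Lemma vector_integral_bound A X (F : G -> X) e : csupp A F ->
  (forall x, A x -> rnorm (F x) <= e) -> rnorm (vector_integral mu F) <= e * vol mu A.
Proof.
move=> cF Fe; have [cA _ FA] := cF.
have iA := integrable_on_indic R cA (compact_borel G_hausdorff cA) (@subset_refl _ A).
rewrite -(integral_on_indic mu cA (compact_borel G_hausdorff cA) (@subset_refl _ A)).
rewrite -(integral_onZ G_hausdorff mu_haar _ iA).
apply: (vector_integral_le cF (integrable_onZ e iA)) => x.
have [Ax|Ax] := pselect (A x); first by rewrite indicE mem_set // mulr1 Fe.
by rewrite indicE memNset // mulr0 FA // rnorm0.
Qed.

Lemma vector_riemann A X (F : G -> X) n (k : 'I_n -> G) B e :
  csupp A F -> borel_partition A k B -> (forall i x, B i x -> rnorm (F x - F (k i)) <= e) ->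
  rnorm (vector_integral mu F - rsum B F k) <= e * vol mu A.
Proof.
move=> cF bp Be; have [phi [phic phi1 <-]] := norming_real (vector_integral mu F - rsum B F k).
rewrite linearB rpB (rp_vector_integral cF phic); apply: le_trans (ler_norm _) _.
by have := functional_riemann cF bp Be phic ler01 phi1; rewrite mul1r.
Qed.

Lemma csupp_scale A X (f : G -> K) (H : G -> X) : csupp A (f : G -> K^o) -> continuous H ->
  csupp A (fun x => f x *: H x).
Proof.
move=> [cA fc fA] Hc; split=> // [x|x /fA ->]; last by rewrite scale0r.
by apply: cvgZ; [exact: fc|exact: Hc].
Qed.

Lemma vector_integral_cst A X (f : G -> K) (v : X) : csupp A (f : G -> K^o) ->
  vector_integral mu (fun x => f x *: v) = sintegral f *: v.
Proof.
move=> cf; apply: eq_of_functionals => phi phic.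
have cfv : csupp A (fun x => f x *: v) by apply: csupp_scale => // x; exact: cvg_cst.
rewrite (rp_vector_integral cfv phic) linearZ /= [X in real_part X]mulrC.
rewrite (rp_scalar_integral G_hausdorff mu_haar _ cf).
by congr Rintegral; apply/funext => x; rewrite linearZ /= [X in real_part X]mulrC.
Qed.

Lemma kabs_sintegral_bound A (u : G -> K) e : csupp A (u : G -> K^o) -> 0 <= e ->
  (forall x, A x -> kabs (u x) <= e) -> kabs (sintegral u) <= e * vol mu A.
Proof.
move=> cu e0 ue; have [cA _ uA] := cu.
apply: (@kabs_le_of_real_part R s K^o idfun) => k k1.
change (real_part (k * sintegral u) <= e * vol mu A).
rewrite (rp_scalar_integral G_hausdorff mu_haar _ cu); apply: le_trans (ler_norm _) _.
apply: integral_abs_bound => //; first exact: rcsupp_integrable (rcsupp_rpM _ cu).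
move=> x; have [Ax|Ax] := pselect (A x); last first.
  by rewrite uA // mulr0 rp0 normr0 indicE memNset // mulr0.
rewrite indicE mem_set // mulr1; apply: le_trans (rp_le_kabs _) _.
by rewrite kabsM k1 mul1r ue.
Qed.

Lemma CcP (f : G -> K) : Cc f <-> exists A, csupp A (f : G -> K^o).
Proof.
split=> [[fc cf]|[A [cA fc fA]]].
  exists (closure [set g | f g != 0]); split=> // x fx; apply/eqP; apply: contraT => fx0.
  by exfalso; apply: fx; exact: subset_closure.
split=> //; apply: (subclosed_compact _ cA); first exact: closed_closure.
rewrite [X in _ `<=` X](_ : A = closure A); last first.
  by apply/closure_id; exact: compact_closed.
by apply: closureS => x /= fx; apply: contrapT => /fA f0; rewrite f0 eqxx in fx.
Qed.

End vector_integrals2.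

(** * Integrated representations and convolution *)

Section limsup.
Variable R : realType.
Implicit Types u v : nat -> \bar R.

Lemma limn_esup_le u (c : \bar R) N : (forall n, (N <= n)%N -> (u n <= c)%E) ->
  (limn_esup u <= c)%E.
Proof.
move=> uc; apply: (@le_trans _ _ (ereal_sup (u @` [set n | (N <= n)%N]))).
  by apply: ereal_inf_lbound; exists [set n | (N <= n)%N] => //; exists N.
by apply: ge_ereal_sup => _ [n Nn <-]; exact: uc.
Qed.

Lemma limn_esup_lt u (c : \bar R) : (limn_esup u < c)%E ->
  exists N, forall n, (N <= n)%N -> (u n < c)%E.
Proof.
move=> /ereal_inf_lt[_ [V [N _ NV] <-] Vc]; exists N => n Nn.
by apply: le_lt_trans Vc; apply: ereal_sup_ubound; exists n => //; exact: NV.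
Qed.

Lemma limn_esup_ge0 u : (forall n, 0 <= u n)%E -> (0 <= limn_esup u)%E.
Proof.
move=> u0; apply: le_ereal_inf_tmp => _ [V [N _ NV] <-].
by apply: le_trans (u0 N) _; apply: ereal_sup_ubound; exists N => //; exact: NV (leqnn _).
Qed.

Lemma limn_esup_mono u v : (forall n, u n <= v n)%E -> (limn_esup u <= limn_esup v)%E.
Proof.
move=> uv; apply: le_ereal_inf_tmp => _ [V [N _ NV] <-]; apply: (@limn_esup_le _ _ N) => n Nn.
by apply: le_trans (uv n) _; apply: ereal_sup_ubound; exists n => //; exact: NV.
Qed.

End limsup.

Section representation_integrals.
Variables (R : realType) (s : scalars) (G : topGroupType).
Variable mu : {measure set (borel G) -> \bar R}.
Hypothesis G_hausdorff : hausdorff_space G.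
Hypothesis mu_haar : left_haar mu.
Local Notation K := (scalar_field R s).
Local Notation rcsupp := (@csupp R RealScalars G R^o).
Local Notation kcsupp := (@csupp R s G K^o).
Local Notation integral := (fun u : G -> R => Rintegral mu setT (u : borel G -> R)).
Local Notation sintegral := (@scalar_integral R s G mu).
Local Notation rint := (rep_integral mu).
Implicit Types (A : set G) (E : completeNormedModType K).

Lemma real_part_continuous (T : topologicalType) (F : T -> K) : continuous (F : T -> K^o) ->
  continuous (fun t => real_part (F t) : R).
Proof.
move=> /continuous_rnorm Fc; apply/real_continuous => t e e0.
have := Fc t e e0; apply: filterS => u; apply: le_lt_trans.
by rewrite -rpB rp_le_kabs.
Qed.

Lemma sintegralB A B (u v : G -> K) : kcsupp A u -> kcsupp B v ->
  kcsupp (A `|` B) (fun x => u x - v x) /\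
  sintegral (fun x => u x - v x) = sintegral u - sintegral v.
Proof.
move=> cu cv; have cuv : kcsupp (A `|` B) (fun x => u x - v x).
  have [cA uc uA] := cu; have [cB vc vB] := cv; split; first exact: compactU.
    by move=> x; apply: (@cvgB K K^o) => //; [exact: uc|exact: vc].
  by move=> x AB; rewrite uA ?vB ?subrr // => ?; apply: AB; [right|left].
split=> //; apply: eq_of_rpM => k; rewrite mulrBr rpB.
rewrite !(rp_scalar_integral G_hausdorff mu_haar _ cu, rp_scalar_integral G_hausdorff mu_haar _ cv,
  rp_scalar_integral G_hausdorff mu_haar _ cuv).
rewrite -(integral_onB G_hausdorff mu_haar (rcsupp_integrable (rcsupp_rpM k cu))
  (rcsupp_integrable (rcsupp_rpM k cv))).
by congr Rintegral; apply/funext => x; rewrite mulrBr rpB.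
Qed.

Section one_representation.
Variables (E : completeNormedModType K) (pi : representation G E).

Lemma rep_csupp A (f : G -> K) x : kcsupp A f -> csupp A (fun g => f g *: pi g x).
Proof. by move=> cf; apply: csupp_scale => //; exact: rep_strongly_continuous. Qed.

Lemma rint_functional A (f : G -> K) x (phi : {linear E -> K^o}) : kcsupp A f -> continuous phi ->
  phi (rint pi f x) = sintegral (fun g => f g * phi (pi g x)).
Proof.
move=> cf phic; rewrite (vector_integralP G_hausdorff mu_haar (rep_csupp x cf) phic).
by congr (sintegral _); apply/funext => g; rewrite linearZ.
Qed.

Lemma rint_linear A (f : G -> K) a x y : kcsupp A f ->
  rint pi f (a *: x + y) = a *: rint pi f x + rint pi f y.
Proof.
move=> cf; rewrite -(vector_integralD G_hausdorff mu_haar a (rep_csupp x cf) (rep_csupp y cf)).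
congr (vector_integral mu _); apply/funext => g.
by rewrite linearP scalerDr !scalerA mulrC.
Qed.

Lemma rintBf A B (f h : G -> K) x : kcsupp A f -> kcsupp B h ->
  rint pi (f \- h)%R x = rint pi f x - rint pi h x.
Proof.
move=> cf ch; rewrite -scaleN1r addrC.
rewrite -(vector_integralD G_hausdorff mu_haar (- 1) (rep_csupp x ch) (rep_csupp x cf)).
congr (vector_integral mu _); apply/funext => g.
by rewrite scaleN1r scalerBl addrC.
Qed.

Lemma rint_invariant A (f : G -> K) x : kcsupp A f -> invariant_vectors pi x ->
  rint pi f x = sintegral f *: x.
Proof.
move=> cf xinv; rewrite -(vector_integral_cst G_hausdorff mu_haar x cf).
by congr (vector_integral mu _); apply/funext => g; rewrite xinv.
Qed.

Lemma rint_bound A (f : G -> K) c M x : kcsupp A f -> 0 <= c -> (forall g, kabs (f g) <= c) ->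
  (forall g, A g -> rnorm (pi g x) <= M) -> rnorm (rint pi f x) <= c * M * vol mu A.
Proof.
move=> cf c0 fc gM; apply: (vector_integral_bound G_hausdorff mu_haar (rep_csupp x cf)) => g Ag.
by rewrite rnormZ ler_pM ?kabs_ge0 ?rnorm_ge0 // gM.
Qed.

Section densities.
Variables (A : set G) (f : G -> R).
Hypotheses (cf : rcsupp A f) (f_ge0 : forall g, 0 <= f g) (f_one : integral f = 1).
Local Notation fK := (fun g : G => emb s (f g) : K).

Lemma density_csupp : kcsupp A fK.
Proof. exact: (sintegral_emb s G_hausdorff mu_haar cf).1. Qed.

Lemma density_one : sintegral fK = 1.
Proof. by rewrite (sintegral_emb s G_hausdorff mu_haar cf).2 f_one emb1. Qed.

Lemma average_dist x z M : (forall g, A g -> rnorm (pi g x - z) <= M) ->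
  rnorm (rint pi fK x - z) <= M.
Proof.
move=> gM; have cfK := density_csupp.
have cz : csupp A (fun g => fK g *: z) by apply: csupp_scale => // g; exact: cvg_cst.
have -> : rint pi fK x - z = vector_integral mu (fun g => - 1 *: (fK g *: z) + fK g *: pi g x).
  rewrite (vector_integralD G_hausdorff mu_haar (- 1) cz (rep_csupp x cfK)).
  by rewrite (vector_integral_cst G_hausdorff mu_haar z cfK) density_one scale1r scaleN1r addrC.
have cF : csupp A (fun g => fK g *: (pi g x - z)).
  apply: csupp_scale => // g; apply: cvgB; first exact: rep_strongly_continuous.
  exact: cvg_cst.
have -> : (fun g => - 1 *: (fK g *: z) + fK g *: pi g x) = (fun g => fK g *: (pi g x - z)).
  by apply/funext => g; rewrite scaleN1r scalerBr addrC.
have iM := integrable_onZ M (rcsupp_integrable cf).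
have -> : M = integral (fun g => M * f g).
  by rewrite (integral_onZ G_hausdorff mu_haar _ (rcsupp_integrable cf)) f_one mulr1.
apply: (vector_integral_le G_hausdorff mu_haar cF iM) => g.
rewrite rnormZe ger0_norm //; have [Ag|Ag] := pselect (A g).
  by rewrite mulrC ler_wpM2r // gM.
by rewrite (cs_supp cf Ag) mul0r mulr0.
Qed.

Lemma average_norm x M : (forall g, A g -> rnorm (pi g x) <= M) -> rnorm (rint pi fK x) <= M.
Proof.
move=> gM; rewrite -[rint pi fK x]subr0; apply: average_dist => g Ag.
by rewrite subr0 gM.
Qed.

End densities.
End one_representation.

Section convolution.
Variables (A B : set G) (f h : G -> K).
Hypotheses (cf : kcsupp A f) (ch : kcsupp B h).

Local Notation AB := [set (x * y)%g | x in A & y in B].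

Let translated_cont : continuous (fun p : G * G => f p.1 * h (p.1^-1 * p.2)%g : K^o).
Proof.
have [_ fc _] := cf; have [_ hc _] := ch => p; apply: (@cvgM K).
  by apply: (@continuous_comp _ _ _ fst f); [exact: cvg_fst|exact: fc].
apply: (@continuous_comp _ _ _ (fun p : G * G => (p.1^-1 * p.2)%g) h); last exact: hc.
apply: (@continuous_comp _ _ _ (fun p : G * G => (p.1^-1%g, p.2)) (fun z => (z.1 * z.2)%g)).
  apply: cvg_pair; last exact: cvg_snd.
  by apply: (@continuous_comp _ _ _ fst (fun x : G => x^-1%g)); [exact: cvg_fst|exact: invg_continuous].
exact: mulg_continuous.
Qed.

Let translated_supp y z : ~ (A y /\ AB z) -> f y * h (y^-1 * z)%g = 0.
Proof.
have [_ _ fA] := cf; have [_ _ hB] := ch => no.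
have [Ay|/fA ->] := pselect (A y); last by rewrite mul0r.
rewrite hB ?mulr0 // => By; apply: no; split=> //.
by exists y => //; exists (y^-1 * z)%g => //; rewrite mulVKg.
Qed.

Let translated_csupp z : kcsupp A (fun y => f y * h (y^-1 * z)%g).
Proof.
split; [by case: cf| |].
  move=> y; apply: (@continuous_comp _ _ _ (fun y : G => (y, z))
    (fun p : G * G => f p.1 * h (p.1^-1 * p.2)%g : K^o)).
    by apply: cvg_pair; [exact: cvg_id|exact: cvg_cst].
  exact: translated_cont.
by move=> y Ay; apply: translated_supp => -[].
Qed.

Lemma convolution_csupp : kcsupp AB (convolution mu f h).
Proof.
have [cA fc fA] := cf; have [cB hc hB] := ch.
split; [exact: mul_compact| |]; last first.
  move=> z ABz; rewrite /convolution (_ : (fun y => _) = (fun=> 0 : K)).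
    have c0 : kcsupp set0 (fun=> 0 : K) by split=> // [|x]; [exact: compact0|exact: cvg_cst].
    rewrite -[RHS](subrr (sintegral (fun=> 0))) -(sintegralB c0 c0).2.
    by congr (sintegral _); apply/funext => x; rewrite subrr.
  by apply/funext => y; apply: translated_supp => -[].
apply/continuous_rnorm => z e e0.
have vA := vol_ge0 mu A.
have vA1 : 0 < vol mu A + 1 by lra.
have d0 : 0 < e / (vol mu A + 1) by rewrite divr_gt0.
have d2 : 0 < e / (vol mu A + 1) / 2 by rewrite divr_gt0.
have : \forall z' \near z, forall y, A y ->
    kabs (f y * h (y^-1 * z')%g - f y * h (y^-1 * z)%g) <= e / (vol mu A + 1).
  have /compact_near_coveringP := cA; apply => y Ay.
  move/continuous_rnorm: translated_cont => /(_ (y, z) _ d2) [[U V] /= [nU nV] UV].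
  exists (U, V) => // -[y' z'] /= [Uy Vz].
  have h1 := UV (y', z') (conj Uy Vz); have h2 := UV (y', z) (conj Uy (nbhs_singleton nV)).
  have := @ler_rdist R s K^o (f y * h (y^-1 * z)%g) (f y' * h (y'^-1 * z')%g) (f y' * h (y'^-1 * z)%g).
  rewrite (rdistC (f y * h (y^-1 * z)%g : K^o)); move: h1 h2 => /=.
  rewrite /rnorm -!/(kabs _); lra.
apply: filterS => z' zz'.
have [cD DE] := sintegralB (translated_csupp z') (translated_csupp z).
rewrite rnorm_K /convolution -DE setUid in cD *.
apply: le_lt_trans (kabs_sintegral_bound G_hausdorff mu_haar cD (ltW d0) zz') _.
rewrite mulrAC ltr_pdivrMr // ltr_pM2l //; lra.
Qed.

(** After multiplication by k and passage to real parts this is Fubini's theorem followed by the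
    substitution of y z for z. *)
Lemma convolution_integral (psi : G -> K) : continuous (psi : G -> K^o) ->
  continuous (fun y => sintegral (fun z => h z * psi (y * z)%g) : K^o) ->
  sintegral (fun z => convolution mu f h z * psi z) =
  sintegral (fun y => f y * sintegral (fun z => h z * psi (y * z)%g)).
Proof.
move=> psic Hc; have [cA fc fA] := cf; have [cB hc hB] := ch.
have cABc := mul_compact cA cB.
apply: eq_of_rpM => k.
have cL : kcsupp AB (fun z => convolution mu f h z * psi z).
  have [_ cc c0] := convolution_csupp; split=> // [z|z /c0 ->]; last by rewrite mul0r.
  by apply: (@cvgM K); [exact: cc|exact: psic].
have cR : kcsupp A (fun y => f y * sintegral (fun z => h z * psi (y * z)%g)).
  split=> // [y|y /fA ->]; last by rewrite mul0r.
  by apply: (@cvgM K); [exact: fc|exact: Hc].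
rewrite (rp_scalar_integral G_hausdorff mu_haar _ cL) (rp_scalar_integral G_hausdorff mu_haar _ cR).
pose Psi y z := real_part (k * psi z * (f y * h (y^-1 * z)%g)).
have Psi_cont : continuous (fun p : G * G => Psi p.1 p.2).
  apply: (real_part_continuous (F := fun p : G * G => k * psi p.2 * (f p.1 * h (p.1^-1 * p.2)%g))).
  move=> p; apply: (@cvgM K); last exact: translated_cont.
  apply: (@cvgM K); first exact: cvg_cst.
  by apply: (@continuous_comp _ _ _ snd psi); [exact: cvg_snd|exact: psic].
have -> : (fun z => real_part (k * (convolution mu f h z * psi z))) =
    (fun z => integral (fun y => Psi y z)).
  apply/funext => z; rewrite mulrA mulrAC.
  by rewrite (rp_scalar_integral G_hausdorff mu_haar _ (translated_csupp z)).
have -> : (fun y => real_part (k * (f y * sintegral (fun z => h z * psi (y * z)%g)))) =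
    (fun y => integral (Psi y)).
  apply/funext => y; rewrite mulrA.
  have ch' : kcsupp B (fun z => h z * psi (y * z)%g).
    split=> // [z|z /hB ->]; last by rewrite mul0r.
    apply: (@cvgM K); first exact: hc.
    by apply: (@continuous_comp _ _ _ (fun z => (y * z)%g) psi); [exact: lmul_continuous|exact: psic].
  rewrite (rp_scalar_integral G_hausdorff mu_haar _ ch').
  have cP : rcsupp AB (Psi y).
    split=> //.
      move=> z; apply: (@continuous_comp _ _ _ (fun z : G => (y, z)) (fun p => Psi p.1 p.2)).
        by apply: cvg_pair; [exact: cvg_cst|exact: cvg_id].
      exact: Psi_cont.
    by move=> z ABz; rewrite /Psi translated_supp ?mulr0 ?rp0 // => -[].
  rewrite -(integral_lmul G_hausdorff mu_haar y cP); congr Rintegral; apply/funext => z.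
  by rewrite /Psi mulKg; congr real_part; ring.
rewrite (fubini_csupp G_hausdorff mu_haar cA cABc Psi_cont) //.
by move=> y z no; rewrite /Psi translated_supp ?mulr0 ?rp0.
Qed.

End convolution.
End representation_integrals.

(** * Kazhdan projections from contracting averages *)

Section kazhdan_from_contraction.
Variables (R : realType) (s : scalars) (G : topGroupType).
Variable mu : {measure set (borel G) -> \bar R}.
Hypothesis G_hausdorff : hausdorff_space G.
Hypothesis mu_haar : left_haar mu.
Local Notation K := (scalar_field R s).
Local Notation rcsupp := (@csupp R RealScalars G R^o).
Local Notation kcsupp := (@csupp R s G K^o).
Local Notation integral := (fun u : G -> R => Rintegral mu setT (u : borel G -> R)).
Local Notation sintegral := (@scalar_integral R s G mu).
Local Notation rint := (rep_integral mu).
Implicit Types (A : set G) (E : completeNormedModType K).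

Lemma rint_convolution E (pi : representation G E) A B (f h : G -> K) x :
  kcsupp A f -> kcsupp B h -> rint pi (convolution mu f h) x = rint pi f (rint pi h x).
Proof.
move=> cf ch; have cfh := convolution_csupp G_hausdorff mu_haar cf ch.
apply: (@eq_of_functionals R s) => phi phic; congr real_part.
rewrite (rint_functional G_hausdorff mu_haar pi x cfh phic).
rewrite (rint_functional G_hausdorff mu_haar pi (rint pi h x) cf phic).
have inner y : sintegral (fun z => h z * phi (pi (y * z)%g x)) = phi (pi y (rint pi h x)).
  have [psi [psic psiE]] := exists_composed_functional (@rep_bounded R s G E pi y) phic.
  rewrite -psiE (rint_functional G_hausdorff mu_haar pi x ch psic).
  by congr (sintegral _); apply/funext => z; rewrite psiE rep_mul.
have orbit_cont v : continuous (fun y => phi (pi y v) : K^o).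
  move=> y; apply: (@continuous_comp _ _ _ (fun y => pi y v) phi); last exact: phic.
  exact: rep_strongly_continuous.
rewrite (convolution_integral G_hausdorff mu_haar cf ch (orbit_cont x)).
  by congr (sintegral _); apply/funext => y; rewrite inner.
rewrite (_ : (fun y => _) = (fun y => phi (pi y (rint pi h x)) : K^o)); first exact: orbit_cont.
by apply/funext => y; exact: inner.
Qed.

Lemma sintegralZ A (f : G -> K) k : kcsupp A f -> sintegral (fun x => f x * k) = sintegral f * k.
Proof.
move=> cf; have cfk : kcsupp A (fun x => f x * k).
  have [cA fc fA] := cf; split=> // [x|x /fA ->]; last by rewrite mul0r.
  by apply: (@cvgM K); [exact: fc|exact: cvg_cst].
apply: eq_of_rpM => l; rewrite mulrCA (mulrC (sintegral f)).
rewrite (rp_scalar_integral G_hausdorff mu_haar _ cfk).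
rewrite (rp_scalar_integral G_hausdorff mu_haar _ cf).
by congr Rintegral; apply/funext => x; congr real_part; ring.
Qed.

Lemma sintegral_convolution A B (f h : G -> K) : kcsupp A f -> kcsupp B h ->
  sintegral (convolution mu f h) = sintegral f * sintegral h.
Proof.
move=> cf ch; have := @convolution_integral R s G mu G_hausdorff mu_haar A B f h cf ch (fun=> 1).
rewrite (_ : (fun z => convolution mu f h z * 1) = convolution mu f h); last first.
  by apply/funext => z; rewrite mulr1.
rewrite (_ : (fun z : G => h z * 1) = h); last by apply/funext => z; rewrite mulr1.
move=> ->; [exact: sintegralZ cf|move=> ?; exact: cvg_cst|move=> ?; exact: cvg_cst].
Qed.

Section rep_class_norm.
Variable F : rep_class R s G.

Lemma F_norm_le (f : G -> K) c : 0 <= c -> (forall E (pi : representation G E), F pi ->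
  forall x, rnorm (rint pi f x) <= c * rnorm x) -> (F_norm mu F f <= c%:E)%E.
Proof.
move=> c0 fc; apply: ge_ereal_sup => _ [->|[E [pi [Fpi ->]]]]; first by rewrite lee_fin.
by apply: opnorm_le => // x _; exact: fc.
Qed.

Lemma le_F_norm (f : G -> K) c E (pi : representation G E) : (F_norm mu F f <= c%:E)%E -> F pi ->
  forall x, rnorm (rint pi f x) <= c * rnorm x.
Proof.
move=> fc Fpi x; apply: (@opnorm_leP _ _ _ _ setT) => //; apply: le_trans fc.
by apply: ereal_sup_ubound; right; exists E, pi.
Qed.

Lemma F_norm_ge0 (f : G -> K) : (0 <= F_norm mu F f)%E.
Proof. by apply: ereal_sup_ubound; left. Qed.

Lemma completion_dist_ge0 (a b : nat -> G -> K) : (0 <= completion_dist mu F a b)%E.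
Proof. by apply: limn_esup_ge0 => n; exact: F_norm_ge0. Qed.

Lemma completion_dist_eq0 (a b : nat -> G -> K) (u : nat -> R) :
  (forall n, (F_norm mu F (a n \- b n)%R <= (u n)%:E)%E) ->
  (forall e, 0 < e -> exists N, forall n, (N <= n)%N -> u n <= e) ->
  completion_dist mu F a b = 0%E.
Proof.
move=> abu u0; apply/eqP; rewrite eq_le completion_dist_ge0 andbT.
apply/lee_addgt0Pr => e e0; rewrite add0e; have [N NP] := u0 e e0.
by apply: (@limn_esup_le _ _ _ N) => n Nn; apply: le_trans (abu n) _; rewrite lee_fin NP.
Qed.

End rep_class_norm.

Definition almost_invariant (S : set G) E (pi : representation G E) (x : E) (r : R) :=
  forall g, S g -> rnorm (pi g x - x) <= r.

Definition length_bounded (S : set G) (eps C : R) E (pi : representation G E) :=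
  forall g x, rnorm (pi g x) <= expR (eps * (word_length S g)%:R + C) * rnorm x.

Lemma rep_class_length_bounded (S : set G) (D : banach_class R s) eps C E (pi : representation G E) :
  rep_class_length S D eps C pi -> length_bounded S eps C pi.
Proof. by move=> [_ pb] g x; apply: (opnorm_leP (pb g)). Qed.

Section contraction.
Variables (S : set G) (eps C : R).
Hypothesis S_generating : compact_symmetric_generating S.
Hypothesis eps_ge0 : 0 <= eps.

Lemma length_bound_mono E (pi : representation G E) (L : R) g x : length_bounded S eps C pi ->
  (word_length S g)%:R <= L -> rnorm (pi g x) <= expR (eps * L + C) * rnorm x.
Proof.
move=> pb gL; apply: le_trans (pb g x) _; rewrite ler_wpM2r ?rnorm_ge0 // ler_expR.
by rewrite lerD2r ler_wpM2l.
Qed.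

Lemma almost_invariant_word E (pi : representation G E) x r n g : length_bounded S eps C pi ->
  0 <= r -> almost_invariant S pi x r -> set_power S n g ->
  rnorm (pi g x - x) <= n%:R * expR (eps * n%:R + C) * r.
Proof.
move=> pb r0 xr; elim: n g => [|n IH] g.
  by move=> ->; rewrite rep_one subrr rnorm0 !mul0r.
move=> [h Sh [k Sk <-]]; rewrite rep_mul.
have := ler_rdist (pi h x) (pi h (pi k x)) x; rewrite -linearB => /le_trans; apply.
have h1 := IH h Sh.
have hn : (word_length S h)%:R <= n%:R :> R by rewrite ler_nat word_length_le.
have h2 : rnorm (pi h (pi k x - x)) <= expR (eps * n%:R + C) * r.
  by apply: le_trans (length_bound_mono _ pb hn) _; rewrite ler_wpM2l ?expR_ge0 // xr.
have h3 : expR (eps * n%:R + C) <= expR (eps * n.+1%:R + C).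
  by rewrite ler_expR lerD2r ler_wpM2l // ler_nat.
have h4 := ler_wpM2r r0 h3; move: (expR (eps * n.+1%:R + C)) h3 h4 => X h3 h4.
rewrite -natr1 !mulrDl mul1r addrC lerD //; last exact: le_trans h2 h4.
by apply: le_trans h1 _; rewrite -!mulrA ler_wpM2l.
Qed.

Lemma invariant_of_generators E (pi : representation G E) x :
  (forall g, S g -> pi g x = x) -> invariant_vectors pi x.
Proof.
move=> Sx; apply: (word_ind S_generating) => [|g k gx Sk]; first exact: rep_one.
by rewrite rep_mul Sx.
Qed.

Variables (A : set G) (f : G -> R) (L : nat).
Hypotheses (cf : rcsupp A f) (f_ge0 : forall g, 0 <= f g) (f_one : integral f = 1).
Hypothesis A_length : forall g, A g -> (word_length S g <= L)%N.
Local Notation fK := (fun g : G => emb s (f g) : K).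
Let cfK : kcsupp A fK := density_csupp s G_hausdorff mu_haar cf.
Let M := expR (eps * L%:R + C).

Lemma average_length_bound E (pi : representation G E) x : length_bounded S eps C pi ->
  rnorm (rint pi fK x) <= M * rnorm x.
Proof.
move=> pb; apply: (average_norm G_hausdorff mu_haar cf f_ge0 f_one) => g Ag.
by apply: length_bound_mono => //; rewrite ler_nat A_length.
Qed.

Lemma iter_average_linear E (pi : representation G E) n a x y :
  iter n (rint pi fK) (a *: x + y) = a *: iter n (rint pi fK) x + iter n (rint pi fK) y.
Proof. by elim: n => //= n ->; exact: (rint_linear G_hausdorff mu_haar pi a _ _ cfK). Qed.

Lemma iter_averageB E (pi : representation G E) n x y :
  iter n (rint pi fK) (x - y) = iter n (rint pi fK) x - iter n (rint pi fK) y.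
Proof. by rewrite addrC -scaleN1r iter_average_linear scaleN1r addrC. Qed.

Lemma iter_average_bound E (pi : representation G E) n x : length_bounded S eps C pi ->
  rnorm (iter n (rint pi fK) x) <= M ^+ n * rnorm x.
Proof.
move=> pb; elim: n => [|n IH] /=; first by rewrite expr0 mul1r.
apply: le_trans (average_length_bound _ pb) _; rewrite exprS -mulrA.
by rewrite ler_wpM2l ?expR_ge0.
Qed.

Lemma average_invariant E (pi : representation G E) x : invariant_vectors pi x ->
  rint pi fK x = x.
Proof.
move=> xinv; rewrite (rint_invariant G_hausdorff mu_haar cfK xinv).
by rewrite (density_one s G_hausdorff mu_haar cf f_one) scale1r.
Qed.

(** If the generators move x by at most r, words of length at most L move it by at most D0 r, and
    hence so does one average. After i averages this bound is multiplied by at most M^i, and Dn n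
    sums these contributions. *)
Let D0 := L%:R * M.
Let Dn n := (\sum_(i < n) M ^+ i) * D0.

Lemma iter_average_dist E (pi : representation G E) n x r : length_bounded S eps C pi ->
  0 <= r -> almost_invariant S pi x r -> rnorm (iter n (rint pi fK) x - x) <= Dn n * r.
Proof.
move=> pb r0 xr.
have avg1 : rnorm (rint pi fK x - x) <= D0 * r.
  apply: (average_dist G_hausdorff mu_haar cf f_ge0 f_one) => g Ag.
  have [Sg _] := word_lengthP S_generating g.
  apply: le_trans (almost_invariant_word pb r0 xr Sg) _.
  have gL : (word_length S g)%:R <= L%:R :> R by rewrite ler_nat A_length.
  rewrite ler_wpM2r // /D0 ler_pM ?expR_ge0 // /M ler_expR lerD2r ler_wpM2l //.
elim: n => [|n IH]; first by rewrite /= subrr rnorm0 /Dn big_ord0 !mul0r.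
have := ler_rdist (iter n (rint pi fK) x) (iter n.+1 (rint pi fK) x) x => /le_trans; apply.
rewrite /Dn big_ord_recr /= [in leRHS]mulrDl [in leRHS]mulrDl addrC lerD //.
rewrite -iterS iterSr -iter_averageB; apply: le_trans (iter_average_bound _ _ pb) _.
by rewrite -mulrA ler_wpM2l // exprn_ge0 // expR_ge0.
Qed.

Variables (F : rep_class R s G) (n : nat).
Hypothesis F_length : forall E (pi : representation G E), F pi -> length_bounded S eps C pi.
Hypothesis F_contraction : forall E (pi : representation G E), F pi -> forall x r, 0 < r ->
  almost_invariant S pi x r -> almost_invariant S pi (iter n (rint pi fK) x) (r / 2).

Let contraction0 E (pi : representation G E) x r : F pi -> 0 <= r -> almost_invariant S pi x r ->
  almost_invariant S pi (iter n (rint pi fK) x) (r / 2).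
Proof.
move=> Fpi r0 xr g Sg; apply/ler_addgt0Pr => e e0.
have re : 0 < r + e * 2 by lra.
have -> : r / 2 + e = (r + e * 2) / 2 by field.
by apply: (F_contraction Fpi re) => // h Sh; apply: le_trans (xr h Sh) _; lra.
Qed.

(** [power k] is the convolution power of exponent k+1: the recursion starts at f itself, the unit
    mass at 1 not being in general a function of C_c(G). *)
Let power := nat_rect (fun=> G -> K) fK (fun _ h => convolution mu fK h).

Let power_csupp k : exists B, kcsupp B (power k).
Proof.
elim: k => [|k [B cB]]; first by exists A.
by eexists; exact: (convolution_csupp G_hausdorff mu_haar cfK cB).
Qed.

Let power_rint E (pi : representation G E) k x : rint pi (power k) x = iter k.+1 (rint pi fK) x.
Proof.
elim: k => [//|k IH]; have [B cB] := power_csupp k.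
by rewrite /= (rint_convolution pi x cfK cB) IH.
Qed.

Let power_one k : sintegral (power k) = 1.
Proof.
elim: k => [|k IH]; first exact: (density_one s G_hausdorff mu_haar cf f_one).
have [B cB] := power_csupp k.
by rewrite /= (sintegral_convolution cfK cB) IH (density_one s G_hausdorff mu_haar cf f_one) mulr1.
Qed.

Let p k := power (n * k).
Let u E (pi : representation G E) x k := rint pi (p k) x.

Let uE E (pi : representation G E) x k : u pi x k = iter (n * k) (rint pi fK) (rint pi fK x).
Proof. by rewrite /u /p power_rint iterSr. Qed.

Let uS E (pi : representation G E) x k : u pi x k.+1 = iter n (rint pi fK) (u pi x k).
Proof. by rewrite !uE mulnS iterD. Qed.

(** A generator moves a vector v by at most (exp(eps + C) + 1) times its norm; D1 is this factor for
    v the average of a vector of norm 1. *)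
Let D1 := (expR (eps + C) + 1) * M.

Let M0 : 0 <= M := expR_ge0 _.
Let D1_ge0 : 0 <= D1.
Proof. by rewrite mulr_ge0 // addr_ge0 // expR_ge0. Qed.

Let u_inv E (pi : representation G E) x k : F pi ->
  almost_invariant S pi (u pi x k) (D1 * rnorm x * 2^-1 ^+ k).
Proof.
move=> Fpi; have pb := F_length Fpi; elim: k => [|k IH].
  rewrite uE muln0 expr0 mulr1 /= => g Sg; apply: le_trans (ler_rnormB _ _) _.
  have h1 := average_length_bound x pb.
  have g1 : (word_length S g)%:R <= 1 :> R by rewrite (ler_nat R _ 1) word_length_gen.
  have := length_bound_mono (rint pi fK x) pb g1; rewrite mulr1 => h2.
  apply: le_trans (lerD h2 (lexx _)) _.
  rewrite -{2}[rnorm (rint pi fK x)]mul1r -mulrDl /D1 -mulrA ler_wpM2l //.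
rewrite uS exprS mulrCA mulrC; apply: contraction0 => //.
by rewrite !mulr_ge0 ?rnorm_ge0 // exprn_ge0 // invr_ge0.
Qed.

Let Dn_ge0 k : 0 <= Dn k.
Proof.
rewrite mulr_ge0 //; last by rewrite mulr_ge0.
by apply: sumr_ge0 => i _; rewrite exprn_ge0.
Qed.

Let u_step E (pi : representation G E) x k : F pi ->
  rnorm (u pi x k.+1 - u pi x k) <= Dn n * D1 * rnorm x * 2^-1 ^+ k.
Proof.
move=> Fpi; have r0 : 0 <= D1 * rnorm x * 2^-1 ^+ k.
  by rewrite !mulr_ge0 ?rnorm_ge0 // exprn_ge0 // invr_ge0.
have := iter_average_dist n (F_length Fpi) r0 (u_inv x k Fpi); rewrite uS.
by move/le_trans; apply; move: (Dn n) D1 => X Y; lra.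
Qed.

Let Cst := 2 * (Dn n * D1).
Let Cst_ge0 : 0 <= Cst. Proof. by apply: mulr_ge0 => //; apply: mulr_ge0; [exact: Dn_ge0|exact: D1_ge0]. Qed.

Let u_dist E (pi : representation G E) x k l : F pi -> (k <= l)%N ->
  rnorm (u pi x l - u pi x k) <= Cst * 2^-1 ^+ k * rnorm x.
Proof.
move=> Fpi kl; have := geometric_dist (fun k => u_step x k Fpi) kl.
by move=> /le_trans; apply; rewrite /Cst; move: (Dn n) D1 => X Y; lra.
Qed.

Let p_csupp k : exists B, kcsupp B (p k) := power_csupp (n * k).

Let rint_sub E (pi : representation G E) k l x : rint pi (p k \- p l)%R x = u pi x k - u pi x l.
Proof.
have [B cB] := p_csupp k; have [B' cB'] := p_csupp l.
by rewrite (rintBf G_hausdorff mu_haar pi x cB cB').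
Qed.

Let half_ge0 k : 0 <= (2^-1 : R) ^+ k.
Proof. by rewrite exprn_ge0 // invr_ge0. Qed.

Let F_norm_dist k l m : (m <= k)%N -> (m <= l)%N ->
  (F_norm mu F (p k \- p l)%R <= (Cst * 2^-1 ^+ m)%:E)%E.
Proof.
move=> mk ml; wlog kl : k l mk ml / (l <= k)%N => [wl|].
  have [lk|/ltnW kl] := leqP l k; first exact: wl.
  apply: F_norm_le => [|E pi Fpi x]; first exact: mulr_ge0.
  rewrite rint_sub rdistC -rint_sub.
  exact: (le_F_norm (wl l k ml mk kl) Fpi).
apply: F_norm_le => [|E pi Fpi x]; first exact: mulr_ge0.
rewrite rint_sub; apply: le_trans (u_dist _ Fpi kl) _; rewrite ler_wpM2r ?rnorm_ge0 //.
by rewrite ler_wpM2l // ler_wiXn2l // ?invr_ge0 // invf_le1 // ler1n.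
Qed.

Let small (c e : R) : 0 <= c -> 0 < e -> exists N, forall k, (N <= k)%N -> c * 2^-1 ^+ k <= e.
Proof.
move=> c0 e0; have c1 : 0 < c + 1 by lra.
have [N] := half_expn_small (divr_gt0 e0 c1); rewrite ltr_pdivlMr // => NP.
exists N => k Nk; apply: le_trans (ltW NP).
have : (2^-1 : R) ^+ k <= 2^-1 ^+ N by rewrite ler_wiXn2l // ?invr_ge0 // invf_le1 // ler1n.
have := half_ge0 k; nra.
Qed.

(** The vector [u pi x k] has displacement at most D1 |x| 2^-k, and averaging moves a vector by a
    multiple of its displacement. So the operators of p k form a Cauchy sequence uniformly over F,
    and applying p k once more to [u pi x k] changes little, which gives idempotence. The limit
    vectors have displacement 0. *)
Lemma kazhdan_of_contraction : has_kazhdan_projection mu F.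
Proof.
have p_Cc k : Cc (p k).
  by apply/(CcP G_hausdorff); exact: p_csupp.
have p_cauchy e : 0 < e -> exists N, forall k l, (N <= k)%N -> (N <= l)%N ->
    (F_norm mu F (p k \- p l)%R < e%:E)%E.
  move=> e0; have e2 : 0 < e / 2 by rewrite divr_gt0.
  have [N NP] := small Cst_ge0 e2; exists N => k l Nk Nl.
  apply: le_lt_trans (F_norm_dist Nk Nl) _; rewrite lte_fin.
  by have := NP N (leqnn _); lra.
exists (@Completion R s G mu F p p_Cc p_cauchy); split=> /=.
- have c0 : 0 <= (Dn 1 + M * (2 * Dn n)) * D1.
    apply: mulr_ge0; [apply: addr_ge0|exact: D1_ge0]; first exact: Dn_ge0.
    by apply: mulr_ge0 => //; apply: mulr_ge0 => //; exact: Dn_ge0.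
  apply: (@completion_dist_eq0 _ _ _ (fun k => (Dn 1 + M * (2 * Dn n)) * D1 * 2^-1 ^+ k)) => [k|e e0]; last exact: small.
  apply: F_norm_le => [|E pi Fpi x]; first by rewrite mulr_ge0.
  have [B cB] := p_csupp k.
  rewrite (rintBf G_hausdorff mu_haar pi x (convolution_csupp G_hausdorff mu_haar cB cB) cB).
  rewrite (rint_convolution pi x cB cB) -/(u pi x k) -/(u pi (u pi x k) k).
  have pb := F_length Fpi; have vinv := u_inv x k Fpi.
  move: (u pi x k) vinv => v vinv; set r := D1 * rnorm x * _ in vinv.
  have r0 : 0 <= r by rewrite !mulr_ge0 ?rnorm_ge0.
  have d1 := iter_average_dist 1 pb r0 vinv; rewrite /= in d1.
  (* The bound has to be independent of k: every block of n averages halves the displacement of v,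
     so the successive moves form a geometric series. *)
  have dk : rnorm (iter (n * k) (rint pi fK) v - v) <= 2 * Dn n * r.
    have step j : rnorm (iter (n * j.+1) (rint pi fK) v - iter (n * j) (rint pi fK) v) <=
        (Dn n * r) * 2^-1 ^+ j.
      rewrite mulnS iterD -mulrA; apply: iter_average_dist => //; first by rewrite mulr_ge0.
      elim: j => [|j IH]; first by rewrite muln0 expr0 mulr1.
      by rewrite mulnS iterD exprS mulrCA mulrC; apply: contraction0 => //; rewrite mulr_ge0.
    by have := geometric_dist step (leq0n k); rewrite muln0 expr0 mulr1 mulrA.
  rewrite uE -iterSr iterS; apply: le_trans (ler_rdist (rint pi fK v) _ _) _.
  have := average_length_bound (iter (n * k) (rint pi fK) v - v) pb.
  rewrite (iter_averageB pi 1 : forall x y, rint pi fK (x - y) = _) /= => d2.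
  have d3 := ler_wpM2l M0 dk.
  rewrite /r in d1 d3; move: d1 d2 d3; move: (Dn 1) (Dn n) D1 M => a b d m; lra.
- move=> e e0; have [N NP] := small Cst_ge0 (divr_gt0 e0 (ltr0Sn R 1) : 0 < e / 2).
  exists (p N); split=> //; first exact: power_one.
  rewrite /completion_dist; apply: (@le_lt_trans _ _ (Cst * 2^-1 ^+ N)%:E).
    by apply: (@limn_esup_le _ _ _ N) => k Nk; exact: F_norm_dist.
  by rewrite lte_fin; have := NP N (leqnn _); lra.
- move=> E pi Fpi; have pb := F_length Fpi.
  have ulim x : exists2 l, completion_rep pi (@Completion R s G mu F p p_Cc p_cauchy) x = l &
      forall k, rnorm (l - u pi x k) <= Cst * rnorm x * 2^-1 ^+ k.
    have [l [ul lu]] := geometric_cvg (fun k => u_step x k Fpi).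
    exists l; first exact: cvg_lim ul.
    by move=> k; apply: le_trans (lu k) _; rewrite /Cst !mulrA.
  have liminv x : invariant_vectors pi (completion_rep pi (@Completion R s G mu F p p_Cc p_cauchy) x).
    have [l -> lu] := ulim x; apply: invariant_of_generators => g Sg.
    apply: rnorm_lim_unique => e e0.
    have c0 : 0 <= (expR (eps + C) + 1) * (Cst * rnorm x) + D1 * rnorm x.
      have := expR_ge0 (eps + C); have := rnorm_ge0 x; move: D1_ge0 Cst_ge0.
      move: (expR _) (rnorm x) D1 Cst => a b d m; move=> *; rewrite addr_ge0 ?mulr_ge0 //; lra.
    have e2 : 0 < e / 2 by rewrite divr_gt0.
    have [N /(_ N (leqnn _)) NP] := small c0 e2.
    have h1 := lu N; have h2 := u_inv x N Fpi Sg.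
    have g1 : (word_length S g)%:R <= 1 :> R by rewrite (ler_nat R _ 1) word_length_gen.
    have := length_bound_mono (l - u pi x N) pb g1; rewrite mulr1 linearB => h3.
    have h4 : expR (eps + C) * rnorm (l - u pi x N) <= expR (eps + C) * (Cst * rnorm x * 2^-1 ^+ N).
      by rewrite ler_wpM2l ?expR_ge0.
    have h5 := ler_rdist (pi g (u pi x N)) (pi g l) l.
    have h6 := ler_rdist (u pi x N) (pi g (u pi x N)) l.
    rewrite (rdistC (u pi x N)) in h6.
    move: NP h4; rewrite !mulrDl !mul1r -!mulrA; rewrite -!mulrA in h1 h2 => NP h4.
    move: (expR _ * _) h3 h4 NP => X; lra.
  have limfix x : invariant_vectors pi x ->
      completion_rep pi (@Completion R s G mu F p p_Cc p_cauchy) x = x.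
    move=> xinv; have [l -> lu] := ulim x; apply: rnorm_lim_unique => e e0.
    have c0 : 0 <= Cst * rnorm x by rewrite mulr_ge0 // rnorm_ge0.
    have e2 : 0 < e / 2 by rewrite divr_gt0.
    have [N /(_ N (leqnn _)) NP] := small c0 e2.
    have := lu N; rewrite uE average_invariant //.
    have -> : iter (n * N) (rint pi fK) x = x by elim: (n * N)%N => //= j ->; exact: average_invariant.
    lra.
  split=> [x|]; first exact: limfix.
  apply/seteqP; split=> [_ [x _ <-]|x xinv]; first exact: liminv.
  by exists x => //; exact: limfix.
Qed.

End contraction.
End kazhdan_from_contraction.

(** * Ultraproducts of representations *)

Lemma le_mul_approx (R : realType) (a b x : R) : 0 <= a -> 0 <= b ->
  (forall d, 0 < d -> x <= (a + d) * (b + d)) -> x <= a * b.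
Proof.
move=> a0 b0 xab; apply/ler_addgt0Pr => e e0; have ab1 : 0 < a + b + 1 by lra.
pose d := Num.min 1 (e / (a + b + 1)).
have d0 : 0 < d by rewrite lt_min ltr01 divr_gt0.
have d1 : d <= 1 by rewrite ge_min lexx.
have d2 : d * (a + b + 1) <= e by rewrite -ler_pdivlMr // ge_min lexx orbT.
by have := xab d d0; nra.
Qed.

Section ultraproduct_representations.
Variables (R : realType) (s : scalars) (G : topGroupType).
Variable mu : {measure set (borel G) -> \bar R}.
Hypothesis G_hausdorff : hausdorff_space G.
Hypothesis mu_haar : left_haar mu.
Variable S : set G.
Hypothesis S_generating : compact_symmetric_generating S.
Local Notation K := (scalar_field R s).
Local Notation banach := (completeNormedModType K).
Local Notation kcsupp := (@csupp R s G K^o).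
Local Notation rint := (rep_integral mu).

Variable U : set_system nat.
Hypothesis U_ultra : UltraFilter U.
Hypothesis U_free : forall N, U [set n | (N <= n)%N].

Variables (C : R) (E : nat -> banach) (pi : forall n, representation G (E n)).
Hypothesis pi_bounded : forall n, length_bounded S n.+1%:R^-1 C (pi n).
Implicit Types (v w : families E) (g h : G) (n : nat).

Lemma length_factor_le (L e : R) : 0 < e ->
  U [set n | expR (n.+1%:R^-1 * L + C) <= expR C + e].
Proof.
move=> e0; have eC := expR_gt0 C.
have : (n.+1%:R^-1 : R) @[n --> \oo] --> (0 : R) by exact: cvg_harmonic.
move=> h; have h1 : (n.+1%:R^-1 * L + C : R) @[n --> \oo] --> 0 * L + C.
  by apply: cvgD; [apply: cvgM; [exact: h|exact: cvg_cst]|exact: cvg_cst].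
have : expR (n.+1%:R^-1 * L + C) @[n --> \oo] --> expR (0 * L + C).
  exact: continuous_cvg (@continuous_expR R _) h1.
rewrite mul0r add0r => /cvgrPdist_lt/(_ e e0)[N _ NP].
apply: filterS (U_free N) => n /= Nn; have := NP n Nn => /=.
by rewrite ltr_norml => /andP[]; lra.
Qed.

Definition action (g : G) v : families E := fun n => pi n g (v n).

Definition bounded_family v := exists c, U [set n | rnorm (v n) <= c].

(** The neighbourhood W is fixed before n. This uniformity is what becomes continuity of the orbit
    map in the ultraproduct. *)
Definition equicontinuous_family v := forall e : R, 0 < e -> exists W : set G, nbhs (1%g : G) W /\
  U [set n | forall g, W g -> rnorm (pi n g (v n) - v n) <= e].

Definition good_family v := bounded_family v /\ equicontinuous_family v.

Definition family_norm v := ulimit U (fun n => rnorm (v n)).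

Lemma family_normP v : bounded_family v -> forall e, 0 < e ->
  U [set n | `|rnorm (v n) - family_norm v| < e].
Proof.
move=> [c vc]; move=> e e0; apply: (@ulimitP _ _ _ _ c) => //; apply: filterS vc => n /=.
by rewrite ger0_norm ?rnorm_ge0.
Qed.

Lemma family_norm_le v b : U [set n | rnorm (v n) <= b] -> family_norm v <= b.
Proof.
move=> vb; apply: (@ulimit_le _ _ _ _ b) => //; apply: filterS vb => n /=.
by rewrite ger0_norm ?rnorm_ge0.
Qed.

Lemma action_near_bound : exists (W : set G) (M : R), nbhs (1%g : G) W /\ 0 <= M /\
  forall n g x, W g -> rnorm (pi n g x) <= M * rnorm x.
Proof.
have [L WL] := set_power_nbhs1 G_hausdorff mu_haar S_generating.
exists (set_power S L), (expR (1 * L%:R + `|C|)); split=> //; split; first exact: expR_ge0.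
move=> n g x Sg; apply: le_trans (pi_bounded g x) _.
rewrite ler_wpM2r ?rnorm_ge0 // ler_expR lerD ?ler_norm // ler_pM ?invr_ge0 //.
  by rewrite invf_le1 // ler1n.
by rewrite ler_nat word_length_le.
Qed.

Lemma good_family_approx v : (forall e, 0 < e -> exists2 w, good_family w &
  U [set n | rnorm (v n - w n) <= e]) -> good_family v.
Proof.
move=> vw; split.
  have [w [[c wc] _] vw1] := vw 1 ltr01; exists (1 + c).
  apply: filterS (filterI wc vw1) => n /= [h1 h2].
  by have := ler_rnorm_dist (v n) (w n); lra.
move=> e e0; have [W0 [M [nW0 [M0 MP]]]] := action_near_bound.
have d0 : 0 < e / (M + 3) by rewrite divr_gt0 //; lra.
have [w [_ weq] vw1] := vw _ d0; have [W [nW WP]] := weq _ d0.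
exists (W `&` W0); split; first exact: filterI.
apply: filterS (filterI vw1 WP) => n /= [h1 h2] g [Wg W0g].
have h3 := h2 g Wg; have := MP n g (v n - w n) W0g; rewrite linearB => h4.
have h5 : M * rnorm (v n - w n) <= M * (e / (M + 3)) by rewrite ler_wpM2l.
have h6 := ler_rdist (pi n g (w n)) (pi n g (v n)) (v n).
have h7 := ler_rdist (w n) (pi n g (w n)) (v n); rewrite (rdistC (w n)) in h7.
have h8 : (M + 3) * (e / (M + 3)) = e by rewrite mulrC divfK // gt_eqF //; lra.
move: (e / _) d0 h1 h3 h5 h8 => d d0 h1 h3 h5 h8; lra.
Qed.

Lemma good_family_linear a v w : good_family v -> good_family w -> good_family (a *: v + w).
Proof.
have a0 := kabs_ge0 a; have a1 : 0 < kabs a + 1 by lra.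
move=> [[c vc] veq] [[d wd] weq]; split.
  exists (kabs a * c + d); apply: filterS (filterI vc wd) => n /= [h1 h2].
  apply: le_trans (ler_rnormD _ _) _; rewrite rnormZ lerD // ler_wpM2l //.
move=> e e0; have e1 : 0 < e / (kabs a + 1) by rewrite divr_gt0.
have [V [nV VP]] := veq _ e1; have [W [nW WP]] := weq _ e1.
exists (V `&` W); split; first exact: filterI.
apply: filterS (filterI VP WP) => n /= [h1 h2] g [Vg Wg].
rewrite famD famZ linearP opprD addrACA -scalerBr.
apply: le_trans (ler_rnormD _ _) _; rewrite rnormZ.
have h3 := ler_wpM2l a0 (h1 g Vg); have h4 := h2 g Wg.
have h5 : (kabs a + 1) * (e / (kabs a + 1)) = e by rewrite mulrC divfK // gt_eqF.
lra.
Qed.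

Lemma good_family0 : good_family 0.
Proof.
split; first by exists 0; apply: filterS (U_free 0) => n _ /=; rewrite rnorm0.
move=> e e0; exists setT; split; first exact: filterT.
by apply: filterS (U_free 0) => n _ /= g _; rewrite linear0 subrr rnorm0 ltW.
Qed.

Lemma good_familyZ a v : good_family v -> good_family (a *: v).
Proof. by move=> gv; rewrite -[a *: v]addr0; apply: good_family_linear => //; exact: good_family0. Qed.

Lemma good_familyD v w : good_family v -> good_family w -> good_family (v + w).
Proof. by move=> gv gw; rewrite -[v]scale1r; exact: good_family_linear. Qed.

Lemma good_familyB v w : good_family v -> good_family w -> good_family (v - w).
Proof. by move=> gv gw; rewrite -scaleN1r addrC; exact: good_family_linear. Qed.

Lemma good_family_sum m (v : 'I_m -> families E) (c : 'I_m -> K) :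
  (forall i, good_family (v i)) -> good_family (\sum_(i < m) c i *: v i).
Proof.
move=> gv; elim/big_ind: _ => [|x y|i _]; [exact: good_family0|exact: good_familyD|exact: good_familyZ].
Qed.

Lemma good_action g v : good_family v -> good_family (action g v).
Proof.
move=> [[c vc] veq]; pose M := expR ((word_length S g)%:R + `|C|).
have MP n x : rnorm (pi n g x) <= M * rnorm x.
  apply: le_trans (pi_bounded g x) _; rewrite ler_wpM2r ?rnorm_ge0 // ler_expR.
  rewrite lerD ?ler_norm // ler_piMl // invf_le1 // ler1n //.
have M0 : 0 < M := expR_gt0 _; split.
  exists (M * c); apply: filterS vc => n /= h.
  by apply: le_trans (MP _ _) _; rewrite ler_wpM2l // ltW.
move=> e e0; have [W [nW WP]] := veq _ (divr_gt0 e0 M0).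
exists [set h | W (g^-1 * (h * g))%g]; split.
  have : (fun h => (g^-1 * (h * g))%g) @ (1%g : G) --> (g^-1 * (1 * g))%g.
    apply: (@continuous_comp _ _ _ (fun h => (h * g)%g)); first exact: rmul_continuous.
    exact: lmul_continuous.
  by rewrite mul1g mulVg => /(_ W nW).
apply: filterS WP => n /= h k Wk.
rewrite /action -rep_mul (_ : (k * g)%g = (g * (g^-1 * (k * g)))%g); last by rewrite mulVKg.
rewrite rep_mul -linearB; apply: le_trans (MP _ _) _.
by rewrite mulrC -ler_pdivlMr // h.
Qed.

Lemma family_norm_ge0 v : bounded_family v -> 0 <= family_norm v.
Proof.
move=> [c vc]; apply: (@ulimit_ge _ _ _ _ c).
  by apply: filterS vc => n /=; rewrite ger0_norm // rnorm_ge0.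
by apply: filterS vc => n _ /=; exact: rnorm_ge0.
Qed.

(** The factor exp(l(g) / (n+1) + C) tends to e^C: the growth in the length disappears in the
    limit. *)
Lemma family_norm_action g v : good_family v -> family_norm (action g v) <= expR C * family_norm v.
Proof.
move=> [bv _]; have n0 := family_norm_ge0 bv; have eC := expR_gt0 C.
apply: le_mul_approx => // d d0.
apply: family_norm_le; apply: filterS (filterI (family_normP bv d0)
  (length_factor_le (word_length S g)%:R d0)) => n /= [].
rewrite ltr_norml => /andP[h1 h2] h3; apply: le_trans (pi_bounded g (v n)) _.
by apply: ler_pM => //; [exact: rnorm_ge0|lra].
Qed.

Lemma family_complete : complete_seminorm good_family family_norm.
Proof.
split; [exact: good_family0|exact: good_family_linear| | |].
- move=> v w [bv _] [bw _]; apply/ler_addgt0Pr => e e0; have e2 : 0 < e / 2 by rewrite divr_gt0.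
  apply: family_norm_le; apply: filterS (filterI (family_normP bv e2) (family_normP bw e2)) => n /= [].
  rewrite !ltr_norml => /andP[_ h1] /andP[_ h2]; have := ler_rnormD (v n) (w n); rewrite famD; lra.
- move=> a v [bv _]; apply: ulimit_unique => e e0; have a1 : 0 < kabs a + 1.
    by have := kabs_ge0 a; lra.
  apply: filterS (family_normP bv (divr_gt0 e0 a1)) => n /=.
  rewrite famZ rnormZ -mulrBr normrM (ger0_norm (kabs_ge0 a)) ltr_pdivlMr //.
  by have := kabs_ge0 a; have := normr_ge0 (rnorm (v n) - family_norm v); nra.
move=> u gu ucauchy.
have gd k : bounded_family (u k.+1 - u k) := (good_familyB (gu k.+1) (gu k)).1.
pose near k n := rnorm (u k.+1 n - u k n) <= 2 * 2^-1 ^+ k.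
have Unear k : U [set n | near k n].
  have p2 : 0 < (2^-1 : R) ^+ k by rewrite exprn_gt0 // invr_gt0.
  apply: filterS (family_normP (gd k) p2) => n /=.
  by rewrite ltr_norml /near famB => /andP[_]; have := ucauchy k; lra.
(* At the index n the diagonal limit uses the member [last n] of the sequence, the largest k at most
   n for which the first k increments are small at n. The condition k <= n makes this maximum exist,
   and for each k the indices n with [last n] at least k form a set of U. *)
pose good n k := (k <= n)%N && [forall j : 'I_k, `[< near j n >]].
have Ugood k : U [set n | good n k].
  have : U [set n | forall j, (j < k)%N -> near j n].
    elim: k => [|k IH]; first by apply: filterS (U_free 0) => n.
    apply: filterS (filterI IH (Unear k)) => n /= [h1 h2] j.
    by rewrite ltnS leq_eqVlt => /orP[/eqP -> //|]; exact: h1.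
  move=> h; apply: filterS (filterI h (U_free k)) => n /= [h1 h2].
  by apply/andP; split=> //; apply/forallP => j; apply/asboolP; exact: h1.
have good0 n : good n 0 by apply/andP; split=> //; apply/forallP => -[].
have ex0 n : exists k, good n k by exists 0%N; exact: good0.
have goodle n k : good n k -> (k <= n)%N by case/andP.
pose last n := ex_maxn (ex0 n) (@goodle n).
pose l : families E := fun n => u (last n) n.
have lastP n k : good n k -> rnorm (u k n - l n) <= 4 * 2^-1 ^+ k.
  rewrite /l /last; case: ex_maxnP => m /andP[_ /forallP gm] mmax gk.
  have km := mmax _ gk.
  have := @geometric_dist R s (E n) 2 (fun j => u (minn j m) n) _ k m km.
  rewrite minnn (minn_idPl km) rdistC -natrM; apply => j.
  have [jm|mj] := ltnP j m.
    have := gm (Ordinal jm) => /asboolP; rewrite /near /=.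
    by rewrite (minn_idPl jm).
  rewrite (minn_idPr (leqW mj)) subrr rnorm0.
  by rewrite mulr_ge0 // exprn_ge0 // invr_ge0.
have gl : good_family l.
  apply: good_family_approx => e e0; have e4 : 0 < e / 4 by rewrite divr_gt0.
  have [k kP] := half_expn_small e4; exists (u k) => //.
  by apply: filterS (Ugood k) => n /lastP /=; rewrite rdistC; lra.
exists l => // e e0; have e8 : 0 < e / 8 by rewrite divr_gt0.
have [N NP] := half_expn_small e8; exists N => k Nk.
apply: (@le_lt_trans _ _ (e / 2)); last by lra.
apply: family_norm_le; apply: filterS (Ugood k) => n /lastP /=; rewrite famB.
have : (2^-1 : R) ^+ k <= 2^-1 ^+ N by rewrite ler_wiXn2l // ?invr_ge0 // invf_le1 // ler1n.
lra.
Qed.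

(* The ultraproduct of the representations [pi n], restricted to the bounded
   equicontinuous families on which it is strongly continuous. *)
Record ultraproduct_rep (X : banach) (q : families E -> X) (rho : representation G X) : Prop := {
  up_linear : forall a v w, good_family v -> good_family w -> q (a *: v + w) = a *: q v + q w ;
  up_norm : forall v, good_family v -> rnorm (q v) = family_norm v ;
  up_onto : forall x, exists2 v, good_family v & q v = x ;
  up_action : forall g v, good_family v -> rho g (q v) = q (action g v) ;
  up_bounded : forall g x, rnorm (rho g x) <= expR C * rnorm x
}.

Lemma exists_ultraproduct : exists (X : banach) (q : families E -> X) (rho : representation G X),
  ultraproduct_rep q rho.
Proof.
have [X [q [qlin qnorm qonto]]] := quotient_banachP family_complete.
have qB v w : good_family v -> good_family w -> q (v - w) = q v - q w.
  by move=> gv gw; rewrite -scaleN1r addrC qlin // scaleN1r addrC.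
have rep_ex x : {v | good_family v & q v = x} by apply: cid2; exact: qonto.
pose rep x := s2val (rep_ex x); have grep x : good_family (rep x) := s2valP (rep_ex x).
have qrep x : q (rep x) = x := s2valP' (rep_ex x).
have wd g v w : good_family v -> good_family w -> q v = q w -> q (action g v) = q (action g w).
  move=> gv gw vw; apply/eqP; rewrite -subr_eq0; apply/eqP/rnorm0_eq0.
  have gvw := good_familyB gv gw.
  have -> : q (action g v) - q (action g w) = q (action g (v - w)).
    rewrite -qB; [|exact: good_action..]; congr q; apply/functional_extensionality_dep => n.
    by rewrite famB /action famB linearB.
  have := family_norm_action g gvw; rewrite -!qnorm //; last exact: good_action.
  rewrite qB // vw subrr rnorm0 mulr0 => h; apply/eqP; rewrite eq_le h /=; exact: rnorm_ge0.
have actlin g a v w : action g (a *: v + w) = a *: action g v + action g w.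
  by apply/functional_extensionality_dep => n; rewrite famD famZ /action famD famZ linearP.
have lin g : exists L : {linear X -> X}, forall x, L x = q (action g (rep x)).
  apply: exists_linear => a x y; rewrite -qlin; [|exact: good_action..].
  rewrite -actlin; apply: wd => //; first exact: good_family_linear.
  by rewrite qlin // !qrep.
have [L LP] := choice lin.
have LqE g v : good_family v -> L g (q v) = q (action g v).
  by move=> gv; rewrite LP; apply: wd => //; rewrite qrep.
have Lb g x : rnorm (L g x) <= expR C * rnorm x.
  rewrite -(qrep x) LqE // !qnorm //; last exact: good_action.
  exact: family_norm_action.
have L1 x : L 1%g x = x.
  rewrite -{1}(qrep x) LqE // -[RHS](qrep x); congr q.
  by apply/functional_extensionality_dep => n; rewrite /action rep_one.
have LM g h x : L (g * h)%g x = L g (L h x).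
  rewrite -(qrep x) !LqE //; last exact: good_action.
  by congr q; apply/functional_extensionality_dep => n; rewrite /action rep_mul.
have Lc x : continuous (fun g => L g x).
  apply/continuous_rnorm => g e e0; have eC := expR_gt0 C.
  have d0 : 0 < e / expR C / 2 by rewrite !divr_gt0.
  have [_ /(_ _ d0) [W [nW WP]]] := grep x.
  have := @lmul_nbhs G g^-1%g g W; rewrite mulVg => /(_ nW); apply: filterS => h /= Wh.
  have -> : L h x - L g x = L g (L (g^-1 * h)%g x - x) by rewrite linearB -LM mulVKg.
  apply: le_lt_trans (Lb _ _) _; rewrite mulrC -ltr_pdivlMr //.
  rewrite -{1 2}(qrep x) LqE // -qB //; last exact: good_action.
  rewrite qnorm; last by apply: good_familyB => //; exact: good_action.
  apply: (@le_lt_trans _ _ (e / expR C / 2)); last by lra.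
  by apply: family_norm_le; apply: filterS WP => n /= h1; rewrite famB; exact: h1.
have Lcont g : continuous (L g) := rnorm_bound_continuous (Lb g).
by exists X, q, (Representation Lcont L1 LM Lc); split.
Qed.

Section ultraproduct_consequences.
Variables (X : banach) (q : families E -> X) (rho : representation G X).
Hypothesis q_rho : ultraproduct_rep q rho.

Lemma upD v w : good_family v -> good_family w -> q (v + w) = q v + q w.
Proof. by move=> gv gw; rewrite -[v in LHS]scale1r (up_linear q_rho) // scale1r. Qed.

Lemma upZ a v : good_family v -> q (a *: v) = a *: q v.
Proof.
move=> gv; rewrite -[a *: v]addr0 (up_linear q_rho) //; last exact: good_family0.
rewrite -[X in _ + X = _](addrK (q 0)) -upD ?addr0 ?subrr ?addr0 //; exact: good_family0.
Qed.

Lemma upB v w : good_family v -> good_family w -> q (v - w) = q v - q w.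
Proof. by move=> gv gw; rewrite -scaleN1r addrC (up_linear q_rho) // scaleN1r addrC. Qed.

Lemma up_sum m (c : 'I_m -> K) (v : 'I_m -> families E) : (forall i, good_family (v i)) ->
  q (\sum_(i < m) c i *: v i) = \sum_(i < m) c i *: q (v i).
Proof.
move=> gv; suff [] : good_family (\sum_(i < m) c i *: v i) /\
    q (\sum_(i < m) c i *: v i) = \sum_(i < m) c i *: q (v i) by [].
elim/big_ind2: _ => [|x1 x2 y1 y2 [gx qx] [gy qy]|i _].
- by split; [exact: good_family0|rewrite -(scale0r 0) upZ ?scale0r //; exact: good_family0].
- by split; [exact: good_familyD|rewrite upD // qx qy].
- by split; [exact: good_familyZ|exact: upZ].
Qed.

Lemma up_le v b : good_family v -> U [set n | rnorm (v n) <= b] -> rnorm (q v) <= b.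
Proof. by move=> gv vb; rewrite (up_norm q_rho) //; exact: family_norm_le. Qed.

Lemma up_lt v b : good_family v -> rnorm (q v) < b -> U [set n | rnorm (v n) < b].
Proof.
move=> gv; rewrite (up_norm q_rho) // => vb; have e0 : 0 < b - family_norm v by rewrite subr_gt0.
apply: filterS (family_normP gv.1 e0) => n /=; rewrite ltr_norml => /andP[_]; lra.
Qed.

Lemma ultraproduct_in_class (Ecl : banach_class R s) : closed_under_finite_representability Ecl ->
  (forall n, local_class Ecl n.+1 n.+1%:R^-1 (E n)) -> Ecl X.
Proof.
move=> Ecl_closed Eloc; have rep_ex x : exists v, good_family v /\ q v = x.
  by have [v gv <-] := up_onto q_rho x; exists v.
have [r rP] := choice rep_ex.
apply: (ultralimit_in_class Ecl_closed U_ultra (E := E) (r := r)) => [N e e0|m v c e e0].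
  have [k ke] : exists k : nat, k.+1%:R^-1 < e.
    have := @cvg_harmonic R => /cvgrPdist_lt/(_ e e0)[k _ /(_ k (leqnn _))] /=.
    by rewrite sub0r normrN ger0_norm ?invr_ge0 //; exists k.
  apply: filterS (filterI (U_free N) (U_free k)) => n /= [Nn kn].
  apply: local_class_mono (Eloc n); first exact: leqW.
  by apply: le_trans (ltW ke); rewrite lef_pV2 ?posrE // ler_nat.
have gr i : good_family (r (v i)) by case: (rP (v i)).
have gz := good_family_sum c gr.
have -> : \sum_(i < m) c i *: v i = q (\sum_(i < m) c i *: r (v i)).
  by rewrite up_sum //; apply: eq_bigr => i _; case: (rP (v i)) => _ ->.
rewrite (up_norm q_rho) //; apply: filterS (family_normP gz.1 e0) => n /=.
by rewrite fam_sum.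
Qed.

Lemma rep_length_bound n g x : rnorm (pi n g x) <= expR ((word_length S g)%:R + `|C|) * rnorm x.
Proof.
apply: le_trans (pi_bounded g x) _; rewrite ler_wpM2r ?rnorm_ge0 // ler_expR.
by rewrite lerD ?ler_norm // ler_piMl // invf_le1 // ler1n.
Qed.

(** By equicontinuity one partition of A serves the integral in X and those of U-almost all [pi n]
    at once. Both sides are then close to the same finite combination of translates of v. *)
Lemma ultraproduct_integral A (f : G -> K) v : kcsupp A f -> good_family v ->
  good_family (fun n => rint (pi n) f (v n)) /\
  q (fun n => rint (pi n) f (v n)) = rint rho f (q v).
Proof.
move=> cf gv; pose z : families E := fun n => rint (pi n) f (v n).
have [cA fc f0] := cf; have [cb fb] := csupp_bounded cf; have [[c vc] veq] := gv.
have frho := rep_csupp rho (q v) cf.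
have approx e : 0 < e -> exists m (k : 'I_m -> G) (B : 'I_m -> set G),
   [/\ borel_partition A k B,
       forall i x, B i x -> rnorm (f x *: rho x (q v) - f (k i) *: rho (k i) (q v)) <= e &
       U [set n | forall i x, B i x ->
         rnorm (f x *: pi n x (v n) - f (k i) *: pi n (k i) (v n)) <= e]].
  move=> e0.
  have loc x : exists V N, [/\ nbhs x V, U N,
      forall y, V y -> rnorm (f y *: rho y (q v) - f x *: rho x (q v)) <= e &
      forall y n, V y -> N n -> rnorm (f y *: pi n y (v n) - f x *: pi n x (v n)) <= e].
    pose M := expR ((word_length S x)%:R + `|C|); have M0 : 0 < M := expR_gt0 _.
    have cb0 : 0 <= cb := le_trans (kabs_ge0 _) (fb 1%g).
    have c0 : 0 <= `|c| by [].
    have M1 : 0 < 2 * (cb + 1) * M by rewrite !mulr_gt0 // ltr_wpDl.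
    have M2 : 0 < 2 * (`|c| + 1) * M by rewrite !mulr_gt0 // ltr_wpDl.
    have [W [nW WP]] := veq _ (divr_gt0 e0 M1).
    have n1 : nbhs x [set y | W (x^-1 * y)%g] by apply: lmul_nbhs; rewrite mulVg.
    have n2 : \forall y \near x, kabs (f y - f x) < e / (2 * (`|c| + 1) * M).
      by move/continuous_rnorm: fc => /(_ x _ (divr_gt0 e0 M2)).
    have n3 : \forall y \near x, rnorm (f y *: rho y (q v) - f x *: rho x (q v)) < e.
      by have [_ Fc _] := frho; move/continuous_rnorm: Fc => /(_ x _ e0).
    exists ([set y | W (x^-1 * y)%g] `&` [set y | kabs (f y - f x) < e / (2 * (`|c| + 1) * M)] `&`
      [set y | rnorm (f y *: rho y (q v) - f x *: rho x (q v)) < e]).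
    eexists; split; [|exact: filterI vc WP| |].
    - by apply: filterI => //; exact: filterI.
    - by move=> y [_ /ltW].
    move=> y n [[/= Wy fy] _] [/= vn Wn].
    have -> : f y *: pi n y (v n) - f x *: pi n x (v n) =
        f y *: (pi n x (pi n (x^-1 * y)%g (v n) - v n)) + (f y - f x) *: pi n x (v n).
      by rewrite linearB -rep_mul mulVKg scalerBr scalerBl addrA subrK.
    apply: le_trans (ler_rnormD _ _) _; rewrite !rnormZ.
    have h1 := rep_length_bound x (pi n (x^-1 * y)%g (v n) - v n); have h2 := Wn _ Wy.
    have h3 := rep_length_bound x (v n); rewrite -/M in h1 h3.
    have h4 : kabs (f y) * rnorm (pi n x (pi n (x^-1 * y)%g (v n) - v n)) <= e / 2.
      apply: (@le_trans _ _ ((cb + 1) * (M * (e / (2 * (cb + 1) * M))))).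
        apply: ler_pM; [exact: kabs_ge0|exact: rnorm_ge0| |].
          by apply: le_trans (fb y : kabs (f y) <= cb) _; lra.
        by apply: le_trans h1 _; rewrite ler_wpM2l // ltW.
      by rewrite le_eqVlt; apply/orP; left; apply/eqP; field; rewrite !gt_eqF // ltr_wpDl.
    have h5 : kabs (f y - f x) * rnorm (pi n x (v n)) <= e / 2.
      apply: (@le_trans _ _ (e / (2 * (`|c| + 1) * M) * (M * (`|c| + 1)))).
        apply: ler_pM; [exact: kabs_ge0|exact: rnorm_ge0|exact: ltW|].
        apply: le_trans h3 _; rewrite ler_wpM2l // ?ltW //; have := ler_norm c; lra.
      by rewrite le_eqVlt; apply/orP; left; apply/eqP; field; rewrite !gt_eqF // ltr_wpDl.
    lra.
  have [V VP] := choice loc; have [N NP] := choice VP.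
  have [|m [k [B [bp BV]]]] := exists_borel_partition G_hausdorff (V := V) cA.
    by move=> x _; have [] := NP x.
  exists m, k, B; split=> // [i x Bx|]; first by have [_ _ h _] := NP (k i); apply: h; exact: BV.
  have : U [set n | forall i, N (k i) n].
    by apply: filter_forall => i; have [] := NP (k i).
  apply: filterS => n h i x Bx; have [_ _ _ h'] := NP (k i).
  by apply: h' => //; exact: BV.
have vA := vol_ge0 mu A; have vA1 : 0 < vol mu A + 1 by lra.
have sums e : 0 < e -> exists w, [/\ good_family w, U [set n | rnorm (z n - w n) <= e] &
    rnorm (rint rho f (q v) - q w) <= e].
  move=> e0; have d0 := divr_gt0 e0 vA1.
  have de : e / (vol mu A + 1) * vol mu A <= e.
    by rewrite mulrAC ler_pdivrMr // ler_wpM2l // ?(ltW e0) //; lra.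
  have [m [k [B [bp h1 h2]]]] := approx _ d0.
  exists (\sum_(i < m) (emb s (vol mu (B i)) * f (k i)) *: action (k i) v).
  have ga i : good_family (action (k i) v) by exact: good_action.
  split; first exact: good_family_sum.
    apply: filterS h2 => n /= h2; rewrite fam_sum; apply: le_trans de.
    have := vector_riemann G_hausdorff mu_haar (rep_csupp (pi n) (v n) cf) bp h2.
    by under eq_bigr do rewrite scalerA.
  rewrite up_sum //; apply: le_trans de.
  have := vector_riemann G_hausdorff mu_haar frho bp h1.
  by under eq_bigr do rewrite scalerA (up_action q_rho) //.
have gz : good_family z.
  by apply: good_family_approx => e /sums[w [gw zw _]]; exists w.
split=> //; apply: rnorm_lim_unique => e e0; have e4 : 0 < e / 4 by rewrite divr_gt0.
have [w [gw zw fw]] := sums _ e4.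
have h1 : rnorm (q z - q w) <= e / 4 by rewrite -upB //; apply: up_le => //; exact: good_familyB.
have := ler_rdist (q w) (q z) (rint rho f (q v)).
rewrite (rdistC (q w)); lra.
Qed.

End ultraproduct_consequences.
End ultraproduct_representations.

(** * Affine actions near the class *)

Section cocycles.
Variables (R : realType) (s : scalars) (G : topGroupType).
Variable mu : {measure set (borel G) -> \bar R}.
Hypothesis G_hausdorff : hausdorff_space G.
Hypothesis mu_haar : left_haar mu.
Variable S : set G.
Hypothesis S_generating : compact_symmetric_generating S.
Local Notation K := (scalar_field R s).
Local Notation banach := (completeNormedModType K).
Local Notation rcsupp := (@csupp R RealScalars G R^o).
Local Notation kcsupp := (@csupp R s G K^o).
Local Notation integral := (fun u : G -> R => Rintegral mu setT (u : borel G -> R)).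

Section one_cocycle.
Variables (E : banach) (pi : representation G E) (b : G -> E).
Hypothesis b_cocycle : is_cocycle pi b.

Lemma cocycle1 : b 1%g = 0.
Proof.
have [_ /(_ 1 1)%g] := b_cocycle; rewrite mulg1 rep_one => h.
by apply: (@addrI _ (b 1%g)); rewrite addr0 -h.
Qed.

(** This is the cocycle of the same affine action in the coordinate k (y - x), whose origin is x. *)
Lemma translate_cocycle k x : is_cocycle pi (fun g => k *: (pi g x + b g - x)).
Proof.
have [bc bM] := b_cocycle; split.
  move=> g; apply: cvgZ; first exact: cvg_cst.
  apply: cvgB; last exact: cvg_cst.
  by apply: cvgD; [exact: rep_strongly_continuous|exact: bc].
move=> g h; rewrite linearZ -scalerDr; congr (_ *: _).
rewrite linearB linearD rep_mul bM; move: (pi g (pi h x)) (pi g x) (pi g (b h)) => a y d.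
by rewrite -(addrA y) [RHS]addrC [RHS]addrA subrK (addrC (b g) d) !addrA.
Qed.

Lemma cocycle_word_bound eps C k g : 0 <= eps -> eps <= 1 -> length_bounded S eps C pi ->
  (forall g, S g -> rnorm (b g) <= 1) -> set_power S k g -> rnorm (b g) <= k%:R * expR (k%:R + `|C|).
Proof.
move=> e0 e1 pb b1; elim: k g => [|k IH] g; first by move=> ->; rewrite cocycle1 rnorm0 mul0r.
move=> [h Sh [t St <-]]; rewrite b_cocycle.2; apply: le_trans (ler_rnormD _ _) _.
have hk : (word_length S h)%:R <= k%:R :> R by rewrite ler_nat word_length_le.
have h2 := length_bound_mono e0 (b t) pb hk.
have h3 : expR (eps * k%:R + C) * rnorm (b t) <= expR (k.+1%:R + `|C|) * 1.
  apply: ler_pM; [exact: expR_ge0|exact: rnorm_ge0| |exact: b1].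
  rewrite ler_expR lerD ?ler_norm //; apply: (@le_trans _ _ k%:R); last by rewrite ler_nat.
  by rewrite ler_piMl.
have h4 : k%:R * expR (k%:R + `|C|) <= k%:R * expR (k.+1%:R + `|C|).
  by rewrite ler_wpM2l // ler_expR lerD2r ler_nat.
have h5 := IH h Sh; rewrite mulr1 in h3; move: h3 h4; rewrite -natr1 mulrDl mul1r natr1; lra.
Qed.

Variables (A : set G) (f : G -> R).
Hypotheses (cf : rcsupp A f) (f_one : integral f = 1).
Local Notation fK := (fun g : G => emb s (f g) : K).

(** With w, the f-average of the orbit of 0, as origin, the cocycle depends on g only through the
    left translate of f. Uniform continuity of f thus gives a modulus of continuity at 1 which
    depends on b only through its size on a compact set. *)
Lemma cocycle_average_translate g :
  let w := vector_integral mu (fun h => fK h *: b h) in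
  pi g w + b g - w = vector_integral mu (fun h => (fK (g^-1 * h)%g - fK h) *: b h).
Proof.
move=> w; have [bc bM] := b_cocycle; have cfK := density_csupp s G_hausdorff mu_haar cf.
have cF : csupp A (fun h => fK h *: b h) by exact: csupp_scale.
have cFg : csupp [set (g^-1^-1 * x)%g | x in A] (fun h => fK (g^-1 * h)%g *: b h).
  have cbg : csupp A (fun h => fK h *: b (g * h)%g).
    apply: csupp_scale => // h; apply: (@continuous_comp _ _ _ (fun h => (g * h)%g) b).
      exact: lmul_continuous.
    exact: bc.
  have := csupp_lmul g^-1%g cbg; congr csupp; apply/funext => h.
  by rewrite mulVKg.
have cpi : csupp A (fun h => pi g (fK h *: b h)) := csupp_op cF (@rep_bounded R s G E pi g).
have cb : csupp A (fun h => fK h *: b g) by apply: csupp_scale => // x; exact: cvg_cst.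
have -> : b g = vector_integral mu (fun h => fK h *: b g).
  by rewrite (vector_integral_cst G_hausdorff mu_haar _ cfK) (density_one s G_hausdorff mu_haar cf f_one) scale1r.
rewrite /w (vector_integral_op G_hausdorff mu_haar cF (@rep_bounded R s G E pi g)).
rewrite -[X in X + _ - _]scale1r -(vector_integralD G_hausdorff mu_haar 1 cpi cb).
have -> : (fun h => 1 *: pi g (fK h *: b h) + fK h *: b g) =
    (fun h => (fun k => fK (g^-1 * k)%g *: b k) (g * h)%g).
  by apply/funext => h; rewrite scale1r linearZ mulKg bM scalerDr addrC.
rewrite (vector_integral_lmul G_hausdorff mu_haar g cFg) -scaleN1r addrC.
rewrite -(vector_integralD G_hausdorff mu_haar (- 1) cF cFg).
by congr (vector_integral mu _); apply/funext => h; rewrite scaleN1r scalerBl addrC.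
Qed.

End one_cocycle.

(** B is the product of a power of S that is a neighbourhood of 1 with the support of f. It contains
    the supports of all translates of f by nearby elements, so it can be fixed before e. *)
Lemma density_translate A (f : G -> K) : kcsupp A f -> exists B, compact B /\
  forall e, 0 < e -> exists W, nbhs (1%g : G) W /\ forall g, W g ->
    kcsupp B (fun h => f (g^-1 * h)%g - f h) /\ forall h, kabs (f (g^-1 * h)%g - f h) <= e.
Proof.
move=> cf; have [cA fc f0] := cf.
have [L nL] := set_power_nbhs1 G_hausdorff mu_haar S_generating.
pose B := [set (x * y)%g | x in set_power S L & y in A].
have cB : compact B by apply: mul_compact => //; exact: set_power_compact.
exists B; split=> // e e0.
have dcont : continuous (fun p : G * G => f (p.2^-1 * p.1)%g - f p.1 : K^o).
  move=> p; apply: (@cvgB K K^o); last first.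
    by apply: (@continuous_comp _ _ _ fst f); [exact: cvg_fst|exact: fc].
  apply: (@continuous_comp _ _ _ (fun p : G * G => (p.2^-1 * p.1)%g) f); last exact: fc.
  apply: (@continuous_comp _ _ _ (fun p : G * G => (p.2^-1%g, p.1)) (fun z => (z.1 * z.2)%g)).
    apply: cvg_pair; last exact: cvg_fst.
    by apply: (@continuous_comp _ _ _ snd (fun x : G => x^-1%g)); [exact: cvg_snd|exact: invg_continuous].
  exact: mulg_continuous.
have near1 : \forall g \near (1%g : G), forall h, B h -> kabs (f (g^-1 * h)%g - f h) <= e.
  have /compact_near_coveringP := cB; apply => h Bh.
  move/continuous_rnorm: dcont => /(_ (h, 1%g) _ e0) [[V W] /= [nV nW] VW].
  exists (V, W) => // -[h' g] /= [Vh Wg]; have := VW (h', g) (conj Vh Wg) => /=.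
  by rewrite invg1 mul1g subrr subr0 rnorm_K; exact: ltW.
exists (set_power S L `&` [set g | forall h, B h -> kabs (f (g^-1 * h)%g - f h) <= e]).
split; first exact: filterI.
move=> g [Lg gP]; have B0 h : ~ B h -> f (g^-1 * h)%g - f h = 0.
  move=> Bh; rewrite !f0 ?subrr // => Ah; apply: Bh.
    by exists 1%g; [exact: nbhs_singleton nL|exists h => //; rewrite mul1g].
  by exists g => //; exists (g^-1 * h)%g => //; rewrite mulVKg.
split; last first.
  by move=> h; have [Bh|/B0 ->] := pselect (B h); [exact: gP|rewrite kabs0 ltW].
split=> // h; apply: (@continuous_comp _ _ _ (fun h : G => (h, g))
  (fun p : G * G => f (p.2^-1 * p.1)%g - f p.1 : K^o)); last exact: dcont.
by apply: cvg_pair; [exact: cvg_id|exact: cvg_cst].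
Qed.

End cocycles.

(** * Contraction of displacements and the spectral gap *)

Section fixed_points_nearby.
Variables (R : realType) (s : scalars) (G : topGroupType).
Variable mu : {measure set (borel G) -> \bar R}.
Hypothesis G_hausdorff : hausdorff_space G.
Hypothesis mu_haar : left_haar mu.
Variable S : set G.
Hypothesis S_generating : compact_symmetric_generating S.
Local Notation K := (scalar_field R s).
Local Notation banach := (completeNormedModType K).
Local Notation integral := (fun u : G -> R => Rintegral mu setT (u : borel G -> R)).
Variables (Ecl : banach_class R s) (C : R).
Hypothesis Ecl_closed : closed_under_finite_representability Ecl.
Variables (A : set G) (f : G -> R).
Hypotheses (cf : @csupp R RealScalars G R^o A f) (f_one : integral f = 1).

Definition almost_fixed (E : banach) (pi : representation G E) (b : G -> E) (x : E) (r : R) :=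
  forall g, S g -> rnorm (pi g x + b g - x) <= r.

Definition nearby_rep n (E : banach) (pi : representation G E) :=
  local_class Ecl n.+1 n.+1%:R^-1 E /\ length_bounded S n.+1%:R^-1 C pi.

Lemma bounded_rep_uniform (E : banach) (pi : representation G E) c :
  (forall g x, rnorm (pi g x) <= c * rnorm x) -> 0 <= c -> uniformly_bounded pi.
Proof.
move=> pc c0; apply: (@le_lt_trans _ _ c%:E); last exact: ltry.
by apply: ge_ereal_sup => _ [g _ <-]; apply: opnorm_le => // x _; exact: pc.
Qed.

Section no_far_sequence.
Variables (E : nat -> banach) (pi : forall n, representation G (E n)) (b : forall n, G -> E n).
Hypothesis near : forall n, nearby_rep n (pi n).
Hypothesis b_cocycle : forall n, is_cocycle (pi n) (b n).
Hypothesis b_small : forall n, almost_fixed (pi n) (b n) 0 1.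
Hypothesis b_far : forall n y, rnorm y <= n.+1%:R -> ~ almost_fixed (pi n) (b n) y (1 / 2).

Lemma no_far_sequence : ~ property_FE G Ecl.
Proof.
move=> FE; have [U [UU Ufree]] := free_ultrafilter.
have pb n : length_bounded S n.+1%:R^-1 C (pi n) by case: (near n).
have [X [q [rho UP]]] := exists_ultraproduct G_hausdorff mu_haar S_generating UU Ufree pb.
have EX : Ecl X.
  by apply: (ultraproduct_in_class UU Ufree UP Ecl_closed) => n; case: (near n).
have inv1 n : 0 <= (n.+1%:R^-1 : R) <= 1 by rewrite invr_ge0 ler0n invf_le1 // ler1n.
have bS n g : S g -> rnorm (b n g) <= 1.
  by move=> Sg; have := b_small n Sg; rewrite linear0 add0r subr0.
have cfK := density_csupp s G_hausdorff mu_haar cf.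
pose fK := fun g : G => emb s (f g) : K.
have b_compact B : compact B -> exists2 c, 0 <= c & forall n g, B g -> rnorm (b n g) <= c.
  move=> /(word_length_compact (R := R) G_hausdorff mu_haar S_generating)[L LP].
  exists (`|L| * expR (`|L| + `|C|)); first by rewrite mulr_ge0 // expR_ge0.
  move=> n g Bg; have [/andP[i0 i1] Lg] := (inv1 n, LP g Bg).
  have [Sg _] := word_lengthP S_generating g.
  apply: le_trans (cocycle_word_bound S_generating (b_cocycle n) i0 i1 (pb n) (@bS n) Sg) _.
  have gL : (word_length S g)%:R <= `|L| := le_trans Lg (ler_norm L).
  by rewrite ler_pM ?expR_ge0 // ler_expR lerD2r.
pose w : families E := fun n => vector_integral mu (fun h => fK h *: b n h).
pose b' n g := pi n g (w n) + b n g - w n.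
have b'_cocycle n : is_cocycle (pi n) (b' n).
  have := translate_cocycle (b_cocycle n) 1 (w n); rewrite /b'.
  by under eq_fun do rewrite scale1r.
have [cw cw0 w_le] : exists2 c, 0 <= c & forall n, rnorm (w n) <= c.
  have [cA _ _] := cf; have [c c0 cP] := b_compact A cA; have [d dP] := csupp_bounded cfK.
  exists (`|d| * c * vol mu A); first by rewrite !mulr_ge0 // vol_ge0.
  move=> n; apply: (vector_integral_bound G_hausdorff mu_haar (A := A)).
    by apply: csupp_scale => //; case: (b_cocycle n).
  move=> g Ag; rewrite rnormZ ler_pM ?kabs_ge0 ?rnorm_ge0 ?cP //.
  by apply: le_trans (ler_norm d); exact: (dP g).
have b'_small e : 0 < e -> exists W, nbhs (1%g : G) W /\ forall n g, W g -> rnorm (b' n g) <= e.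
  have [B [cB BP]] := density_translate G_hausdorff mu_haar S_generating cfK.
  have [c c0 cP] := b_compact B cB; have vB := vol_ge0 mu B.
  move=> e0; have cv : 0 < c * vol mu B + 1 by rewrite ltr_wpDl // mulr_ge0.
  have d0 := divr_gt0 e0 cv; have [W [nW WP]] := BP _ d0.
  exists W; split=> // n g Wg; have [cd dle] := WP g Wg.
  rewrite /b' (cocycle_average_translate G_hausdorff mu_haar (b_cocycle n) cf f_one g).
  apply: (@le_trans _ _ (e / (c * vol mu B + 1) * c * vol mu B)).
    apply: (vector_integral_bound G_hausdorff mu_haar (A := B)).
      by apply: csupp_scale => //; case: (b_cocycle n).
    by move=> h Bh; rewrite rnormZ ler_pM ?kabs_ge0 ?rnorm_ge0 ?cP //; exact: dle.
  by rewrite -mulrA mulrAC ler_pdivrMr // ler_pM2l //; lra.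
have b'M n g h : b' n (g * h)%g = b' n g + pi n g (b' n h) := (b'_cocycle n).2 g h.
have good_b' g : good_family U pi (fun n => b' n g).
  pose Mg := expR ((word_length S g)%:R + `|C|); have Mg0 : 0 < Mg := expR_gt0 _.
  split.
    have [c _ cP] := b_compact [set g] (@compact_set1 G g).
    exists (Mg * cw + c + cw); apply: filterS (Ufree 0%N) => n _ /=.
    apply: le_trans (ler_rnormB _ _) _; rewrite lerD //.
    apply: le_trans (ler_rnormD _ _) _; rewrite lerD ?cP //.
    apply: le_trans (rep_length_bound pb g (w n)) _.
    by rewrite ler_wpM2l // ltW.
  move=> e e0; have Mg1 : 0 < Mg + 1 by lra.
  have [W [nW WP]] := b'_small _ (divr_gt0 e0 Mg1).
  exists (W `&` [set h | W (g^-1 * (h * g))%g]); split.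
    apply: filterI => //; have : (fun h => (g^-1 * (h * g))%g) @ (1%g : G) --> (g^-1 * (1 * g))%g.
      apply: (@continuous_comp _ _ _ (fun h => (h * g)%g)); first exact: rmul_continuous.
      exact: lmul_continuous.
    by rewrite mul1g mulVg => /(_ W nW).
  apply: filterS (Ufree 0%N) => n _ /= h [Wh Wgh].
  (* Expand the cocycle at h g both as it stands and as g times g^-1 h g: smallness of [b' n] near 1
     then controls the displacement of its value at any g. *)
  have -> : pi n h (b' n g) - b' n g = pi n g (b' n (g^-1 * (h * g))%g) - b' n h.
    have := b'M n g (g^-1 * (h * g))%g; rewrite mulVKg b'M => e1.
    by rewrite -[X in _ = X - _](addKr (b' n g)) -e1 addrCA [in RHS]addrAC subrr add0r addrC.
  apply: le_trans (ler_rnormB _ _) _.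
  have h1 := rep_length_bound pb g (b' n (g^-1 * (h * g))%g).
  have h2 := ler_wpM2l (ltW Mg0) (WP n _ Wgh); have h3 := WP n _ Wh.
  have h4 : (Mg + 1) * (e / (Mg + 1)) = e by rewrite mulrC divfK // gt_eqF.
  rewrite -/Mg in h1; lra.
pose beta g := q (fun n => b' n g).
have betaM g h : beta (g * h)%g = beta g + rho g (beta h).
  rewrite /beta (up_action UP) // -(upD UP) //; last exact: (good_action UU pb).
  by congr q; apply/functional_extensionality_dep => n; exact: b'M.
have beta_cocycle : is_cocycle rho beta.
  split=> //; apply/continuous_rnorm => g e e0; have eC := expR_gt0 C.
  have d0 : 0 < e / expR C / 2 by rewrite !divr_gt0.
  have [W [nW WP]] := b'_small _ d0.
  have := @lmul_nbhs G g^-1%g g W; rewrite mulVg => /(_ nW); apply: filterS => h /= Wh.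
  have -> : beta h - beta g = rho g (beta (g^-1 * h)%g).
    by rewrite -[in LHS](mulVKg g h) betaM addrC addKr.
  apply: le_lt_trans (up_bounded UP _ _) _; rewrite mulrC -ltr_pdivlMr //.
  apply: (@le_lt_trans _ _ (e / expR C / 2)); last by lra.
  by apply: (up_le UU UP) => //; apply: filterS (Ufree 0%N) => n _; exact: WP.
have [x xfix] := FE X rho EX (bounded_rep_uniform (up_bounded UP) (expR_ge0 C)) beta beta_cocycle.
have [v gv qv] := up_onto UP x.
pose d n g := pi n g (v n) + b' n g - v n.
have dM n g h : d n (g * h)%g = d n g + pi n g (d n h).
  have := (translate_cocycle (b'_cocycle n) 1 (v n)).2 g h.
  by rewrite !scale1r.
have d_small g e : 0 < e -> U [set n | rnorm (d n g) < e].
  move=> e0; have ga := good_action UU pb g gv.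
  have gab := good_familyD UU ga (good_b' g).
  have gd := good_familyB UU gab gv.
  apply: (up_lt UU UP gd).
  rewrite (upB UP) // (upD UP) // -(up_action UP) // qv xfix subrr rnorm0 //.
(* The fixed point of the limit gives small displacements at finitely many k i only, namely below
   1/4. On each translate of W by some k i the displacement changes by at most exp(1 + |C|) times
   the bound chosen here, again 1/4, which reaches the 1/2 excluded by [b_far]. *)
have [W [nW WP]] : exists W, nbhs (1%g : G) W /\
    U [set n | forall g, W g -> rnorm (d n g) <= (expR (1 + `|C|))^-1 / 8 + (expR (1 + `|C|))^-1 / 8].
  have t0 : 0 < (expR (1 + `|C|))^-1 / 8 by rewrite divr_gt0 // invr_gt0 expR_gt0.
  have [W1 [nW1 W1P]] := gv.2 _ t0; have [W2 [nW2 W2P]] := b'_small _ t0.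
  exists (W1 `&` W2); split; first exact: filterI.
  apply: filterS W1P => n /= W1P g [W1g W2g].
  rewrite /d addrAC; apply: le_trans (ler_rnormD _ _) _.
  by rewrite lerD ?W1P ?W2P.
have [|m [k [Sk cov]]] := @compact_finite_subcover G S (fun x => [set y | W (x^-1 * y)%g])
    (csg_compact S_generating).
  by move=> y _; apply: lmul_nbhs; rewrite mulVg.
have U1 : U [set n | forall i, rnorm (d n (k i)) < 1 / 4].
  by apply: filter_forall => i; apply: d_small.
have [cv Uv] := gv.1.
(* The point [w n + v n], with v a lift of the fixed point, stays bounded in n, while [b_far]
   excludes a radius tending to infinity. *)
have [N [_ Nbig]] : exists N : nat, True /\ cw + cv <= N%:R.
  exists (Num.truncn `|cw + cv|).+1; split=> //.
  by apply: le_trans (ler_norm _) _; apply/ltW/truncnS_gt.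
have [n [/= [n1 n2] [n3 n4]]] := filter_ex (filterI (filterI WP U1) (filterI Uv (Ufree N))).
apply: (b_far (n := n) (y := w n + v n)).
  apply: le_trans (ler_rnormD _ _) _; apply: (@le_trans _ _ N%:R).
    by apply: le_trans Nbig; rewrite lerD.
  by rewrite ler_nat ltnW.
move=> g Sg; have -> : pi n g (w n + v n) + b n g - (w n + v n) = d n g.
  rewrite /d /b' linearD opprD; move: (w n) (v n) (pi n g (w n)) (pi n g (v n)) (b n g).
  move=> z z' a a' b0; rewrite (addrC a) -!addrA; congr (_ + _).
have [i Wi] := cov g Sg; rewrite -(mulVKg (k i) g) dM.
apply: le_trans (ler_rnormD _ _) _.
have h1 := rep_length_bound pb (k i) (d n ((k i)^-1 * g)%g); have h2 := n1 _ Wi; have h3 := n2 i.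
have h4 : expR ((word_length S (k i))%:R + `|C|) * rnorm (d n ((k i)^-1 * g)%g) <=
    expR (1 + `|C|) * ((expR (1 + `|C|))^-1 / 8 + (expR (1 + `|C|))^-1 / 8).
  rewrite ler_pM ?expR_ge0 ?rnorm_ge0 // ler_expR lerD2r (ler_nat R _ 1).
  exact: word_length_gen.
have h5 : expR (1 + `|C|) * ((expR (1 + `|C|))^-1 / 8 + (expR (1 + `|C|))^-1 / 8) = 1 / 4.
  by field; rewrite gt_eqF // expR_gt0.
lra.
Qed.

End no_far_sequence.

Definition displacement_contracts n (E : banach) (pi : representation G E) (b : G -> E) :=
  forall x r, 0 < r -> almost_fixed pi b x r ->
  exists2 y, rnorm (y - x) <= n.+1%:R * r & almost_fixed pi b y (r / 2).

(** A counterexample at stage n, bundled so that one can be chosen for every n; translation and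
    dilation have made its point of displacement r the origin with displacement 1. *)
Record far_action n := FarAction {
  far_space : banach ;
  far_rep : representation G far_space ;
  far_cocycle : G -> far_space ;
  far_near : nearby_rep n far_rep ;
  far_cocycleP : is_cocycle far_rep far_cocycle ;
  far_small : almost_fixed far_rep far_cocycle 0 1 ;
  far_far : forall y, rnorm y <= n.+1%:R -> ~ almost_fixed far_rep far_cocycle y (1 / 2)
}.

Lemma exists_displacement_contraction : property_FE G Ecl -> exists n,
  forall (E : banach) (pi : representation G E) b, nearby_rep n pi -> is_cocycle pi b ->
  displacement_contracts n pi b.
Proof.
move=> FE; apply: contrapT => no; suff far n : exists d : far_action n, True.
  pose d n := sval (cid (far n)).
  by case: (no_far_sequence (fun n => @far_near n (d n)) (fun n => @far_cocycleP n (d n))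
    (fun n => @far_small n (d n)) (fun n => @far_far n (d n))).
apply: contrapT => nofar; apply: no; exists n => E pi b near bc x r r0 xr.
apply: contrapT => noy; apply: nofar.
have kabs_r : kabs (emb s r^-1 : K) = r^-1 by rewrite kabs_emb ger0_norm // invr_ge0 ltW.
have shift g y : pi g (emb s r^-1 *: y) + emb s r^-1 *: (pi g x + b g - x) - emb s r^-1 *: y =
    emb s r^-1 *: (pi g (y + x) + b g - (y + x)).
  rewrite linearZ -scalerDr -scalerBr; congr (_ *: _); rewrite linearD opprD.
  move: (pi g y) (pi g x) (b g) => a a' c.
  rewrite -!addrA; congr (_ + (_ + (_ + _))); exact: addrC.
unshelve eexists (@FarAction n E pi (fun g => emb s r^-1 *: (pi g x + b g - x)) near
  (translate_cocycle bc (emb s r^-1) x) _ _) => //.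
  move=> g Sg; have := shift g 0; rewrite !scaler0 add0r => ->.
  by rewrite rnormZ kabs_r mulrC ler_pdivrMr // mul1r xr.
move=> y yn; have : ~ almost_fixed pi b (emb s r *: y + x) (r / 2).
  move=> h; apply: noy; exists (emb s r *: y + x) => //.
  by rewrite addrK rnormZ kabs_emb (ger0_norm (ltW r0)) mulrC ler_pM2r.
apply: contra_not => h g Sg; have := h g Sg.
have := shift g (emb s r *: y); rewrite scalerA -embM mulVf ?gt_eqF // emb1 scale1r => ->.
by rewrite rnormZ kabs_r mulrC ler_pdivrMr // mulrC mul1r.
Qed.

Lemma fixed_point_of_contraction n (E : banach) (pi : representation G E) b : nearby_rep n pi ->
  is_cocycle pi b -> displacement_contracts n pi b -> forall x r, 0 < r -> almost_fixed pi b x r ->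
  exists2 y, rnorm (y - x) <= 2 * n.+1%:R * r & forall g, pi g y + b g = y.
Proof.
move=> [_ pb] [_ bM] contr x r r0 xr.
have nextP (p : nat * E) : exists y, almost_fixed pi b p.2 (r * 2^-1 ^+ p.1) ->
    rnorm (y - p.2) <= n.+1%:R * (r * 2^-1 ^+ p.1) /\ almost_fixed pi b y (r * 2^-1 ^+ p.1.+1).
  have [h|h] := pselect (almost_fixed pi b p.2 (r * 2^-1 ^+ p.1)); last by exists 0.
  have [|y y1 y2] := contr _ _ _ h; first by rewrite mulr_gt0 // exprn_gt0 // invr_gt0.
  by exists y => _; split=> //; rewrite exprSr mulrA.
have [next nextE] := choice nextP.
pose u := nat_rect (fun=> E) x (fun k y => next (k, y)).
have u_disp k : almost_fixed pi b (u k) (r * 2^-1 ^+ k).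
  by elim: k => [|k IH]; [rewrite expr0 mulr1|case: (nextE (k, u k) IH)].
have u_step k : rnorm (u k.+1 - u k) <= n.+1%:R * r * 2^-1 ^+ k.
  by rewrite -mulrA; case: (nextE (k, u k) (u_disp k)).
have [l [ul lu]] := geometric_cvg u_step.
have lS g : S g -> pi g l + b g = l.
  move=> Sg; apply: rnorm_lim_unique => e e0; pose M := expR ((word_length S g)%:R + `|C|).
  have MP y : rnorm (pi g y) <= M * rnorm y.
    apply: le_trans (pb g y) _; rewrite ler_wpM2r ?rnorm_ge0 // ler_expR.
    by rewrite lerD ?ler_norm // ler_piMl // invf_le1 // ler1n.
  pose c := (M + 1) * (2 * (n.+1%:R * r)) + r + 1.
  have M0 : 0 < M := expR_gt0 _.
  have n0 : 0 < n.+1%:R :> R by [].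
  have c0 : 0 < c.
    have : 0 < (M + 1) * (2 * (n.+1%:R * r)) by rewrite !mulr_gt0 //; lra.
    rewrite /c; lra.
  have [k] := half_expn_small (divr_gt0 e0 c0); rewrite ltr_pdivlMr // => kP.
  have p0 : 0 <= (2^-1 : R) ^+ k by rewrite exprn_ge0 // invr_ge0.
  have h1 := lu k; have h2 := u_disp k g Sg.
  have := MP (l - u k); rewrite linearB => h3.
  have h4 : rnorm (pi g l + b g - (pi g (u k) + b g)) <= M * (2 * (n.+1%:R * r) * 2^-1 ^+ k).
    rewrite opprD addrACA subrr addr0; apply: le_trans h3 _.
    by rewrite ler_wpM2l // ltW.
  have h5 := ler_rdist (pi g (u k) + b g) (pi g l + b g) l.
  have h6 := ler_rdist (u k) (pi g (u k) + b g) l; rewrite (rdistC (u k)) in h6.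
  rewrite /c in kP; move: (2^-1 ^+ k) p0 kP h1 h2 h4 => t p0 kP h1 h2 h4; lra.
exists l; first by have := lu 0%N; rewrite expr0 mulr1 /= mulrA.
apply: (word_ind S_generating) => [|g t gl St].
  rewrite rep_one; have := bM 1%g 1%g; rewrite mulg1 rep_one => h.
  by rewrite (_ : b 1%g = 0) ?addr0 //; apply: (@addrI _ (b 1%g)); rewrite addr0 -h.
by rewrite rep_mul bM addrCA -linearD lS // addrC.
Qed.

Lemma nearby_H1 n (E : banach) (pi : representation G E) :
  (forall b, is_cocycle pi b -> displacement_contracts n pi b) -> nearby_rep n pi -> H1_vanishes pi.
Proof.
move=> contr near b bc; have [c cP] : exists c, forall g, S g -> rnorm (b g) <= c.
  apply: compact_locally_bounded (csg_compact S_generating) _ => g _.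
  exists (rnorm (b g) + 1); case: bc => /continuous_rnorm/(_ g 1 ltr01) h _.
  by apply: filterS h => h hb; have := ler_rnorm_dist (b h) (b g); lra.
have [||y _ yfix] := fixed_point_of_contraction near bc (contr b bc) (x := 0) (r := `|c| + 1).
- by rewrite ltr_wpDl.
- move=> g Sg; rewrite linear0 add0r subr0; apply: le_trans (cP g Sg) _.
  by have := ler_norm c; lra.
- by exists y.
Qed.

Definition spectral_gap c (E : banach) (pi : representation G E) := forall x r, 0 < r ->
  almost_invariant S pi x r -> exists2 y, invariant_vectors pi y & rnorm (y - x) <= c * r.

(** Take the zero cocycle: displacement is then lack of invariance, and fixed points are invariant
    vectors. *)
Lemma nearby_spectral_gap n (E : banach) (pi : representation G E) :
  (forall b, is_cocycle pi b -> displacement_contracts n pi b) -> nearby_rep n pi ->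
  spectral_gap (2 * n.+1%:R) pi.
Proof.
move=> contr near x r r0 xr.
have c0 : is_cocycle pi (fun=> 0).
  by split=> [g|g h]; [exact: cvg_cst|rewrite linear0 addr0].
have [|y yx yfix] := fixed_point_of_contraction near c0 (contr _ c0) r0 (x := x).
  by move=> g Sg; rewrite addr0; exact: xr.
by exists y => // g; have := yfix g; rewrite addr0.
Qed.

End fixed_points_nearby.

(** * Backward orbits of averages *)

Section overlaps.
Variables (R : realType) (G : topGroupType).
Variable mu : {measure set (borel G) -> \bar R}.
Hypothesis G_hausdorff : hausdorff_space G.
Hypothesis mu_haar : left_haar mu.
Variable S : set G.
Hypothesis S_generating : compact_symmetric_generating S.
Local Notation rcsupp := (@csupp R RealScalars G R^o).
Local Notation integral := (fun u : G -> R => Rintegral mu setT (u : borel G -> R)).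
Variables (A : set G) (f : G -> R).
Hypotheses (cf : rcsupp A f) (f_ge0 : forall g, 0 <= f g) (f_pos : forall g, S g -> 0 < f g).

Let overlap t h := Num.min (f h) (f (t * h)%g).

Lemma overlap_csupp t : rcsupp A (fun h => Num.min (f h) (f (t * h)%g)).
Proof.
have [cA fc f0] := cf; split=> // [h|h Ah]; last first.
  by rewrite (f0 _ Ah) min_l.
apply: (@continuous_min _ _ (f : G -> R) (fun h => f (t * h)%g)); first exact: fc.
apply: (@continuous_comp _ _ _ (fun h => (t * h)%g) f); first exact: lmul_continuous.
exact: fc.
Qed.

(** Both f h and f (t h) are positive at h = 1, so the integral is positive for each t in S. By
    uniform continuity of f it stays above half its value near t, and S is compact. The bound later
    forces some h and t h to be good positions simultaneously. *)
Lemma overlap_bound : exists2 c, 0 < c & forall t, S t ->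
  c <= integral (fun h => Num.min (f h) (f (t * h)%g)).
Proof.
have S1 := csg_one S_generating.
have I_gt0 t : S t -> 0 < integral (overlap t).
  move=> St; apply: (integral_gt0 G_hausdorff mu_haar (x0 := 1%g) (overlap_csupp t)) => [h|].
    by rewrite /overlap le_min !f_ge0.
  by rewrite /overlap mulg1 lt_min !f_pos.
have [c cP] : exists c, forall t, S t -> (integral (overlap t))^-1 <= c.
  apply: (compact_locally_bounded (csg_compact S_generating)) => t St.
  have [B [cB BP]] := @density_translate R RealScalars G mu G_hausdorff mu_haar S S_generating A f cf.
  have vB := vol_ge0 mu B; have It := I_gt0 t St.
  have d0 : 0 < integral (overlap t) / 2 / (vol mu B + 1) by rewrite !divr_gt0 //; lra.
  have [W [nW WP]] := BP _ d0.
  exists (integral (overlap t) / 2)^-1.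
  have : \forall t' \near t, W (t * t'^-1)%g.
    have : (fun t' : G => (t * t'^-1)%g) @ t --> (t * t^-1)%g.
      apply: (@continuous_comp _ _ _ (fun x : G => x^-1%g)); first exact: invg_continuous.
      exact: lmul_continuous.
    by rewrite mulgV => /(_ W nW).
  apply: filterS => t' Wt'; have [cd dle] := WP _ Wt'.
  pose Bt := [set (t^-1 * x)%g | x in B].
  have cBt : compact Bt by exact: lmul_compact.
  have mBt := compact_borel G_hausdorff cBt.
  pose A' := A `|` Bt; have cA' : compact A' by apply: compactU => //; case: cf.
  have iBt : integrable_on A' (\1_Bt : G -> R) by apply: integrable_on_indic => // x; right.
  have iov u : integrable_on A' (overlap u).
    apply: rcsupp_integrable; have [_ oc o0] := overlap_csupp u; split=> // x Ax.
    by apply: o0 => Ax'; apply: Ax; left.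
  set e := integral (overlap t) / 2 / _ in d0 dle.
  have diff h : f (t * h)%g <= f (t' * h)%g + e * \1_Bt h.
    have := dle (t * h)%g; have [_ _ d00] := cd; have := d00 (t * h)%g.
    rewrite invgM invgK !mulgA mulgVK indicE => h0 h1.
    have [Bh|Bh] := pselect (B (t * h)%g).
      have -> : h \in Bt by apply/mem_set; exists (t * h)%g => //; rewrite mulKg.
      have h2 : `|f (t' * h)%g - f (t * h)%g| <= e := h1.
      by rewrite mulr1; have := ler_norm (f (t * h)%g - f (t' * h)%g); rewrite distrC; lra.
    have := h0 Bh; have : 0 <= e * (h \in Bt)%:R by rewrite mulr_ge0 // ltW.
    lra.
  have le_int : integral (overlap t) <= integral (fun h => overlap t' h + e * \1_Bt h).
    apply: (le_integral_on G_hausdorff mu_haar (A := A') (B := A')) => //.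
      by apply: integrable_onD => //; exact: integrable_onZ.
    move=> h; have := diff h; have : 0 <= e * \1_Bt h by rewrite mulr_ge0 // ltW.
    by rewrite /overlap /Num.min; do 2 case: ifPn; rewrite -?leNgt; lra.
  move: le_int; rewrite (integral_onD G_hausdorff mu_haar (iov t') (integrable_onZ e iBt)) (integral_onZ G_hausdorff mu_haar _ iBt).
  rewrite (integral_on_indic mu cBt mBt (@subset_refl _ Bt)).
  rewrite (vol_lmul mu_haar _ (compact_borel G_hausdorff cB)) => le_int.
  have ev : e * vol mu B <= integral (overlap t) / 2.
    by rewrite /e mulrAC ler_pdivrMr; [rewrite ler_wpM2l|]; lra.
  by rewrite lef_pV2 ?posrE; lra.
have c0 : 0 < c by apply: lt_le_trans (cP _ S1); rewrite invr_gt0 I_gt0.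
exists c^-1 => [|t St]; first by rewrite invr_gt0.
by rewrite -[leRHS]invrK lef_pV2 ?posrE ?invr_gt0 ?I_gt0 //; exact: cP.
Qed.

End overlaps.

(** * A countable set dense in a real span *)

Section countable_combinations.
Variables (R : realType) (s : scalars).
Local Notation K := (scalar_field R s).
Variables (X : completeNormedModType K) (z : nat -> X).

Let comb (l : seq (rat * nat)) : X := \sum_(p <- l) emb s (ratr p.1) *: z p.2.
Let b n := if unpickle n is Some l then comb l else 0.

Let b_comb l : exists n, b n = comb l.
Proof. by exists (pickle l); rewrite /b pickleK. Qed.

Let comb_b n : exists l, b n = comb l.
Proof.
rewrite /b; case: (unpickle n) => [l|]; first by exists l.
by exists [::]; rewrite /comb big_nil.
Qed.

(** Rational combinations suffice, since only real scalars are needed to separate a point from the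
    closed real span. *)
Lemma dense_combinations : exists b : nat -> X, [/\
  forall i e, 0 < e -> exists n, rnorm (z i - b n) < e &
  forall a x y, (forall e, 0 < e -> exists n, rnorm (x - b n) < e) ->
    (forall e, 0 < e -> exists n, rnorm (y - b n) < e) ->
    forall e, 0 < e -> exists n, rnorm (emb s a *: x + y - b n) < e].
Proof.
exists b; split=> [i e e0|a x y xb yb e e0].
  have [n nE] := b_comb [:: (1, i)]; exists n.
  by rewrite nE /comb big_seq1 /= rmorph1 emb1 scale1r subrr rnorm0.
have x1 : 0 < 3 * (rnorm x + 1) by rewrite mulr_gt0 // ltr_wpDl ?rnorm_ge0.
have [r] : exists r : rat, ratr r \in `]a, a + e / (3 * (rnorm x + 1))[ .
  by apply: rat_in_itvoo; rewrite ltrDl divr_gt0.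
rewrite in_itv /= => /andP[ar ra]; pose t : R := ratr r.
have t1 : 0 < 3 * (`|t| + 1) by rewrite mulr_gt0 // ltr_wpDl.
have [n xn] := xb _ (divr_gt0 e0 t1); have e3 : 0 < e / 3 by rewrite divr_gt0.
have [m ym] := yb _ e3; have [l bl] := comb_b n; have [l' bl'] := comb_b m.
have [k kE] := b_comb ([seq (r * p.1, p.2) | p <- l] ++ l').
exists k; have -> : b k = emb s t *: b n + b m.
  rewrite kE bl bl' /comb big_cat big_map scaler_sumr; congr (_ + _).
  by apply: eq_bigr => p _; rewrite scalerA -embM -rmorphM.
have -> : emb s a *: x + y - (emb s t *: b n + b m) =
    emb s (a - t) *: x + (emb s t *: (x - b n) + (y - b m)).
  rewrite embB scalerBl scalerBr !addrA subrK opprD !addrA; congr (_ - _).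
  by rewrite addrAC.
apply: le_lt_trans (ler_rnormD _ _) _; rewrite rnormZe.
have := ler_rnormD (emb s t *: (x - b n)) (y - b m); rewrite rnormZe.
have h1 : `|a - t| * rnorm x <= e / 3.
  have -> : e / 3 = e / (3 * (rnorm x + 1)) * (rnorm x + 1).
    by field; rewrite gt_eqF // ltr_wpDl ?rnorm_ge0.
  apply: ler_pM; [exact: normr_ge0|exact: rnorm_ge0| |by lra].
  by rewrite ler_norml; apply/andP; split; rewrite /t; lra.
have h2 : `|t| * rnorm (x - b n) <= e / 3.
  have -> : e / 3 = (`|t| + 1) * (e / (3 * (`|t| + 1))).
    by field; rewrite gt_eqF // ltr_wpDl.
  by apply: ler_pM; [exact: normr_ge0|exact: rnorm_ge0|lra|exact: ltW].
lra.
Qed.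

End countable_combinations.

Section backward_orbits.
Variables (R : realType) (s : scalars) (G : topGroupType).
Variable mu : {measure set (borel G) -> \bar R}.
Hypothesis G_hausdorff : hausdorff_space G.
Hypothesis G_separable : separable_space G.
Hypothesis mu_haar : left_haar mu.
Variable S : set G.
Hypothesis S_generating : compact_symmetric_generating S.
Local Notation K := (scalar_field R s).
Local Notation rcsupp := (@csupp R RealScalars G R^o).
Local Notation integral := (fun u : G -> R => Rintegral mu setT (u : borel G -> R)).
Local Notation rint := (rep_integral mu).
Variables (A : set G) (f : G -> R).
Hypotheses (cf : rcsupp A f) (f_ge0 : forall g, 0 <= f g) (f_pos : forall g, S g -> 0 < f g).
Hypothesis f_one : integral f = 1.
Local Notation fK := (fun g : G => emb s (f g) : K).
Let cfK := density_csupp s G_hausdorff mu_haar cf.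

(** Bounding all translates at once, instead of bounding [rho g] by its norm, loses no constant, so
    the estimate can be iterated. *)
Lemma average_translate_norm (X : completeNormedModType K) (rho : representation G X) x g M :
  (forall h, A h -> rnorm (rho (g * h)%g x) <= M) -> rnorm (rho g (rint rho fK x)) <= M.
Proof.
move=> xM; have cF := rep_csupp rho x cfK.
rewrite (vector_integral_op G_hausdorff mu_haar cF (@rep_bounded R s G X rho g)).
have iM := integrable_onZ M (rcsupp_integrable cf).
have -> : M = integral (fun g => M * f g).
  by rewrite (integral_onZ G_hausdorff mu_haar _ (rcsupp_integrable cf)) f_one mulr1.
apply: (vector_integral_le G_hausdorff mu_haar (csupp_op cF (@rep_bounded R s G X rho g)) iM) => h.
rewrite linearZ rnormZe ger0_norm // mulrC -rep_mul; have [Ah|Ah] := pselect (A h).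
  by rewrite ler_wpM2r // xM.
by rewrite (cs_supp cf Ah) !mulr0.
Qed.

Variables (X : completeNormedModType K) (rho : representation G X) (M c B : R).
Hypothesis X_reflexive : reflexive_space X.
Hypothesis rho_bounded : forall g x, rnorm (rho g x) <= M * rnorm x.
Hypothesis gap : spectral_gap S c rho.
Variable Y : nat -> X.
Hypothesis Y_bounded : forall k, rnorm (Y k) <= B.
Hypothesis Y_average : forall k, Y k = rint rho fK (Y k.+1).

Let rp_phi (phi : {linear X -> K^o}) x : R := real_part (phi x : K).

Let node (p : G * nat) := rho p.1 (Y p.2).

(** The closed convex hull of the nodes, described by the half-spaces containing it: with this
    description a functional has the same upper bounds on the hull as on the nodes. *)
Let hull : set X := [set x | forall (phi : {linear X -> K^o}) m, continuous phi ->
  (forall p, rp_phi phi (node p) <= m) -> rp_phi phi x <= m].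

Let node_hull p : hull (node p).
Proof. by move=> phi m _; exact. Qed.

Let M0 : 0 <= `|M| := normr_ge0 M.

Let rho_le g x : rnorm (rho g x) <= (`|M| + 1) * rnorm x.
Proof.
apply: le_trans (rho_bounded g x) _; rewrite ler_wpM2r ?rnorm_ge0 //.
by have := ler_norm M; lra.
Qed.

Let rad := (`|M| + 1) * B.

Let node_bounded p : rnorm (node p) <= rad.
Proof.
apply: le_trans (rho_le p.1 (Y p.2)) _; rewrite ler_wpM2l //; lra.
Qed.

(** By continuity of orbits and separability of G countably many nodes are dense among the nodes. A
    point of the hull away from their closed real span P would be separated from it; but a
    functional bounded above on P is nonpositive on the nodes, hence at that point, while its bound
    on P is at least 0. *)
Let hull_separable : exists b : nat -> X, forall x, hull x -> forall e, 0 < e ->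
  exists n, rnorm (x - b n) < e.
Proof.
have [D cD dD] := G_separable.
have [h hinj] := elimT (countable_injP D) cD.
pose d n := xget 1%g [set g | D g /\ h g = n].
have dP V : open V -> V !=set0 -> exists n, V (d n).
  move=> oV V0; have [g [Vg Dg]] := dD V V0 oV; exists (h g); rewrite /d.
  case: xgetP => [g' _ [Dg' hg']|/(_ g)]; last by case.
  by rewrite (hinj g' g) ?inE.
pose z n : X := if unpickle n is Some p then node (d p.1, p.2) else 0.
have [b [zb blin]] := dense_combinations z; exists b.
pose P x := forall e, 0 < e -> exists n, rnorm (x - b n) < e.
have Plin a x y : P x -> P y -> P (emb s a *: x + y) := blin a x y.
have P_closed x : (forall e, 0 < e -> exists2 y, P y & rnorm (x - y) < e) -> P x.
  move=> xy e e0; have e2 : 0 < e / 2 by rewrite divr_gt0.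
  have [y Py yx] := xy _ e2; have [n yn] := Py _ e2; exists n.
  by have := ler_rdist y x (b n); lra.
have P_node p : P (node p).
  apply: P_closed => e e0; case: p => g k.
  move/continuous_rnorm: (@rep_strongly_continuous R s G X rho (Y k)) => /(_ g e e0)/nbhs_interior nV.
  have [||n nP] := dP (interior [set g' | rnorm (rho g' (Y k) - rho g (Y k)) < e]).
  - exact: open_interior.
  - by exists g; exact: nbhs_singleton nV.
  exists (node (d n, k)); last by rewrite rdistC; exact: (interior_subset nP).
  have := zb (pickle (n, k)); rewrite /z pickleK; exact.
have P0 : P 0.
  have := Plin (- 1) _ _ (P_node (1%g, 0%N)) (P_node (1%g, 0%N)).
  by rewrite embN emb1 scaleN1r addNr.
move=> x xhull e e0; apply: contrapT => far.
have [||||phi [be [phic bx be_le]]] := @separation R s X P x (e / 2).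
- move=> y y' t Py Py' t0 t1; apply: (Plin) => //.
  by rewrite -[emb s (1 - t) *: y']addr0; exact: Plin.
- by exists 0.
- by rewrite divr_gt0.
- move=> y Py; rewrite leNgt; apply/negP => xy; apply: far.
  have e2 : 0 < e / 2 by rewrite divr_gt0.
  have [n yn] := Py _ e2; exists n; have := ler_rdist y x (b n); lra.
have be0 : 0 <= be by have := be_le 0 P0; rewrite linear0 rp0.
have : rp_phi phi x <= 0.
  apply: xhull => // p; rewrite leNgt; apply/negP => r0; set r := rp_phi phi (node p) in r0.
  have Pa : P (emb s ((be + 1) / r) *: node p + 0) by apply: (Plin) => //; exact: P_node.
  have := be_le _ Pa; rewrite addr0 linearZ.
  change (real_part (emb s ((be + 1) / r) * (phi (node p) : K)) <= be -> False).
  rewrite rpZ -/(rp_phi phi (node p)) -/r divfK ?gt_eqF //; lra.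
rewrite /rp_phi; lra.
Qed.

Lemma backward_orbit_invariant tau : 0 < tau -> almost_invariant S rho (Y 0) tau.
Proof.
move=> tau0.
pose M1 := `|M| + 1; have M1_gt0 : 0 < M1 by rewrite ltr_wpDl.
pose c1 := `|c| + 1; have c1_gt0 : 0 < c1 by rewrite ltr_wpDl.
(* From a slice of diameter eta: w is invariant up to (M1^2 + M1) eta, the gap loses c1, translation
   back by h0^-1 and then by any g' loses M1 twice, and the displacement of Y 0 counts its distance
   to y twice. With this kk the result is tau. *)
pose kk := 2 * (M1 * M1 * c1 * (M1 * M1 + M1)).
have kk0 : 0 < kk.
  have mm : 0 < M1 * M1 by rewrite mulr_gt0.
  by apply: mulr_gt0 => //; apply: mulr_gt0; [apply: mulr_gt0|apply: addr_gt0].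
pose eta := tau / kk; have eta0 : 0 < eta by rewrite divr_gt0.
have [b bP] := hull_separable.
have [] := @small_slice R s X X_reflexive hull rad b eta _ _ _ _ bP eta0.
- move=> x y t hx hy t0 t1 phi m phic pm; have := hx phi m phic pm; have := hy phi m phic pm.
  rewrite /rp_phi linearD rpD !linearZ.
  change (real_part (phi y : K) <= m -> real_part (phi x : K) <= m ->
    real_part (emb s t * (phi x : K)) + real_part (emb s (1 - t) * (phi y : K)) <= m).
  by rewrite !rpZ; nra.
- move=> x hx; have [phi [phic phi1 <-]] := norming_real x.
  apply: hx => // p; apply: le_trans (ler_norm _) _; apply: le_trans (phi1 _) _.
  by rewrite mul1r.
- move=> x xy phi m phic pm; apply/ler_addgt0Pr => e e0.
  have [a a0 aP] := continuous_functional_bound phic.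
  have [y hy yx] := xy _ (divr_gt0 e0 a0).
  have := hy phi m phic pm; have := aP (x - y); rewrite linearB rpB.
  have : a * rnorm (x - y) < e by rewrite mulrC -ltr_pdivlMr.
  have := ler_norm (real_part (phi x : K) - real_part (phi y : K)); rewrite /rp_phi; lra.
- by exists (node (1%g, 0%N)).
move=> phi [al [phic [x0 hx0 alx0] slice]].
pose nodes := [set rp_phi phi (node p) | p in [set: G * nat]].
have nodes_sup : has_sup nodes.
  split; first by exists (rp_phi phi (node (1%g, 0%N))); exists (1%g, 0%N).
  have [a a0 aP] := continuous_functional_bound phic; exists (a * rad) => _ [p _ <-].
  apply: le_trans (ler_norm _) _; apply: le_trans (aP _) _.
  by rewrite ler_wpM2l // ltW.
pose m := sup nodes.
have node_le p : rp_phi phi (node p) <= m by apply: (sup_upper_bound nodes_sup); exists p.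
have al_m : al < m by apply: lt_le_trans alx0 _; exact: hx0.
have [c0 c0_gt0 c0P] := overlap_bound G_hausdorff mu_haar S_generating cf f_ge0 f_pos.
have d0 : 0 < (m - al) * (c0 / 2) by rewrite mulr_gt0 ?subr_gt0 // divr_gt0.
(* The slice also contains nodes, since heights on the hull do not exceed their supremum m on the
   nodes. The one chosen here is so high that the mean defect u of the translates it averages is
   below (m - al) c0 / 2. *)
have [_ [[g k] _ <-] near_m] := sup_adherent d0 nodes_sup; rewrite -/m in near_m.
pose u h := m - rp_phi phi (rho g (rho h (Y k.+1))).
have u_ge0 h : 0 <= u h by rewrite subr_ge0 -rep_mul; exact: (node_le (g * h, k.+1)%g).
have [psi [psic psiE]] := exists_composed_functional (@rep_bounded R s G X rho g) phic.
have uc : continuous u.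
  have : continuous (fun h => psi (rho h (Y k.+1)) : K^o).
    move=> h; apply: (@continuous_comp _ _ _ (fun h => rho h (Y k.+1)) psi); last exact: psic.
    exact: rep_strongly_continuous.
  move=> /real_part_continuous pc h; apply: cvgB; first exact: cvg_cst.
  by rewrite /rp_phi -psiE; have := pc h; under [X in X @ _ --> _ -> _]eq_fun do rewrite psiE.
have [cA fc f0] := cf.
have cfu : rcsupp A (fun h => f h * u h).
  split=> // [h|h /f0 ->]; last by rewrite mul0r.
  by apply: cvgM; [exact: fc|exact: uc].
have int_fu : integral (fun h => f h * u h) < (m - al) * (c0 / 2).
  have cF := rep_csupp rho (Y k.+1) cfK.
  have iF := rcsupp_integrable (csupp_rp cF psic).
  have -> : (fun h => f h * u h) = (fun h => m * f h - real_part (psi (fK h *: rho h (Y k.+1)) : K)).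
    apply/funext => h; rewrite /u linearZ psiE.
    change (f h * (m - rp_phi phi (rho g (rho h (Y k.+1)))) = m * f h -
      real_part (emb s (f h) * (phi (rho g (rho h (Y k.+1))) : K))).
    by rewrite rpZ /rp_phi; ring.
  rewrite (integral_onB G_hausdorff mu_haar (integrable_onZ m (rcsupp_integrable cf)) iF).
  rewrite (integral_onZ G_hausdorff mu_haar _ (rcsupp_integrable cf)) f_one mulr1.
  rewrite -(rp_vector_integral G_hausdorff mu_haar cF psic) psiE.
  move: near_m; rewrite /node /rp_phi /= [in X in _ < X -> _](Y_average k) -/(rep_integral mu rho fK _) /rep_integral; lra.
(* Otherwise u h + u (t h) would be at least m - al for all h. Integrating against the minimum of f
   h and f (t h) would bound (m - al) c0 by twice the mean of u. *)
have good t : S t -> exists h, u h < m - al /\ u (t * h)%g < m - al.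
  move=> St; apply: contrapT => no.
  have alt h : m - al <= u h \/ m - al <= u (t * h)%g.
    have [|h1] := leP (m - al) (u h); first by left.
    by have [|h2] := leP (m - al) (u (t * h)%g); [right|case: no; exists h].
  pose D := A `|` [set (t^-1 * x)%g | x in A].
  have [_ fuc fu0] := cfu.
  have cfut : rcsupp [set (t^-1 * x)%g | x in A] (fun h => f (t * h)%g * u (t * h)%g).
    split; first exact: lmul_compact.
      move=> h; apply: (@continuous_comp _ _ _ (fun h => (t * h)%g) (fun h => f h * u h)).
        exact: lmul_continuous.
      exact: fuc.
    move=> h nh; rewrite f0 ?mul0r // => Ath; apply: nh.
    by exists (t * h)%g => //; rewrite mulKg.
  have csum : rcsupp D (fun h => f h * u h + f (t * h)%g * u (t * h)%g).
    have [ct tc t0] := cfut; split; first exact: compactU.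
      by move=> h; apply: cvgD; [exact: fuc|exact: tc].
    by move=> h nD; rewrite fu0 ?t0 ?addr0 // => ?; apply: nD; [right|left].
  have ov := rcsupp_integrable (overlap_csupp cf f_ge0 t).
  have := @le_integral_on R G mu G_hausdorff mu_haar A D _ _ (integrable_onZ (m - al) ov)
    (rcsupp_integrable csum).
  rewrite (integral_onZ G_hausdorff mu_haar _ ov).
  rewrite (integral_onD G_hausdorff mu_haar (rcsupp_integrable cfu) (rcsupp_integrable cfut)).
  rewrite (integral_lmul G_hausdorff mu_haar t cfu) => le_int.
  have h1 : (m - al) * c0 <= (m - al) * integral (fun h => Num.min (f h) (f (t * h)%g)).
    by rewrite ler_wpM2l ?subr_ge0 ?(ltW al_m) // c0P.
  suff : forall h, (m - al) * Num.min (f h) (f (t * h)%g) <= f h * u h + f (t * h)%g * u (t * h)%g.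
    by move=> /le_int; lra.
  move=> h; have fh := f_ge0 h; have fth := f_ge0 (t * h)%g.
  have uh := u_ge0 h; have uth := u_ge0 (t * h)%g.
  have p1 : 0 <= f h * u h by rewrite mulr_ge0.
  have p2 : 0 <= f (t * h)%g * u (t * h)%g by rewrite mulr_ge0.
  have [h2|h2] := alt h.
    apply: (@le_trans _ _ (f h * u h)); last by lra.
    by rewrite mulrC ler_pM // ?le_min ?fh ?ge_min ?lexx // subr_ge0 ltW.
  apply: (@le_trans _ _ (f (t * h)%g * u (t * h)%g)); last by lra.
  by rewrite mulrC ler_pM // ?le_min ?fh ?ge_min ?lexx ?orbT // subr_ge0 ltW.
have inslice h : u h < m - al -> al < rp_phi phi (node ((g * h)%g, k.+1)).
  by rewrite /u /node /= rep_mul; lra.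
have close h h' : u h < m - al -> u h' < m - al ->
    rnorm (rho h (Y k.+1) - rho h' (Y k.+1)) <= M1 * eta.
  move=> uh uh'; have := slice _ _ (node_hull _) (node_hull _) (inslice h uh) (inslice h' uh').
  have := rho_le g^-1%g (node ((g * h)%g, k.+1) - node ((g * h')%g, k.+1)).
  rewrite linearB /node /= -!rep_mul !mulKg -/M1 => h1 h2; apply: le_trans h1 _.
  by rewrite ler_wpM2l // ltW.
have [h0 [uh0 _]] := good 1%g (csg_one S_generating).
(* For t in S choose a good h: then h and h0, as well as t h and h0, have nodes in the slice, so t w
   is close to the (t h)-translate of Y k.+1 and this one to w. *)
pose w := rho h0 (Y k.+1).
have w_inv : almost_invariant S rho w ((M1 * M1 + M1) * eta).
  move=> t St; have [h [uh uth]] := good t St.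
  have := close _ _ uth uh0; have h1 := close _ _ uh0 uh.
  have := rho_le t (rho h0 (Y k.+1) - rho h (Y k.+1)); rewrite linearB -(rep_mul rho t h) => h2 h3.
  have h4 := ler_wpM2l (ltW M1_gt0) h1.
  have := ler_rdist (rho (t * h)%g (Y k.+1)) (rho t w) w.
  rewrite /w; rewrite -/M1 in h2; lra.
have r0 : 0 < (M1 * M1 + M1) * eta by rewrite mulr_gt0 // addr_gt0 // mulr_gt0.
have [y yinv yw] := gap r0 w_inv.
(* The distance to the invariant vector y is carried from Y k.+1 down to Y 0. Since it is bounded
   for all translates together, each averaging step preserves the bound, and k does not enter it. *)
have rad' j : (j <= k.+1)%N -> forall g', rnorm (rho g' (Y (k.+1 - j)%N - y)) <= M1 * (M1 * (c1 * ((M1 * M1 + M1) * eta))).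
  elim: j => [_ g'|j IH jk g'].
    rewrite subn0; have -> : Y k.+1 - y = rho h0^-1%g (w - y).
      by rewrite linearB yinv /w -rep_mul mulVg rep_one.
    apply: le_trans (rho_le _ _) _; rewrite ler_wpM2l ?(ltW M1_gt0) //.
    apply: le_trans (rho_le _ _) _; rewrite ler_wpM2l ?(ltW M1_gt0) //.
    rewrite rdistC; apply: le_trans yw _; rewrite ler_wpM2r ?(ltW r0) //.
    by rewrite /c1; have := ler_norm c; lra.
  have -> : Y (k.+1 - j.+1)%N - y = rint rho fK (Y (k.+1 - j)%N - y).
    rewrite -scaleN1r addrC [RHS](_ : _ = rint rho fK (- 1 *: y + Y (k.+1 - j)%N)); last first.
      by rewrite scaleN1r addrC.
    rewrite (rint_linear G_hausdorff mu_haar rho (- 1) _ _ cfK).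
    rewrite (rint_invariant G_hausdorff mu_haar cfK yinv).
    rewrite (density_one s G_hausdorff mu_haar cf f_one) scale1r.
    by rewrite (Y_average (k.+1 - j.+1)) subnSK.
  by apply: average_translate_norm => h _; exact: IH (ltnW jk) _.
move=> t St; have h1 := rad' k.+1 (leqnn _) t; have h2 := rad' k.+1 (leqnn _) 1%g.
rewrite subnn in h1 h2; rewrite rep_one in h2.
have -> : rho t (Y 0) - Y 0 = rho t (Y 0 - y) - (Y 0 - y).
  by rewrite linearB yinv opprB addrA subrK.
apply: le_trans (ler_rnormB _ _) _.
have e1 : kk * eta = tau by rewrite /eta mulrC divfK // gt_eqF.
have e2 : M1 * (M1 * (c1 * ((M1 * M1 + M1) * eta))) = kk * eta / 2 by rewrite /kk; field.
lra.
Qed.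

End backward_orbits.

(** * Contraction of averages near the class *)

Section averages_nearby.
Variables (R : realType) (s : scalars) (G : topGroupType).
Variable mu : {measure set (borel G) -> \bar R}.
Hypothesis G_hausdorff : hausdorff_space G.
Hypothesis G_separable : separable_space G.
Hypothesis mu_haar : left_haar mu.
Variable S : set G.
Hypothesis S_generating : compact_symmetric_generating S.
Local Notation K := (scalar_field R s).
Local Notation banach := (completeNormedModType K).
Local Notation rcsupp := (@csupp R RealScalars G R^o).
Local Notation integral := (fun u : G -> R => Rintegral mu setT (u : borel G -> R)).
Local Notation rint := (rep_integral mu).
Variables (A : set G) (f : G -> R) (L : nat).
Hypotheses (cf : rcsupp A f) (f_ge0 : forall g, 0 <= f g) (f_pos : forall g, S g -> 0 < f g).
Hypothesis f_one : integral f = 1.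
Hypothesis A_length : forall g, A g -> (word_length S g <= L)%N.
Local Notation fK := (fun g : G => emb s (f g) : K).
Let cfK := density_csupp s G_hausdorff mu_haar cf.

(** The constant C is paid once and not once per average, because j averages are an average of
    translates by products of j elements of A. With eps of order 1 / j the bound is independent of
    j. *)
Lemma iter_average_length_bound eps C (E : banach) (pi : representation G E) j x g : 0 <= eps ->
  length_bounded S eps C pi -> rnorm (pi g (iter j (rint pi fK) x)) <=
  expR (eps * (word_length S g + j * L)%:R + C) * rnorm x.
Proof.
move=> e0 pb; elim: j g => [|j IH] g; first by rewrite mul0n addn0; exact: pb.
apply: (average_translate_norm G_hausdorff mu_haar cf f_ge0 f_one) => h Ah.
apply: le_trans (IH _) _; rewrite ler_wpM2r ?rnorm_ge0 // ler_expR lerD2r ler_wpM2l //.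
rewrite ler_nat mulSn addnA leq_add2r.
by apply: leq_trans (word_lengthM S_generating g h) _; rewrite leq_add2l A_length.
Qed.

Section sequences.
Variable U : set_system nat.
Hypothesis U_ultra : UltraFilter U.
Hypothesis U_free : forall N, U [set n | (N <= n)%N].
Variables (C : R) (E : nat -> banach) (pi : forall n, representation G (E n)).
Hypothesis pi_bounded : forall n, length_bounded S n.+1%:R^-1 C (pi n).

(** This is [cocycle_average_translate] for the coboundary of x. *)
Lemma rep_average_translate (F : banach) (rho : representation G F) x g :
  rho g (rint rho fK x) - rint rho fK x =
  vector_integral mu (fun h => (fK (g^-1 * h)%g - fK h) *: (rho h x - x)).
Proof.
have c0 : is_cocycle rho (fun=> 0).
  by split=> [h|h k]; [exact: cvg_cst|rewrite linear0 addr0].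
have cb : is_cocycle rho (fun h => rho h x - x).
  rewrite (_ : (fun h => _) = (fun h => 1 *: (rho h x + 0 - x))); first exact: translate_cocycle.
  by apply/funext => h; rewrite scale1r addr0.
have <- := cocycle_average_translate G_hausdorff mu_haar cb cf f_one g.
have -> : vector_integral mu (fun h => fK h *: (rho h x - x)) = rint rho fK x - x.
  have cx : csupp A (fun h => fK h *: x) by apply: csupp_scale => // h; exact: cvg_cst.
  have := vector_integralD G_hausdorff mu_haar (- 1) cx (rep_csupp rho x cfK).
  rewrite (vector_integral_cst G_hausdorff mu_haar _ cfK).
  rewrite (density_one s G_hausdorff mu_haar cf f_one) scale1r scaleN1r addrC => <-.
  by congr (vector_integral mu _); apply/funext => h; rewrite scaleN1r scalerBr addrC.
by rewrite linearB addrA subrK opprB addrA subrK.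
Qed.

(** Averaging smooths: a bounded family becomes equicontinuous, as the displacement of its averages
    is governed by the translates of f. *)
Lemma good_average (v : families E) : bounded_family U v ->
  good_family U pi (fun n => rint (pi n) fK (v n)).
Proof.
move=> [c vc]; have [cA _ _] := cf.
have [B [cB BP]] := density_translate G_hausdorff mu_haar S_generating cfK.
have [LB LBP] := word_length_compact (R := R) G_hausdorff mu_haar S_generating cB.
pose M := expR (`|LB| + `|C|) + 1.
have MP n h x : B h -> rnorm (pi n h x - x) <= M * rnorm x.
  move=> Bh; apply: le_trans (ler_rnormB _ _) _; rewrite mulrDl mul1r lerD2r.
  apply: le_trans (rep_length_bound pi_bounded h x) _; rewrite ler_wpM2r ?rnorm_ge0 //.
  by rewrite ler_expR lerD2r; apply: le_trans (LBP h Bh) (ler_norm _).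
have M0 : 0 <= M by have := expR_ge0 (`|LB| + `|C|); rewrite /M; lra.
have vB := vol_ge0 mu B; split.
  exists (expR (1 * L%:R + `|C|) * `|c|); apply: filterS vc => n /= nc.
  have i0 : 0 <= n.+1%:R^-1 :> R by rewrite invr_ge0.
  apply: le_trans (average_length_bound G_hausdorff mu_haar i0 cf f_ge0 f_one A_length (v n) (pi_bounded (n := n))) _.
  rewrite ler_pM ?expR_ge0 ?rnorm_ge0 //; last by apply: le_trans nc (ler_norm _).
  by rewrite ler_expR lerD ?ler_norm // ler_wpM2r // invf_le1 // ler1n.
move=> e e0; have cc : 0 < M * `|c| * vol mu B + 1 by rewrite ltr_wpDl // !mulr_ge0.
have [W [nW WP]] := BP _ (divr_gt0 e0 cc); exists W; split=> //.
apply: filterS vc => n /= nc g Wg; have [cd dle] := WP g Wg; rewrite rep_average_translate.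
apply: (@le_trans _ _ (e / (M * `|c| * vol mu B + 1) * (M * `|c|) * vol mu B)).
  apply: (vector_integral_bound G_hausdorff mu_haar (A := B)).
    apply: csupp_scale => // h; apply: cvgB; last exact: cvg_cst.
    exact: rep_strongly_continuous.
  move=> h Bh; rewrite rnormZ ler_pM ?kabs_ge0 ?rnorm_ge0 //.
  apply: le_trans (MP n h _ Bh) _; rewrite ler_wpM2l //.
  exact: le_trans nc (ler_norm _).
by rewrite -mulrA mulrAC ler_pdivrMr // ler_pM2l //; lra.
Qed.

Lemma good_family_eq (v w : families E) : U [set n | v n = w n] ->
  good_family U pi w -> good_family U pi v.
Proof.
move=> vw [[c wc] weq]; split.
  by exists c; apply: filterS (filterI vw wc) => n /= [->].
move=> e e0; have [W [nW WP]] := weq e e0; exists W; split=> //.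
by apply: filterS (filterI vw WP) => n /= [->].
Qed.

Lemma up_eq (X : banach) (q : families E -> X) (rho : representation G X) (v w : families E) :
  ultraproduct_rep U C pi q rho -> good_family U pi v -> good_family U pi w ->
  U [set n | v n = w n] -> q v = q w.
Proof.
move=> UP gv gw vw; apply: rnorm_lim_unique => e e0.
apply: (@le_lt_trans _ _ 0) => //; rewrite -(upB UP) //.
apply: (up_le U_ultra UP); first exact: (good_familyB U_ultra).
by apply: filterS vw => n /= h; rewrite famB h subrr rnorm0.
Qed.

(** The hypothesis holds for each g on a set of U depending on g. Equicontinuity and compactness of
    S reduce the conclusion to finitely many g, at the cost of e. *)
Lemma almost_invariant_uniform (v : families E) : good_family U pi v -> forall r e, 0 < e ->
  (forall g, S g -> U [set n | rnorm (pi n g (v n) - v n) <= r]) ->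
  U [set n | almost_invariant S (pi n) (v n) (r + e)].
Proof.
move=> gv r e e0 Sr; have t0 : 0 < e / expR (1 + `|C|) by rewrite divr_gt0 // expR_gt0.
have [W [nW WP]] := gv.2 _ t0.
have [|m [k [Sk cov]]] := @compact_finite_subcover G S (fun x => [set y | W (x^-1 * y)%g])
    (csg_compact S_generating).
  by move=> y _; apply: lmul_nbhs; rewrite mulVg.
have U1 : U [set n | forall i, rnorm (pi n (k i) (v n) - v n) <= r].
  by apply: filter_forall => i; exact: Sr.
apply: filterS (filterI WP U1) => n /= [n1 n2] g Sg.
have [i Wi] := cov g Sg; rewrite -(mulVKg (k i) g) rep_mul.
have := ler_rdist (pi n (k i) (v n)) (pi n (k i) (pi n ((k i)^-1 * g)%g (v n))) (v n).
have h1 := rep_length_bound pi_bounded (k i) (pi n ((k i)^-1 * g)%g (v n) - v n).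
have h4 : expR ((word_length S (k i))%:R + `|C|) * rnorm (pi n ((k i)^-1 * g)%g (v n) - v n) <=
    expR (1 + `|C|) * (e / expR (1 + `|C|)).
  rewrite ler_pM ?expR_ge0 ?rnorm_ge0 //; last exact: n1.
  by rewrite ler_expR lerD2r (ler_nat R _ 1) word_length_gen.
have h5 : expR (1 + `|C|) * (e / expR (1 + `|C|)) = e by rewrite mulrC divfK // gt_eqF // expR_gt0.
rewrite linearB in h1; have := n2 i; lra.
Qed.

End sequences.

Variables (Ecl : banach_class R s) (C : R).
Hypothesis Ecl_superreflexive : forall X, Ecl X -> superreflexive X.
Hypothesis Ecl_closed : closed_under_finite_representability Ecl.
Local Notation nearby := (nearby_rep S Ecl C).

Lemma nearby_rep_mono n n' (E : banach) (pi : representation G E) : (n <= n')%N ->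
  nearby n' pi -> nearby n pi.
Proof.
move=> nn [loc pb]; have inv_le : n'.+1%:R^-1 <= n.+1%:R^-1 :> R.
  by rewrite lef_pV2 ?posrE // ler_nat.
split; first exact: local_class_mono loc.
move=> g x; apply: le_trans (pb g x) _; rewrite ler_wpM2r ?rnorm_ge0 // ler_expR lerD2r.
by rewrite ler_wpM2r.
Qed.

Variable n0 : nat.
Hypothesis contr : forall (E : banach) (pi : representation G E) b, nearby n0 pi ->
  is_cocycle pi b -> displacement_contracts S n0 pi b.

Lemma no_slow_averages (E : nat -> banach) (pi : forall n, representation G (E n))
    (x : families E) c : (forall n, nearby n (pi n)) -> (forall n, rnorm (x n) <= c) ->
  (forall n, ~ almost_invariant S (pi n) (iter (n0 + n) (rint (pi n) fK) (x n)) (1 / 2)) -> False.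
Proof.
move=> near xc far; have [U [UU Ufree]] := free_ultrafilter.
have pb n : length_bounded S n.+1%:R^-1 C (pi n) by case: (near n).
have [X [q [rho UP]]] := exists_ultraproduct G_hausdorff mu_haar S_generating UU Ufree pb.
have EX : Ecl X.
  by apply: (ultraproduct_in_class UU Ufree UP Ecl_closed) => n; case: (near n).
(* The limit representation is itself one of those to which [contr] applies, so it has a spectral
   gap. *)
have rho_near : nearby n0 rho.
  split; first by apply: local_class_incl => //; rewrite invr_gt0.
  move=> g y; apply: le_trans (up_bounded UP g y) _; rewrite ler_wpM2r ?rnorm_ge0 //.
  by rewrite ler_expR lerDr mulr_ge0 // invr_ge0.
have gap := nearby_spectral_gap S_generating (fun b => contr rho_near (b := b)) rho_near.
(* A backward orbit counted from the last average. The truncated subtraction is harmless: the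
   recursion is used for n at least k+1 only, which is a set of U. *)
pose v k : families E := fun n => iter (n0 + n - k) (rint (pi n) fK) (x n).
(* At most n0 + n averages are made, and (n0 + n) / (n + 1) is at most n0 + 1. *)
pose B := expR (n0.+1%:R * L%:R + C) * c.
have v_bound k n : rnorm (v k n) <= B.
  have i0 : 0 <= n.+1%:R^-1 :> R by rewrite invr_ge0.
  have S0 : word_length S 1%g = 0%N by apply/eqP; rewrite -leqn0; apply: word_length_le.
  have := iter_average_length_bound (n0 + n - k) (x n) 1%g i0 (pb n); rewrite rep_one S0 add0n.
  move=> /le_trans; apply; rewrite ler_pM ?expR_ge0 ?rnorm_ge0 // ler_expR lerD2r.
  rewrite natrM mulrA ler_wpM2r // ler_pdivrMl // -natrM ler_nat.
  apply: leq_trans (leq_subr _ _) _; rewrite mulSn mulnS.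
  by rewrite addnA (leq_trans _ (leq_addr _ _)) // leq_add2r.
have v_step k : U [set n | v k n = rint (pi n) fK (v k.+1 n)].
  apply: filterS (Ufree k.+1) => n /= kn; rewrite /v -iterS; congr (iter _ _ _).
  by rewrite subnSK // (leq_trans kn) // leq_addl.
have bv k : bounded_family U (v k).
  by exists B; apply: filterS (Ufree 0%N) => n _; exact: v_bound.
have gv k : good_family U pi (v k).
  exact: (good_family_eq UU (v_step k) (good_average UU pb (bv k.+1))).
pose Y k := q (v k).
have Y_avg k : Y k = rint rho fK (Y k.+1).
  have [ga qa] := ultraproduct_integral G_hausdorff mu_haar S_generating UU Ufree pb UP cfK (gv k.+1).
  by rewrite /Y -qa; apply: (up_eq UU UP).
have Y_b k : rnorm (Y k) <= B.
  by apply: (up_le UU UP) => //; apply: filterS (Ufree 0%N) => n _; exact: v_bound.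
have Xr := superreflexive_reflexive (Ecl_superreflexive EX).
(* The limit Y 0 is invariant up to 1/8, so each generator moves [v 0] by at most 1/4 on a set of U.
   Uniformity over S costs another 1/4, and 1/2 contradicts [far]. *)
have d8 : 0 < 1 / 8 :> R by rewrite divr_gt0.
have d4 : 0 < 1 / 4 :> R by rewrite divr_gt0.
have Yinv := backward_orbit_invariant G_hausdorff G_separable mu_haar S_generating cf f_ge0 f_pos
  f_one Xr (up_bounded UP) gap Y_b Y_avg d8.
have v_inv g : S g -> U [set n | rnorm (pi n g (v 0%N n) - v 0%N n) <= 1 / 4].
  move=> Sg; have ga := good_action UU pb g (gv 0%N).
  have : rnorm (q (action pi g (v 0%N) - v 0%N)) < 1 / 4.
    by rewrite (upB UP) // -(up_action UP) //; apply: le_lt_trans (Yinv g Sg) _; lra.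
  move=> /(up_lt UU UP (good_familyB UU ga (gv 0%N))).
  by apply: filterS => n /= /ltW.
have := almost_invariant_uniform UU pb (gv 0%N) d4 v_inv.
move=> /filter_ex[n ninv]; apply: (far n) => g Sg; have := ninv g Sg.
rewrite /v subn0; lra.
Qed.

Lemma exists_average_contraction : exists2 n, (n0 <= n)%N &
  forall (E : banach) (pi : representation G E), nearby n pi -> forall x r, 0 < r ->
  almost_invariant S pi x r -> almost_invariant S pi (iter n (rint pi fK) x) (r / 2).
Proof.
apply: contrapT => no.
have far n : exists p : {E : banach & (representation G E * E)%type}, [/\ nearby (n0 + n) (projT2 p).1,
    rnorm (projT2 p).2 <= 2 * n0.+1%:R &
    ~ almost_invariant S (projT2 p).1 (iter (n0 + n) (rint (projT2 p).1 fK) (projT2 p).2) (1 / 2)].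
  apply: contrapT => noex; apply: no; exists (n0 + n)%N; first exact: leq_addr.
  move=> E pi near x r r0 xr; apply: contrapT => ninv; apply: noex.
  have near0 := nearby_rep_mono (leq_addr n n0) near.
  have [y yinv yx] := nearby_spectral_gap S_generating (fun b => contr near0 (b := b)) near0 r0 xr.
  (* Subtracting the nearby invariant vector given by the spectral gap, which averages fix, makes
     the counterexample bounded after division by r, as [no_slow_averages] requires. *)
  exists (existT _ E (pi, emb s r^-1 *: (x - y))) => /=; split=> //.
    rewrite rnormZe ger0_norm ?invr_ge0 ?(ltW r0) // mulrC ler_pdivrMr // rdistC //.
  apply: contra_not ninv => h g Sg; have := h g Sg.
  have -> : iter (n0 + n) (rint pi fK) (emb s r^-1 *: (x - y)) =
      emb s r^-1 *: (iter (n0 + n) (rint pi fK) x - y).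
    have iterZ z : iter (n0 + n) (rint pi fK) (emb s r^-1 *: z) =
        emb s r^-1 *: iter (n0 + n) (rint pi fK) z.
      have lin := @iter_average_linear R s G mu G_hausdorff mu_haar A f cf E pi (n0 + n).
      have iter0 : iter (n0 + n) (rint pi fK) 0 = 0.
        have := lin 1 0 0; rewrite !scale1r addr0 => h0.
        by apply: (@addrI _ (iter (n0 + n) (rint pi fK) 0)); rewrite addr0 -h0.
      by rewrite -[_ *: z]addr0 lin iter0 addr0.
    rewrite iterZ (iter_averageB G_hausdorff mu_haar cf); congr (_ *: (_ - _)).
    elim: (n0 + n)%N => //= j ->.
    exact: (average_invariant G_hausdorff mu_haar cf f_one).
  rewrite linearZ -scalerBr (linearB (pi g)) yinv opprB addrA subrK rnormZe ger0_norm ?invr_ge0 ?(ltW r0) //.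
  by rewrite mulrC ler_pdivrMr // mulrC mul1r.
have [p pP] := choice far.
apply: (@no_slow_averages (fun n => projT1 (p n)) (fun n => (projT2 (p n)).1)
  (fun n => (projT2 (p n)).2) (2 * n0.+1%:R)) => n; have [h1 h2 h3] := pP n => //.
exact: nearby_rep_mono (leq_addl n0 n) h1.
Qed.

End averages_nearby.

(** * Implications between the conditions *)

Section restriction.
Variables (R : realType) (s : scalars) (G : topGroupType).
Variable mu : {measure set (borel G) -> \bar R}.
Local Notation K := (scalar_field R s).
Local Notation banach := (completeNormedModType K).
Variables F F' : rep_class R s G.
Hypothesis F'F : forall (E : banach) (pi : representation G E), F' pi -> F pi.

Lemma F_norm_restrict (f : G -> K) : (F_norm mu F' f <= F_norm mu F f)%E.
Proof.
apply: ge_ereal_sup => _ [->|[E [pi [Fpi ->]]]]; first by apply: ereal_sup_ubound; left.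
by apply: ereal_sup_ubound; right; exists E, pi; split=> //; exact: F'F.
Qed.

Lemma completion_dist_restrict (a b : nat -> G -> K) :
  (completion_dist mu F' a b <= completion_dist mu F a b)%E.
Proof. by apply: limn_esup_mono => n; exact: F_norm_restrict. Qed.

Lemma completion_restrict (p : completion mu F) : exists p' : completion mu F',
  Defs.approx p' = Defs.approx p.
Proof.
unshelve eexists (@Completion R s G mu F' (Defs.approx p) (approx_Cc p) _) => // e e0.
have [N NP] := approx_cauchy p e0; exists N => n k Nn Nk.
exact: le_lt_trans (F_norm_restrict _) (NP n k Nn Nk).
Qed.

Lemma kazhdan_restrict : has_kazhdan_projection mu F -> has_kazhdan_projection mu F'.
Proof.
move=> [p [pid pone pproj]]; have [p' pE] := completion_restrict p; exists p'; split.
- apply/eqP; rewrite eq_le completion_dist_ge0 andbT -pid pE; exact: completion_dist_restrict.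
- move=> e /pone[f [fC f1 fe]]; exists f; split; [exact: fC|exact: f1|rewrite pE].
  by apply: le_lt_trans fe; apply: completion_dist_restrict.
- by move=> E pi /F'F/pproj; rewrite /completion_rep pE.
Qed.

End restriction.

Section implications.
Variables (R : realType) (s : scalars) (G : topGroupType).
Variable mu : {measure set (borel G) -> \bar R}.
Hypothesis G_hausdorff : hausdorff_space G.
Hypothesis G_separable : separable_space G.
Hypothesis G_locally_compact : locally_compact [set: G].
Hypothesis mu_haar : left_haar mu.
Variable S : set G.
Hypothesis S_generating : compact_symmetric_generating S.
Local Notation K := (scalar_field R s).
Local Notation banach := (completeNormedModType K).
Variable Ecl : banach_class R s.
Hypothesis Ecl_superreflexive : forall X, Ecl X -> superreflexive X.
Hypothesis Ecl_closed : closed_under_finite_representability Ecl.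

Lemma word_length_compact_nat (A : set G) : compact A ->
  exists L, forall g, A g -> (word_length S g <= L)%N.
Proof.
move=> /(word_length_compact (R := R) G_hausdorff mu_haar S_generating)[c cP].
exists (Num.truncn `|c|).+1 => g /cP gc; rewrite -(ler_nat R).
by apply: le_trans gc _; apply: le_trans (ler_norm c) _; apply/ltW/truncnS_gt.
Qed.

Lemma nearby_rep_class n C (E : banach) (pi : representation G E) :
  rep_class_length S (local_class Ecl n.+1 n.+1%:R^-1) n.+1%:R^-1 C pi -> nearby_rep S Ecl C n pi.
Proof.
move=> Fpi; split; last exact: rep_class_length_bounded Fpi.
by have [[Y EY iso] _] := Fpi; exact: local_class_isometric EY iso.
Qed.

Lemma property_FE_condition2 : property_FE G Ecl -> forall C, exists N eps,
  0 < eps /\ condition2 S mu Ecl C N eps.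
Proof.
move=> FE C.
have [A [f [cf f_ge0 f_one f_pos]]] := exists_density G_hausdorff mu_haar S_generating G_locally_compact.
have [L LP] := word_length_compact_nat (cs_compact cf).
have [n0 contr] := exists_displacement_contraction G_hausdorff mu_haar S_generating C Ecl_closed cf f_one FE.
have [n n0n avg] := exists_average_contraction G_hausdorff G_separable mu_haar S_generating cf f_ge0
  f_pos f_one LP Ecl_superreflexive Ecl_closed contr.
have i0 : 0 < n.+1%:R^-1 :> R by rewrite invr_gt0.
exists n.+1, n.+1%:R^-1; split=> //; split=> [|E pi /nearby_rep_class near].
  apply: (kazhdan_of_contraction G_hausdorff mu_haar S_generating (ltW i0) cf f_ge0 f_one LP (n := n) (C := C)).
    by move=> E pi; exact: rep_class_length_bounded.
  by move=> E pi /nearby_rep_class; exact: avg.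
have near0 := nearby_rep_mono n0n near.
apply: (nearby_H1 S_generating _ near0) => b; exact: contr.
Qed.

Lemma rep_class_length_mono (D D' : banach_class R s) eps C (E : banach) (pi : representation G E) :
  (forall X, D X -> D' X) -> rep_class_length S D eps C pi -> rep_class_length S D' eps C pi.
Proof. by move=> DD [[Y DY iso] pb]; split=> //; exists Y => //; exact: DD. Qed.

Lemma condition2_condition3 C N eps : 0 < eps -> condition2 S mu Ecl C N eps ->
  condition3 S mu Ecl C eps.
Proof.
move=> e0 [kaz h1]; have incl X : Ecl X -> local_class Ecl N eps X by exact: local_class_incl.
split=> [|E pi Fpi]; last by apply: h1; exact: rep_class_length_mono Fpi.
by apply: kazhdan_restrict kaz => E pi; exact: rep_class_length_mono.
Qed.

Lemma isometric_refl (X : banach) : isometric_spaces X X.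
Proof.
have [T TE] := @exists_linear K X X id (fun a x y => erefl).
by exists T; split=> [x|y]; [rewrite TE|exists y; rewrite TE].
Qed.

Lemma uniformly_bounded_class (E : banach) (pi : representation G E) : Ecl E ->
  uniformly_bounded pi -> exists2 C, 0 < C & forall eps, 0 <= eps -> rep_class_length S Ecl eps C pi.
Proof.
move=> EE ub; have le_sup g : (opnorm setT (pi g) <= ereal_sup (range (fun g => opnorm setT (pi g))))%E.
  by apply: ereal_sup_ubound; exists g.
move: ub le_sup; rewrite /uniformly_bounded; case: (ereal_sup _) => [c _|//|_] le_sup; last first.
  by have := le_trans (opnorm_ge0 _ _) (le_sup 1%g); rewrite leNgt ltNyr.
exists (`|c| + 1) => [|eps e0]; first by rewrite ltr_wpDl.
split; first by exists E => //; exact: isometric_refl.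
move=> g; apply: le_trans (le_sup g) _; rewrite lee_fin.
have := expR_ge1Dx (eps * (word_length S g)%:R + (`|c| + 1)).
have : 0 <= eps * (word_length S g)%:R by rewrite mulr_ge0.
have := ler_norm c; lra.
Qed.

Lemma condition3_property_FE : (forall C, 0 < C -> exists eps, 0 < eps /\ condition3 S mu Ecl C eps) ->
  property_FE G Ecl.
Proof.
move=> h3 E pi EE ub; have [C C0 FC] := uniformly_bounded_class EE ub.
by have [eps [e0 [_ h1]]] := h3 C C0; apply: h1; apply: FC; exact: ltW.
Qed.

End implications.

(** * Sums with a line inside the class *)

Section extensions.
Variables (R : realType) (s : scalars).
Local Notation K := (scalar_field R s).
Local Notation banach := (completeNormedModType K).

(** Riesz's lemma: take z outside the span, subtract a point of the span whose distance to z is less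
    than twice the least one, and normalise. The least distance is positive because z extends a
    basis of the span to a free family. *)
Lemma far_unit_vector (Z : banach) m (v : 'I_m -> Z) : infinite_dimensional Z ->
  exists e : Z, rnorm e <= 1 /\ forall c : 'I_m -> K, 1 / 2 <= rnorm (e - \sum_(i < m) c i *: v i).
Proof.
move=> infZ; have Vm : subspace_dim_le m (span v) by exists v.
have [k [w [_ vw wfree]]] := independent_spanning Vm.
have [z zspan] : exists z, ~ span w z.
  apply: contrapT => no; apply: (infZ k); exists w; apply/seteqP; split=> // x _.
  by apply: contrapT => xw; apply: no; exists x.
have [a a0 aP] : exists2 a, 0 < a & forall c : 'I_k -> K, a <= rnorm (z - \sum_(i < k) c i *: w i).
  pose zw (i : 'I_k.+1) := if unlift ord_max i is Some j then w j else z.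
  have zwE c : \sum_(i < k.+1) c i *: zw i =
      \sum_(i < k) c (lift ord_max i) *: w i + c ord_max *: z.
    rewrite big_ord_recr /= /zw unlift_none; congr (_ + _); apply: eq_bigr => i _.
    have -> : widen_ord (leqnSn k) i = lift ord_max i by apply: val_inj; rewrite /= /bump leqNgt ltn_ord.
    by rewrite liftK.
  have zwfree c : \sum_(i < k.+1) c i *: zw i = 0 -> forall i, c i = 0.
    rewrite zwE => c0; have cm : c ord_max = 0.
      apply/eqP; apply: contrapT => /negP cm; apply: zspan.
      exists (fun i => - (c ord_max)^-1 * c (lift ord_max i)) => //.
      have : - (c ord_max)^-1 *: (\sum_(i < k) c (lift ord_max i) *: w i) = z.
        move/eqP: c0; rewrite addr_eq0 => /eqP ->.
        by rewrite scalerN scaleNr opprK scalerA mulVf // scale1r.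
      by rewrite scaler_sumr; under eq_bigr do rewrite scalerA.
    move: c0; rewrite cm scale0r addr0 => /wfree cw i.
    by case: (unliftP ord_max i) => [j ->|->].
  have [a a0 aP] := independent_coordinates_bound zwfree; exists a => // c.
  have := aP (fun i => if unlift ord_max i is Some j then - c j else 1) ord_max.
  rewrite unlift_none kabs1 mulr1 zwE unlift_none scale1r.
  by under eq_bigr do rewrite liftK scaleNr; rewrite sumrN addrC.
pose dists := [set r | exists c : 'I_k -> K, r = rnorm (z - \sum_(i < k) c i *: w i)].
have dinf : has_inf dists.
  by split; [exists (rnorm (z - \sum_(i < k) 0 *: w i)); exists (fun=> 0)|exists a => _ [c ->]].
have d0 : 0 < inf dists.
  by apply: lt_le_trans a0 _; apply: lb_le_inf; [case: dinf|move=> _ [c ->]].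
have [_ [c ->] cd] := inf_adherent d0 dinf.
set z0 := \sum_(i < k) c i *: w i in cd; set r := rnorm (z - z0) in cd.
have rd : inf dists <= r by apply: (ge_inf dinf.2); exists c.
have r0 : 0 < r by lra.
exists (emb s r^-1 *: (z - z0)); split=> [|c'].
  by rewrite rnormZe ger0_norm ?invr_ge0 ?(ltW r0) // -/r mulVf // gt_eqF.
have [c'' _ c''E] : span w (\sum_(i < m) c' i *: v i) by rewrite -vw; exists c'.
have : inf dists <= rnorm (z - \sum_(i < k) (c i + emb s r * c'' i) *: w i).
  by apply: (ge_inf dinf.2); eexists.
rewrite -c''E; have -> : z - \sum_(i < k) (c i + emb s r * c'' i) *: w i =
    emb s r *: (emb s r^-1 *: (z - z0) - \sum_(i < k) c'' i *: w i).
  rewrite scalerBr scalerA -embM mulfV ?gt_eqF // emb1 scale1r /z0 -addrA -opprD; congr (_ - _).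
  rewrite scaler_sumr -big_split; apply: eq_bigr => i _.
  by rewrite scalerDl scalerA.
rewrite rnormZe ger0_norm ?(ltW r0) // -ler_pdivrMl // => h; apply: le_trans h.
by rewrite ler_pdivlMl //; lra.
Qed.

Lemma exists_far_sequence (Z : banach) : infinite_dimensional Z -> exists e : nat -> Z,
  (forall n, rnorm (e n) <= 1) /\
  forall n (c : 'I_n -> K), 1 / 2 <= rnorm (e n - \sum_(i < n) c i *: e i).
Proof.
move=> infZ; have [next nextP] := choice (fun p : nat * seq Z =>
  far_unit_vector (fun i : 'I_p.1 => nth 0 p.2 i) infZ).
pose l := nat_rect (fun=> seq Z) [::] (fun n t => rcons t (next (n, t))).
pose e n := next (n, l n).
have lS n : l n.+1 = rcons (l n) (e n) by [].
have lsize n : size (l n) = n by elim: n => // n IH; rewrite lS size_rcons IH.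
have lnth n i : (i < n)%N -> nth 0 (l n) i = e i.
  elim: n => // n IH; rewrite lS nth_rcons lsize ltnS leq_eqVlt => /orP[/eqP ->|i_n].
    by rewrite ltnn eqxx.
  by rewrite i_n IH.
exists e; split=> [n|n c]; first by case: (nextP (n, l n)).
have [_ /(_ c)] := nextP (n, l n) => /=.
by under eq_bigr => i _ do rewrite lnth //.
Qed.

Section one_extension.
Variables (U : set_system nat) (Z E : banach) (T : {linear E -> Z}) (e : nat -> Z) (a a' d : R).
Hypothesis U_ultra : UltraFilter U.
Hypothesis U_free : forall N, U [set n | (N <= n)%N].
Hypotheses (a_gt0 : 0 < a) (d_gt0 : 0 < d).
Hypothesis T_lower : forall x, a * rnorm x <= rnorm (T x).
Hypothesis T_upper : forall x, rnorm (T x) <= a' * rnorm x.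
Hypothesis e_le1 : forall n, rnorm (e n) <= 1.
(** The norm of E + K in which the new coordinate is a vector e n seen from infinity. Finite
    dimensional subspaces for this norm are nearly subspaces of Z, whence membership in the class;
    [e_far] prevents the new coordinate from collapsing into E. *)
Let p (y : E * K^o) := ulimit U (fun n => rnorm (T y.1 + (y.2 : K) *: e n)).
Hypothesis e_far : forall x (t : K), d * kabs t <= p (x, t).

Let bound (y : E * K^o) n : rnorm (T y.1 + (y.2 : K) *: e n) <= a' * rnorm y.1 + kabs (y.2 : K).
Proof.
apply: le_trans (ler_rnormD _ _) _; rewrite rnormZ lerD //.
by rewrite ler_piMr ?kabs_ge0.
Qed.

Let p_near (y : E * K^o) r : 0 < r -> U [set n | `|rnorm (T y.1 + (y.2 : K) *: e n) - p y| < r].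
Proof.
apply: (@ulimitP _ _ _ _ (a' * rnorm y.1 + kabs (y.2 : K))).
by apply: filterS (U_free 0) => n _ /=; rewrite ger0_norm ?rnorm_ge0.
Qed.

Let p_upper (y : E * K^o) : p y <= a' * rnorm y.1 + kabs (y.2 : K).
Proof.
apply: (@ulimit_le _ _ _ _ (a' * rnorm y.1 + kabs (y.2 : K))).
  by apply: filterS (U_free 0) => n _ /=; rewrite ger0_norm ?rnorm_ge0.
by apply: filterS (U_free 0) => n _; exact: bound.
Qed.

Let p_lower (y : E * K^o) : a * rnorm y.1 <= p y + kabs (y.2 : K).
Proof.
apply/ler_addgt0Pr => r r0; have [n /= /ltW h] := filter_ex (p_near y r0).
have h1 := T_lower y.1; have h2 := ler_rnormB (T y.1 + (y.2 : K) *: e n) ((y.2 : K) *: e n).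
rewrite addrK rnormZ in h2; have h3 : kabs (y.2 : K) * rnorm (e n) <= kabs (y.2 : K).
  by rewrite ler_piMr ?kabs_ge0.
by move: h; rewrite ler_norml => /andP[_]; lra.
Qed.

Lemma exists_extension (Ecl : banach_class R s) : closed_under_finite_representability Ecl ->
  Ecl Z -> exists (F : banach) (q : E * K^o -> F) (m1 m2 : R),
  [/\ Ecl F, 0 < m1, 0 < m2,
      [/\ forall (k : K) y z, q (k *: y + z) = k *: q y + q z & forall y, exists x, q x = y] &
      forall y, m1 * (rnorm y.1 + kabs (y.2 : K)) <= rnorm (q y) <= m2 * (rnorm y.1 + kabs (y.2 : K))].
Proof.
(* From d |t| <= p and a |x| <= p + |t| one gets |x| + |t| <= c p; the norm p is therefore
   equivalent to the sum norm, which provides completeness. *)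
move=> Ecl_closed EZ; pose c := a^-1 * (1 + d^-1) + d^-1.
have c0 : 0 < c by rewrite addr_gt0 ?mulr_gt0 ?invr_gt0 ?addr_gt0 ?invr_gt0.
have p_t y : kabs (y.2 : K) <= d^-1 * p y.
  by rewrite mulrC ler_pdivlMr // mulrC; have := e_far y.1 y.2; rewrite -surjective_pairing.
have p_all y : rnorm y.1 + kabs (y.2 : K) <= c * p y.
  have h1 := p_t y; have h2 := p_lower y.
  have h3 : rnorm y.1 <= a^-1 * (p y + kabs (y.2 : K)) by rewrite mulrC ler_pdivlMr // mulrC.
  have h4 : a^-1 * (p y + kabs (y.2 : K)) <= a^-1 * (p y + d^-1 * p y).
    by rewrite ler_wpM2l ?invr_ge0 ?(ltW a_gt0) //; lra.
  by rewrite /c; move: (a^-1) (d^-1) h1 h3 h4 => u v; lra.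
have [|F [q [qlin qp qonto]]] := @quotient_banachP R s (E * K^o)%type setT p.
  split=> //.
  - move=> x y _ _; apply/ler_addgt0Pr => r r0; have r3 : 0 < r / 3 by rewrite divr_gt0.
    have [n /= [[h1 h2] h3]] := filter_ex (filterI (filterI (p_near x r3) (p_near y r3)) (p_near (x + y) r3)).
    have := ler_rnormD (T x.1 + (x.2 : K) *: e n) (T y.1 + (y.2 : K) *: e n).
    rewrite addrACA -linearD -scalerDl.
    change (rnorm (T (x + y).1 + ((x + y).2 : K) *: e n) <= rnorm (T x.1 + (x.2 : K) *: e n) +
      rnorm (T y.1 + (y.2 : K) *: e n) -> p (x + y) <= p x + p y + r).
    by move: h1 h2 h3; rewrite !ltr_norml => /andP[? ?] /andP[? ?] /andP[? ?]; lra.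
  - move=> k x _; have h : U [set n | `|rnorm (T x.1 + (x.2 : K) *: e n)| <= a' * rnorm x.1 + kabs (x.2 : K)].
      by apply: filterS (U_free 0) => n _ /=; rewrite ger0_norm ?rnorm_ge0.
    rewrite /p -(ulimitZ U_ultra (kabs k) h); congr (ulimit U); apply/funext => n.
    by rewrite linearZ /= -rnormZ scalerDr scalerA.
  move=> u _ uc; have step k : rnorm ((u k.+1 - u k).1) + kabs ((u k.+1 - u k).2 : K) <= c * 2^-1 ^+ k.
    by apply: le_trans (p_all _) _; rewrite ler_wpM2l // ltW.
  have s1 k : rnorm ((u k.+1).1 - (u k).1) <= c * 2^-1 ^+ k.
    by have := step k; have := kabs_ge0 ((u k.+1 - u k).2 : K); rewrite /=; lra.
  have s2 k : kabs ((u k.+1).2 - (u k).2 : K) <= c * 2^-1 ^+ k.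
    by have := step k; have := rnorm_ge0 ((u k.+1 - u k).1); rewrite /=; lra.
  have [l1 [_ l1P]] := geometric_cvg s1; have [l2 l2P] := scalar_geometric_cvg s2.
  exists (l1, l2) => // r r0; have C0 : 0 < `|a'| * (2 * c) + 4 * c + 1.
    by rewrite ltr_wpDl // addr_ge0 ?mulr_ge0 // ltW.
  have [N] := half_expn_small (divr_gt0 r0 C0); rewrite ltr_pdivlMr // => NP.
  exists N => k Nk; have kN : (2^-1 : R) ^+ k <= 2^-1 ^+ N.
    by rewrite ler_wiXn2l // ?invr_ge0 // invf_le1 // ler1n.
  have k0 : 0 <= (2^-1 : R) ^+ k by rewrite exprn_ge0 // invr_ge0.
  apply: le_lt_trans (p_upper _) _ => /=.
  have h1 := l1P k; have h2 := l2P k; rewrite rdistC in h1; rewrite -kabsN opprB in h2.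
  have h3 : a' * rnorm ((u k).1 - l1) <= `|a'| * (2 * c * 2^-1 ^+ k).
    apply: (@le_trans _ _ (`|a'| * rnorm ((u k).1 - l1))).
      by rewrite ler_wpM2r ?rnorm_ge0 // ler_norm.
    by rewrite ler_wpM2l.
  have h4 : 2^-1 ^+ k * (`|a'| * (2 * c) + 4 * c + 1) <= 2^-1 ^+ N * (`|a'| * (2 * c) + 4 * c + 1).
    by rewrite ler_wpM2r // ltW.
  have h5 : kabs ((u k).2 - l2 : K) <= 4 * c * 2^-1 ^+ k := h2.
  move: (2^-1 ^+ k) (2^-1 ^+ N) k0 NP h3 h4 h5 => x y k0 NP h3 h4 h5; lra.
have [ql qlE] := exists_linear (fun k x y => qlin k x y I I).
exists F, q, c^-1, (`|a'| + 1); split; last first.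
- move=> y; rewrite qp // ler_pdivrMl // p_all /=; apply: le_trans (p_upper y) _.
  have := kabs_ge0 (y.2 : K); have := rnorm_ge0 y.1; have := ler_norm a'; have := normr_ge0 a'.
  by move: (`|a'|) (rnorm y.1) (kabs _) => A X Y; nra.
- split=> [k y z|y]; first exact: qlin.
  by have [x _ <-] := qonto y; exists x.
- by rewrite ltr_wpDl.
- by rewrite invr_gt0.
have rep_ex x : exists y, q y = x by have [y _ <-] := qonto x; exists y.
have [rp rpE] := choice rep_ex.
have phi_ex n : exists phi : {linear (E * K^o)%type -> Z},
    forall y : E * K^o, phi y = T y.1 + (y.2 : K) *: e n.
  apply: exists_linear => k x y /=; rewrite linearP scalerDl scalerDr -scalerA.
  by rewrite addrACA.
have [phi phiE] := choice phi_ex.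
apply: (@ultralimit_in_class R s Ecl Ecl_closed U U_ultra (fun=> Z) F (fun x n => phi n (rp x))).
  by move=> N eps eps0; apply: filterS (U_free 0) => n _; exact: local_class_incl.
move=> m v k r r0; set y := \sum_(i < m) k i *: rp (v i).
have -> : \sum_(i < m) k i *: v i = q y.
  rewrite -qlE linear_sum; apply: eq_bigr => i _.
  by rewrite linearZ /= qlE rpE.
rewrite qp //; apply: filterS (p_near y r0) => n /=; rewrite -phiE.
have -> // : phi n y = \sum_(i < m) k i *: phi n (rp (v i)).
by rewrite /y linear_sum; apply: eq_bigr => i _; rewrite linearZ.
Qed.

End one_extension.
Lemma far_sequence_lower (Z : banach) (e : nat -> Z) :
  (forall n (c : 'I_n -> K), 1 / 2 <= rnorm (e n - \sum_(i < n) c i *: e i)) ->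
  forall n (c : 'I_n -> K) t, 1 / 2 * kabs t <= rnorm (\sum_(i < n) c i *: e i + t *: e n).
Proof.
move=> efar n c t; have [->|t0] := eqVneq t 0; first by rewrite kabs0 mulr0 rnorm_ge0.
have -> : \sum_(i < n) c i *: e i + t *: e n = t *: (e n - \sum_(i < n) (- t^-1 * c i) *: e i).
  rewrite scalerBr addrC scaler_sumr -sumrN; congr (_ + _); apply: eq_bigr => i _.
  by rewrite scalerA mulrA mulrN mulfV // mulN1r scaleNr opprK.
by rewrite rnormZ mulrC ler_wpM2l ?kabs_ge0.
Qed.

Lemma far_sequence_free (Z : banach) (e : nat -> Z) :
  (forall n (c : 'I_n -> K), 1 / 2 <= rnorm (e n - \sum_(i < n) c i *: e i)) ->
  forall n (c : 'I_n -> K), \sum_(i < n) c i *: e i = 0 -> forall i, c i = 0.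
Proof.
move=> efar; elim=> [c _ []//|n IH] c; rewrite big_ord_recr /= => c0.
have := far_sequence_lower efar (fun i => c (widen_ord (leqnSn n) i)) (c ord_max).
rewrite c0 rnorm0 => h; have cn : c ord_max = 0.
  by apply: kabs_eq0; apply/eqP; rewrite eq_le kabs_ge0 andbT; lra.
move: c0; rewrite cn scale0r addr0 => /IH cw i.
have [j ->|->] := unliftP ord_max i => //.
by rewrite -(cw j); congr c; apply: val_inj; rewrite /= /bump leqNgt ltn_ord.
Qed.

(** If E is infinite dimensional, the new direction is taken in E, along a sequence whose terms are
    far from the spans of their predecessors. If not, a basis of E is sent to the first terms of
    such a sequence in Z and the next term is the new direction. Only an isomorphism with E + K is
    obtained, not an isometry. *)
Lemma exists_product_in_class (Ecl : banach_class R s) (E Z : banach) :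
  closed_under_finite_representability Ecl -> Ecl E -> Ecl Z -> infinite_dimensional Z ->
  exists (F : banach) (q : E * K^o -> F) (m1 m2 : R),
  [/\ Ecl F, 0 < m1, 0 < m2,
      [/\ forall (k : K) y z, q (k *: y + z) = k *: q y + q z & forall y, exists x, q x = y] &
      forall y, m1 * (rnorm y.1 + kabs (y.2 : K)) <= rnorm (q y) <= m2 * (rnorm y.1 + kabs (y.2 : K))].
Proof.
move=> Ecl_closed EE EZ infZ; have [U [UU Ufree]] := free_ultrafilter.
have [infE|finE] := pselect (infinite_dimensional E).
  have [e [e1 efar]] := exists_far_sequence infE; have elow := far_sequence_lower efar.
  have [T TE] := @exists_linear K E E id (fun a x y => erefl).
  have d4 : 0 < 1 / 4 :> R by rewrite divr_gt0.
  apply: (@exists_extension U E E T e 1 1 (1 / 4) UU Ufree ltr01 d4 _ _ e1 _ Ecl Ecl_closed EE).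
  - by move=> x; rewrite TE mul1r.
  - by move=> x; rewrite TE mul1r.
  (* If the limit were below |t| / 4, two indices n < n' would give t e n' - t e n norm below |t| /
     2, against the choice of e n'. *)
  move=> x t; rewrite leNgt; apply/negP => far.
  have xb : U [set n | `|rnorm (T x + t *: e n)| <= rnorm x + kabs t].
    apply: filterS (Ufree 0%N) => n _ /=; rewrite ger0_norm ?rnorm_ge0 // TE.
    by apply: le_trans (ler_rnormD _ _) _; rewrite lerD // rnormZ ler_piMr ?kabs_ge0.
  have r0 : 0 < 1 / 4 * kabs t - ulimit U (fun n => rnorm (T x + t *: e n)) by rewrite subr_gt0.
  have Ux := ulimitP UU xb r0; have [n /= nP] := filter_ex Ux.
  have [n' /= [n'P nn']] := filter_ex (filterI Ux (Ufree n.+1)).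
  have := elow n' (fun i => if i == Ordinal nn' then - t else 0) t.
  rewrite (bigD1 (Ordinal nn')) //= eqxx big1 ?addr0; last first.
    by move=> i /negbTE ->; rewrite scale0r.
  have -> : - t *: e n + t *: e n' = (T x + t *: e n') - (T x + t *: e n).
    by rewrite opprD addrACA subrr add0r addrC scaleNr.
  have := ler_rnormB (T x + t *: e n') (T x + t *: e n).
  by move: nP n'P; rewrite !ltr_norml => /andP[_ h1] /andP[_ h2]; lra.
have [n En] : exists n, subspace_dim_le n [set: E].
  by apply: contrapT => no; apply: finE => n h; apply: no; exists n.
have [m [v [_ Ev vfree]]] := independent_spanning En.
have [e [e1 efar]] := exists_far_sequence infZ; have elow := far_sequence_lower efar.
have [al al0 alP] := independent_coordinates_bound vfree.
have [be be0 beP] := independent_coordinates_bound (@far_sequence_free Z e efar m).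
have coord_ex x : exists c : 'I_m -> K, \sum_(i < m) c i *: v i = x.
  have : [set: E] x by []. 
  by rewrite Ev => -[c _ <-]; exists c.
have [co coE] := choice coord_ex.
have [T TE] : exists T : {linear E -> Z}, forall x, T x = \sum_(i < m) co x i *: e i.
  apply: exists_linear => k x y; rewrite scaler_sumr -big_split; apply: eq_bigr => i _ /=.
  rewrite scalerA -scalerDl; congr (_ *: _); apply/eqP; rewrite -subr_eq0; apply/eqP.
  apply: (vfree (fun i => co (k *: x + y) i - (k * co x i + co y i))).
  under eq_bigr do rewrite scalerBl scalerDl -scalerA.
  by rewrite sumrB big_split -scaler_sumr !coE subrr.
pose sv := \sum_(i < m) rnorm (v i); have sv0 : 0 <= sv by apply: sumr_ge0 => i _; exact: rnorm_ge0.
have a0 : 0 < be / (sv + 1) by rewrite divr_gt0 // ltr_wpDl.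
have d2 : 0 < 1 / 2 :> R by rewrite divr_gt0.
apply: (@exists_extension U Z E T (fun=> e m) (be / (sv + 1)) (m%:R / al) (1 / 2)
  UU Ufree a0 d2 _ _ _ _ Ecl Ecl_closed EZ) => //.
- move=> x; rewrite mulrAC ler_pdivrMr ?ltr_wpDl //.
  apply: (@le_trans _ _ (rnorm (T x) * sv)); last by rewrite ler_wpM2l ?rnorm_ge0 // lerDl.
  rewrite -{1}(coE x); apply: (@le_trans _ _ (be * \sum_(i < m) kabs (co x i) * rnorm (v i))).
    rewrite ler_wpM2l ?(ltW be0) //; apply: le_trans (ler_rnorm_sum _ _ _) _.
    by under eq_bigr do rewrite rnormZ.
  rewrite !mulr_sumr ler_sum // => i _; rewrite mulrA ler_wpM2r ?rnorm_ge0 // TE.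
  exact: (beP (co x) i).
- move=> x; rewrite TE; apply: le_trans (ler_rnorm_sum _ _ _) _.
  apply: (@le_trans _ _ (\sum_(i < m) rnorm x / al)); last first.
    by rewrite sumr_const card_ord -[leLHS]mulr_natl mulrA mulrAC.
  apply: ler_sum => i _; rewrite rnormZ ler_pdivlMr //.
  apply: (@le_trans _ _ (al * kabs (co x i))); last by rewrite -{2}(coE x); exact: alP.
  by rewrite mulrC ler_wpM2l ?(ltW al0) // ler_piMr ?kabs_ge0.
move=> x t; apply: (@ulimit_ge _ _ _ _ (rnorm (T x + t *: e m))).
  by apply: filterS (Ufree 0%N) => k _ /=; rewrite ger0_norm ?rnorm_ge0.
by apply: filterS (Ufree 0%N) => k _ /=; rewrite TE; exact: elow.
Qed.

End extensions.

(** * Kazhdan projections and invariant functionals *)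

Section projections.
Variables (R : realType) (s : scalars) (G : topGroupType).
Variable mu : {measure set (borel G) -> \bar R}.
Hypothesis G_hausdorff : hausdorff_space G.
Hypothesis mu_haar : left_haar mu.
Local Notation K := (scalar_field R s).
Local Notation banach := (completeNormedModType K).
Local Notation rint := (rep_integral mu).
Local Notation sintegral := (@scalar_integral R s G mu).
Variable F : rep_class R s G.

Lemma rint_Cc_dist (f h : G -> K) c (E : banach) (pi : representation G E) x : Cc f -> Cc h ->
  F pi -> (F_norm mu F (f \- h)%R <= c%:E)%E -> rnorm (rint pi f x - rint pi h x) <= c * rnorm x.
Proof.
move=> /(CcP G_hausdorff)[A cf] /(CcP G_hausdorff)[B ch] Fpi fh.
by rewrite -(rintBf G_hausdorff mu_haar pi x cf ch); exact: (le_F_norm fh Fpi).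
Qed.

Lemma completion_rep_cvg (p : completion mu F) (E : banach) (pi : representation G E) x : F pi ->
  rint pi (p n) x @[n --> \oo] --> completion_rep pi p x.
Proof.
move=> Fpi; have [|l pl] := @cauchy_seq_cvg R s E (fun n => rint pi (p n) x).
  move=> e e0; have x1 : 0 < rnorm x + 1 by rewrite ltr_wpDl ?rnorm_ge0.
  have [N NP] := approx_cauchy p (divr_gt0 e0 x1); exists N => n k Nn Nk.
  apply: le_lt_trans (rint_Cc_dist x (approx_Cc p n) (approx_Cc p k) Fpi (ltW (NP n k Nn Nk))) _.
  by rewrite mulrAC ltr_pdivrMr // ltr_pM2l //; lra.
by rewrite /completion_rep (cvg_lim _ pl).
Qed.

(** An invariant functional takes the same value at x and at the image of x under a function of mean
    one, and p is a limit of such functions. *)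
Lemma kazhdan_functional (p : completion mu F) (E : banach) (pi : representation G E)
    (tau : {linear E -> K^o}) x : in_closure_of_mean_one p -> F pi -> continuous tau ->
  (forall g y, tau (pi g y) = tau y) -> tau (completion_rep pi p x) = tau x.
Proof.
move=> p1 Fpi tauc tau_inv; have [c c0 cP] := continuous_rnorm_bound tauc.
apply: (@rnorm_lim_unique R s K^o) => e e0; have C0 : 0 < 2 * (c * (rnorm x + 1) + 1).
  by rewrite mulr_gt0 // ltr_wpDl // mulr_ge0 // addr_ge0 // rnorm_ge0.
have d0 := divr_gt0 e0 C0; set d := e / _ in d0.
have [f [fC f1 pf]] := p1 _ d0; have [N NP] := limn_esup_lt pf.
have := (cvg_seq_rnorm _ _).1 (@completion_rep_cvg p E pi x Fpi) d d0 => -[N' N'P].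
pose n := maxn N N'; have h1 := N'P n (leq_maxr _ _).
have h2 := rint_Cc_dist x (approx_Cc p n) fC Fpi (ltW (NP n (leq_maxl _ _))).
have [A cf] := (CcP G_hausdorff f).1 fC.
have tauf : tau (rint pi f x) = tau x.
  rewrite (rint_functional G_hausdorff mu_haar pi x cf tauc).
  rewrite (_ : (fun g => _) = (fun g => f g * (tau x : K))); last by apply/funext => g; rewrite tau_inv.
  by rewrite (sintegralZ G_hausdorff mu_haar _ cf) f1 mul1r.
rewrite -tauf -linearB; apply: le_lt_trans (cP _) _.
have := ler_rdist (rint pi (p n) x) (completion_rep pi p x) (rint pi f x).
rewrite (rdistC (completion_rep pi p x) (rint pi (p n) x)) => h3.
have h4 : c * rnorm (completion_rep pi p x - rint pi f x) <= c * (d + d * rnorm x).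
  by rewrite ler_wpM2l //; lra.
have h5 : d * (2 * (c * (rnorm x + 1) + 1)) = e by rewrite /d divfK // gt_eqF.
have : c * (d + d * rnorm x) = d * (c * (rnorm x + 1)) by ring.
lra.
Qed.

End projections.

(** * Fixed points from Kazhdan projections *)

Section extension_of_cocycles.
Variables (R : realType) (s : scalars) (G : topGroupType).
Variable mu : {measure set (borel G) -> \bar R}.
Hypothesis G_hausdorff : hausdorff_space G.
Hypothesis mu_haar : left_haar mu.
Variable S : set G.
Hypothesis S_generating : compact_symmetric_generating S.
Local Notation K := (scalar_field R s).
Local Notation banach := (completeNormedModType K).
Variable Ecl : banach_class R s.
Hypothesis Ecl_closed : closed_under_finite_representability Ecl.

Lemma condition4_property_FE (Z : banach) : Ecl Z -> infinite_dimensional Z ->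
  (forall C, 0 < C -> exists eps, 0 < eps /\ condition4 S mu Ecl C eps) -> property_FE G Ecl.
Proof.
move=> EZ infZ h4 E pi EE ub b bcoc; have [bc bM] := bcoc.
have [C1 C10 FC1] := uniformly_bounded_class S EE ub.
pose M := expR C1; have M1 : 0 < M := expR_gt0 _.
have piM g x : rnorm (pi g x) <= M * rnorm x.
  by have := rep_class_length_bounded (FC1 0 (lexx 0)) g x; rewrite mul0r add0r.
have [B B0 BP] : exists2 B, 0 <= B & forall g, S g -> rnorm (b g) <= B.
  have [|c cP] := @compact_locally_bounded R G S (fun g => rnorm (b g)) (csg_compact S_generating).
    move=> g _; exists (rnorm (b g) + 1); move/continuous_rnorm: bc => /(_ g 1 ltr01).
    by apply: filterS => h hb; have := ler_rnorm_dist (b h) (b g); lra.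
  by exists `|c| => // g Sg; apply: le_trans (cP g Sg) (ler_norm c).
have b_word n g : set_power S n g -> rnorm (b g) <= n%:R * (M * B).
  elim: n g => [|n IH] g; first by move=> ->; rewrite (cocycle1 bcoc) rnorm0 mul0r.
  move=> [h Sh [t St <-]]; rewrite bM; apply: le_trans (ler_rnormD _ _) _.
  rewrite -natr1 mulrDl mul1r lerD ?IH //; apply: le_trans (piM _ _) _.
  by rewrite ler_wpM2l ?(ltW M1) // BP.
have [F [q [m1 [m2 [EF m10 m20 [qlin qonto] qb]]]]] :=
  exists_product_in_class Ecl_closed EE EZ infZ.
(* The distortion of the realisation q of E + K inside the class. C is fixed before eps is known, so
   it absorbs ka (M + 1), leaving a growth factor 1 + eps l(g), which is at most exp(eps l(g)). *)
pose ka := m2 / m1; have ka0 : 0 < ka by rewrite divr_gt0.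
have C0 : 0 < ka * (M + 1) + 1 by rewrite ltr_wpDl // mulr_ge0 ?addr_ge0 // ltW.
have [eps [e0 [p [_ p1 pproj]]]] := h4 _ C0; set C := ka * (M + 1) + 1 in p p1 pproj.
(* The cocycle grows at most linearly, |b g| <= M B l(g). Scaling it by de, chosen after eps, makes
   its rate de B at most eps. *)
pose de := eps / (B + 1); have de0 : 0 < de by rewrite divr_gt0 // ltr_wpDl.
pose act g (y : E * K^o) : E * K^o := (pi g y.1 + ((y.2 : K) * emb s de) *: b g, y.2).
have qB y z : q (y - z) = q y - q z by rewrite -scaleN1r addrC qlin scaleN1r addrC.
have q_inj y z : q y = q z -> y = z.
  move=> qyz; have /andP[] := qb (y - z); rewrite qB qyz subrr rnorm0 pmulr_rle0 // => h _.
  have n1 := rnorm_ge0 (y - z).1; have n2 := kabs_ge0 ((y - z).2 : K).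
  have z1 : (y - z).1 = 0 by apply: rnorm0_eq0; apply/eqP; rewrite eq_le n1 andbT; lra.
  have z2 : ((y - z).2 : K) = 0 by apply: kabs_eq0; apply/eqP; rewrite eq_le n2 andbT; lra.
  apply/eqP; rewrite -subr_eq0; apply/eqP; rewrite [y - z]surjective_pairing z1.
  by congr (_, _).
have [rp rpE] := choice qonto.
have rpK y : rp (q y) = y by apply: q_inj; rewrite rpE.
have actlin g k y z : act g (k *: y + z) = k *: act g y + act g z.
  rewrite /act; congr (_, _) => /=; rewrite linearP.
  change (k *: pi g y.1 + pi g z.1 + ((k * (y.2 : K) + z.2) * emb s de) *: b g =
    k *: (pi g y.1 + ((y.2 : K) * emb s de) *: b g) + (pi g z.1 + ((z.2 : K) * emb s de) *: b g)).
  by rewrite scalerDr scalerA mulrDl scalerDl mulrA addrACA.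
have sig_ex g : exists L : {linear F -> F}, forall y, L y = q (act g (rp y)).
  apply: exists_linear => k y z; rewrite -qlin -actlin; congr (q (act g _)).
  by apply: q_inj; rewrite rpE qlin !rpE.
have [sg sgE] := choice sig_ex.
have sgq g y : sg g (q y) = q (act g y) by rewrite sgE rpK.
have sg_bound g y : rnorm (sg g y) <= expR (eps * (word_length S g)%:R + C) * rnorm y.
  rewrite -(rpE y) sgq; move: (rp y) => z; pose l : R := (word_length S g)%:R.
  have /andP[_ h1] := qb (act g z); have /andP[h2 _] := qb z; apply: le_trans h1 _ => /=.
  have bl : rnorm (b g) <= l * (M * B) by apply: b_word; case: (word_lengthP S_generating g).
  have h3 : rnorm (pi g z.1 + ((z.2 : K) * emb s de) *: b g) <=
      M * rnorm z.1 + kabs (z.2 : K) * de * (l * (M * B)).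
    apply: le_trans (ler_rnormD _ _) _; rewrite lerD // rnormZ kabsM kabs_emb ger0_norm ?(ltW de0) //.
    by rewrite ler_wpM2l // mulr_ge0 ?kabs_ge0 // ltW.
  have l0 : 0 <= l by []. 
  have deB : de * B <= eps by rewrite /de mulrAC ler_pdivrMr ?ltr_wpDl // ler_wpM2l ?(ltW e0) // lerDl.
  set nx := rnorm z.1 in h2 h3 *; set t := kabs (z.2 : K) in h2 h3 *.
  have nx0 : 0 <= nx := rnorm_ge0 _; have t0 : 0 <= t := kabs_ge0 _.
  have h5 : M * nx + t * de * (l * (M * B)) + t <= (M + 1) * (1 + eps * l) * (nx + t).
    have : t * (l * M) * (de * B) <= t * (l * M) * eps by rewrite ler_wpM2l // !mulr_ge0 // ltW.
    have q1 : 0 <= eps * l * nx by rewrite !mulr_ge0 // ltW.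
    have q2 : 0 <= eps * l * t by rewrite !mulr_ge0 // ltW.
    have q3 : 0 <= M * (eps * l * nx) by rewrite mulr_ge0 // ltW.
    have q4 : 0 <= M * t by rewrite mulr_ge0 // ltW.
    lra.
  have h6 : (1 + eps * l) * (ka * (M + 1)) <= expR (eps * l + C).
    rewrite expRD; apply: ler_pM.
    - by rewrite addr_ge0 // mulr_ge0 // ltW.
    - by rewrite mulr_ge0 ?addr_ge0 // ltW.
    - exact: expR_ge1Dx.
    by apply: le_trans (expR_ge1Dx _); rewrite /C; lra.
  apply: (@le_trans _ _ (m2 * ((M + 1) * (1 + eps * l) * (nx + t)))).
    by rewrite ler_wpM2l ?(ltW m20) //; lra.
  apply: (@le_trans _ _ ((1 + eps * l) * (ka * (M + 1)) * (m1 * (nx + t)))).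
    by rewrite le_eqVlt; apply/orP; left; apply/eqP; rewrite /ka; field; rewrite gt_eqF.
  apply: ler_pM => //; last by rewrite mulr_ge0 ?(ltW m10) // addr_ge0.
  apply: mulr_ge0; first by rewrite addr_ge0 // mulr_ge0 // ltW.
  by rewrite mulr_ge0 ?addr_ge0 // ltW.
have sgc g : continuous (sg g) := rnorm_bound_continuous (sg_bound g).
have sg1 y : sg 1%g y = y.
  rewrite -[in RHS](rpE y) -{1}(rpE y) sgq; congr q; rewrite [RHS]surjective_pairing /act.
  by rewrite rep_one (cocycle1 bcoc) scaler0 addr0.
have sgM g h y : sg (g * h)%g y = sg g (sg h y).
  rewrite -(rpE y) !sgq; congr q; rewrite /act /=; congr (_, _).
  have lz (k : K) v : pi g (k *: v) = k *: pi g v by exact: linearZ.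
  by rewrite rep_mul bM (linearD (pi g)) lz scalerDr addrAC addrA.
have sgs y : continuous (fun g => sg g y).
  rewrite -(rpE y); move: (rp y) => z; apply/continuous_rnorm => g e e1.
  have : continuous (fun g => pi g z.1 + ((z.2 : K) * emb s de) *: b g).
    move=> h; apply: cvgD; first exact: rep_strongly_continuous.
    by apply: cvgZ; [exact: cvg_cst|exact: bc].
  move/continuous_rnorm => /(_ g _ (divr_gt0 e1 m20)); apply: filterS => h.
  rewrite ltr_pdivlMr // mulrC => h1; apply: le_lt_trans h1; rewrite !sgq -qB.
  have /andP[_ h2] := qb (act h z - act g z); apply: le_trans h2 _.
  have -> : ((act h z - act g z).2 : K) = 0 by rewrite /= subrr.
  by rewrite kabs0 addr0.
pose sigma := Representation sgc sg1 sgM sgs.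
have Fsigma : rep_class_length S Ecl eps C sigma.
  split; first by exists F => //; exact: isometric_refl.
  by move=> g; apply: opnorm_le => [|y _]; [exact: expR_ge0|exact: sg_bound].
(* The second coordinate is an invariant functional, so the projection of (0, 1) is an invariant
   vector with second coordinate 1; invariance of such a vector is the fixed point equation for its
   first coordinate, up to the factor de. *)
have [tau tauE] : exists tau : {linear F -> K^o}, forall y, tau y = (rp y).2.
  apply: exists_linear => k y z; have -> : rp (k *: y + z) = k *: rp y + rp z.
    by apply: q_inj; rewrite rpE qlin !rpE.
  by [].
have tauc : continuous tau.
  apply: (rnorm_bound_continuous (c := m1^-1)) => y; rewrite tauE rnorm_K ler_pdivlMl //.
  have /andP[h1 _] := qb (rp y); rewrite rpE in h1; apply: le_trans h1.
  by rewrite ler_wpM2l ?(ltW m10) // lerDr rnorm_ge0.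
have [_ range_inv] := pproj F sigma Fsigma.
pose y0 := completion_rep sigma p (q (0, 1)).
have y0_inv : invariant_vectors sigma y0 by rewrite -range_inv; exists (q (0, 1)).
have tau_y0 : tau y0 = 1.
  rewrite (kazhdan_functional G_hausdorff mu_haar _ p1 Fsigma tauc); first by rewrite tauE rpK.
  by move=> g y; rewrite !tauE /= sgE rpK.
exists (emb s de^-1 *: (rp y0).1) => g.
have := y0_inv g; rewrite /= -{1}(rpE y0) sgq -[RHS](rpE y0) => /q_inj.
move=> /(congr1 fst) /=; rewrite -tauE tau_y0.
change (pi g (rp y0).1 + (1 * emb s de) *: b g = (rp y0).1 ->
  pi g (emb s de^-1 *: (rp y0).1) + b g = emb s de^-1 *: (rp y0).1).
rewrite mul1r => yE; rewrite -{2}yE linearZ scalerDr scalerA -embM mulVf ?gt_eqF //.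
by rewrite emb1 scale1r.
Qed.

End extension_of_cocycles.

(** * Contragredient representations and centrality *)

Section dual_representations.
Variables (R : realType) (s : scalars) (G : topGroupType).
Variable mu : {measure set (borel G) -> \bar R}.
Hypothesis G_hausdorff : hausdorff_space G.
Hypothesis mu_haar : left_haar mu.
Variable S : set G.
Hypothesis S_generating : compact_symmetric_generating S.
Local Notation K := (scalar_field R s).
Local Notation banach := (completeNormedModType K).
Local Notation sintegral := (@scalar_integral R s G mu).
Local Notation rcsupp := (@csupp R RealScalars G R^o).
Local Notation kcsupp := (@csupp R s G K^o).
Local Notation integral := (fun u : G -> R => Rintegral mu setT (u : borel G -> R)).
Variables (E Y : banach) (B : Y -> {linear E -> K^o}) (pi : representation G E) (eps C : R).
Hypothesis B_dual : dual_pairing B.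
Hypothesis eps_ge0 : 0 <= eps.
Hypothesis E_reflexive : reflexive_space E.
Hypothesis pi_bounded : length_bounded S eps C pi.
Local Notation weight g := (expR (eps * (word_length S g)%:R + C)).

Lemma pairing_le y x : kabs (B y x : K) <= rnorm y * rnorm x.
Proof.
have := @opnorm_leP R s E K^o setT (B y) (rnorm y); rewrite (dual_isometric B_dual) lexx.
by move=> /(_ isT x I); rewrite rnorm_K.
Qed.

Lemma le_dual_norm y c : 0 <= c -> (forall x, kabs (B y x : K) <= c * rnorm x) -> rnorm y <= c.
Proof.
move=> c0 yc; have := @opnorm_le R s E K^o setT (B y) c c0.
rewrite (dual_isometric B_dual) lee_fin; apply=> x _; rewrite rnorm_K; exact: yc.
Qed.

Lemma pairing_injective y z : (forall x, B y x = B z x) -> y = z.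
Proof.
move=> yz; apply: rnorm_lim_unique => e e0; apply: (@le_lt_trans _ _ 0) => //.
apply: le_dual_norm => // x; have := dual_linear B_dual (- 1) z y x.
by rewrite addrC scaleN1r yz scaleN1r addNr => ->; rewrite kabs0 mul0r.
Qed.

Lemma pairing_separates x : (forall y, B y x = 0) -> x = 0.
Proof.
move=> x0; apply: (@eq_of_functionals R s) => phi phic.
by have [y yE] := dual_surjective B_dual phic; rewrite -yE x0 linear0.
Qed.

Lemma contragredient_exists g : exists T : {linear Y -> Y}, forall y x, B (T y) x = B y (pi g^-1%g x).
Proof.
have Ty y : exists z, forall x, B z x = B y (pi g^-1%g x).
  have [phi [phic phiE]] := exists_composed_functional (@rep_bounded R s G E pi g^-1%g) (@dual_continuous R s E Y B B_dual y).
  by have [z zE] := dual_surjective B_dual phic; exists z => x; rewrite zE phiE.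
have [T TE] := choice Ty; have [|L LE] := @exists_linear K Y Y T.
  move=> a y z; apply: pairing_injective => x; rewrite TE (dual_linear B_dual).
  by rewrite (dual_linear B_dual) !TE.
by exists L => y x; rewrite LE TE.
Qed.

Variable T : G -> {linear Y -> Y}.
Hypothesis TE : forall g y x, B (T g y) x = B y (pi g^-1%g x).

Lemma contragredient_bound g y : rnorm (T g y) <= weight g * rnorm y.
Proof.
apply: le_dual_norm => [|x]; first by rewrite mulr_ge0 ?expR_ge0 ?rnorm_ge0.
rewrite TE; apply: le_trans (pairing_le _ _) _; rewrite mulrAC [leRHS]mulrC ler_wpM2l ?rnorm_ge0 //.
by have := pi_bounded g^-1%g x; rewrite word_lengthV.
Qed.

Lemma contragredientM g h y : T (g * h)%g y = T g (T h y).
Proof. by apply: pairing_injective => x; rewrite !TE invgM rep_mul. Qed.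

Lemma contragredient1 y : T 1%g y = y.
Proof. by apply: pairing_injective => x; rewrite TE invg1 rep_one. Qed.

Let matrix_coefficient y x : continuous (fun g => B y (pi g^-1%g x) : K^o).
Proof.
move=> g; apply: (@continuous_comp _ _ _ (fun g => pi g^-1%g x) (B y)); last exact: dual_continuous.
apply: (@continuous_comp _ _ _ (fun g : G => g^-1%g) (fun g => pi g x)); first exact: invg_continuous.
exact: rep_strongly_continuous.
Qed.

Let cont_vectors : set Y := [set y | forall e, 0 < e ->
  \forall h \near (1%g : G), rnorm (T h y - y) < e].

Let near_bound : exists2 M, 0 < M & \forall h \near (1%g : G), forall y, rnorm (T h y) <= M * rnorm y.
Proof.
have [L nL] := set_power_nbhs1 G_hausdorff mu_haar S_generating.
exists (expR (eps * L%:R + C)); first exact: expR_gt0.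
apply: filterS nL => h Lh y; apply: le_trans (contragredient_bound h y) _.
rewrite ler_wpM2r ?rnorm_ge0 // ler_expR lerD2r ler_wpM2l // ler_nat.
exact: word_length_le.
Qed.

(** The vector z is y composed with the f-average of the operators of g^-1. Translating z by h
    amounts to translating f by h, so uniform continuity of f makes z a continuous vector. *)
Let smooth_vector A (f : G -> K) y : kcsupp A f -> exists2 z, cont_vectors z &
  forall x, B z x = B y (vector_integral mu (fun g => f g *: pi g^-1%g x)).
Proof.
move=> cf; have [cA fc f0] := cf.
have inv_cont x : continuous (fun g => pi g^-1%g x).
  move=> g; apply: (@continuous_comp _ _ _ (fun g : G => g^-1%g) (fun g => pi g x)).
    exact: invg_continuous.
  exact: rep_strongly_continuous.
have orbit_csupp D (h : G -> K) x : kcsupp D h -> csupp D (fun g => h g *: pi g^-1%g x).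
  by move=> ch; apply: csupp_scale.
have weight_bound D : compact D -> exists2 m, 0 <= m & forall g x, D g -> rnorm (pi g^-1%g x) <= m * rnorm x.
  move=> /(word_length_compact (R := R) G_hausdorff mu_haar S_generating)[L LP].
  exists (expR (eps * L + C)) => [|g x Dg]; first exact: expR_ge0.
  apply: le_trans (pi_bounded g^-1%g x) _; rewrite word_lengthV // ler_wpM2r ?rnorm_ge0 //.
  by rewrite ler_expR lerD2r ler_wpM2l // LP.
have int_bound D : compact D -> exists2 m, 0 <= m & forall (h : G -> K) c x, kcsupp D h ->
    0 <= c -> (forall g, kabs (h g) <= c) ->
    rnorm (vector_integral mu (fun g => h g *: pi g^-1%g x)) <= c * m * rnorm x.
  move=> cD; have [m m0 mP] := weight_bound D cD; have vD := vol_ge0 mu D.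
  exists (m * vol mu D) => [|h c x ch c0 hc]; first exact: mulr_ge0.
  have -> : c * (m * vol mu D) * rnorm x = c * (m * rnorm x) * vol mu D by ring.
  apply: (vector_integral_bound G_hausdorff mu_haar (orbit_csupp D h x ch)) => g Dg.
  by rewrite rnormZ ler_pM ?kabs_ge0 ?rnorm_ge0 // mP.
pose Af x := vector_integral mu (fun g => f g *: pi g^-1%g x).
have Af_linear a x x' : B y (Af (a *: x + x')) = a *: B y (Af x) + B y (Af x').
  rewrite -linearP; congr (B y _); rewrite /Af.
  rewrite -(vector_integralD G_hausdorff mu_haar a (orbit_csupp _ _ x cf) (orbit_csupp _ _ x' cf)).
  congr (vector_integral mu _); apply/funext => g.
  by rewrite linearP scalerDr !scalerA mulrC.
have [phi phiE] := @exists_linear K E K^o (fun x => B y (Af x)) Af_linear.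
have [m m0 mP] := int_bound A cA; have [c cP] := csupp_bounded cf.
have c0 : 0 <= c := le_trans (rnorm_ge0 _) (cP 1%g).
have y0 := rnorm_ge0 y.
have phic : continuous phi.
  apply: (rnorm_bound_continuous (c := rnorm y * (c * m))) => x.
  rewrite phiE rnorm_K; apply: le_trans (pairing_le _ _) _; rewrite -mulrA ler_wpM2l //.
  by apply: mP => // g; exact: cP.
have [z zE] := dual_surjective B_dual phic; exists z => [e e0|x]; last by rewrite zE phiE.
have [D [cD DP]] := density_translate G_hausdorff mu_haar S_generating cf.
have [m' m'0 m'P] := int_bound D cD.
have C0 : 0 < rnorm y * m' + 1 by rewrite ltr_wpDl // mulr_ge0.
have d0 : 0 < e / (rnorm y * m' + 1) / 2 by rewrite !divr_gt0.
have [W [nW WP]] := DP _ d0; apply: filterS nW => h Wh; have [cd dle] := WP h Wh.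
apply: (@le_lt_trans _ _ (e / 2)); last by lra.
apply: le_dual_norm => [|x]; first by rewrite divr_ge0 // ltW.
have -> : B (T h z - z) x = B y (vector_integral mu (fun g => (f (h^-1 * g)%g - f g) *: pi g^-1%g x)).
  rewrite addrC -scaleN1r (dual_linear B_dual) TE !zE !phiE -linearP; congr (B y _).
  have cH : csupp [set (h^-1^-1 * x)%g | x in A] (fun g => f (h^-1 * g)%g *: pi g^-1%g x).
    have cH1 : csupp A (fun g => f g *: pi (h * g)^-1%g x).
      apply: csupp_scale => // g; apply: (@continuous_comp _ _ _ (fun g => (h * g)%g) (fun g => pi g^-1%g x)).
        exact: lmul_continuous.
      exact: inv_cont.
    have := csupp_lmul h^-1%g cH1; congr csupp; apply/funext => g.
    by rewrite mulVKg.
  have -> : Af (pi h^-1%g x) = vector_integral mu (fun g => f (h^-1 * g)%g *: pi g^-1%g x).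
    rewrite -(vector_integral_lmul G_hausdorff mu_haar h cH); congr (vector_integral mu _).
    by apply/funext => g; rewrite mulKg invgM rep_mul.
  rewrite -(vector_integralD G_hausdorff mu_haar (- 1) (orbit_csupp _ _ x cf) cH).
  by congr (vector_integral mu _); apply/funext => g; rewrite scaleN1r scalerBl addrC.
apply: le_trans (pairing_le _ _) _.
apply: le_trans (ler_wpM2l y0 (m'P _ _ x cd (ltW d0) dle)) _.
have te : e / (rnorm y * m' + 1) * (rnorm y * m' + 1) = e by rewrite divfK // gt_eqF.
have t0 : 0 < e / (rnorm y * m' + 1) by rewrite divr_gt0.
move: te t0; set t := e / (rnorm y * m' + 1) => te t0; have := mulr_ge0 (ltW t0) (rnorm_ge0 x).
have : t * (rnorm y * m' + 1) * rnorm x = e * rnorm x by rewrite te.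
move: (rnorm y) (rnorm x) => u v; lra.
Qed.

Hypothesis G_locally_compact : locally_compact [set: G].

Let cont_closed y : (forall d, 0 < d -> exists2 z, cont_vectors z & rnorm (y - z) < d) -> cont_vectors y.
Proof.
move=> yz e e0; have [M M0 nM] := near_bound.
have d0 : 0 < e / (M + 2) by rewrite divr_gt0 // addr_gt0.
have [z zc yz1] := yz _ d0.
apply: filterS (filterI nM (zc _ d0)) => h [hM hz].
have h1 := hM (y - z); rewrite linearB in h1.
have h2 : M * rnorm (y - z) <= M * (e / (M + 2)) by rewrite ler_wpM2l // ltW.
have h3 := ler_rdist (T h z) (T h y) y; have h4 := ler_rdist z (T h z) y.
rewrite (rdistC z) in h4.
have h5 : (M + 2) * (e / (M + 2)) = e by rewrite mulrC divfK // gt_eqF // addr_gt0.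
lra.
Qed.

Let cont_linear a y z : cont_vectors y -> cont_vectors z -> cont_vectors (a *: y + z).
Proof.
move=> yc zc e e0; have a1 : 0 < kabs a + 1 by rewrite ltr_wpDl ?kabs_ge0.
have d0 := divr_gt0 e0 a1; apply: filterS (filterI (yc _ d0) (zc _ d0)) => h [h1 h2].
rewrite linearP opprD addrACA -scalerBr; apply: le_lt_trans (ler_rnormD _ _) _; rewrite rnormZ.
have h3 : kabs a * rnorm (T h y - y) <= kabs a * (e / (kabs a + 1)) by rewrite ler_wpM2l ?kabs_ge0 // ltW.
have h4 : (kabs a + 1) * (e / (kabs a + 1)) = e by rewrite mulrC divfK // gt_eqF.
lra.
Qed.

(* If some vector were not a limit of continuous vectors, a functional, that is
   a point of E by reflexivity, would vanish on all smoothed vectors. *)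
Lemma contragredient_continuous y : continuous (fun g => T g y).
Proof.
have all_cont z : cont_vectors z.
  apply: contrapT => zc.
  have [d d0 dP] : exists2 d, 0 < d & forall c, cont_vectors c -> d <= rnorm (z - c).
    apply: contrapT => no; apply: zc; apply: cont_closed => d d0; apply: contrapT => far.
    apply: no; exists d => // c cc; rewrite leNgt; apply/negP => h; apply: far.
    by exists c.
  have c0 : cont_vectors 0.
    by move=> e e0; apply: filterS filterT => h _; rewrite linear0 subrr rnorm0.
  have cZ a c : cont_vectors c -> cont_vectors (emb s a *: c).
    by move=> cc; rewrite -[_ *: c]addr0; apply: cont_linear.
  have [||Psi [be [Psic bz be_le]]] := @separation R s Y cont_vectors z d _ _ d0 dP.
  - by move=> c c' t cc cc' _ _; apply: cont_linear => //; exact: cZ.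
  - by exists 0.
  have [x PsiE] := E_reflexive B_dual Psic.
  have be0 : 0 <= be by have := be_le 0 c0; rewrite linear0 rp0.
  (* The functional is bounded above on a real linear subspace, so its real part vanishes there. *)
  have vanish c : cont_vectors c -> real_part (B c x : K) = 0.
    move=> cc; apply/eqP; apply: contraT => r0; set r := real_part _ in r0.
    have := be_le _ (cZ ((be + 1) / r) c cc); rewrite linearZ PsiE.
    change (real_part (emb s ((be + 1) / r) * (B c x : K)) <= be -> false).
    rewrite rpZ -/r divfK //; lra.
  pose psi g := real_part (B z (pi g^-1%g x) : K).
  have psic : continuous psi := real_part_continuous (@matrix_coefficient z x).
  have [A [u [cu u0 _ uS]]] := exists_density G_hausdorff mu_haar S_generating G_locally_compact.
  (* The weight keeps the positive part of the coefficient psi. The real part of the functional at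
     the smoothed vector is then the integral of f psi, which is positive because psi 1 is the real
     part of Psi z, hence positive. *)
  pose f g := u g * Num.max (psi g) 0.
  have cf : rcsupp A f.
    have [cA uc uA] := cu; split=> // [g|g /uA]; last by rewrite /f => ->; rewrite mul0r.
    apply: cvgM; first exact: uc.
    by apply: (@continuous_max _ _ psi (fun=> 0)); [exact: psic|exact: cvg_cst].
  have cfK := density_csupp s G_hausdorff mu_haar cf.
  have [v vc vE] := smooth_vector z cfK.
  have cO : csupp A (fun g => emb s (f g) *: pi g^-1%g x).
    apply: csupp_scale => // g; apply: (@continuous_comp _ _ _ (fun g : G => g^-1%g) (fun g => pi g x)).
      exact: invg_continuous.
    exact: rep_strongly_continuous.
  have := vanish v vc; rewrite vE.
  rewrite (rp_vector_integral G_hausdorff mu_haar cO (@dual_continuous R s E Y B B_dual z)).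
  have -> : (fun g => real_part (B z (emb s (f g) *: pi g^-1%g x) : K)) =
      (fun g => f g * psi g).
    apply/funext => g; rewrite linearZ.
    change (real_part (emb s (f g) * (B z (pi g^-1%g x) : K)) = f g * psi g).
    by rewrite rpZ.
  apply/eqP; rewrite gt_eqF //; apply: (integral_gt0 G_hausdorff mu_haar (A := A) (x0 := 1%g)).
  - have [cA fc fA] := cf; split=> // [g|g /fA ->]; last by rewrite mul0r.
    by apply: cvgM; [exact: fc|exact: psic].
  - move=> g; rewrite /f -mulrA mulr_ge0 ?u0 // /Num.max; case: ifPn => h; first by rewrite mul0r.
    by rewrite -leNgt in h; exact: mulr_ge0.
  have p1 : 0 < psi 1%g by rewrite /psi invg1 rep_one -PsiE; lra.
  rewrite /f (_ : Num.max (psi 1%g) 0 = psi 1%g); last by apply: max_l; exact: ltW.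
  by rewrite !mulr_gt0 // uS //; exact: csg_one S_generating.
apply/continuous_rnorm => g e e0; have w0 : 0 < weight g := expR_gt0 _.
have := all_cont y _ (divr_gt0 e0 w0) => n1.
have := @lmul_nbhs G g^-1%g g [set h | rnorm (T h y - y) < e / weight g].
rewrite mulVg => /(_ n1); apply: filterS => h /= hy.
have -> : T h y - T g y = T g (T (g^-1 * h)%g y - y) by rewrite linearB -contragredientM mulVKg.
apply: le_lt_trans (contragredient_bound _ _) _; rewrite mulrC -ltr_pdivlMr //.
Qed.

End dual_representations.

(** * Centrality of the Kazhdan projection *)

Section centrality.
Variables (R : realType) (s : scalars) (G : topGroupType).
Variable mu : {measure set (borel G) -> \bar R}.
Hypothesis G_hausdorff : hausdorff_space G.
Hypothesis G_locally_compact : locally_compact [set: G].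
Hypothesis mu_haar : left_haar mu.
Variable S : set G.
Hypothesis S_generating : compact_symmetric_generating S.
Local Notation K := (scalar_field R s).
Local Notation banach := (completeNormedModType K).
Local Notation sintegral := (@scalar_integral R s G mu).
Local Notation rint := (rep_integral mu).
Variable Ecl : banach_class R s.
Hypothesis Ecl_superreflexive : forall X, Ecl X -> superreflexive X.
Hypothesis Ecl_closed : closed_under_finite_representability Ecl.
Hypothesis Ecl_dual : stable_by_duality Ecl.
Variables (eps C : R).
Hypothesis eps_ge0 : 0 <= eps.
Local Notation F := (rep_class_length S Ecl eps C).

Lemma exists_contragredient (E Y : banach) (B : Y -> {linear E -> K^o}) (pi : representation G E) :
  dual_pairing B -> Ecl E -> F pi -> exists rho : representation G Y,
  F rho /\ forall g y x, B (rho g y) x = B y (pi g^-1%g x).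
Proof.
move=> BD EE Fpi; have pb := rep_class_length_bounded Fpi.
have Er := superreflexive_reflexive (Ecl_superreflexive EE).
have [T TE] := choice (contragredient_exists pi BD).
have Tb := contragredient_bound S_generating BD pb TE.
have T1 := contragredient1 BD TE; have TM := contragredientM BD TE.
have Ts := contragredient_continuous G_hausdorff mu_haar S_generating BD eps_ge0 Er pb TE G_locally_compact.
have Tc g : continuous (T g) := rnorm_bound_continuous (Tb g).
exists (Representation Tc T1 TM Ts); split=> //; split.
  by exists Y; [exact: Ecl_dual EE BD|exact: isometric_refl].
by move=> g; apply: opnorm_le => [|y _]; [exact: expR_ge0|exact: Tb].
Qed.

Variable p : completion mu F.
Hypothesis p_kazhdan : kazhdan_projection p.

(** With P' the projection of the contragredient representation, [adj1] and [adj2] make P' the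
    transpose of P. Each P' y is an invariant functional, so P followed by y ignores the group, and
    P turns [rint pi f] into multiplication by the integral of f. *)
Lemma kazhdan_rint (E : banach) (pi : representation G E) (f : G -> K) x : F pi -> Cc f ->
  completion_rep pi p (rint pi f x) = sintegral f *: completion_rep pi p x.
Proof.
move=> Fpi fC; have [_ p1 pproj] := p_kazhdan.
have EE : Ecl E by have [[Y EY [T [Tiso _]]] _] := Fpi; exact: subspace_in_class Tiso EY.
have [Y [B BD]] := exists_dual E.
have [rho [Frho rhoE]] := exists_contragredient BD EE Fpi.
have [_ range_pi] := pproj E pi Fpi; have [_ range_rho] := pproj Y rho Frho.
pose P := completion_rep pi p; pose P' := completion_rep rho p.
have P_inv z : invariant_vectors pi (P z) by rewrite -range_pi; exists z.
have P'_inv y : invariant_vectors rho (P' y) by rewrite -range_rho; exists y.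
(* P' y is an invariant functional on E, hence is not changed by P. *)
have adj1 y z : B (P' y) (P z) = B (P' y) z.
  apply: (kazhdan_functional G_hausdorff mu_haar z p1 Fpi (@dual_continuous R s E Y B BD (P' y))) => g w.
  by rewrite -[in RHS](P'_inv y g^-1%g) rhoE invgK.
(* The roles are exchanged: the invariant vector P z is an invariant functional on the dual, hence
   is not changed by P'. *)
have adj2 y z : B (P' y) (P z) = B y (P z).
  have [tau tauE] := @exists_linear K Y K^o (fun y => B y (P z)) (fun a y y' => dual_linear BD a y y' (P z)).
  have tauc : continuous tau.
    apply: (rnorm_bound_continuous (c := rnorm (P z))) => y'.
    by rewrite tauE rnorm_K mulrC; exact: (pairing_le BD).
  rewrite -!tauE; apply: (kazhdan_functional G_hausdorff mu_haar y p1 Frho tauc) => g w.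
  by rewrite !tauE rhoE P_inv.
have inv_coef y g z : B (P' y) (pi g z) = B (P' y) z.
  by rewrite -[in RHS](P'_inv y g^-1%g) rhoE invgK.
apply/eqP; rewrite -subr_eq0; apply/eqP; apply: (pairing_separates BD) => y.
rewrite linearB -/P linearZ -(adj2 y (rint pi f x)) -(adj2 y x) !adj1; apply/eqP; rewrite subr_eq0; apply/eqP.
have [A cf] := (CcP G_hausdorff f).1 fC.
rewrite (rint_functional G_hausdorff mu_haar pi x cf (@dual_continuous R s E Y B BD (P' y))).
rewrite (_ : (fun g => _) = (fun g => f g * (B (P' y) x : K))); last first.
  by apply/funext => g; rewrite inv_coef.
exact: (sintegralZ G_hausdorff mu_haar _ cf).
Qed.

Lemma F_norm_finite (f : G -> K) : Cc f -> exists2 c, 0 <= c & (F_norm mu F f <= c%:E)%E.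
Proof.
move=> /(CcP G_hausdorff)[A cf]; have [cA fc f0] := cf; have [c cP] := csupp_bounded cf.
have [L LP] := word_length_compact (R := R) G_hausdorff mu_haar S_generating cA.
have c0 : 0 <= c := le_trans (rnorm_ge0 _) (cP 1%g).
have vA := vol_ge0 mu A; have e0 := expR_ge0 (eps * L + C).
exists (c * expR (eps * L + C) * vol mu A); first by rewrite !mulr_ge0.
apply: F_norm_le => [|E pi Fpi x]; first by rewrite !mulr_ge0.
have -> : c * expR (eps * L + C) * vol mu A * rnorm x = c * (expR (eps * L + C) * rnorm x) * vol mu A by ring.
apply: (rint_bound G_hausdorff mu_haar cf c0) => [g|g Ag]; first exact: (cP g).
apply: le_trans (rep_class_length_bounded Fpi g x) _; rewrite ler_wpM2r ?rnorm_ge0 // ler_expR.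
by rewrite lerD2r ler_wpM2l // LP.
Qed.

Lemma completion_rep_dist e : 0 < e -> exists N, forall n, (N <= n)%N ->
  forall (E : banach) (pi : representation G E) x, F pi ->
  rnorm (completion_rep pi p x - rint pi (p n) x) <= e * rnorm x.
Proof.
move=> e0; have [N NP] := approx_cauchy p e0; exists N => n Nn E pi x Fpi.
apply/ler_addgt0Pr => r r0.
have := (cvg_seq_rnorm _ _).1 (@completion_rep_cvg R s G mu G_hausdorff mu_haar F p E pi x Fpi) r r0.
move=> [N' N'P]; pose k := maxn N N'; have h1 := N'P k (leq_maxr _ _).
have h2 := rint_Cc_dist G_hausdorff mu_haar x (approx_Cc p k) (approx_Cc p n) Fpi
  (ltW (NP k n (leq_maxl _ _) Nn)).
have := ler_rdist (rint pi (p k) x) (completion_rep pi p x) (rint pi (p n) x).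
rewrite (rdistC (completion_rep pi p x) (rint pi (p k) x)); lra.
Qed.

(** With P the operator of p, both orders of the product with q n are close to the integral of q n
    times P: on one side by [kazhdan_rint], on the other because the image of P is invariant. The
    number c + 1 bounds the operators of q n for large n uniformly over F, so approximating P by p n
    within e / (2 (c + 1)) costs at most e / 2 on each side. *)
Lemma kazhdan_central : central p.
Proof.
move=> q; apply/eqP; rewrite eq_le completion_dist_ge0 andbT.
apply/lee_addgt0Pr => e e0; rewrite add0e.
have [N1 N1P] := approx_cauchy q ltr01.
have [c c0 qc] := F_norm_finite (approx_Cc q N1).
have C0 : 0 < 2 * (c + 1) by rewrite mulr_gt0 // ltr_wpDl.
have [N2 N2P] := completion_rep_dist (divr_gt0 e0 C0).
apply: (@limn_esup_le _ _ _ (maxn N1 N2)) => n Nn.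
have Nn1 := leq_trans (leq_maxl _ _) Nn; have Nn2 := leq_trans (leq_maxr _ _) Nn.
apply: F_norm_le => [|E pi Fpi x]; first exact: ltW.
have [A cp] := (CcP G_hausdorff _).1 (approx_Cc p n).
have [B cq] := (CcP G_hausdorff _).1 (approx_Cc q n).
have q_bound z : rnorm (rint pi (q n) z) <= (c + 1) * rnorm z.
  have h1 := rint_Cc_dist G_hausdorff mu_haar z (approx_Cc q n) (approx_Cc q N1) Fpi
    (ltW (N1P n N1 Nn1 (leqnn _))).
  have h2 := le_F_norm qc Fpi z.
  have := ler_rnorm_dist (rint pi (q n) z) (rint pi (q N1) z); lra.
rewrite /completion_mul (rintBf G_hausdorff mu_haar pi x (convolution_csupp G_hausdorff mu_haar cp cq)
  (convolution_csupp G_hausdorff mu_haar cq cp)).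
rewrite (rint_convolution G_hausdorff mu_haar pi x cp cq) (rint_convolution G_hausdorff mu_haar pi x cq cp).
have Px_inv : invariant_vectors pi (completion_rep pi p x).
  by have [_ _ /(_ E pi Fpi)[_ <-]] := p_kazhdan; exists x.
have h1 := N2P n Nn2 E pi (rint pi (q n) x) Fpi.
have h2 := N2P n Nn2 E pi x Fpi.
rewrite (kazhdan_rint x Fpi (approx_Cc q n)) -(rint_invariant G_hausdorff mu_haar cq Px_inv) in h1.
have h3 := q_bound (completion_rep pi p x - rint pi (p n) x).
have qB z z' : rint pi (q n) (z - z') = rint pi (q n) z - rint pi (q n) z'.
  by rewrite addrC -scaleN1r (rint_linear G_hausdorff mu_haar pi _ _ _ cq) scaleN1r addrC.
rewrite qB in h3.
have := ler_rdist (rint pi (q n) (completion_rep pi p x)) (rint pi (p n) (rint pi (q n) x))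
  (rint pi (q n) (rint pi (p n) x)).
rewrite (rdistC (rint pi (p n) (rint pi (q n) x)) (rint pi (q n) (completion_rep pi p x))) => h4.
have d0 : 0 < e / (2 * (c + 1)) by rewrite divr_gt0.
have h5 : e / (2 * (c + 1)) * (2 * (c + 1)) = e by rewrite divfK // gt_eqF.
have h6 := ler_wpM2l (ltW d0) (q_bound x).
have c1 : 0 <= c + 1 by rewrite addr_ge0.
have h7 := ler_wpM2l c1 h2.
move: h5 h1 h6 h7 h3 h4; move: (e / _) d0 (rnorm x) => t d0 nx h5 h1 h6 h7 h3 h4.
have : e * nx = t * (2 * (c + 1)) * nx by rewrite h5.
lra.
Qed.

End centrality.

Theorem corollary5p8 (R : realType) (s : scalars)
  (G : topGroupType) (S : set G) (mu : {measure set (borel G) -> \bar R})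
  (G_hausdorff : hausdorff_space G)
  (G_locally_compact : locally_compact [set: G])
  (G_separable : separable_space G)
  (G_infinite : infinite_set [set: G])
  (S_generating : compact_symmetric_generating S)
  (mu_haar : left_haar mu)
  (Ecl : banach_class R s)
  (Ecl_superreflexive : forall X, Ecl X -> superreflexive X)
  (Ecl_closed : closed_under_finite_representability Ecl) :
  let item1 := property_FE G Ecl in
  let item2 := forall C : R, 0 < C -> exists (N : nat) (eps : R),
                 0 < eps /\ condition2 S mu Ecl C N eps in
  let item3 := forall C : R, 0 < C -> exists eps : R,
                 0 < eps /\ condition3 S mu Ecl C eps in
  let item4 := forall C : R, 0 < C -> exists eps : R,
                 0 < eps /\ condition4 S mu Ecl C eps in
  let Ecl_infinite_dim := exists2 X, Ecl X & infinite_dimensional X in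
  [/\ item1 <-> item2,
      item1 <-> item3,
      Ecl_infinite_dim -> (item1 <-> item4) &
      item1 -> stable_by_duality Ecl ->
      forall C eps : R, 0 < C -> 0 < eps ->
        [\/ exists N : nat, condition2 S mu Ecl C N eps,
            condition3 S mu Ecl C eps |
            Ecl_infinite_dim /\ condition4 S mu Ecl C eps] ->
        has_central_kazhdan_projection mu (rep_class_length S Ecl eps C)].
Proof.
move=> item1 item2 item3 item4 Ecl_infinite_dim.
have h12 : item1 -> item2.
  move=> FE C _; exact: (property_FE_condition2 G_hausdorff G_separable G_locally_compact mu_haar
    S_generating Ecl_superreflexive Ecl_closed FE).
have h23 : item2 -> item3.
  move=> h2 C C0; have [N [eps [e0 c2]]] := h2 C C0.
  by exists eps; split=> //; exact: condition2_condition3 e0 c2.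
have h31 : item3 -> item1 by exact: condition3_property_FE.
have h34 : item3 -> item4.
  by move=> h3 C C0; have [eps [e0 [kaz _]]] := h3 C C0; exists eps.
split; [by split=> // /h23/h31|by split=> // /h12/h23|move=> [Z EZ infZ]|].
  split=> [/h12/h23/h34 //|h4].
  exact: (condition4_property_FE G_hausdorff mu_haar S_generating Ecl_closed EZ infZ h4).
move=> _ dual C eps C0 e0 conds.
have [p pk] : has_kazhdan_projection mu (rep_class_length S Ecl eps C).
  by case: conds => [[N /(condition2_condition3 e0)[]]|[]|[]].
exists p; split=> //.
exact: (kazhdan_central G_hausdorff G_locally_compact mu_haar S_generating Ecl_superreflexive
  Ecl_closed dual (ltW e0) pk).
Qed.
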